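(* Let $D\subset\mathbb{R}^2$ be a bounded domain with boundary of class $\mathcal{C}^4$, let $f\in L^2(D)$, let $\mathbf{x}_0\in D$, let $\mathcal{F}\subset\mathcal{C}^4(\overline{D})$ be an admissible family and let $j:D\times\mathbb{R}\to\mathbb{R}$ be a Carathéodory function (see context). Then the shape optimization problem (S) is equivalent to the constrained optimal control problem (C), both described in the context, in the following sense. (i) If $(g,u)$ is an admissible pair of controls for (C) (that is, $g\in\mathcal{F}$, $u$ is measurable on $D$, $g_+^2u\in L^2(D)$, and the associated state $y_{g,u}$ satisfies the two integral constraints of (C)), then the restriction of $y_{g,u}$ to $\Omega_g$ is the solution $y_{\Omega_g}$ of the clamped plate problem in $\Omega_g$, and the cost of $(g,u)$ in (C) equals the cost of $\Omega_g$ in (S). (ii) Conversely, for every $g\in\mathcal{F}$ there exists a measurable function $u$ on $D$ with $g_+^2u\in L^2(D)$ such that $(g,u)$ is admissible for (C), the restriction of $y_{g,u}$ to $\Omega_g$ is $y_{\Omega_g}$, and the cost of $(g,u)$ in (C) equals the cost of $\Omega_g$ in (S). (Equality of costs means: if one of the two integrals is defined then so is the other, and they are equal.)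
   Context: Admissible family. $\mathcal{F}\subset\mathcal{C}^4(\overline{D})$ is a set of functions such that every $g\in\mathcal{F}$ satisfies: $g(\mathbf{x}_0)=0$; $|\nabla g(\mathbf{x})|>0$ for all $\mathbf{x}\in D$ with $g(\mathbf{x})=0$; $g>0$ on $\partial D$; and, with $\Omega_g$ denoting the connected component of the open set $\mathrm{int}\{\mathbf{x}\in D: g(\mathbf{x})\le 0\}$ whose boundary contains $\mathbf{x}_0$, one has $\partial\Omega_g=\{\mathbf{x}\in D: g(\mathbf{x})=0\}$. The domain $\Omega_g$ need not be simply connected, and $\partial\Omega_g$ is of class $\mathcal{C}^4$. It is known that $\partial\Omega_g$ has finitely many connected components, and that for any point $\mathbf{p}$ on a component, the Hamiltonian system $$z_1'(t)=-\partial_2 g(z_1(t),z_2(t)),\quad z_2'(t)=\partial_1 g(z_1(t),z_2(t)),\quad (z_1(0),z_2(0))=\mathbf{p}$$ has a unique solution, which is periodic and which parametrizes that whole component on its main (minimal) period. $T_g$ denotes this period. Notation. $g_+=\max(g,0)$. $\mathbf{n}$ is the unit normal. A Carathéodory function $j(\mathbf{x},s)$ is (Borel) measurable in $\mathbf{x}$ for each $s$ and continuous in $s$ for each $\mathbf{x}$. Since $H^2\subset\mathcal{C}$ on closures of smooth planar domains, $\Delta y$ is continuous up to the boundary when $y\in H^4$. Shape optimization problem (S). Minimize over $g\in\mathcal{F}$ the cost $\int_{\partial\Omega_g} j(\sigma,\Delta y_{\Omega_g}(\sigma))\,d\sigma$, where $y_{\Omega_g}\in H^4(\Omega_g)\cap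 H^2_0(\Omega_g)$ is the (unique) solution of the clamped plate problem $\Delta\Delta y_{\Omega_g}=f$ in $\Omega_g$, $y_{\Omega_g}=\frac{\partial y_{\Omega_g}}{\partial\mathbf{n}}=0$ on $\partial\Omega_g$. Constrained control problem (C). The controls are $g\in\mathcal{F}$ and a measurable function $u$ on $D$ with $g_+^2u\in L^2(D)$. The state $y=y_{g,u}\in H^4(D)\cap H^2_0(D)$ is the unique solution of $$\Delta\Delta y=f+g_+^2u\ \text{ a.e. in } D,\qquad y=\frac{\partial y}{\partial\mathbf{n}}=0\ \text{ on }\partial D.$$ One minimizes the cost $$\int_0^{T_g} j\big(\mathbf{z}(t),\Delta y(\mathbf{z}(t))\big)\,|\mathbf{z}'(t)|\,dt$$ subject to the constraints $$\int_0^{T_g}|y(\mathbf{z}(t))|^2|\mathbf{z}'(t)|\,dt=0,\qquad \int_0^{T_g}\Big|\nabla y(\mathbf{z}(t))\cdot\frac{\nabla g(\mathbf{z}(t))}{|\nabla g(\mathbf{z}(t))|}\Big|^2|\mathbf{z}'(t)|\,dt=0,$$ where $\mathbf{z}=(z_1,z_2)$ solves the Hamiltonian system above with $\mathbf{z}(0)=\mathbf{x}_0$. If $\partial\Omega_g$ has several connected components, each of these three integrals $\int_0^{T_g}$ is understood as the sum of the corresponding integrals over all components, each component being parametrized by the Hamiltonian system started at some fixed point of it, over its own main period. *)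

(* Defs.v *)
From HB Require Import structures.
From mathcomp Require Import all_boot all_order all_algebra.
From mathcomp Require Import all_classical all_reals all_analysis.
Set Implicit Arguments.
Unset Strict Implicit.
Unset Printing Implicit Defensive.
Import Order.TTheory GRing.Theory Num.Theory.
Import numFieldNormedType.Exports.
Local Open Scope classical_set_scope.
Local Open Scope ring_scope.

Section calculus.
Context {R : realType}.
Implicit Types (U D : set (R * R)) (h y v : R * R -> R) (s : seq bool).

(* The library norm of [R * R] is the sup norm. *)
Definition norm2 (x : R * R) : R := Num.sqrt (x.1 ^+ 2 + x.2 ^+ 2).

(* Directions are booleans: [false] is x_1 and [true] is x_2.  A list of
   directions encodes an iterated partial derivative. *)
Definition dir (b : bool) : R * R := if b then (0, 1) else (1, 0).

Definition pd (b : bool) h : R * R -> R := fun x => 'D_(dir b) h x.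

Definition pds s h : R * R -> R := foldr pd h s.

Definition grad h (x : R * R) : R * R := (pd false h x, pd true h x).

Definition class_C (k : nat) U h : Prop :=
  (forall s, (size s <= k)%N -> forall x, U x -> {for x, continuous (pds s h)})
  /\ (forall s b, (size s < k)%N ->
        forall x, U x -> derivable (pds s h) x (dir b)).

Definition class_C_closure (k : nat) D h : Prop :=
  [/\ class_C k D h, {within closure D, continuous h} &
      forall s, (size s <= k)%N -> exists v,
        {within closure D, continuous v} /\ forall x, D x -> v x = pds s h x].

Definition class_C1d (k : nat) (c : R -> R) : Prop :=
  (forall i t, (i < k)%N -> derivable (derive1n i c) t 1)
  /\ (forall i, (i <= k)%N -> continuous (derive1n i c)).

Definition bdry (A : set (R * R)) : set (R * R) := closure A `\` A°.

(* Near each boundary point D is, after possibly exchanging the coordinates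
   and reversing the second one, the strict epigraph of a C^k function. *)
Definition boundary_C (k : nat) D : Prop :=
  forall p, bdry D p -> exists (swap neg : bool) (c : R -> R),
    class_C1d k c /\
    \forall x \near p,
      let a := if swap then x.2 else x.1 in
      let b := if swap then x.1 else x.2 in
      D x <-> c a < (-1) ^+ neg * b.

Definition bounded_domain D : Prop :=
  [/\ open D, connected D, D !=set0 & bounded_set D].

End calculus.

Section sobolev.
Context {R : realType}.
Implicit Types (U : set (R * R)) (h y v w : R * R -> R) (s : seq bool).

Definition leb2 :
    {measure set (measurableTypeR R * measurableTypeR R) -> \bar R} :=
  (@lebesgue_measure R \x @lebesgue_measure R)%E.

Definition L2 U h : Prop :=
  measurable_fun U h /\ leb2.-integrable U (EFin \o (fun x => h x ^+ 2)).

Definition test_fun U (phi : R * R -> R) : Prop :=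
  (forall k, class_C k setT phi) /\
  exists K, [/\ compact K, K `<=` U & forall x, ~ K x -> phi x = 0].

Definition wderiv U s y v : Prop :=
  [/\ L2 U y, L2 U v & forall phi, test_fun U phi ->
    (\int[leb2]_(x in U) (y x * pds s phi x) =
     (-1) ^+ size s * \int[leb2]_(x in U) (v x * phi x))%R].

Definition sobolev (k : nat) U y : Prop :=
  L2 U y /\ forall s, (size s <= k)%N -> exists v, wderiv U s y v.

(* H^2_0(U): closure of the test functions in H^2(U). *)
Definition H20 U y : Prop :=
  sobolev 2 U y /\
  forall e : R, 0 < e -> exists phi, test_fun U phi /\
    forall s v, (size s <= 2)%N -> wderiv U s y v ->
      (\int[leb2]_(x in U) (((v x - pds s phi x) ^+ 2)%:E) < e%:E)%E.

Definition wlap U y w : Prop :=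
  exists v1 v2, [/\ wderiv U [:: false; false] y v1,
    wderiv U [:: true; true] y v2 &
    {ae leb2, forall x, U x -> w x = v1 x + v2 x}].

(* The boundary conditions y = dy/dn = 0 are those encoded by H^2_0(U). *)
Definition clamped_plate U h y : Prop :=
  [/\ sobolev 4 U y, H20 U y &
    exists w b, [/\ wlap U y w, wlap U w b &
      {ae leb2, forall x, U x -> b x = h x}]].

(* Representative, continuous up to the boundary, of the weak derivative of y
   along s.  For open U its values on [closure U] are uniquely determined
   whenever such a representative exists, which is the case for [size s <= 2]
   and y in H^4(U), since H^2 embeds into the continuous functions. *)
Definition cderiv U s y : R * R -> R :=
  xget (fun=> 0) [set v | wderiv U s y v /\ {within closure U, continuous v}].

Definition clap U y : R * R -> R :=
  fun x => cderiv U [:: false; false] y x + cderiv U [:: true; true] y x.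

End sobolev.

(* The arc length d(sigma) is the one-dimensional Hausdorff measure for the
   Euclidean distance.  [mu_ext] takes coverings by Borel sets; as a set and its
   closure have the same diameter, this is no restriction. *)
Section hausdorff.
Context {R : realType}.
Local Open Scope ereal_scope.

Definition diam2 (A : set (R * R)) : \bar R :=
  ereal_sup (0 |` [set r | exists x y, [/\ A x, A y & r = (norm2 (x - y)%R)%:E]]).

Definition diam_le (d : R) (A : set (R * R)) : \bar R :=
  if diam2 A <= d%:E then diam2 A else +oo.

Definition hausdorff1 (A : set (R * R)) : \bar R :=
  ereal_sup [set mu_ext (diam_le d) A | d in [set d : R | (0 < d)%R]].

Lemma diam2_ge0 A : 0 <= diam2 A.
Proof. by apply: ereal_sup_ubound; left. Qed.

Lemma diam2_set0 : diam2 set0 = 0.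
Proof.
apply/eqP; rewrite eq_le diam2_ge0 andbT.
by apply: ge_ereal_sup => r [->//|[x [y []]]].
Qed.

Lemma diam_le_ge0 d A : 0 <= diam_le d A.
Proof. by rewrite /diam_le; case: ifP => _; rewrite ?diam2_ge0 ?leey. Qed.

Lemma diam_le_set0 d : (0 < d)%R -> diam_le d set0 = 0.
Proof. by move=> d0; rewrite /diam_le diam2_set0 lee_fin ltW. Qed.

Lemma hausdorff1_ge0 A : 0 <= hausdorff1 A.
Proof.
apply: ereal_sup_ge; exists (mu_ext (diam_le 1%R) A); first by exists 1%R => /=.
by apply: mu_ext_ge0 => // *; exact: diam_le_ge0.
Qed.

Lemma hausdorff1_set0 : hausdorff1 set0 = 0.
Proof.
apply/eqP; rewrite eq_le hausdorff1_ge0 andbT.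
apply: ge_ereal_sup => _ [d /= d0 <-].
by rewrite mu_ext0 ?diam_le_set0// => *; exact: diam_le_ge0.
Qed.

Lemma le_hausdorff1 : {homo hausdorff1 : A B / A `<=` B >-> A <= B}.
Proof.
move=> A B AB; apply: ge_ereal_sup => _ [d /= d0 <-].
apply: ereal_sup_ge; exists (mu_ext (diam_le d) B); first by exists d.
exact: le_mu_ext.
Qed.

Lemma hausdorff1_sigma_subadditive : sigma_subadditive hausdorff1.
Proof.
move=> A; apply: ge_ereal_sup => _ [d /= d0 <-].
have ge0 X : 0 <= diam_le d X by exact: diam_le_ge0.
apply: (le_trans (mu_ext_sigma_subadditive ge0 A)).
apply: lee_nneseries => [n *|n *]; first by apply: mu_ext_ge0 => *; exact: ge0.
by apply: ereal_sup_ubound; exists d.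
Qed.

HB.instance Definition _ := isOuterMeasure.Build R (R * R)%type hausdorff1
  hausdorff1_set0 hausdorff1_ge0 le_hausdorff1 hausdorff1_sigma_subadditive.

Definition hausdorff1_outer : {outer_measure set (R * R) -> \bar R} := hausdorff1.

Definition arclength :
    {measure set (caratheodory_type hausdorff1_outer) -> \bar R} :=
  hausdorff1_outer : set (caratheodory_type hausdorff1_outer) -> \bar R.

End hausdorff.

Section problems.
Context {R : realType}.
Implicit Types (D U : set (R * R)) (g f u y : R * R -> R).
Implicit Types (j : R * R -> R -> R) (n : nat).

Definition caratheodory_fun D j : Prop :=
  (forall s, measurable_fun D (j ^~ s)) /\ (forall x, D x -> continuous (j x)).

(* Omega_g.  The connected component having x0 on its boundary is unique because
   the gradient of g does not vanish at x0; it is therefore the set of the points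
   whose component has x0 on its boundary. *)
Definition Omega D (x0 : R * R) g : set (R * R) :=
  let S := [set x | D x /\ g x <= 0]° in
  [set x | S x /\ bdry (connected_component S x) x0].

Definition admissible_family D (x0 : R * R) (F : set (R * R -> R)) : Prop :=
  forall g, F g ->
  [/\ class_C_closure 4 D g,
      g x0 = 0,
      (forall x, D x -> g x = 0 -> 0 < norm2 (grad g x)),
      (forall x, bdry D x -> 0 < g x) &
      bdry (Omega D x0 g) = [set x | D x /\ g x = 0]].

Definition hamiltonian_flow D g (p : R * R) (z : R -> R * R) : Prop :=
  z 0 = p /\ forall t : R,
  [/\ D (z t),
      is_derive t 1 (fun r => (z r).1) (- pd true g (z t)) &
      is_derive t 1 (fun r => (z r).2) (pd false g (z t))].

Definition main_period (z : R -> R * R) (T : R) : Prop :=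
  [/\ 0 < T, (forall t, z (t + T) = z t) &
      forall S, 0 < S < T -> exists t, z (t + S) <> z t].

(* One starting point on each of the n components of the boundary of Omega_g,
   with x0 on its own component, the Hamiltonian trajectories started at these
   points, and their main periods. *)
Definition boundary_param D (x0 : R * R) g n (p : 'I_n -> R * R) (z : 'I_n -> R -> R * R)
    (T : 'I_n -> R) : Prop :=
  let G := bdry (Omega D x0 g) in
  [/\ (forall i, G (p i)),
      (forall q, G q -> exists! i, connected_component G (p i) q),
      (exists i, p i = x0),
      (forall i, hamiltonian_flow D g (p i) (z i)) &
      (forall i, main_period (z i) (T i))].

Definition speed (z : R -> R * R) (t : R) : R :=
  norm2 (derive1 (fun r => (z r).1) t, derive1 (fun r => (z r).2) t).

Definition gplus g : R * R -> R := fun x => Num.max (g x) 0.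

Definition control D g u : Prop :=
  measurable_fun D u /\ L2 D (fun x => gplus g x ^+ 2 * u x).

Definition is_state D f g u y : Prop :=
  clamped_plate D (fun x => f x + gplus g x ^+ 2 * u x) y.

Definition normal_deriv D g y (x : R * R) : R :=
  (cderiv D [:: false] y x * (grad g x).1 + cderiv D [:: true] y x * (grad g x).2)
  / norm2 (grad g x).

Definition constraints D g n (z : 'I_n -> R -> R * R) (T : 'I_n -> R) y : Prop :=
  ((\sum_(i < n) \int[lebesgue_measure]_(t in `[0%R, T i])
      ((`|cderiv D [::] y (z i t)| ^+ 2 * speed (z i) t)%R%:E) = 0)%E) /\
  ((\sum_(i < n) \int[lebesgue_measure]_(t in `[0%R, T i])
      ((`|normal_deriv D g y (z i t)| ^+ 2 * speed (z i) t)%R%:E) = 0)%E).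

(* An integral is defined when its positive or its negative part has a finite
   integral; its value is then possibly infinite. *)
Definition integral_defined d (X : measurableType d)
    (mu : {measure set X -> \bar R}) (A : set X) (h : X -> R) : Prop :=
  measurable_fun A h /\
  ((\int[mu]_(x in A) ((EFin \o h)^\+ x) < +oo)%E \/
   (\int[mu]_(x in A) ((EFin \o h)^\- x) < +oo)%E).

Definition shape_density j U y : caratheodory_type (@hausdorff1_outer R) -> R :=
  fun x => j x (clap U y x).

Definition shape_cost_defined j U y : Prop :=
  integral_defined arclength (bdry U) (shape_density j U y).

Definition shape_cost j U y : \bar R :=
  (\int[arclength]_(x in bdry U) (shape_density j U y x)%:E)%E.

Definition control_density j D y (z : R -> R * R) (t : R) : R :=
  j (z t) (clap D y (z t)) * speed z t.

Definition control_cost_defined j D n (z : 'I_n -> R -> R * R) (T : 'I_n -> R) y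
    : Prop :=
  (forall i, measurable_fun `[0, T i] (control_density j D y (z i))) /\
  ((forall i, \int[lebesgue_measure]_(t in `[0%R, T i])
      ((EFin \o control_density j D y (z i))^\+ t) < +oo)%E \/
   (forall i, \int[lebesgue_measure]_(t in `[0%R, T i])
      ((EFin \o control_density j D y (z i))^\- t) < +oo)%E).

Definition control_cost j D n (z : 'I_n -> R -> R * R) (T : 'I_n -> R) y
    : \bar R :=
  (\sum_(i < n) \int[lebesgue_measure]_(t in `[0%R, T i])
      (control_density j D y (z i) t)%:E)%E.

Definition equal_costs j D U n (z : 'I_n -> R -> R * R) (T : 'I_n -> R) y yU
    : Prop :=
  (control_cost_defined j D z T y <-> shape_cost_defined j U yU) /\
  (control_cost_defined j D z T y -> control_cost j D z T y = shape_cost j U yU).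

End problems.

(* Main.v *)
(** Omega_g is {g < 0}, a domain of class C^4 whose boundary is {g = 0}, and g_+ vanishes on it.

    The trajectory z_i is injective over its period and runs through its whole component, so that arc length
    pulls back to |z_i'(t)| dt; hence the two costs agree as soon as the two states have the same second
    derivatives on {g = 0}.  By the Sobolev embedding a state y has a C^2 representative V, and the constraints
    say that V and its gradient vanish on {g = 0}: the normal derivative by hypothesis, the tangential one
    because V is 0 along the trajectories.

    (i) A C^2 function whose trace and gradient vanish on the boundary lies in H^2_0: multiply it by a cutoff of
    -g at scale 1/n.  Thus y restricted to Omega_g solves the clamped plate problem, whose solution is unique.

    (ii) Extend y_Omega by higher-order reflection to a function of H^4(R^2), and cut it off inside D into y.
    Then u = (bilaplacian of y - f) / g_+^2 on {g > 0} and u = 0 elsewhere is the control: the equation holds on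
    Omega_g by assumption and on {g > 0} by construction, while {g = 0} is negligible.  The constraints hold
    because functions of H^2_0(Omega_g) have zero trace and zero gradient on the boundary. *)

Require Import Defs.
From HB Require Import structures.
From mathcomp Require Import all_boot all_order all_algebra.
From mathcomp Require Import all_classical all_reals all_analysis.
From mathcomp Require Import measurable_realfun ring lra.
Import Order.TTheory GRing.Theory Num.Theory.
Import numFieldNormedType.Exports.
Local Open Scope classical_set_scope.
Local Open Scope ring_scope.
Set Implicit Arguments.
Unset Strict Implicit.
Unset Printing Implicit Defensive.

(** * Integration on the plane *)

(** The values of [cderiv] and [clap] on a closure come from a choice made by [xget]. They become
    computable through one compactly supported C^2 function [V] on the whole plane that equals the
    state almost everywhere in the domain: by [cderiv_representative] they are the classical
    derivatives of [V]. Constraints, costs and membership in [H20] are then all statements about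
    [V].

    No trace operator is constructed. A boundary value of a function of [H20] is detected by the
    divergence identity against a bump.

    No change of variables theorem for the plane is used either. The boundary is a local graph, and
    the reflections across it are shears, affine on each line parallel to one axis; Fubini and the
    scaling of Lebesgue measure on the line suffice, and the slope of the graph enters only as a
    multiplier.

    That Omega_g is all of {g < 0}, and not one component of it among others, rests on the
    assumption that its boundary is the full zero set of g.

    Arc length is a Hausdorff measure defined by coverings, so both its additivity on Borel sets and
    its agreement with the speed have to be derived from diameters. *)

Section plane_measure.
Context {R : realType}.
Local Notation mR := (measurableTypeR R).
Local Notation mP := (mR * mR)%type.
Implicit Types (h f g : R * R -> R) (A U : set (R * R)).

Definition intg h := leb2.-integrable setT (EFin \o h).
Definition It h : R := (\int[leb2]_x h x)%R.

(** The rational squares contained in [A] are countably many and cover it; this links the product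
    sigma-algebra, generated by rectangles, to the topology. *)
Lemma open_measurable2 A : open A -> @measurable _ mP A.
Proof.
move=> oA.
pose B (q : (rat * rat) * rat) : set (R * R) :=
  `]ratr q.1.1 - ratr q.2, ratr q.1.1 + ratr q.2[%classic `*` `]ratr q.1.2 - ratr q.2, ratr q.1.2 + ratr q.2[%classic.
have mB q : @measurable _ mP (B q) by apply: measurableX; exact: measurable_itv.
have -> : A = \bigcup_q (if pselect (B q `<=` A) then B q else set0).
  apply/seteqP; split => [x Ax|x [q _]]; last by case: (pselect (B q `<=` A)) => [h /h|].
  have /nbhs_ballP[e /= e0 xeA] := open_nbhs_nbhs (conj oA Ax).
  have e2 : 0 < e / 2 by rewrite divr_gt0.
  have [r] : exists r : rat, ratr r \in `]0, e / 2[ by exact: rat_in_itvoo.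
  rewrite in_itv/= => /andP[r0 re].
  have [q1] : exists r' : rat, ratr r' \in `]x.1 - ratr r, x.1 + ratr r[.
    by apply: rat_in_itvoo; rewrite ltrBlDr -addrA ltrDl addr_gt0.
  have [q2] : exists r' : rat, ratr r' \in `]x.2 - ratr r, x.2 + ratr r[.
    by apply: rat_in_itvoo; rewrite ltrBlDr -addrA ltrDl addr_gt0.
  rewrite !in_itv/= => /andP[a1 a2] /andP[b1 b2].
  exists ((q1, q2), r) => //; case: (pselect (B ((q1, q2), r) `<=` A)) => [?|[]] /=; first by split; rewrite /= in_itv/=; lra.
  move=> y [] /=; rewrite !in_itv/= => y1 y2; apply: xeA; split; rewrite /ball/= ltr_norml; lra.
apply: countable_bigcupT_measurable => [|q]; first exact: countableP.
by case: (pselect (B q `<=` A)) => ? /=; [exact: mB|exact: measurable0].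
Qed.

Lemma closed_measurable2 A : closed A -> @measurable _ mP A.
Proof.
by move=> cA; rewrite -[A]setCK; apply: measurableC; apply: open_measurable2; rewrite openC.
Qed.

Definition mf h := @measurable_fun _ _ mP R setT h.

Lemma continuous_measurable_on U h : open U ->
  (forall x, U x -> {for x, continuous h}) -> @measurable_fun _ _ mP R U h.
Proof.
move=> oU ch; apply: (measurability _ (RGenOpens.measurableE R)).
move=> _ [_ [a [b ->] <-]]; apply: open_measurable2.
rewrite openE => x [Ux hx]; apply: filterI; first exact: open_nbhs_nbhs.
by apply: (ch x Ux); apply: open_nbhs_nbhs; split => //; exact: interval_open.
Qed.

Lemma continuous_mf h : continuous h -> mf h.
Proof.
move=> ch; apply: (@continuous_measurable_on [set: R * R]); last by move=> x _; exact: ch.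
exact: openT. Qed.

Lemma intg_mf h : intg h -> mf h.
Proof. by move=> /measurable_int /measurable_EFinP. Qed.

Lemma le_intg h f : mf h -> (forall x, `|h x| <= f x) -> intg f -> intg h.
Proof.
move=> mh hf fi; apply: (le_integrable _ _ _ fi) => //; first exact/measurable_EFinP.
by move=> x _ /=; rewrite lee_fin (le_trans (hf x))// ler_norm.
Qed.

Lemma intgD h f : intg h -> intg f -> intg (h \+ f).
Proof. by move=> ih jf; apply: eq_integrable (integrableD _ ih jf). Qed.

Lemma intgZ k h : intg h -> intg (fun x => k * h x).
Proof. by move=> ih; apply: eq_integrable (integrableZl _ k ih). Qed.

Lemma intgN h : intg h -> intg (fun x => - h x).
Proof. by move=> /(intgZ (-1)); apply: eq_integrable => // x _ /=; rewrite mulN1r. Qed.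

Lemma intgB h f : intg h -> intg f -> intg (fun x => h x - f x).
Proof. by move=> ih /intgN; exact: intgD. Qed.

Lemma ItD h f : intg h -> intg f -> It (fun x => h x + f x) = It h + It f.
Proof. by move=> ih jf; apply: RintegralD. Qed.

Lemma ItB h f : intg h -> intg f -> It (fun x => h x - f x) = It h - It f.
Proof. by move=> ih jf; apply: RintegralB. Qed.

Lemma ItZ k h : intg h -> It (fun x => k * h x) = k * It h.
Proof. by move=> ih; apply: RintegralZl. Qed.

Lemma ItN h : intg h -> It (fun x => - h x) = - It h.
Proof.
move=> ih; rewrite -mulN1r -ItZ//; congr It; apply/funext => x; by rewrite mulN1r.
Qed.

Lemma le_It h f : intg h -> intg f -> (forall x, h x <= f x) -> It h <= It f.
Proof. by move=> ih jf hf; apply: le_Rintegral. Qed.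

Lemma It_ge0 h : (forall x, 0 <= h x) -> 0 <= It h.
Proof. by move=> h0; apply: Rintegral_ge0. Qed.

Lemma It_eq0 h : (forall x, h x = 0) -> It h = 0.
Proof.
by move=> h0; rewrite /It (_ : h = cst 0) ?Rintegral_cst ?mul0r//; exact/funext.
Qed.

Lemma EFin_It h : intg h -> (It h)%:E = (\int[leb2]_x (h x)%:E)%E.
Proof. by move=> ih; rewrite /It /Rintegral fineK//; apply: integrable_fin_num. Qed.

Lemma le_norm_It h f : mf h -> intg f -> (forall x, `|h x| <= f x) -> `|It h| <= It f.
Proof.
move=> mh jf hf; have ih := le_intg mh hf jf.
rewrite ler_norml; apply/andP; split; last first.
  by apply: le_It => // x; rewrite (le_trans (ler_norm _)).
rewrite -ItN//; apply: le_It => //; first exact: intgN.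
by move=> x; rewrite lerNl (le_trans _ (hf x))// -normrN ler_norm.
Qed.

Lemma aeS (P Q : R * R -> Prop) : {ae leb2, forall x, P x} ->
  (forall x, P x -> Q x) -> {ae leb2, forall x, Q x}.
Proof. by move=> aP PQ; apply: negligibleS aP => x /= nQ Px; apply: nQ; exact: PQ. Qed.

Lemma aeI (P Q : R * R -> Prop) : {ae leb2, forall x, P x} ->
  {ae leb2, forall x, Q x} -> {ae leb2, forall x, P x /\ Q x}.
Proof.
move=> aP aQ; apply: negligibleS (negligibleU aP aQ) => x /= nPQ.
by case: (pselect (P x)) => Px; [right => Qx; apply: nPQ|left].
Qed.

Lemma It_mkcond U h : (\int[leb2]_(x in U) h x)%R = It (h \_ U).
Proof. exact: Rintegral_mkcond. Qed.

Lemma ae_eq_It h f : mf h -> mf f -> {ae leb2, forall x, h x = f x} -> It h = It f.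
Proof.
move=> mh mff hf; congr fine; apply: ae_eq_integral => //; try exact/measurable_EFinP.
by apply: (aeS hf) => x -> _.
Qed.

Lemma dct (h_ : nat -> R * R -> R) h f :
  (forall n, mf (h_ n)) -> mf h -> {ae leb2, forall x, h_ n x @[n --> \oo] --> h x} ->
  intg f -> (forall n x, `|h_ n x| <= f x) -> It (h_ n) @[n --> \oo] --> It h.
Proof.
move=> mh_ mh cvh fi hf.
have ci : forall k, mf k -> @measurable_fun _ _ mP _ setT (EFin \o k).
  by move=> k mk; exact/measurable_EFinP.
have [|||ih _ cv] := @dominated_convergence _ _ _ (@leb2 R) setT measurableT
  (fun n => EFin \o h_ n) (EFin \o h) (EFin \o f) (fun n => ci _ (mh_ n)) (ci _ mh).
- by apply: (aeS cvh) => x cvx _; apply: cvg_EFin => //; apply: nearW.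
- exact: fi.
- by apply: aeW => x n _; rewrite /= lee_fin.
- apply: fine_cvg; rewrite fineK; first exact: cv.
  by apply: integrable_fin_num.
Qed.

Lemma mf_patch U h : @measurable _ mP U -> mf (h \_ U) <-> @measurable_fun _ _ mP _ U h.
Proof. by move=> mU; split => /(measurable_restrictT _ mU). Qed.

Lemma mfM h f : mf h -> mf f -> mf (fun x => h x * f x).
Proof. by move=> mh mff; apply: measurable_funM. Qed.

Lemma mfD h f : mf h -> mf f -> mf (fun x => h x + f x).
Proof. by move=> mh mff; apply: measurable_funD. Qed.

Lemma mfB h f : mf h -> mf f -> mf (fun x => h x - f x).
Proof. by move=> mh mff; apply: measurable_funB. Qed.

Lemma mf_indic U : @measurable _ mP U -> mf (\1_U).
Proof. by move=> mU; apply: measurable_indic. Qed.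

(** With [co] and [pt] the distinguished direction [b] always comes last, so that each one-variable
    argument is written once for both axes. *)
Definition co (b : bool) (x : R * R) : R := if b then x.2 else x.1.
Definition pt (b : bool) (s t : R) : R * R := if b then (s, t) else (t, s).

Lemma co_pt b s t : co b (pt b s t) = t. Proof. by case: b. Qed.
Lemma co_ptN b s t : co (~~ b) (pt b s t) = s. Proof. by case: b. Qed.
Lemma pt_co b x : pt b (co (~~ b) x) (co b x) = x. Proof. by case: b; case: x. Qed.

Lemma continuous_co b : continuous (co b).
Proof. by case: b => x; [exact: cvg_snd|exact: cvg_fst]. Qed.

Lemma continuous_pt b s : continuous (pt b s).
Proof.
case: b => t.
  exact: (@cvg_pair _ _ _ (nbhs t) (nbhs s) (nbhs t) _ _ _ (fun=> s) id (cvg_cst s) cvg_id).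
exact: (@cvg_pair _ _ _ (nbhs t) (nbhs t) (nbhs s) _ _ _ id (fun=> s) cvg_id (cvg_cst s)).
Qed.

Lemma measurable_pt b s : @measurable_fun _ _ mR mP setT (pt b s).
Proof. by case: b; [exact: pair1_measurable|exact: pair2_measurable]. Qed.

Lemma mf_co b : mf (co b). Proof. by apply: continuous_mf; exact: continuous_co. Qed.

Lemma sigma_finite_leb2 : sigma_finite setT (@leb2 R).
Proof.
exists (fun n : nat => `]- n%:R, n%:R]%classic `*` `]- n%:R, n%:R]%classic).
  apply/seteqP; split => // x _.
  have : setT x.1 by []. have : setT x.2 by [].
  rewrite -(bigcup_itvT false false) => -[n _ xn] [m _ xm]; exists (maxn n m) => //.
  have nx : n%:R <= (maxn n m)%:R :> R by rewrite ler_nat leq_maxl.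
  have mx : m%:R <= (maxn n m)%:R :> R by rewrite ler_nat leq_maxr.
  move: xn xm; rewrite /= !in_itv/= => xn xm.
  have h1 : x.1 \in `]- (maxn n m)%:R, (maxn n m)%:R] by rewrite in_itv/=; lra.
  have h2 : x.2 \in `]- (maxn n m)%:R, (maxn n m)%:R] by rewrite in_itv/=; lra.
  by split.
move=> n; split; first by apply: measurableX; exact: measurable_itv.
pose I := [set` `]- n%:R, n%:R] : interval R].
have -> : leb2 (I `*` I) = (lebesgue_measure I * lebesgue_measure I)%E.
  by apply: product_measure1E; exact: measurable_itv.
by rewrite /I lebesgue_measure_itv/= lte_fin; case: ifP => _; rewrite ?mule0// -EFinD -EFinM ltry.
Qed.

(* [leb2] unfolded to a plain set function, on which the structure of sigma-finite
   measure can be inferred *)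
Definition sleb2 : set mP -> \bar R := @leb2 R.
HB.instance Definition _ := Measure.on sleb2.
HB.instance Definition _ := @Measure_isSigmaFinite.Build _ _ _ sleb2 sigma_finite_leb2.

Lemma leb2_ysection A : @measurable _ mP A ->
  leb2 A = (\int[lebesgue_measure]_t lebesgue_measure (ysection A t))%E.
Proof.
move=> mA; have T := indic_fubini_tonelli (@lebesgue_measure R) (@lebesgue_measure R) mA.
have EF := @indic_fubini_tonelli_FE _ _ _ _ R (@lebesgue_measure R) A.
have EG := @indic_fubini_tonelli_GE _ _ _ _ R (@lebesgue_measure R) A.
transitivity (integral lebesgue_measure setT (fubini_F (@lebesgue_measure R) (EFin \o \1_A))).
  by rewrite EF.
transitivity (integral lebesgue_measure setT (fubini_G (@lebesgue_measure R) (EFin \o \1_A))).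
  exact: T.
by rewrite EG.
Qed.

Lemma leb2_xsection A : @measurable _ mP A ->
  leb2 A = (\int[lebesgue_measure]_s lebesgue_measure (xsection A s))%E.
Proof. by []. Qed.

Definition bsection (b : bool) A (s : R) : set R := [set t | A (pt b s t)].

Lemma measurable_bsection b A s : @measurable _ mP A -> @measurable _ mR (bsection b A s).
Proof. by move=> mA; rewrite -[bsection _ _ _]setTI; exact: measurable_pt. Qed.

Lemma measurable_bsection_measure b A : @measurable _ mP A ->
  @measurable_fun _ _ mR _ setT (fun s => lebesgue_measure (bsection b A s)).
Proof.
move=> mA; case: b.
  rewrite (_ : (fun s => _) = @lebesgue_measure R \o xsection A).
    exact: measurable_fun_xsection.
  apply/funext => s /=; congr lebesgue_measure.
  by apply/seteqP; split => t; rewrite /xsection/= inE.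
rewrite (_ : (fun s => _) = @lebesgue_measure R \o ysection A).
  exact: measurable_fun_ysection.
apply/funext => s /=; congr lebesgue_measure.
by apply/seteqP; split => t; rewrite /ysection/= inE.
Qed.

Lemma leb2_bsection b A : @measurable _ mP A ->
  leb2 A = (\int[lebesgue_measure]_s lebesgue_measure (bsection b A s))%E.
Proof.
move=> mA; case: b.
  rewrite leb2_xsection//; congr integral; apply/funext => s; congr lebesgue_measure.
  by apply/seteqP; split => t; rewrite /xsection/= inE.
rewrite leb2_ysection//; congr integral; apply/funext => s; congr lebesgue_measure.
by apply/seteqP; split => t; rewrite /ysection/= inE.
Qed.

Lemma Fubini_It b h : intg h ->
  It h = (\int[lebesgue_measure]_s (\int[lebesgue_measure]_t h (pt b s t)))%R.
Proof.
move=> ih; case: b.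
  have aei := ae_integrable1 ih.
  rewrite /It {1}/Rintegral -[X in fine X](integral12_prod_meas1 ih).
  have mF := measurable_fubini_F ih.
  congr fine; apply: ae_eq_integral => //.
    apply/measurable_EFinP; exact: (measurableT_comp (fine_measurable measurableT) mF).
  apply: filterS aei => s si _; rewrite /fubini_F/= /Rintegral fineK//.
  exact: integrable_fin_num.
have aei := ae_integrable2 ih.
rewrite /It {1}/Rintegral -[X in fine X](integral21_prod_meas1 ih).
have mF := measurable_fubini_G ih.
congr fine; apply: ae_eq_integral => //.
  apply/measurable_EFinP; exact: (measurableT_comp (fine_measurable measurableT) mF).
apply: filterS aei => s si _; rewrite /fubini_G/= /Rintegral fineK//.
exact: integrable_fin_num.
Qed.

(** The image measure rescaled by |a| agrees with Lebesgue measure on half-open intervals, hence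
    everywhere by uniqueness. The sign of [a] decides which end of the preimage is open. *)
Lemma lebesgue_affine (a c : R) (A' : set R) : a != 0 -> @measurable _ mR A' ->
  (lebesgue_measure [set t | A' (a * t + c)%R] = `|a|^-1%:E * lebesgue_measure A')%E.
Proof.
move=> a0 mA.
have mphi : @measurable_fun _ _ mR mR setT (fun t => a * t + c).
  apply: continuous_measurable_fun => t; apply: cvgD; last exact: cvg_cst.
  by apply: cvgM; [exact: cvg_cst|exact: cvg_id].
have na : 0 <= `|a| by [].
have an : 0 < `|a| by rewrite normr_gt0.
suff -> : lebesgue_measure A' = mscale (NngNum na)
    (pushforward (@lebesgue_measure R) (fun t : mR => (a * t + c) : mR)) A'.
  by rewrite /mscale/= muleA -EFinM mulVf ?normr_eq0// mul1e.
move=> m; apply: lebesgue_measure_unique => // X [[u v] _ <-] /=.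
rewrite /mscale/= /pushforward/=.
have [a_gt0|a_le0] := ltP 0 a.
  have -> : (fun t => a * t + c) @^-1` `]u, v]%classic = `](u - c) / a, (v - c) / a]%classic.
    apply/seteqP; split => t; rewrite /= !in_itv/= ltr_pdivrMr// ler_pdivlMr// => /andP[h1 h2];
    by apply/andP; split; lra.
  rewrite !lebesgue_measure_itv/= !lte_fin gtr0_norm// ltr_pM2r ?invr_gt0//.
  have -> : (u - c < v - c) = (u < v) by apply/idP/idP; lra.
  case: ifP => uv; last by rewrite mule0.
  by rewrite -!EFinD -EFinM; congr EFin; field; lra.
have a_lt0 : a < 0 by rewrite lt_neqAle a0.
have -> : (fun t => a * t + c) @^-1` `]u, v]%classic = `[(v - c) / a, (u - c) / a[%classic.
  apply/seteqP; split => t; rewrite /= !in_itv/= ler_ndivrMr// ltr_ndivlMr// => /andP[h1 h2];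
  by apply/andP; split; lra.
rewrite !lebesgue_measure_itv/= !lte_fin ltr0_norm// ltr_nM2r ?invr_lt0//.
have -> : (u - c < v - c) = (u < v) by apply/idP/idP; lra.
case: ifP => uv; last by rewrite mule0.
by rewrite -!EFinD -EFinM; congr EFin; field; lra.
Qed.

(** The only changes of variables needed in the plane: of constant slope [a] on each line in
    direction [b], with an offset depending on the other coordinate. By Fubini the Jacobian is |a|
    as soon as [c] is measurable. *)
Definition shear b (a : R) (c : R -> R) (x : R * R) : R * R :=
  pt b (co (~~ b) x) (a * co b x + c (co (~~ b) x)).

Lemma measurable_shear b a c : @measurable_fun _ _ mR mR setT c ->
  @measurable_fun _ _ mP mP setT (shear b a c).
Proof.
move=> mc; have m1 : mf (fun x => a * co b x + c (co (~~ b) x)).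
  apply: mfD; first by apply: measurable_funM => //; exact: mf_co.
  by apply: (measurableT_comp mc); exact: mf_co.
have m2 := mf_co (~~ b).
by rewrite /shear; case: b m1 m2 => m1 m2; apply: measurable_fun_pair.
Qed.

Lemma leb2_shear b a c A : a != 0 -> @measurable_fun _ _ mR mR setT c ->
  @measurable _ mP A -> leb2 (shear b a c @^-1` A) = (`|a|^-1%:E * leb2 A)%E.
Proof.
move=> a0 mc mA; rewrite (leb2_bsection b)//; last first.
  by rewrite -[X in measurable X]setTI; exact: measurable_shear.
rewrite (leb2_bsection b mA) -ge0_integralZl//; last exact: measurable_bsection_measure.
apply: eq_integral => s _; rewrite -(@lebesgue_affine a (c s))//; last exact: measurable_bsection.
congr lebesgue_measure; apply/seteqP.
by split => t; rewrite /bsection/= /shear co_pt co_ptN.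
Qed.

Lemma ge0_integral_shear b a c (f : mP -> \bar R) : a != 0 ->
  @measurable_fun _ _ mR mR setT c -> measurable_fun setT f -> (forall x, 0 <= f x)%E ->
  (\int[leb2]_x f (shear b a c x) = `|a|^-1%:E * \int[leb2]_x f x)%E.
Proof.
move=> a0 mc mff f0; have mS := measurable_shear b a mc.
have na : 0 <= `|a|^-1 by [].
transitivity (\int[pushforward (@leb2 R) (shear b a c : mP -> mP)]_x f x)%E.
  by rewrite ge0_integral_pushforward// => x _.
transitivity (\int[mscale (NngNum na) (@leb2 R)]_x f x)%E.
  apply: (@eq_measure_integral _ _ _ setT (mscale (NngNum na) (@leb2 R))
    (measure_function_pushforward__canonical__measure_function_Measure (@leb2 R) mS)).
  by move=> A mA _; apply: leb2_shear.
by rewrite ge0_integral_mscale.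
Qed.

Lemma intg_shear b a c h : a != 0 -> @measurable_fun _ _ mR mR setT c ->
  intg h -> intg (h \o shear b a c).
Proof.
move=> a0 mc ih; apply/integrableP; split.
  apply/measurable_EFinP; apply: (measurableT_comp (intg_mf ih)); exact: measurable_shear.
have := @ge0_integral_shear b a c (fun x => `|(h x)%:E|%E) a0 mc.
move=> ->; last by [].
  by move/integrableP : ih => [_ ?]; apply: lte_mul_pinfty.
by apply: measurableT_comp => //; exact: (measurable_int _ ih).
Qed.

Lemma It_shear b a c h : a != 0 -> @measurable_fun _ _ mR mR setT c ->
  intg h -> It (h \o shear b a c) = `|a|^-1 * It h.
Proof.
move=> a0 mc ih; have mh := measurable_int _ ih.
have ep := @ge0_integral_shear b a c (fun x => (EFin \o h)^\+ x)%E a0 mc.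
have en := @ge0_integral_shear b a c (fun x => (EFin \o h)^\- x)%E a0 mc.
have fp := integrable_pos_fin_num measurableT ih.
have fn := integrable_neg_fin_num measurableT ih.
rewrite /It /Rintegral integralE.
transitivity (fine (\int[leb2]_x (EFin \o h)^\+ (shear b a c x) -
                    \int[leb2]_x (EFin \o h)^\- (shear b a c x))%E).
  by congr (fine (_ - _)%E); apply: eq_integral => x _; rewrite ?funeposE ?funenegE.
rewrite ep ?en//; [|exact: measurable_funeneg|exact: measurable_funepos].
rewrite fineB ?fin_numM// !fineM// -mulrBr -fineB//; congr (_ * fine _).
by rewrite [RHS]integralE.
Qed.

End plane_measure.

(** * Square integrable functions on the plane *)

Section plane_L2.
Context {R : realType}.
Local Notation mR := (measurableTypeR R).
Local Notation mP := (mR * mR)%type.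
Implicit Types (h f g : R * R -> R) (A U : set (R * R)).

Lemma intg_abs h : intg h -> intg (fun x => `|h x|).
Proof.
move=> /integrable_abse; apply: eq_integrable => // x _ /=.
Qed.

Lemma L2_patch U h : @measurable _ mP U -> L2 U h <-> L2 setT (h \_ U).
Proof.
move=> mU; have E : EFin \o (fun x => (h \_ U) x ^+ 2) = (EFin \o (fun x => h x ^+ 2)) \_ U.
  by apply/funext => x /=; rewrite /patch; case: ifP => // _; rewrite expr0n.
rewrite /L2 E; split => -[mh ih]; split.
- exact/(mf_patch _ mU).
- exact/(integrable_mkcond _ mU).
- exact/(mf_patch _ mU).
- exact/(integrable_mkcond _ mU).
Qed.

Lemma L2_mf h : L2 setT h -> mf h. Proof. by case. Qed.

Lemma L2_sq h : L2 setT h -> intg (fun x => h x ^+ 2). Proof. by case. Qed.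

Lemma mf_sq h : mf h -> mf (fun x => h x ^+ 2).
Proof. by move=> mh; rewrite (_ : (fun x => _) = (fun x => h x * h x))//; exact: mfM. Qed.

Lemma L2_intgM h f : L2 setT h -> L2 setT f -> intg (fun x => h x * f x).
Proof.
move=> [mh ih] [mff jf]; apply: (le_intg _ _ (intgD ih jf)); first exact: mfM.
by move=> x /=; rewrite ler_norml; nra.
Qed.

Lemma L2D h f : L2 setT h -> L2 setT f -> L2 setT (fun x => h x + f x).
Proof.
move=> Lh Lf; have [mh ih] := Lh; have [mff jf] := Lf.
split; first exact: mfD.
apply: (le_intg _ _ (intgZ 2 (intgD ih jf))); first by apply: mf_sq; exact: mfD.
move=> x /=; rewrite ger0_norm ?sqr_ge0//; have := sqr_ge0 (h x - f x).
by rewrite !sqrrD !sqrrN mulrN; lra.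
Qed.

Lemma L2_bnd C h f : L2 setT h -> mf f -> (forall x, `|f x| <= C * `|h x|) -> L2 setT f.
Proof.
move=> [mh ih] mff le; split => //.
apply: (le_intg _ _ (intgZ (C ^+ 2) ih)); first exact: mf_sq.
move=> x; rewrite normrX -[h x ^+ 2]real_normK ?num_real// -exprMn.
by apply: lerXn2r => //; rewrite nnegrE ?(le_trans _ (le x)).
Qed.

Lemma L2Z k h : L2 setT h -> L2 setT (fun x => k * h x).
Proof.
move=> Lh; apply: (@L2_bnd `|k| h _ Lh); first by apply: mfM; [exact: measurable_cst|exact: L2_mf].
by move=> x; rewrite normrM.
Qed.

Lemma L2B h f : L2 setT h -> L2 setT f -> L2 setT (fun x => h x - f x).
Proof.
move=> Lh /(L2Z (-1)) /(L2D Lh); congr L2; apply/funext => x; by rewrite mulN1r.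
Qed.

Lemma CauchySchwarz h f : L2 setT h -> L2 setT f ->
  (It (fun x => h x * f x)) ^+ 2 <= It (fun x => h x ^+ 2) * It (fun x => f x ^+ 2).
Proof.
move=> Lh Lf; have ihf := L2_intgM Lh Lf; have [_ ih] := Lh; have [_ jf] := Lf.
set a := It (fun x => h x ^+ 2); set b := It (fun x => h x * f x); set c := It (fun x => f x ^+ 2).
have q t : 0 <= a + 2 * t * b + t ^+ 2 * c.
  have -> : a + 2 * t * b + t ^+ 2 * c = It (fun x => (h x + t * f x) ^+ 2).
    rewrite -ItZ// -ItZ// -ItD//; last exact: intgZ.
    rewrite -ItD; [|by apply: intgD => //; exact: intgZ|exact: intgZ].
    by congr It; apply/funext => x; ring.
  by apply: It_ge0 => x; exact: sqr_ge0.
have c0 : 0 <= c by apply: It_ge0 => x; exact: sqr_ge0.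
have [ceq|cn] := eqVneq c 0.
  rewrite ceq mulr0; have [->|bn] := eqVneq b 0; first by rewrite expr0n.
  (* With c = 0 the quadratic is affine in t, and at this t it would be -1. *)
  have := q (- (a + 1) / (2 * b)); rewrite ceq mulr0 addr0.
  have -> : 2 * (- (a + 1) / (2 * b)) * b = - (a + 1) by field.
  lra.
have cp : 0 < c by rewrite lt_neqAle eq_sym cn.
have := q (- b / c).
have -> : a + 2 * (- b / c) * b + (- b / c) ^+ 2 * c = (a * c - b ^+ 2) / c by field.
by rewrite pmulr_lge0 ?invr_gt0// subr_ge0.
Qed.

Lemma intg_bounded h (M r : R) : mf h -> (forall x, `|h x| <= M) ->
  (forall x, ~ (`|x.1| <= r /\ `|x.2| <= r) -> h x = 0) -> intg h.
Proof.
move=> mh hM h0.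
pose I := [set` `[- r, r] : interval R]; pose B : set (R * R) := I `*` I.
have mB : @measurable _ mP B by apply: measurableX; exact: measurable_itv.
apply: (@le_intg R _ (fun x => `|M| * \1_B x)) => //.
  move=> x; rewrite /indic; case: (boolP (x \in B)) => [_|xB].
    by rewrite mulr1 (le_trans (hM x))// ler_norm.
  rewrite mulr0 h0 ?normr0// => -[x1 x2]; move/negP: xB; apply; rewrite inE.
  by split; rewrite /I/= in_itv/= -ler_norml.
apply: intgZ; apply/integrableP; split; first by apply/measurable_EFinP; exact: measurable_indic.
have -> : (\int[leb2]_x `|(EFin \o \1_B) x| = \int[leb2]_x (\1_B x)%:E)%E.
  by apply: eq_integral => x _ /=; rewrite ger0_norm.
rewrite integral_indic// setIT.
have -> : leb2 B = (lebesgue_measure I * lebesgue_measure I)%E.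
  by apply: product_measure1E; exact: measurable_itv.
by rewrite /I lebesgue_measure_itv/= lte_fin; case: ifP => _; rewrite ?mule0// -EFinD -EFinM ltry.
Qed.

(** Used with the kernel of quadrants, to move a primitive from a weak derivative to the test
    function. *)
Lemma Fubini_kernel (C : R) (k : R * R -> R * R -> R) f g :
  @measurable_fun _ _ (mP * mP)%type R setT (fun z => k z.1 z.2) -> (forall p q, `|k p q| <= C) ->
  intg f -> intg g ->
  It (fun p => f p * It (fun q => k p q * g q)) = It (fun q => g q * It (fun p => k p q * f p)).
Proof.
move=> mk kC jf jg; pose F (z : mP * mP) := f z.1 * (k z.1 z.2 * g z.2).
have mF : measurable_fun setT F.
  apply: measurable_funM; first by apply: (measurableT_comp (intg_mf jf)); exact: measurable_fst.
  by apply: measurable_funM => //; apply: (measurableT_comp (intg_mf jg)); exact: measurable_snd.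
have absg : (\int[leb2]_q `|(g q)%:E| < +oo)%E by case/integrableP: jg.
have absf : (\int[leb2]_q `|(f q)%:E| < +oo)%E by case/integrableP: jf.
have mEF : measurable_fun setT (EFin \o F) by exact/measurable_EFinP.
have iF : (\int[leb2]_p \int[leb2]_q `|(EFin \o F) (p, q)| < +oo)%E.
  have fg1 : (\int[leb2]_p (`|C|%:E * \int[leb2]_q `|(g q)%:E| * `|(f p)%:E|) < +oo)%E.
    rewrite ge0_integralZl//.
    - apply: lte_mul_pinfty => //; first by rewrite mule_ge0// integral_ge0.
      by rewrite fin_numM// ge0_fin_numE// integral_ge0.
    - by apply: measurableT_comp => //; exact: (measurable_int _ jf).
    - by rewrite mule_ge0// integral_ge0.
  apply: le_lt_trans fg1; apply: ge0_le_integral; first exact: measurableT.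
  - by move=> p _; exact: integral_ge0.
  - have mFF := @measurable_fun_fubini_tonelli_F _ _ mP mP R (@sleb2 R) (fun z => `|(F z)%:E|%E).
  by apply: mFF => //; exact: measurableT_comp.
  - apply: measurable_funeM; apply: measurableT_comp => //; exact: (measurable_int _ jf).
  - move=> p _; rewrite -muleA [X in (_ * X)%E]muleC muleA -ge0_integralZl//; last first.
      by apply: measurableT_comp => //; exact: (measurable_int _ jg).
    apply: ge0_le_integral => //.
    + apply: measurableT_comp => //; apply: (measurableT_comp mEF); exact: pair1_measurable.
    + by apply: measurable_funeM; apply: measurableT_comp => //; exact: (measurable_int _ jg).
    + move=> q _; rewrite -!EFinM lee_fin /F /= !normrM.
      have kC' : `|k p q| <= `|C| by rewrite (le_trans (kC p q))// ler_norm.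
      by rewrite mulrA ler_wpM2r// mulrC ler_wpM2r.
have {}iF := proj2 (@integrable12ltyP _ _ _ _ R (@sleb2 R) (@sleb2 R) _ mEF) iF.
have F1 := integral12_prod_meas1 iF; have F2 := integral21_prod_meas1 iF.
have kg p : intg (fun q => k p q * g q).
  apply: (le_intg _ _ (intgZ `|C| (intg_abs jg))).
  - apply: mfM; last exact: intg_mf.
    exact: (measurableT_comp mk (pair1_measurable p)).
  - by move=> q; rewrite normrM ler_wpM2r// (le_trans (kC p q))// ler_norm.
have kf q : intg (fun p => k p q * f p).
  apply: (le_intg _ _ (intgZ `|C| (intg_abs jf))).
  - apply: mfM; last exact: intg_mf.
    exact: (measurableT_comp mk (pair2_measurable q)).
  - by move=> p; rewrite normrM ler_wpM2r// (le_trans (kC p q))// ler_norm.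
transitivity (fine (\int[leb2]_x fubini_F (@leb2 R) (EFin \o F) x)); last first.
  rewrite F1 -F2 /It [RHS]/Rintegral; congr fine; apply: eq_integral => q _.
  transitivity (\int[leb2]_p ((g q)%:E * (k p q * f p)%:E))%E.
    by apply: eq_integral => p _; rewrite -EFinM/=; congr EFin; rewrite /F/=; ring.
  by rewrite (integralZl measurableT (kf q)) -EFin_It.
rewrite [LHS]/Rintegral; congr fine; apply: eq_integral => p _.
transitivity (\int[leb2]_q ((f p)%:E * (k p q * g q)%:E))%E; last by [].
by rewrite (integralZl measurableT (kg p)) -EFin_It.
Qed.

End plane_L2.

(** * Calculus of functions of class C^k *)

Section plane_calculus.
Context {R : realType}.
Implicit Types (h f g : R * R -> R) (A U : set (R * R)) (x p q : R * R) (b : bool) (k : nat).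

Definition line b x h : R -> R := fun t => h (pt b (co (~~ b) x) t).

Lemma dir_shift b x (t : R) : t *: dir b + x = pt b (co (~~ b) x) (t *: 1 + co b x).
Proof.
case: b; case: x => x1 x2; congr pair; rewrite /= ?scaler0 ?add0r//.
Qed.

(** A partial derivative and the derivative of the restriction to a line have the same difference
    quotient; all one-variable calculus is imported through this equality. *)
Lemma line_quotient b h x : (fun t : R => t^-1 *: ((h \o shift x) (t *: dir b) - h x)) =
  (fun t : R => t^-1 *: ((line b x h \o shift (co b x)) (t *: 1) - line b x h (co b x))).
Proof. by apply/funext => t; rewrite /line pt_co /= /shift/= dir_shift. Qed.

Lemma derivable_line b h x : derivable h x (dir b) <-> derivable (line b x h) (co b x) 1.
Proof. by rewrite /derivable line_quotient. Qed.

Lemma pd_line b h x : pd b h x = 'D_1 (line b x h) (co b x).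
Proof. by rewrite /pd /derive line_quotient. Qed.

Lemma is_pd_line b h x d : is_derive x (dir b) h d <-> is_derive (co b x) 1 (line b x h) d.
Proof.
split=> -[h1 h2]; split.
- exact/derivable_line.
- by rewrite -pd_line.
- exact/derivable_line.
- by rewrite -h2 -pd_line.
Qed.

Lemma is_pd_line_at b h s t d : is_derive (pt b s t) (dir b) h d ->
  is_derive t 1 (fun t => h (pt b s t)) d.
Proof. by move/is_pd_line; rewrite /line co_pt co_ptN. Qed.

Lemma derivable_pd b h x : derivable h x (dir b) -> is_derive x (dir b) h (pd b h x).
Proof. exact: derivableP. Qed.

Lemma is_pdE b h x d : is_derive x (dir b) h d -> pd b h x = d.
Proof. by move=> hd; rewrite /pd derive_val. Qed.

Lemma is_pd_comp (c : R -> R) b h x a d : is_derive (h x) 1 c a ->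
  is_derive x (dir b) h d -> is_derive x (dir b) (c \o h) (a * d).
Proof.
move=> dc /is_pd_line dh; apply/is_pd_line.
rewrite (_ : line _ _ _ = c \o line b x h)//.
by apply: is_derive1_comp => //; rewrite /line pt_co.
Qed.

Lemma is_pdM b h f x d e : is_derive x (dir b) h d -> is_derive x (dir b) f e ->
  is_derive x (dir b) (fun y => h y * f y) (d * f x + h x * e).
Proof.
move=> dh df; rewrite addrC [X in _ + X]mulrC; exact: is_deriveM.
Qed.

Lemma is_pdD b h f x d e : is_derive x (dir b) h d -> is_derive x (dir b) f e ->
  is_derive x (dir b) (fun y => h y + f y) (d + e).
Proof. by move=> dh df; exact: is_deriveD. Qed.

Lemma is_pd_co b b' x : is_derive x (dir b) (co b') (if b == b' then 1 else 0).
Proof.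
apply/is_pd_line; case: b; case: b' => /=; rewrite /line/=; (exact: is_derive_id || exact: is_derive_cst).
Qed.

Lemma is_pd_cst b (c : R) x : is_derive x (dir b) (cst c) 0.
Proof. exact: is_derive_cst. Qed.

Lemma near_open U x (P : R * R -> Prop) : open U -> U x -> (forall y, U y -> P y) -> \near x, P x.
Proof. by move=> oU Ux UP; apply: filterS UP _; exact: open_nbhs_nbhs. Qed.

Lemma pd_ext b h f U : open U -> (forall x, U x -> h x = f x) ->
  forall x, U x -> pd b h x = pd b f x.
Proof. by move=> oU hf x Ux; apply: near_eq_derive; exact: near_open hf. Qed.

Lemma pds_ext s h f U : open U -> (forall x, U x -> h x = f x) ->
  forall x, U x -> pds s h x = pds s f x.
Proof. by move=> oU hf; elim: s => //= b s IH; apply: pd_ext. Qed.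

Lemma pds_rcons s b h : pds (rcons s b) h = pds s (pd b h).
Proof. by rewrite /pds foldr_rcons. Qed.

Definition cont U h := forall x, U x -> {for x, continuous h}.

Lemma cont_ext U h f : open U -> (forall x, U x -> h x = f x) -> cont U h -> cont U f.
Proof.
move=> oU hf ch x Ux; have := ch x Ux; rewrite /prop_for /continuous_at (hf x Ux).
by apply: cvg_trans; apply: near_eq_cvg; exact: near_open hf.
Qed.

Lemma contM U h f : cont U h -> cont U f -> cont U (fun x => h x * f x).
Proof. by move=> ch cf x Ux; apply: continuousM; [exact: ch|exact: cf]. Qed.

Lemma contD U h f : cont U h -> cont U f -> cont U (fun x => h x + f x).
Proof. by move=> ch cf x Ux; apply: continuousD; [exact: ch|exact: cf]. Qed.

Lemma class_C0 U h : class_C 0 U h <-> cont U h.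
Proof.
split=> [[ch _]|ch]; first exact: (ch [::]).
by split=> // s; rewrite leqn0 size_eq0 => /eqP->.
Qed.

(** Peels off the derivative taken first, which is the last letter of the list. The closure
    properties of [class_C] become inductions on [k]. *)
Lemma class_CS k U h : class_C k.+1 U h <->
  [/\ cont U h, (forall b x, U x -> derivable h x (dir b)) & forall b, class_C k U (pd b h)].
Proof.
split=> [[ch dh]|[ch dh pdh]].
  split=> [x Ux|b x Ux|b]; [exact: (ch [::])|exact: (dh [::])|split=> s].
    by move=> sk x Ux; have := ch (rcons s b); rewrite pds_rcons size_rcons; exact.
  by move=> b' sk x Ux; have := dh (rcons s b) b'; rewrite pds_rcons size_rcons; exact.
split=> s; case/lastP: s => [|s b].
- by move=> _; exact: ch.
- by rewrite size_rcons pds_rcons ltnS => sk; case: (pdh b) => + _; exact.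
- by move=> b _; exact: dh.
- by move=> b'; rewrite size_rcons pds_rcons ltnS => sk; case: (pdh b) => _; exact.
Qed.

Lemma class_C_sub k U V h : U `<=` V -> class_C k V h -> class_C k U h.
Proof. by move=> UV [h1 h2]; split => [s sk x /UV|s b sk x /UV]; [exact: h1|exact: h2]. Qed.

Lemma class_C_cup k U V h : class_C k U h -> class_C k V h -> class_C k (U `|` V) h.
Proof.
move=> [h1 h2] [k1 k2]; split=> [s sk x [|]|s b sk x [|]];
  [exact: h1|exact: k1|exact: h2|exact: k2].
Qed.

Lemma class_C_le k m U h : (m <= k)%N -> class_C k U h -> class_C m U h.
Proof.
move=> mk [h1 h2]; split=> [s sm|s b sm]; [apply: h1|apply: h2]; exact: leq_trans mk.
Qed.

Lemma class_C_ext k U h f : open U -> (forall x, U x -> h x = f x) -> class_C k U h -> class_C k U f.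
Proof.
move=> oU hf [h1 h2]; split=> [s sk|s b sk x Ux].
  by apply: (@cont_ext _ (pds s h)) => //; [exact: pds_ext|exact: h1].
apply: (@near_eq_derivable _ _ _ (pds s h)); last exact: h2.
apply: near_open Ux _ => //; exact: pds_ext.
Qed.

Lemma class_C_cst k U c : class_C k U (cst c).
Proof.
elim: k c => [|k IH] c; first by apply/class_C0 => x _; exact: cst_continuous.
apply/class_CS; split=> [x _|b x _|b]; first exact: cst_continuous.
  by have [] := is_pd_cst b c x.
rewrite (_ : pd b _ = cst 0); first exact: IH.
by apply/funext => x; exact: is_pdE (is_pd_cst b c x).
Qed.

Lemma class_C_co k U b : class_C k U (co b).
Proof.
case: k => [|k]; first by apply/class_C0 => x _; exact: continuous_co.
apply/class_CS; split=> [x _|b' x _|b']; first exact: continuous_co.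
  by have [] := is_pd_co b' b x.
rewrite (_ : pd b' _ = cst (if b' == b then 1 else 0)); first exact: class_C_cst.
by apply/funext => x; exact: is_pdE (is_pd_co b' b x).
Qed.

Lemma class_CD k U h f : open U -> class_C k U h -> class_C k U f -> class_C k U (fun x => h x + f x).
Proof.
move=> oU; elim: k h f => [|k IH] h f.
  by move=> /class_C0 ch /class_C0 cf; apply/class_C0; exact: contD.
move=> /class_CS[ch dh kh] /class_CS[cf df kf].
have E b x : U x -> is_derive x (dir b) (fun x => h x + f x) (pd b h x + pd b f x).
  by move=> Ux; apply: is_pdD; apply: derivable_pd; [exact: dh|exact: df].
apply/class_CS; split=> [|b x Ux|b]; first exact: contD.
  by have [] := E b x Ux.
apply: class_C_ext (IH _ _ (kh b) (kf b)) => // x Ux.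
by rewrite (is_pdE (E b x Ux)).
Qed.

Lemma class_CM k U h f : open U -> class_C k U h -> class_C k U f -> class_C k U (fun x => h x * f x).
Proof.
move=> oU; elim: k h f => [|k IH] h f.
  by move=> /class_C0 ch /class_C0 cf; apply/class_C0; exact: contM.
move=> Ch Cf; have /class_CS[ch dh kh] := Ch; have /class_CS[cf df kf] := Cf.
have E b x : U x -> is_derive x (dir b) (fun x => h x * f x) (pd b h x * f x + h x * pd b f x).
  by move=> Ux; apply: is_pdM; apply: derivable_pd; [exact: dh|exact: df].
apply/class_CS; split=> [|b x Ux|b]; first exact: contM.
  by have [] := E b x Ux.
have Ch' := class_C_le (leqnSn k) Ch; have Cf' := class_C_le (leqnSn k) Cf.
apply: class_C_ext (class_CD oU (IH _ _ (kh b) Cf') (IH _ _ Ch' (kf b))) => // x Ux.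
by rewrite (is_pdE (E b x Ux)).
Qed.

Lemma class_CZ k U (a : R) h : open U -> class_C k U h -> class_C k U (fun x => a * h x).
Proof. by move=> oU; apply: class_CM => //; exact: class_C_cst. Qed.

Lemma class_CN k U h : open U -> class_C k U h -> class_C k U (fun x => - h x).
Proof. by move=> oU /(class_CZ (-1) oU); apply: class_C_ext => // x _; rewrite mulN1r. Qed.

Lemma class_CB k U h f : open U -> class_C k U h -> class_C k U f -> class_C k U (fun x => h x - f x).
Proof. by move=> oU Ch /(class_CN oU); exact: class_CD. Qed.

Lemma class_C1dS k (c : R -> R) : class_C1d k.+1 c <->
  [/\ continuous c, (forall t, derivable c t 1) & class_C1d k (derive1 c)].
Proof.
split=> [[h1 h2]|[cc dc [h1 h2]]].
  split; [exact: (h2 0%N)|by move=> t; exact: (h1 0%N)|split=> [i t ik|i ik]].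
    by have := h1 i.+1 t; rewrite derive1Sn; exact.
  by have := h2 i.+1; rewrite derive1Sn; exact.
split=> [[|i] t ik|[|i] ik]; [exact: dc|rewrite derive1Sn; exact: h1|exact: cc|rewrite derive1Sn; exact: h2].
Qed.

Lemma class_C1d0 (c : R -> R) : class_C1d 0 c <-> continuous c.
Proof. by split=> [[_ /(_ 0%N)]|cc]; [exact|split=> // -[]]. Qed.

Lemma class_C1d_le k m (c : R -> R) : (m <= k)%N -> class_C1d k c -> class_C1d m c.
Proof.
move=> mk [h1 h2]; split=> [i t im|i im]; [apply: h1|apply: h2].
- exact: leq_trans mk.
- exact: leq_trans mk.
Qed.

Lemma class_C_comp k U (c : R -> R) h : open U -> class_C1d k c -> class_C k U h ->
  class_C k U (fun x => c (h x)).
Proof.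
move=> oU; elim: k c h => [|k IH] c h.
  move=> /class_C1d0 cc /class_C0 ch; apply/class_C0 => x Ux.
  by apply: continuous_comp; [exact: ch|exact: cc].
move=> /class_C1dS[cc dc kc] Ch; have /class_CS[ch dh kh] := Ch.
have E b x : U x -> is_derive x (dir b) (fun x => c (h x)) (derive1 c (h x) * pd b h x).
  move=> Ux; apply: (is_pd_comp (h := h)); last by apply: derivable_pd; exact: dh.
  by rewrite derive1E; apply: derivableP; exact: dc.
apply/class_CS; split=> [x Ux|b x Ux|b].
- by apply: continuous_comp; [exact: ch|exact: cc].
- by have [] := E b x Ux.
have Ch' := class_C_le (leqnSn k) Ch.
apply: class_C_ext (class_CM oU (IH _ _ kc Ch') (kh b)) => // x Ux.
by rewrite (is_pdE (E b x Ux)).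
Qed.

Lemma pd_comp (c : R -> R) b h x : derivable c (h x) 1 -> derivable h x (dir b) ->
  pd b (fun x => c (h x)) x = derive1 c (h x) * pd b h x.
Proof.
move=> dc dh; apply: is_pdE; apply: (is_pd_comp (h := h)); last exact: derivable_pd.
rewrite derive1E; exact: (derivableP dc).
Qed.

Lemma pdM b h f x : derivable h x (dir b) -> derivable f x (dir b) ->
  pd b (fun x => h x * f x) x = pd b h x * f x + h x * pd b f x.
Proof. by move=> dh df; apply: is_pdE; apply: is_pdM; exact: derivable_pd. Qed.

Lemma pdD b h f x : derivable h x (dir b) -> derivable f x (dir b) ->
  pd b (fun x => h x + f x) x = pd b h x + pd b f x.
Proof. by move=> dh df; apply: is_pdE; apply: is_pdD; exact: derivable_pd. Qed.

Lemma pdB b h f x : derivable h x (dir b) -> derivable f x (dir b) ->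
  pd b (fun x => h x - f x) x = pd b h x - pd b f x.
Proof.
by move=> /derivable_pd dh /derivable_pd df; apply: is_pdE; exact: is_deriveB.
Qed.

Lemma pd_co b b' x : pd b (co b') x = if b == b' then 1 else 0.
Proof. exact: is_pdE (is_pd_co b b' x). Qed.

Lemma class_C_continuous k h : class_C k setT h -> continuous h.
Proof. by move=> [/(_ [::] isT) ch _] x; exact: ch. Qed.

Lemma class_C_derivable k U h b x : class_C k.+1 U h -> U x -> derivable h x (dir b).
Proof. by move=> /class_CS[_ + _]; exact. Qed.

Lemma class_C_pd k U h b : class_C k.+1 U h -> class_C k U (pd b h).
Proof. by case/class_CS. Qed.

Lemma class_C_pds s k U h : class_C (k + size s) U h -> class_C k U (pds s h).
Proof.
elim/last_ind: s h => [|s b IH] h; first by rewrite addn0.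
by rewrite size_rcons addnS pds_rcons => /(@class_C_pd _ _ _ b); exact: IH.
Qed.

Definition zero_off A h := forall x, ~ A x -> h x = 0.

Lemma zero_off_pd A b h : closed A -> zero_off A h -> zero_off A (pd b h).
Proof.
move=> cA h0 x nAx; rewrite (@pd_ext b h (cst 0) (~` A)) ?openC//.
exact: is_pdE (is_pd_cst b 0 x).
Qed.

Lemma zero_off_pds A s h : closed A -> zero_off A h -> zero_off A (pds s h).
Proof. by move=> cA h0; elim: s => //= b s; exact: zero_off_pd. Qed.

Definition box (r : R) : set (R * R) := [set x | `|x.1| <= r /\ `|x.2| <= r].

Lemma compact_box r : compact (box r).
Proof.
have -> : box r = [set` `[- r, r] : interval R] `*` [set` `[- r, r] : interval R].
  by apply/seteqP; split => x []; rewrite /= !in_itv/= -!ler_norml.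
by apply: compact_setX; exact: segment_compact.
Qed.

Lemma hausdorff_plane : hausdorff_space (R * R)%type.
Proof. exact: norm_hausdorff. Qed.

Lemma compact_closed2 A : compact A -> closed A.
Proof. exact: (compact_closed hausdorff_plane). Qed.

Lemma closed_box r : closed (box r).
Proof. exact: (compact_closed2 (@compact_box r)). Qed.

Lemma compact_sub_box A : compact A -> exists2 r : R, 0 < r & A `<=` box r.
Proof.
move=> /compact_bounded[M [_ MA]]; exists (`|M| + 1); first by rewrite ltr_pwDr.
move=> x /(MA (`|M| + 1)); rewrite /= prod_normE ge_max.
by move=> /(_ _)/andP; apply; rewrite (le_lt_trans (ler_norm _))// ltrDl.
Qed.

Lemma compact_bounded_fun A h : compact A -> {within A, continuous h} ->
  exists M : R, forall x, A x -> `|h x| <= M.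
Proof.
move=> cA ch; have /compact_bounded[M [_ MA]] := continuous_compact ch cA.
exists (`|M| + 1) => x Ax; apply: (MA (`|M| + 1)); last by exists x.
by rewrite (le_lt_trans (ler_norm _))// ltrDl.
Qed.

Lemma continuous_zero_off_bounded A h : compact A -> continuous h -> zero_off A h ->
  exists2 M : R, 0 < M & forall x, `|h x| <= M.
Proof.
move=> cA ch h0; have [|M hM] := @compact_bounded_fun A h cA.
  exact: continuous_subspaceT.
exists (`|M| + 1) => [|x]; first by rewrite ltr_pwDr.
have [/hM/le_trans->//|/h0->] := pselect (A x); last by rewrite normr0 addr_ge0.
by rewrite (le_trans (ler_norm _))// lerDl.
Qed.

Lemma intg_continuous A h : compact A -> continuous h -> zero_off A h -> intg h.
Proof.
move=> cA ch h0; have [M _ hM] := continuous_zero_off_bounded cA ch h0.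
have [r _ Ar] := compact_sub_box cA.
apply: (@intg_bounded _ _ M r) => //; first exact: continuous_mf.
by move=> x nx; apply: h0 => /Ar.
Qed.

End plane_calculus.

(** * Smooth steps and plateaus *)

Section smooth_bump.
Context {R : realType}.
Implicit Types (h f g : R * R -> R) (A U K : set (R * R)) (x p q : R * R) (b : bool) (k n : nat) (t : R).

(** A function of one variable is a function on the plane that is constant in the other, so
    [class_C1d] inherits its algebra from [class_C]. *)
Lemma class_C_1d b k (c : R -> R) : class_C k setT (fun x => c (co b x)) <-> class_C1d k c.
Proof.
split=> [|kc]; last by apply: class_C_comp => //; [exact: openT|exact: class_C_co].
have cE (d : R -> R) : d = (fun x => d (co b x)) \o pt b 0.
  by apply/funext => t /=; rewrite co_pt.
have cc (d : R -> R) : cont setT (fun x => d (co b x)) -> continuous d.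
  move=> cd t; rewrite (cE d); apply: continuous_comp; first exact: continuous_pt.
  exact: cd.
elim: k c => [|k IH] c; first by move=> /class_C0/cc/class_C1d0.
move=> /class_CS[ch dh kh]; have dc t : derivable c t 1.
  have := dh b (pt b 0 t) Logic.I; move/derivable_line; rewrite co_pt.
  rewrite (_ : line _ _ _ = c)//; apply/funext => u; by rewrite /line co_pt.
apply/class_C1dS; split => //; first exact: cc.
apply: IH; apply: class_C_ext (kh b) => [|x _]; first exact: openT.
rewrite pd_line derive1E (_ : line _ _ _ = c)//; apply/funext => t.
by rewrite /line co_pt.
Qed.

Lemma class_C1dD k (c d : R -> R) : class_C1d k c -> class_C1d k d ->
  class_C1d k (fun t => c t + d t).
Proof.
move=> /(class_C_1d true) Cc /(class_C_1d true) Cd; apply/(class_C_1d true).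
by apply: class_CD => //; exact: openT.
Qed.

Lemma class_C1dM k (c d : R -> R) : class_C1d k c -> class_C1d k d ->
  class_C1d k (fun t => c t * d t).
Proof.
move=> /(class_C_1d true) Cc /(class_C_1d true) Cd; apply/(class_C_1d true).
by apply: class_CM => //; exact: openT.
Qed.

Lemma class_C1d_cst k (a : R) : class_C1d k (fun=> a).
Proof. by apply/(class_C_1d true); exact: class_C_cst. Qed.

Lemma class_C1d_id k : class_C1d k (@id R).
Proof. by apply/(class_C_1d true); exact: (@class_C_co R k setT true). Qed.

Lemma class_C1d_comp k (c d : R -> R) : class_C1d k c -> class_C1d k d ->
  class_C1d k (fun t => c (d t)).
Proof.
move=> Cc /(class_C_1d true) Cd; apply/(class_C_1d true).
by apply: class_C_comp => //; exact: openT.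
Qed.

Lemma class_C1d_affine k (a c : R) : class_C1d k (fun t => a * t + c).
Proof.
apply: class_C1dD; last exact: class_C1d_cst.
by apply: class_C1dM; [exact: class_C1d_cst|exact: class_C1d_id].
Qed.

Lemma is_derive_near (c d : R -> R) t a : is_derive t 1 c a -> (\near t, c t = d t) ->
  is_derive t 1 d a.
Proof. by move=> dc cd; exact: near_eq_is_derive dc. Qed.

Lemma is_derive1M (c d : R -> R) t (a e : R) : is_derive t 1 c a -> is_derive t 1 d e ->
  is_derive t 1 (fun u => c u * d u) (a * d t + c t * e).
Proof. by move=> dc dd; rewrite addrC [X in _ + X]mulrC; exact: is_deriveM. Qed.

Lemma is_derive_val (c : R -> R) t (a e : R) : is_derive t 1 c a -> a = e -> is_derive t 1 c e.
Proof. by move=> ? <-. Qed.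

(** The powers of 1/t are included to make the family stable under differentiation; smoothness of
    e^(-1/t) is then an induction on the order. *)
Definition flat n t : R := if 0 < t then t ^- n * expR (- t^-1) else 0.

(** From e^x >= x^(n+1) / (n+1)! at x = 1/t. Applied to [flat n.+1] through [flatS], it makes the
    difference quotient of [flat n] at 0 tend to 0. *)
Lemma flat_le n t : `|flat n t| <= (n.+1)`!%:R * `|t|.
Proof.
rewrite /flat; case: ltP => [t0|_]; last by rewrite normr0 mulr_ge0.
have ti : 0 < t^-1 by rewrite invr_gt0.
have e0 : 0 < expR (t^-1) by exact: expR_gt0.
have := expR_ge1Dxn n (ltW ti); set N : R := (n.+1)`!%:R => H.
have N0 : 0 < N by rewrite ltr0n fact_gt0.
have {}H : t^-1 ^+ n.+1 <= N * expR t^-1.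
  by rewrite -ler_pdivrMl// mulrC; lra.
rewrite normrM !gtr0_norm ?expR_gt0 ?invr_gt0 ?exprn_gt0// expRN ler_pdivrMr//.
by rewrite -exprVn mulrAC -ler_pdivrMr// -exprSr.
Qed.

Lemma flatS n t : t != 0 -> flat n t / t = flat n.+1 t.
Proof.
move=> t0; rewrite /flat; case: ifP => // _; last by rewrite mul0r.
by rewrite exprS invfM mulrAC [t^-1 * _]mulrC.
Qed.

Lemma is_derive_flat n t : is_derive t 1 (flat n) (flat n.+2 t - n%:R * flat n.+1 t).
Proof.
have [t0|t0|->] := ltgtP t 0.
- rewrite {2 3}/flat !ltNge (ltW t0)/= mulr0 subr0.
  apply: (is_derive_near (is_derive_cst 0 _ _)).
  near=> u; rewrite /flat ifN// -leNgt; apply/ltW; near: u; exact: lt_nbhsl.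
- rewrite {2 3}/flat t0.
  have tn0 : t != 0 by rewrite gt_eqF.
  have dV : is_derive t 1 (fun u : R => u^-1) (- t ^- 2).
    have := @is_deriveV R id t 1 1 tn0 (is_derive_id _ _).
    by rewrite /= /GRing.scale/= mulr1.
  have dX : is_derive t 1 (fun u : R => u^-1 ^+ n) (n%:R * t^-1 ^+ n.-1 * - t ^- 2).
    rewrite (_ : (fun u => _) = (fun u : R => u^-1) ^+ n); last by apply/funext => u; rewrite exprfctE.
    exact: (@is_deriveX _ _ (fun u : R => u^-1) n t 1 _ dV).
  have dE : is_derive t 1 (fun u : R => expR (- u^-1)) (expR (- t^-1) * (- - t ^- 2)).
    exact: (@is_derive1_comp _ expR (fun u : R => - u^-1) t _ _ (is_derive_expR _) (is_deriveN dV)).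
  apply: (@is_derive_near (fun u => u^-1 ^+ n * expR (- u^-1))); last first.
    near=> u; rewrite /flat ifT ?exprVn//; near: u; by apply: (@cvgr_gt _ _ (nbhs t) _ (@id R) t).
  apply: (is_derive_val (is_derive1M dX dE)).
  rewrite -!exprVn; case: n {dX} => [|m] /=.
    by rewrite !mul0r add0r subr0 expr0 mul1r opprK mulrC.
  by rewrite !exprS; ring.
- rewrite {2 3}/flat ltxx mulr0 subr0.
  suff cv : (fun u : R => u^-1 *: ((flat n \o shift 0) (u *: 1) - flat n 0)) @ 0^' --> (0 : R).
    split; first by apply/cvg_ex; exists 0.
    exact: (cvg_lim _ cv).
  apply/cvgrPdist_le => e e0.
  near=> u; have u0 : u != 0 by near: u; exact: nbhs_dnbhs_neq.
  rewrite sub0r normrN /= /shift/= addr0 {2}/flat ltxx subr0 /GRing.scale/= mulr1 mulrC flatS//.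
  rewrite (le_trans (flat_le _ _))// -ler_pdivlMl ?ltr0n ?fact_gt0//.
  near: u; apply: nbhs_dnbhs; apply/(@nbhs0_le _ R^o).
  by rewrite mulr_gt0// invr_gt0 ltr0n fact_gt0.
Unshelve. all: by end_near. Qed.

Lemma class_C1d_flat k n : class_C1d k (flat n).
Proof.
elim: k n => [|k IH] n.
  apply/class_C1d0 => t; apply: (@differentiable_continuous _ R^o R^o).
  by apply/derivable1_diffP; case: (is_derive_flat n t).
apply/class_C1dS; split.
- move=> t; apply: (@differentiable_continuous _ R^o R^o).
  by apply/derivable1_diffP; case: (is_derive_flat n t).
- by move=> t; case: (is_derive_flat n t).
rewrite (_ : derive1 _ = (fun t => flat n.+2 t + (- n%:R) * flat n.+1 t)).
  by apply: class_C1dD => //; apply: class_C1dM => //; exact: class_C1d_cst.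
apply/funext => t; rewrite derive1E; case: (is_derive_flat n t) => _ ->.
by rewrite mulNr.
Qed.

(* [step] is smooth, 0 for t <= 0 and 1 for t >= 1. *)
Definition step t : R := flat 0 (1 - expR 1 * flat 0 (1 - t)) / flat 0 1.

Lemma flat0E t : 0 < t -> flat 0 t = expR (- t^-1).
Proof. by move=> t0; rewrite /flat t0 expr0 invr1 mul1r. Qed.

Lemma flat0_le0 t : t <= 0 -> flat 0 t = 0.
Proof. by move=> t0; rewrite /flat ltNge t0. Qed.

Lemma flat0_ge0 t : 0 <= flat 0 t.
Proof. by have [t0|t0] := ltP 0 t; [rewrite flat0E// expR_ge0|rewrite flat0_le0]. Qed.

Lemma flat0_le t u : t <= u -> flat 0 t <= flat 0 u.
Proof.
move=> tu; have [t0|t0] := ltP 0 t; last by rewrite (flat0_le0 t0) flat0_ge0.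
have u0 := lt_le_trans t0 tu.
by rewrite !flat0E// ler_expR lerN2 lef_pV2.
Qed.

Lemma flat01_gt0 : 0 < flat 0 1. Proof. by rewrite flat0E// expR_gt0. Qed.

Lemma step_le0 t : t <= 0 -> step t = 0.
Proof.
move=> t0; rewrite /step flat0_le0 ?mul0r// subr_le0.
have : flat 0 1 <= flat 0 (1 - t) by apply: flat0_le; lra.
rewrite flat0E// invr1 expRN => h.
by rewrite -ler_pdivrMl ?expR_gt0// mulr1.
Qed.

Lemma step_ge1 t : 1 <= t -> step t = 1.
Proof.
move=> t1; rewrite /step (@flat0_le0 (1 - t)); last by lra.
by rewrite mulr0 subr0 divff// gt_eqF// flat01_gt0.
Qed.

Lemma step_ge0 t : 0 <= step t.
Proof. by rewrite /step divr_ge0// flat0_ge0. Qed.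

Lemma step_le1 t : step t <= 1.
Proof.
rewrite /step ler_pdivrMr ?flat01_gt0// mul1r; apply: flat0_le.
by rewrite gerBl mulr_ge0 ?expR_ge0 ?flat0_ge0.
Qed.

Lemma class_C1d_step k : class_C1d k step.
Proof.
apply: class_C1dM; last exact: class_C1d_cst.
apply: (@class_C1d_comp k (flat 0) (fun t => 1 - expR 1 * flat 0 (1 - t))); first exact: class_C1d_flat.
rewrite (_ : (fun t => _) = (fun t => (- expR 1) * flat 0 ((-1) * t + 1) + 1)); last first.
  by apply/funext => t; rewrite mulN1r [1 - t]addrC mulNr [RHS]addrC.
apply: class_C1dD; last exact: class_C1d_cst.
apply: class_C1dM; first exact: class_C1d_cst.
by apply: class_C1d_comp; [exact: class_C1d_flat|exact: class_C1d_affine].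
Qed.

Definition plateau1 (a r t : R) : R := step (2 - (t - a) / r) * step (2 + (t - a) / r).

Lemma plateau1_ge0 a r t : 0 <= plateau1 a r t.
Proof. by rewrite mulr_ge0// step_ge0. Qed.

Lemma plateau1_le1 a r t : plateau1 a r t <= 1.
Proof. by rewrite mulr_ile1 ?step_ge0 ?step_le1. Qed.

Lemma plateau1_eq1 a r t : 0 < r -> `|t - a| <= r -> plateau1 a r t = 1.
Proof.
move=> r0; rewrite ler_norml => /andP[h1 h2].
have h3 : (t - a) / r <= 1 by rewrite ler_pdivrMr ?mul1r.
have h4 : -1 <= (t - a) / r by rewrite ler_pdivlMr ?mulN1r.
by rewrite /plateau1 !step_ge1 ?mulr1//; lra.
Qed.

Lemma plateau1_eq0 a r t : 0 < r -> 2 * r <= `|t - a| -> plateau1 a r t = 0.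
Proof.
move=> r0; rewrite ler_normr /plateau1 => /orP[h|h].
  have h3 : 2 <= (t - a) / r by rewrite ler_pdivlMr.
  by rewrite step_le0 ?mul0r//; lra.
have h3 : (t - a) / r <= -2 by rewrite ler_pdivrMr// mulNr lerNr.
by rewrite mulrC step_le0 ?mul0r//; lra.
Qed.

Lemma class_C1d_plateau1 k a r : class_C1d k (plateau1 a r).
Proof.
have E s : (fun t => step (2 + s * ((t - a) / r))) = (fun t => step (s / r * t + (2 - s * a / r))).
  by apply/funext => t; congr step; ring.
have D s : class_C1d k (fun t => step (2 + s * ((t - a) / r))).
  by rewrite E; apply: class_C1d_comp; [exact: class_C1d_step|exact: class_C1d_affine].
apply: class_C1dM.
  rewrite (_ : (fun t => _) = fun t => step (2 + -1 * ((t - a) / r))); first exact: D.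
  by apply/funext => t; rewrite mulN1r.
rewrite (_ : (fun t => _) = fun t => step (2 + 1 * ((t - a) / r))); first exact: D.
by apply/funext => t; rewrite mul1r.
Qed.

Definition sqbox p (r : R) : set (R * R) := [set x | `|x.1 - p.1| <= r /\ `|x.2 - p.2| <= r].

Definition plateau p (r : R) x : R := plateau1 p.1 r x.1 * plateau1 p.2 r x.2.

Lemma plateau_ge0 p r x : 0 <= plateau p r x.
Proof. by rewrite mulr_ge0// plateau1_ge0. Qed.

Lemma plateau_le1 p r x : plateau p r x <= 1.
Proof. by rewrite mulr_ile1 ?plateau1_ge0 ?plateau1_le1. Qed.

Lemma plateau_eq1 p r x : 0 < r -> sqbox p r x -> plateau p r x = 1.
Proof. by move=> r0 [h1 h2]; rewrite /plateau !plateau1_eq1 ?mulr1. Qed.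

Lemma plateau_zero_off p r : 0 < r -> zero_off (sqbox p (2 * r)) (plateau p r).
Proof.
move=> r0 x /= nx; rewrite /plateau.
have [h1|/ltW h1] := leP (`|x.1 - p.1|) (2 * r); last by rewrite plateau1_eq0// mul0r.
have [h2|/ltW h2] := leP (`|x.2 - p.2|) (2 * r); last by rewrite mulrC plateau1_eq0// mul0r.
by case: nx.
Qed.

Lemma class_C_plateau k p r : class_C k setT (plateau p r).
Proof.
apply: class_CM; first exact: openT.
  exact: (class_C_comp (@openT _) (class_C1d_plateau1 k p.1 r) (@class_C_co R k setT false)).
exact: (class_C_comp (@openT _) (class_C1d_plateau1 k p.2 r) (@class_C_co R k setT true)).
Qed.

Lemma sqboxE p r : sqbox p r = [set` `[p.1 - r, p.1 + r] : interval R] `*` [set` `[p.2 - r, p.2 + r] : interval R].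
Proof.
have E (a t : R) : `[a - r, a + r]%classic t = (`|t - a| <= r) :> Prop.
  apply/propext; rewrite /= in_itv/= ler_norml.
  by split=> /andP[h1 h2]; apply/andP; split; lra.
apply/seteqP; split => x [h1 h2]; first by split; rewrite E.
by move: h1 h2; rewrite !E.
Qed.

Lemma compact_sqbox p r : compact (sqbox p r).
Proof. by rewrite sqboxE; apply: compact_setX; exact: segment_compact. Qed.

Lemma nbhs_sqbox p r : 0 < r -> nbhs p (sqbox p r).
Proof.
move=> r0; apply/nbhs_ballP; exists r => // x [] /= h1 h2.
by split; apply/ltW; rewrite distrC.
Qed.

Lemma nbhs_sqbox_sub p A : nbhs p A -> exists2 r, 0 < r & sqbox p r `<=` A.
Proof.
move=> /nbhs_ballP[e /= e0 eA]; exists (e / 2); first by rewrite divr_gt0.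
move=> x [h1 h2]; apply: eA; have e2 : e / 2 < e by rewrite ltr_pdivrMr// ltr_pMr// ltr1n.
by split; rewrite /ball/= distrC; exact: le_lt_trans e2.
Qed.

End smooth_bump.

(** * Smooth cutoffs and integration by parts *)

Section cutoffs.
Context {R : realType}.
Implicit Types (h f g : R * R -> R) (A B U K : set (R * R)) (x p q : R * R) (b : bool) (k n : nat) (t : R).

Lemma compact_induction (T : topologicalType) (K : set T) (P : set T -> Prop) : compact K ->
  P set0 -> (forall A B : set T, P A -> P B -> P (A `|` B)) ->
  (forall A B : set T, A `<=` B -> P B -> P A) ->
  (forall x : T, K x -> exists2 V, nbhs x V & P V) -> P K.
Proof.
move=> /compact_near_coveringP cK P0 PU PS loc.
(* The filter of eventualities along growing sets that satisfy [P]. Compactness in near-covering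
   form then provides one such set containing [K], with no finite subcover to extract. *)
pose F : set_system (set T) := [set S | exists2 B, P B & forall A : set T, P A -> B `<=` A -> S A].
have FF : Filter F.
  split; first by exists set0.
    move=> S1 S2 [B1 PB1 h1] [B2 PB2 h2]; exists (B1 `|` B2); first exact: PU.
    move=> A PA BA; split; [apply: h1 => //|apply: h2 => //].
      by apply: subset_trans BA; exact: subsetUl.
    by apply: subset_trans BA; exact: subsetUr.
  by move=> S1 S2 S12 [B PB h]; exists B => // A PA BA; apply: S12; exact: h.
have [|B PB /(_ B PB) KB] := cK _ F (fun (A : set T) (x : T) => A x) FF.
  move=> x Kx; have [V xV PV] := loc x Kx.
  exists (V, [set A : set T | V `<=` A]); last by move=> [y A] /= [Vy]; exact.
  by split => //=; exists V.
by apply: PS PB; exact: KB.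
Qed.

Lemma uniform_continuity K f e : compact K -> continuous f -> 0 < e ->
  exists2 d : R, 0 < d & forall x y, K x -> `|x.1 - y.1| <= d -> `|x.2 - y.2| <= d ->
    `|f x - f y| <= e.
Proof.
move=> cK cf e0; pose P A := exists2 d : R, 0 < d & forall x y, A x ->
  `|x.1 - y.1| <= d -> `|x.2 - y.2| <= d -> `|f x - f y| <= e.
suff : P K by [].
apply: (compact_induction cK).
- by exists 1.
- move=> A B [d d0 hd] [d' d'0 hd']; exists (Num.min d d'); first by rewrite lt_min d0.
  by move=> x y + ; rewrite !le_min => -[Ax|Bx] /andP[? ?] /andP[? ?]; [exact: hd|exact: hd'].
- by move=> A B AB [d d0 hd]; exists d => // x y /AB; exact: hd.
move=> p Kp; have e2 : 0 < e / 2 by rewrite divr_gt0.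
have /nbhs_sqbox_sub[d d0 hd] : nbhs p [set x | `|f p - f x| <= e / 2].
  by have /cvgrPdist_le/(_ _ e2) := cf p.
have d2 : 0 < d / 2 by rewrite divr_gt0.
exists (sqbox p (d / 2)); first exact: nbhs_sqbox.
exists (d / 2) => // x y [h1 h2] h3 h4.
have hx : `|f p - f x| <= e / 2 by apply: hd; split; lra.
have hy : `|f p - f y| <= e / 2.
  apply: hd; split.
    by have := ler_distD x.1 y.1 p.1; rewrite [`|y.1 - x.1|]distrC; lra.
  by have := ler_distD x.2 y.2 p.2; rewrite [`|y.2 - x.2|]distrC; lra.
have := ler_distD (f p) (f x) (f y); rewrite [`|f x - f p|]distrC; lra.
Qed.

Lemma uniform_continuity_zero_off K f e : compact K -> continuous f -> zero_off K f -> 0 < e ->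
  exists2 d : R, 0 < d & forall x y, `|x.1 - y.1| <= d -> `|x.2 - y.2| <= d -> `|f x - f y| <= e.
Proof.
move=> cK cf f0 e0; have [d d0 hd] := uniform_continuity cK cf e0.
exists d => // x y h1 h2; have [Kx|/f0 fx] := pselect (K x); first exact: hd.
have [Ky|/f0 fy] := pselect (K y); last by rewrite fx fy subrr normr0 ltW.
by rewrite distrC; apply: hd => //; rewrite distrC.
Qed.

Definition smooth h := forall k, class_C k setT h.

Lemma smoothM h f : smooth h -> smooth f -> smooth (fun x => h x * f x).
Proof. by move=> sh sf k; apply: class_CM => //; exact: openT. Qed.

Lemma smoothD h f : smooth h -> smooth f -> smooth (fun x => h x + f x).
Proof. by move=> sh sf k; apply: class_CD => //; exact: openT. Qed.

Lemma smoothB h f : smooth h -> smooth f -> smooth (fun x => h x - f x).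
Proof. by move=> sh sf k; apply: class_CB => //; exact: openT. Qed.

Lemma smooth_cst (a : R) : smooth (fun=> a).
Proof. by move=> k; exact: class_C_cst. Qed.

Lemma smooth_pd b h : smooth h -> smooth (pd b h).
Proof. by move=> sh k; exact: class_C_pd (sh k.+1). Qed.

Lemma smooth_pds s h : smooth h -> smooth (pds s h).
Proof. by move=> sh; elim: s => [//|b s IH]; exact: (smooth_pd b IH). Qed.

Lemma smooth_continuous h : smooth h -> continuous h.
Proof. by move=> /(_ 0%N)/class_C_continuous. Qed.

Lemma smooth_cutoff K U : compact K -> open U -> K `<=` U ->
  exists chi, [/\ smooth chi, (forall x, 0 <= chi x <= 1),
    exists2 V, open V & K `<=` V /\ (forall x, V x -> chi x = 1) &
    exists2 K', compact K' & K' `<=` U /\ zero_off K' chi].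
Proof.
move=> cK oU KU; pose P A := exists chi, [/\ smooth chi, (forall x, 0 <= chi x <= 1),
    exists2 V, open V & A `<=` V /\ (forall x, V x -> chi x = 1) &
    exists2 K', compact K' & K' `<=` U /\ zero_off K' chi].
suff : P K by [].
apply: (compact_induction cK).
- exists (cst 0); split; [exact: smooth_cst|by move=> x; rewrite lexx ler01| |].
    by exists set0; [exact: open0|split].
  by exists set0; [exact: compact0|split].
- move=> A B [f [sf f01 [V oV [AV fV]] [K1 cK1 [K1U fK1]]]] [g [sg g01 [W oW [BW gW]] [K2 cK2 [K2U gK2]]]].
  (* This is 1 - (1 - f)(1 - g): it stays in [0, 1] and is 1 wherever one of the two is. *)
  exists (fun x => f x + g x - f x * g x); split.
  + by apply: smoothB; [exact: smoothD|exact: smoothM].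
  + by move=> x; have /andP[? ?] := f01 x; have /andP[? ?] := g01 x; apply/andP; split; nra.
  + exists (V `|` W); first exact: openU.
    split; first exact: setUSS.
    by move=> x [/fV ->|/gW ->]; ring.
  + exists (K1 `|` K2); first exact: compactU.
    split; first by move=> x [/K1U|/K2U].
    move=> x nx; rewrite fK1 ?gK2 ?mul0r ?addr0 ?subr0// => ?; apply: nx; [by right|by left].
- move=> A B AB [f [sf f01 [V oV [BV fV]] H]]; exists f; split => //.
  by exists V => //; split => //; exact: subset_trans BV.
move=> p Kp; have [r r0 rU] := nbhs_sqbox_sub (open_nbhs_nbhs (conj oU (KU p Kp))).
have r2 : 0 < r / 2 by rewrite divr_gt0.
exists (sqbox p (r / 2))°; first by apply: nbhs_interior; exact: nbhs_sqbox.
exists (plateau p (r / 2)); split.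
- by move=> k; exact: class_C_plateau.
- by move=> x; rewrite plateau_ge0 plateau_le1.
- exists (sqbox p (r / 2))°; first exact: open_interior.
  by split=> // x /interior_subset; exact: plateau_eq1.
- exists (sqbox p r); first exact: compact_sqbox.
  split=> //; have := @plateau_zero_off R p _ r2; by rewrite mulrCA divff// mulr1.
Qed.

Lemma FTC_Rintegral (u u' : R -> R) (a c : R) : a < c -> (forall t, is_derive t 1 u (u' t)) ->
  continuous u' -> (\int[lebesgue_measure]_(t in `[a, c]) u' t)%R = u c - u a.
Proof.
move=> ac du cu'; rewrite /Rintegral (@continuous_FTC2 _ u' u)//.
- exact: continuous_subspaceT.
- have cu : continuous u.
    by move=> t; apply: (@differentiable_continuous _ R^o R^o); apply/derivable1_diffP; case: (du t).
  by split=> [t _| |]; [case: (du t)|apply: cvg_at_right_filter; exact: cu|apply: cvg_at_left_filter; exact: cu].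
- by move=> t _; rewrite derive1E; case: (du t).
Qed.

Lemma Rintegral_zero_off (u : R -> R) (a c : R) : (forall t, ~ (a <= t <= c) -> u t = 0) ->
  (\int[lebesgue_measure]_t u t)%R = (\int[lebesgue_measure]_(t in `[a, c]) u t)%R.
Proof.
move=> u0; rewrite [RHS]Rintegral_mkcond; congr Rintegral; apply/funext => t.
rewrite /patch; case: ifPn => //; rewrite notin_setE/= in_itv/= => /u0; exact.
Qed.

Lemma Rintegral_derive0 (u u' : R -> R) (a c : R) : a < c -> (forall t, is_derive t 1 u (u' t)) ->
  continuous u' -> (forall t, ~ (a < t < c) -> u t = 0) -> (forall t, ~ (a < t < c) -> u' t = 0) ->
  (\int[lebesgue_measure]_t u' t)%R = 0.
Proof.
move=> ac du cu' u0 u'0; rewrite (@Rintegral_zero_off _ a c); last first.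
  by move=> t ht; apply: u'0 => /andP[? ?]; apply: ht; rewrite !ltW.
by rewrite (FTC_Rintegral ac du cu') !u0 ?subr0// ltxx ?andbF.
Qed.

Lemma is_pd_linet b h s t k : class_C k.+1 setT h ->
  is_derive t 1 (fun t => h (pt b s t)) (pd b h (pt b s t)).
Proof. by move=> Ch; apply: is_pd_line_at; apply: derivable_pd; exact: class_C_derivable Ch _. Qed.

Lemma continuous_line b h s : continuous h -> continuous (fun t => h (pt b s t)).
Proof. by move=> ch t; apply: continuous_comp; [exact: continuous_pt|exact: ch]. Qed.

Lemma co_box b r x : box r x -> `|co b x| <= r.
Proof. by case: b => -[]. Qed.

Lemma It_pd0 K b h : compact K -> class_C 1 setT h -> zero_off K h -> It (pd b h) = 0.
Proof.
move=> cK Ch h0; have cpd := class_C_continuous (class_C_pd b Ch).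
have h0' := zero_off_pd b (compact_closed2 cK) h0.
rewrite (Fubini_It b); last exact: intg_continuous cpd h0'.
have [r r0 Kr] := compact_sub_box cK.
have E s : (\int[lebesgue_measure]_t pd b h (pt b s t))%R = 0.
  apply: (@Rintegral_derive0 (fun t => h (pt b s t)) _ (- (r + 1)) (r + 1)).
  - lra.
  - by move=> t; exact: is_pd_linet Ch.
  - exact: continuous_line.
  - by move=> t nt; apply: h0 => /Kr/(@co_box b); rewrite co_pt ler_norml; lra.
  - by move=> t nt; apply: h0' => /Kr/(@co_box b); rewrite co_pt ler_norml; lra.
under eq_Rintegral => s _ do rewrite E.
by rewrite Rintegral_cst ?mul0r.
Qed.

Lemma It_by_parts K b h f : compact K -> class_C 1 setT h -> class_C 1 setT f -> zero_off K h ->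
  It (fun x => h x * pd b f x) = - It (fun x => pd b h x * f x).
Proof.
move=> cK Ch Cf h0; have cf := class_C_continuous Cf; have ch := class_C_continuous Ch.
have cpf := class_C_continuous (class_C_pd b Cf); have cph := class_C_continuous (class_C_pd b Ch).
have h0' := zero_off_pd b (compact_closed2 cK) h0.
have i1 : intg (fun x => h x * pd b f x).
  apply: (intg_continuous cK); first by move=> x; apply: continuousM; [exact: ch|exact: cpf].
  by move=> x /h0 ->; rewrite mul0r.
have i2 : intg (fun x => pd b h x * f x).
  apply: (intg_continuous cK); first by move=> x; apply: continuousM; [exact: cph|exact: cf].
  by move=> x /h0' ->; rewrite mul0r.
apply/eqP; rewrite -addr_eq0 addrC -ItD//; apply/eqP.
rewrite -(@It_pd0 K b (fun x => h x * f x) cK).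
- by congr It; apply/funext => x; rewrite (pdM (class_C_derivable Ch _) (class_C_derivable Cf _)).
- by apply: class_CM => //; exact: openT.
- by move=> x /h0 ->; rewrite mul0r.
Qed.

End cutoffs.

(** * Convolution and mollification *)

Section convolution.
Context {R : realType}.
Local Notation mR := (measurableTypeR R).
Local Notation mP := (mR * mR)%type.
Implicit Types (h f g : R * R -> R) (A B U K : set (R * R)) (x y p q : R * R) (b : bool) (n : nat) (s t u v : R).

Definition refl p x : R * R := (p.1 - x.1, p.2 - x.2).

(** A point reflection is a product of two shears, which gives the invariance of the integral needed
    for convolutions. *)
Lemma refl_shear p : refl p = shear false (-1) (fun=> p.1) \o shear true (-1) (fun=> p.2).
Proof.
by apply/funext => -[x1 x2]; rewrite /refl /shear /= !mulN1r; congr pair; rewrite addrC.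
Qed.

Lemma intg_refl p h : intg h -> intg (fun x => h (refl p x)).
Proof.
move=> ih; rewrite refl_shear.
have n1 : (-1 : R) != 0 by rewrite oppr_eq0 oner_eq0.
have /= := @intg_shear R true (-1) (fun=> p.2) _ n1 (measurable_cst _)
  (@intg_shear R false (-1) (fun=> p.1) _ n1 (measurable_cst _) ih).
by [].
Qed.

Lemma It_refl p h : intg h -> It (fun x => h (refl p x)) = It h.
Proof.
move=> ih; rewrite refl_shear.
have n1 : (-1 : R) != 0 by rewrite oppr_eq0 oner_eq0.
have /= := @It_shear R true (-1) (fun=> p.2) _ n1 (measurable_cst _)
  (@intg_shear R false (-1) (fun=> p.1) _ n1 (measurable_cst _) ih).
rewrite (@It_shear R false (-1) (fun=> p.1) _ n1 (measurable_cst _) ih).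
by rewrite normrN normr1 invr1 !mul1r.
Qed.

Lemma continuous_refl p : continuous (refl p).
Proof.
move=> x; apply: (@cvg_pair _ _ _ (nbhs x) (nbhs (p.1 - x.1)) (nbhs (p.2 - x.2))).
  by apply: cvgB; [exact: cvg_cst|exact: cvg_fst].
by apply: cvgB; [exact: cvg_cst|exact: cvg_snd].
Qed.

Lemma reflE p x : refl p x = p - x. Proof. by []. Qed.

Lemma reflK p : involutive (refl p).
Proof. by move=> [x1 x2]; case: p => p1 p2; rewrite /refl/=; congr pair; ring. Qed.

Definition conv h k x : R := It (fun q => h q * k (x - q)).

Lemma intg_conv h k M x : intg h -> continuous k -> (forall y, `|k y| <= M) ->
  intg (fun q => h q * k (x - q)).
Proof.
move=> ih ck kM; apply: (le_intg _ _ (intgZ M (intg_abs ih))); last first.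
  by move=> q; rewrite normrM mulrC ler_wpM2r.
apply: mfM; first exact: intg_mf.
apply: continuous_mf => q; apply: (@continuous_comp _ _ _ (refl x) k); first exact: continuous_refl.
exact: ck.
Qed.

Lemma pt_sub b s t q : pt b s t - q = pt b (s - co (~~ b) q) (t - co b q).
Proof. by case: b. Qed.

Lemma pd_mvt b k s t u : class_C 1 setT k ->
  exists v, `|v - t| <= `|u - t| /\ k (pt b s u) - k (pt b s t) = pd b k (pt b s v) * (u - t).
Proof.
move=> Ck; have dk v : is_derive v 1 (fun t => k (pt b s t)) (pd b k (pt b s v)).
  exact: is_pd_linet Ck.
have ck : continuous (fun t => k (pt b s t)) by apply: continuous_line; exact: class_C_continuous Ck.
have [tu|ut] := leP t u.
  have [v vtu ->] := @MVT_segment R _ _ t u tu (fun v _ => dk v) (continuous_subspaceT ck).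
  exists v; split => //; move: vtu; rewrite in_itv/= => /andP[h1 h2].
  by rewrite !ger0_norm; lra.
have [v vtu e] := @MVT_segment R _ _ u t (ltW ut) (fun v _ => dk v) (continuous_subspaceT ck).
exists v; split; last by rewrite -opprB e -mulrN opprB.
move: vtu; rewrite in_itv/= => /andP[h1 h2].
by rewrite !ler0_norm; lra.
Qed.

Lemma lip_pd b k M x u : class_C 1 setT k -> (forall y, `|pd b k y| <= M) ->
  `|k (pt b (co (~~ b) x) u) - k x| <= M * `|u - co b x|.
Proof.
move=> Ck kM; rewrite -{2}(pt_co b x).
have [v [_ ->]] := pd_mvt b (co (~~ b) x) (co b x) u Ck.
by rewrite normrM ler_wpM2r.
Qed.

Lemma conv_lip h k M b x u : intg h -> class_C 1 setT k -> (forall y, `|k y| <= M) ->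
  (forall y, `|pd b k y| <= M) ->
  `|conv h k (pt b (co (~~ b) x) u) - conv h k x| <= M * It (fun q => `|h q|) * `|u - co b x|.
Proof.
move=> ih Ck kM pM; have ck := class_C_continuous Ck.
rewrite /conv -ItB; [|exact: intg_conv kM|exact: intg_conv kM].
rewrite mulrAC -ItZ; last exact: intg_abs.
apply: le_norm_It; last first.
- move=> q; rewrite -mulrBr normrM [leRHS]mulrC ler_wpM2l//.
  have := @lip_pd b k M (x - q) (u - co b q) Ck pM.
  have -> : pt b (co (~~ b) (x - q)) (u - co b q) = pt b (co (~~ b) x) u - q.
    by rewrite pt_sub; case: (b).
  have -> // : u - co b q - co b (x - q) = u - co b x.
  by case: (b) => /=; ring.
- by apply: intgZ; exact: intg_abs.
- by apply: intg_mf; apply: intgB; exact: intg_conv kM.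
Qed.

Lemma conv_continuous h k M : intg h -> class_C 1 setT k -> (forall y, `|k y| <= M) ->
  (forall b y, `|pd b k y| <= M) -> continuous (conv h k).
Proof.
move=> ih Ck kM pM x; apply/cvgrPdist_le => e e0.
set C := M * It (fun q => `|h q|).
have M0 : 0 <= M by exact: le_trans (kM x).
have C0 : 0 <= C by rewrite mulr_ge0//; apply: It_ge0.
have d0 : 0 < e / (2 * (C + 1)) by rewrite divr_gt0// mulr_gt0//; lra.
have := nbhs_sqbox x d0; apply: filterS => y [h1 h2].
have e1 := @conv_lip h k M false x y.1 ih Ck kM (pM false).
have e2 := @conv_lip h k M true (y.1, x.2) y.2 ih Ck kM (pM true).
have b1 : C * `|y.1 - x.1| <= e / 2.
  apply: (@le_trans _ _ ((C + 1) * (e / (2 * (C + 1))))); last by rewrite le_eqVlt; apply/orP; left; apply/eqP; field; lra.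
  by apply: ler_pM => //; lra.
have b2 : C * `|y.2 - x.2| <= e / 2.
  apply: (@le_trans _ _ ((C + 1) * (e / (2 * (C + 1))))); last by rewrite le_eqVlt; apply/orP; left; apply/eqP; field; lra.
  by apply: ler_pM => //; lra.
move: e1 e2; rewrite -/C /= -surjective_pairing => e1 e2.
have := ler_distD (conv h k (y.1, x.2)) (conv h k x) (conv h k y).
rewrite (distrC (conv h k x) (conv h k (y.1, x.2))) (distrC (conv h k (y.1, x.2)) (conv h k y)); lra.
Qed.

Lemma is_derive_small_o (c : R -> R) t d :
  (forall e, 0 < e -> exists2 r, 0 < r & forall u, `|u - t| <= r -> `|c u - c t - (u - t) * d| <= e * `|u - t|) ->
  is_derive t 1 c d.
Proof.
move=> H; suff cv : (fun u : R => u^-1 *: ((c \o shift t) (u *: 1) - c t)) @ 0^' --> d.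
  split; first by apply/cvg_ex; exists d.
  exact: (cvg_lim _ cv).
apply/cvgrPdist_le => e e0; have [r r0 hr] := H e e0.
near=> u; have u0 : u != 0 by near: u; exact: nbhs_dnbhs_neq.
have ur : `|u| <= r by near: u; apply: nbhs_dnbhs; exact: (@nbhs0_le _ R^o).
have := hr (u + t); rewrite addrK => /(_ ur) {}hr.
rewrite /= /shift/= /GRing.scale/= mulr1.
have -> : d - u^-1 * (c (u + t) - c t) = - (u^-1 * (c (u + t) - c t - u * d)) by field.
by rewrite normrN normrM normfV mulrC ler_pdivrMr// normr_gt0.
Unshelve. all: by end_near. Qed.

(** The bound on the second derivative of [k] makes the error under the integral quadratic in the
    increment, uniformly in [q]; differentiation under the integral is then a direct estimate. *)
Lemma conv_is_pd h k M b x : intg h -> class_C 2 setT k -> (forall y, `|k y| <= M) ->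
  (forall y, `|pd b k y| <= M) -> (forall y, `|pd b (pd b k) y| <= M) ->
  is_derive x (dir b) (conv h k) (conv h (pd b k) x).
Proof.
move=> ih Ck kM pM ppM; apply/is_pd_line; apply: is_derive_small_o => e e0.
have Ck1 := class_C_le (leqnSn 1) Ck.
have M0 : 0 <= M by exact: le_trans (kM x).
set C := M * It (fun q => `|h q|).
have C0 : 0 <= C by rewrite mulr_ge0//; apply: It_ge0.
exists (e / (C + 1)); first by rewrite divr_gt0//; lra.
move=> u ur; set r := u - co b x in ur *.
rewrite /line pt_co.
have i1 z : intg (fun q => h q * k (z - q)) by apply: intg_conv kM => //; exact: class_C_continuous Ck1.
have i2 z : intg (fun q => h q * pd b k (z - q)).
  by apply: intg_conv pM => //; exact: class_C_continuous (class_C_pd b Ck).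
have cle : C * `|r| <= e.
  apply: (@le_trans _ _ ((C + 1) * (e / (C + 1)))); last by rewrite mulrC divfK//; lra.
  by apply: ler_pM => //; lra.
apply: (@le_trans _ _ (C * `|r| * `|r|)); last exact: ler_wpM2r.
rewrite /conv -ItZ// -ItB// -ItB//; last 2 first.
- exact: intgB.
- exact: intgZ.
have -> : C * `|r| * `|r| = It (fun q => M * `|r| * `|r| * `|h q|).
  by rewrite ItZ ?intg_abs// /C; ring.
apply: le_norm_It.
- by apply: intg_mf; apply: intgB; [exact: intgB|exact: intgZ].
- by apply: intgZ; exact: intg_abs.
move=> q; set w := x - q.
have E0 : pt b (co (~~ b) x) u - q = pt b (co (~~ b) w) (co b w + r).
  by rewrite pt_sub /w /r; case: (b) => /=; congr pair; ring.
have E1 : x - q = pt b (co (~~ b) w) (co b w) by rewrite pt_co.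
rewrite E0 [k (x - q)](_ : _ = k (pt b (co (~~ b) w) (co b w))) -?E1//.
rewrite E1; have [v [hv kE]] := pd_mvt b (co (~~ b) w) (co b w) (co b w + r) Ck1.
have -> : h q * k (pt b (co (~~ b) w) (co b w + r)) - h q * k (pt b (co (~~ b) w) (co b w)) -
   r * (h q * pd b k w) =
   h q * (r * (pd b k (pt b (co (~~ b) w) v) - pd b k w)).
  by rewrite -mulrBr kE addrAC subrr add0r; ring.
rewrite !normrM mulrC ler_wpM2r// mulrC ler_wpM2r//.
have := @lip_pd b (pd b k) M w v (class_C_pd b Ck) ppM.
move=> /le_trans; apply; rewrite ler_wpM2l//.
by move: hv; rewrite addrAC subrr add0r.
Qed.

Lemma smooth_bounded K k : compact K -> smooth k -> zero_off K k ->
  exists2 M, 0 < M & forall (s : seq bool) y, (size s <= 2)%N -> `|pds s k y| <= M.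
Proof.
move=> cK sk k0.
have B (s : seq bool) : exists2 M, 0 < M & forall y, `|pds s k y| <= M.
  apply: (continuous_zero_off_bounded cK); first by apply: smooth_continuous; exact: smooth_pds.
  exact: zero_off_pds (compact_closed2 cK) k0.
have B2 (s : seq bool) : exists2 M, 0 < M & forall b y, `|pds s k y| <= M /\ `|pds (b :: s) k y| <= M.
  have [M0 M00 h0] := B s; have [M1 M10 h1] := B (true :: s); have [M2 M20 h2] := B (false :: s).
  exists (M0 + M1 + M2); first by rewrite !addr_gt0.
  move=> b y; split; first by rewrite (le_trans (h0 y))//; lra.
  by case: b; [rewrite (le_trans (h1 y))//; lra|rewrite (le_trans (h2 y))//; lra].
have [M0 M00 h0] := B2 [::]; have [M1 M10 h1] := B2 [:: true]; have [M2 M20 h2] := B2 [:: false].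
exists (M0 + M1 + M2); first by rewrite !addr_gt0.
move=> [|b [|b' [|]]]//= y _.
- by have [+ _] := h0 true y; move=> /le_trans; apply; lra.
- by have [_] := h0 b y; move=> /le_trans; apply; lra.
- by case: b'; [have [_] := h1 b y|have [_] := h2 b y]; move=> /le_trans; apply; lra.
Qed.

Lemma conv_smooth K h k : compact K -> intg h -> smooth k -> zero_off K k ->
  smooth (conv h k) /\ forall b, pd b (conv h k) = conv h (pd b k).
Proof.
move=> cK ih sk k0.
have D f b x : smooth f -> zero_off K f -> is_derive x (dir b) (conv h f) (conv h (pd b f) x).
  move=> sf f0; have [M M0 hM] := smooth_bounded cK sf f0.
  exact: (@conv_is_pd h f M b x ih (sf 2%N) (fun y => hM [::] y isT) (fun y => hM [:: b] y isT)
    (fun y => hM [:: b; b] y isT)).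
have C f : smooth f -> zero_off K f -> continuous (conv h f).
  move=> sf f0; have [M M0 hM] := smooth_bounded cK sf f0.
  exact: (@conv_continuous h f M ih (sf 1%N) (fun y => hM [::] y isT) (fun b y => hM [:: b] y isT)).
split; last by move=> b; apply/funext => x; exact: is_pdE (D k b x sk k0).
move=> n; elim: n k sk k0 => [|n IH] f sf f0.
  by apply/class_C0 => x _; exact: C.
apply/class_CS; split=> [x _|b x _|b]; first exact: C.
  by case: (D f b x sf f0).
rewrite (_ : pd b (conv h f) = conv h (pd b f)).
  apply: IH; first exact: smooth_pd.
  exact: zero_off_pd (compact_closed2 cK) f0.
by apply/funext => x; exact: is_pdE (D f b x sf f0).
Qed.

Lemma pds_conv K h k (s : seq bool) : compact K -> intg h -> smooth k -> zero_off K k ->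
  pds s (conv h k) = conv h (pds s k).
Proof.
move=> cK ih; elim/last_ind: s k => // s b IH k sk k0.
rewrite !pds_rcons (proj2 (conv_smooth cK ih sk k0)) (IH _ (smooth_pd b sk))//.
exact: zero_off_pd (compact_closed2 cK) k0.
Qed.

Lemma conv_eq0 h k A B x : zero_off A h -> zero_off B k -> (forall q, A q -> ~ B (x - q)) ->
  conv h k x = 0.
Proof.
move=> h0 k0 H; apply: It_eq0 => q; have [Aq|/h0->] := pselect (A q); last by rewrite mul0r.
by rewrite k0 ?mulr0//; exact: H.
Qed.

End convolution.

(** * Mollifiers and approximation by smooth functions *)

Section mollification.
Context {R : realType}.
Local Notation mR := (measurableTypeR R).
Local Notation mP := (mR * mR)%type.
Implicit Types (h f g k psi phi : R * R -> R) (A B U K : set (R * R)) (x y p q : R * R)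
  (b : bool) (m n : nat) (s : seq bool) (t u v r d e : R).

Lemma refl_is_pd b k p x : class_C 1 setT k ->
  is_derive x (dir b) (fun q => k (refl p q)) (- pd b k (refl p x)).
Proof.
move=> Ck; apply/is_pd_line.
have -> : line b x (fun q => k (refl p q)) =
    (fun t => k (pt b (co (~~ b) (refl p x)) t)) \o (fun u => - u + co b p).
  by apply/funext => u; rewrite /line /refl /=; case: (b) => /=; congr k; congr pair; rewrite addrC.
rewrite -mulrN1; apply: is_derive1_comp.
  have := @is_pd_linet _ b k (co (~~ b) (refl p x)) (- co b x + co b p) 0 Ck.
  by congr is_derive; congr (pd b k _); rewrite /refl; case: (b) => /=; congr pair; rewrite addrC.
have := is_deriveD (is_deriveN (is_derive_id (co b x) (1 : R))) (is_derive_cst (co b p) (co b x) (1 : R)).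
by rewrite addr0.
Qed.

Lemma class_C_refl n k p : class_C n setT k -> class_C n setT (fun q => k (refl p q)).
Proof.
elim: n k => [|n IH] k.
  move=> /class_C0 ck; apply/class_C0 => x _.
  by apply: continuous_comp; [exact: continuous_refl|exact: ck].
move=> Ck; have Ck1 := class_C_le (ltn0Sn n : (1 <= n.+1)%N) Ck.
apply/class_CS; split=> [x _|b x _|b].
- by apply: continuous_comp; [exact: continuous_refl|exact: class_C_continuous Ck _].
- by case: (refl_is_pd b p x Ck1).
rewrite (_ : pd b _ = (fun q => - pd b k (refl p q))).
  by apply: class_CN; [exact: openT|apply: IH; exact: class_C_pd].
by apply/funext => x; exact: is_pdE (refl_is_pd b p x Ck1).
Qed.

Lemma smooth_refl k p : smooth k -> smooth (fun q => k (refl p q)).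
Proof. by move=> sk n; exact: class_C_refl. Qed.

Lemma pd_refl b k p x : class_C 1 setT k ->
  pd b (fun q => k (refl p q)) x = - pd b k (refl p x).
Proof. by move=> Ck; exact: is_pdE (refl_is_pd b p x Ck). Qed.

Lemma compact_refl p K : compact K -> compact [set x | K (refl p x)].
Proof.
move=> cK; have -> : [set x | K (refl p x)] = refl p @` K.
  apply/seteqP; split => [x Kx|_ [x Kx <-]]; last by rewrite /= reflK.
  by exists (refl p x) => //; rewrite reflK.
by apply: continuous_compact => //; apply: continuous_subspaceT; exact: continuous_refl.
Qed.

Lemma test_fun_refl K k p : compact K -> smooth k -> zero_off K k ->
  test_fun setT (fun q => k (refl p q)).
Proof.
move=> cK sk k0; split; first exact: smooth_refl.
exists [set x | K (refl p x)]; split => //; first exact: compact_refl.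
by move=> x /k0.
Qed.

Lemma conv_pd K b h k : compact K -> class_C 1 setT h -> zero_off K h -> smooth k ->
  conv (pd b h) k = conv h (pd b k).
Proof.
move=> cK Ch h0 sk; apply/funext => x; rewrite /conv.
have Ck := class_C_refl x (sk 1%N).
have /(congr1 (@GRing.opp R)) := It_by_parts b cK Ch Ck h0; rewrite opprK => <-.
rewrite -ItN; last first.
  apply: (intg_continuous cK); last by move=> y /h0 ->; rewrite mul0r.
  move=> y; apply: continuousM; first exact: class_C_continuous Ch _.
  exact: class_C_continuous (class_C_pd b Ck) _.
congr It; apply/funext => y; rewrite (pd_refl _ _ _ (sk 1%N)).
by rewrite mulrN opprK.
Qed.

Lemma conv_pds K s h k : compact K -> class_C (size s) setT h -> zero_off K h -> smooth k ->
  (exists2 K', compact K' & zero_off K' k) -> pds s (conv h k) = conv (pds s h) k.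
Proof.
move=> cK Ch h0 sk [K' cK' k0].
elim/last_ind: s h Ch h0 => // s b IH h; rewrite size_rcons => Ch h0.
have Ch1 := class_C_le (ltn0Sn (size s) : (1 <= (size s).+1)%N) Ch.
have ih : intg h := intg_continuous cK (class_C_continuous Ch) h0.
rewrite !pds_rcons (proj2 (conv_smooth cK' ih sk k0)) -(conv_pd b cK Ch1 h0 sk) IH//.
  exact: class_C_pd.
exact: zero_off_pd (compact_closed2 cK) h0.
Qed.

Lemma leb2_sqbox p r : 0 < r -> leb2 (sqbox p r) = ((2 * r) ^+ 2)%:E.
Proof.
move=> r0; rewrite sqboxE.
rewrite (_ : leb2 _ = (lebesgue_measure [set` `[(p.1 - r)%R, (p.1 + r)%R] : interval R] *
   lebesgue_measure [set` `[(p.2 - r)%R, (p.2 + r)%R] : interval R])%E); last first.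
  by apply: product_measure1E; exact: measurable_itv.
have h a : (a - r < a + r) by lra.
rewrite !lebesgue_measure_itv/= !lte_fin !h -!EFinD -EFinM; congr EFin; ring.
Qed.

Lemma measurable_sqbox p r : @measurable _ mP (sqbox p r).
Proof. exact: closed_measurable2 (compact_closed2 (@compact_sqbox _ p r)). Qed.

Lemma It_gt0 f p r d : 0 < r -> 0 < d -> intg f -> (forall x, 0 <= f x) ->
  (forall x, sqbox p r x -> d <= f x) -> 0 < It f.
Proof.
move=> r0 d0 jf f0 fd.
have mB := measurable_sqbox p r.
have i1 : intg (\1_(sqbox p r)).
  apply: (@intg_bounded _ _ 1 (`|p.1| + `|p.2| + r)); first exact: measurable_indic.
    by move=> x; rewrite /indic; case: (_ \in _); rewrite ?normr1 ?normr0.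
  move=> x nx; rewrite /indic memNset//= => -[h1 h2]; apply: nx.
  have := ler_normD (x.1 - p.1) p.1; have := ler_normD (x.2 - p.2) p.2.
  by rewrite !subrK; have := normr_ge0 p.1; have := normr_ge0 p.2; split; lra.
have : It (fun x => d * \1_(sqbox p r) x) <= It f.
  apply: le_It => //; first exact: intgZ.
  move=> x; rewrite /indic; case: (boolP (x \in _)) => [/set_mem/fd|_]; first by rewrite mulr1.
  by rewrite mulr0.
apply: lt_le_trans; rewrite ItZ// mulr_gt0//.
rewrite /It /Rintegral integral_indic// setIT.
by rewrite leb2_sqbox// exprn_gt0//; lra.
Qed.

Lemma intg_plateau p r : 0 < r -> intg (plateau p r).
Proof.
move=> r0; have r20 : 0 < 2 * r by lra.
apply: (intg_continuous (@compact_sqbox _ p (2 * r))); last exact: plateau_zero_off.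
exact: class_C_continuous (class_C_plateau 0 p r).
Qed.

Lemma It_plateau_gt0 p r : 0 < r -> 0 < It (plateau p r).
Proof.
move=> r0; apply: (@It_gt0 _ p r 1) => //; first exact: intg_plateau.
  by move=> x; exact: plateau_ge0.
by move=> x /(plateau_eq1 r0) ->.
Qed.

Definition moll d x : R := (It (plateau 0 (d / 2)))^-1 * plateau 0 (d / 2) x.

Lemma moll_smooth d : smooth (moll d).
Proof. by move=> n; apply: class_CZ; [exact: openT|exact: class_C_plateau]. Qed.

Lemma moll_zero_off d : 0 < d -> zero_off (sqbox 0 d) (moll d).
Proof.
move=> d0 x nx; have d2 : 0 < d / 2 by rewrite divr_gt0.
rewrite /moll (@plateau_zero_off R 0 (d / 2) d2) ?mulr0//.
by rewrite mulrCA divff// mulr1.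
Qed.

Lemma moll_ge0 d x : 0 < d -> 0 <= moll d x.
Proof.
move=> d0; rewrite mulr_ge0 ?plateau_ge0// invr_ge0; apply: It_ge0 => y; exact: plateau_ge0.
Qed.

Lemma intg_moll d : 0 < d -> intg (moll d).
Proof. by move=> d0; apply: intgZ; apply: intg_plateau; rewrite divr_gt0. Qed.

Lemma It_moll d : 0 < d -> It (moll d) = 1.
Proof.
move=> d0; have d2 : 0 < d / 2 by rewrite divr_gt0.
rewrite ItZ; last exact: intg_plateau.
by rewrite mulVf// gt_eqF//; exact: It_plateau_gt0.
Qed.

Lemma compact_sqbox0 d : compact (sqbox (0 : R * R) d). Proof. exact: compact_sqbox. Qed.

Lemma moll_bounded d : 0 < d -> exists2 M, 0 < M & forall y, `|moll d y| <= M.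
Proof.
move=> d0; apply: (continuous_zero_off_bounded (@compact_sqbox0 d) _ (moll_zero_off d0)).
exact: smooth_continuous (moll_smooth d).
Qed.

(** The mollifier is a probability density carried by the square of half side [d], so the
    convolution averages values of [h] near [x]. *)
Lemma conv_moll_le h d e x : 0 < d -> intg h ->
  (forall q, sqbox 0 d (x - q) -> `|h q - h x| <= e) -> `|conv h (moll d) x - h x| <= e.
Proof.
move=> d0 ih he; have im := intg_refl x (intg_moll d0).
have [M M0 hM] := moll_bounded d0.
have ic : intg (fun q => h q * moll d (x - q)).
  apply: intg_conv hM => //; exact: smooth_continuous (moll_smooth d).
have E a : It (fun q => a * moll d (refl x q)) = a.
  by rewrite ItZ; [rewrite (It_refl _ (intg_moll d0)) It_moll ?mulr1|].
have ih' : intg (fun q => h x * moll d (refl x q)) by exact: intgZ.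
rewrite -(E e) -[X in `|_ - X|](E (h x)) /conv -ItB; [|exact: ic|exact: ih'].
apply: le_norm_It.
- by apply: intg_mf; exact: (intgB ic ih').
- exact: intgZ.
move=> q; rewrite reflE -mulrBl normrM (ger0_norm (moll_ge0 (x - q) d0)).
have [/he hq|nB] := pselect (sqbox 0 d (x - q)).
  by apply: ler_wpM2r hq; exact: moll_ge0.
by rewrite (moll_zero_off d0 nB) !mulr0.
Qed.

(** One threshold for all derivatives up to order [m]; the recursion on the last letter replaces the
    finiteness of the set of lists. *)
Lemma uniform_lists m (Q : seq bool -> R -> Prop) :
  (forall s, (size s <= m)%N -> exists2 d, 0 < d & Q s d) ->
  (forall s d d', d' <= d -> Q s d -> Q s d') ->
  exists2 d, 0 < d & forall s, (size s <= m)%N -> Q s d.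
Proof.
elim: m Q => [|m IH] Q H mono.
  have [d d0 Qd] := H [::] isT; exists d => // s; rewrite leqn0 size_eq0 => /eqP -> //.
have H' b : exists2 d, 0 < d & forall s, (size s <= m)%N -> Q (rcons s b) d.
  apply: (IH (fun s d => Q (rcons s b) d)); last by move=> s d d'; exact: mono.
  by move=> s sm; apply: H; rewrite size_rcons.
have [d0 d00 Q0] := H [::] isT.
have [d1 d10 Q1] := H' true; have [d2 d20 Q2] := H' false.
exists (Num.min d0 (Num.min d1 d2)); first by rewrite !lt_min d00 d10.
move=> s; case/lastP: s => [_|s b]; first by apply: mono Q0; rewrite ge_min lexx.
rewrite size_rcons ltnS => sm; case: b.
  by apply: mono (Q1 s sm); rewrite !ge_min lexx orbT.
by apply: mono (Q2 s sm); rewrite !ge_min lexx !orbT.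
Qed.

Lemma thicken K U : compact K -> open U -> K `<=` U -> exists2 K', compact K' & K' `<=` U /\
  exists2 d, 0 < d & forall x q, K q -> sqbox 0 d (x - q) -> K' x.
Proof.
move=> cK oU KU; have [chi [sc _ [V oV [KV cV]] [K' cK' [K'U c0]]]] := smooth_cutoff cK oU KU.
exists K' => //; split => //.
(* Within [d] of [K] the cutoff is at least 1/2, and it is 0 off [K']: such points cannot lie
   outside [K']. *)
have e2 : (0 : R) < 2^-1 by rewrite invr_gt0.
have [d d0 hd] := uniform_continuity_zero_off cK' (smooth_continuous sc) c0 e2.
exists d => // x q Kq [h1 h2]; apply: contrapT => nK'.
move: h1 h2; rewrite /= !subr0 => h1 h2.
have := hd x q h1 h2; rewrite (cV _ (KV _ Kq)) (c0 _ nK') sub0r normrN normr1; lra.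
Qed.

(** Mollification at the smaller of two scales: one keeps the support inside the compact [K'], the
    other controls all derivatives up to order [m]. [K'] is fixed before [e], which later yields
    domination by functions supported in one compact set. *)
Lemma smooth_approx m K U psi : compact K -> open U -> K `<=` U -> class_C m setT psi ->
  zero_off K psi -> exists2 K', compact K' & K' `<=` U /\ forall e, 0 < e ->
  exists phi, [/\ smooth phi, zero_off K' phi &
    forall s x, (size s <= m)%N -> `|pds s phi x - pds s psi x| <= e].
Proof.
move=> cK oU KU Cpsi psi0; have [K' cK' [K'U [d0 d00 hd0]]] := thicken cK oU KU.
exists K' => //; split => // e e0.
have [d d1 hd] : exists2 d, 0 < d & forall s, (size s <= m)%N ->
    forall x y, `|x.1 - y.1| <= d -> `|x.2 - y.2| <= d -> `|pds s psi x - pds s psi y| <= e.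
  apply: (@uniform_lists m (fun s d => forall x y, `|x.1 - y.1| <= d -> `|x.2 - y.2| <= d ->
     `|pds s psi x - pds s psi y| <= e)); last first.
    by move=> s d d' dd' H x y h1 h2; apply: H; exact: le_trans dd'.
  move=> s sm; apply: (uniform_continuity_zero_off cK) => //.
    by move=> x; case: Cpsi => + _; apply.
  exact: zero_off_pds (compact_closed2 cK) psi0.
have dm0 : 0 < Num.min d d0 by rewrite lt_min d1.
have ipsi : intg psi := intg_continuous cK (class_C_continuous Cpsi) psi0.
exists (conv psi (moll (Num.min d d0))); split.
- exact: (proj1 (conv_smooth (@compact_sqbox0 _) ipsi (@moll_smooth _) (moll_zero_off dm0))).
- move=> x nx; apply: (conv_eq0 psi0 (moll_zero_off dm0)) => q Kq [h1 h2]; apply: nx.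
  by apply: hd0 Kq _; split; [apply: le_trans h1 _|apply: le_trans h2 _]; rewrite ge_min lexx orbT.
move=> s x sm.
have Cs : class_C (size s) setT psi by exact: class_C_le Cpsi.
rewrite (conv_pds cK Cs psi0 (moll_smooth _)); last first.
  by exists (sqbox 0 (Num.min d d0)); [exact: compact_sqbox0|exact: moll_zero_off].
apply: conv_moll_le => //.
  apply: (intg_continuous cK); last exact: zero_off_pds (compact_closed2 cK) psi0.
  by move=> y; case: Cpsi => + _; apply.
move=> q [h1 h2]; move: h1 h2; rewrite /= !subr0 => h1 h2.
rewrite distrC; apply: hd => //; apply: le_trans (_ : Num.min d d0 <= d) => //; by rewrite ge_min lexx.
Qed.

End mollification.

(** * The fundamental lemma of the calculus of variations *)

Section fundamental_lemma.
Context {R : realType}.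
Local Notation mR := (measurableTypeR R).
Local Notation mP := (mR * mR)%type.
Implicit Types (h f g k psi phi : R * R -> R) (A B U V K : set (R * R)) (x y p q : R * R)
  (b : bool) (m n : nat) (s : seq bool) (t u v r d e : R).

Lemma open_sigma_compact U : open U -> exists Q : nat -> set (R * R),
  (forall n, compact (Q n) /\ Q n `<=` U) /\ U = \bigcup_n Q n.
Proof.
move=> oU.
pose B (q : (rat * rat) * rat) : set (R * R) := sqbox (ratr q.1.1, ratr q.1.2) (ratr q.2).
pose Q n := if (unpickle n : option ((rat * rat) * rat)) is Some q then
   if pselect (B q `<=` U) then B q else set0 else set0.
exists Q; split=> [n|].
  rewrite /Q; case: unpickle => [q|]; last by split; [exact: compact0|].
  by case: (pselect (B q `<=` U)) => ? /=; split=> //; [exact: compact_sqbox|exact: compact0].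
apply/seteqP; split => [x Ux|x [n _]]; last first.
  by rewrite /Q; case: unpickle => // q; case: (pselect (B q `<=` U)) => //= h /h.
have [e e0 xeU] := nbhs_sqbox_sub (open_nbhs_nbhs (conj oU Ux)).
have e2 : 0 < e / 2 by rewrite divr_gt0.
have [r] : exists r : rat, ratr r \in `]0, e / 2[ by exact: rat_in_itvoo.
rewrite in_itv/= => /andP[r0 re].
have [q1] : exists r' : rat, ratr r' \in `]x.1 - ratr r, x.1 + ratr r[.
  by apply: rat_in_itvoo; rewrite ltrBlDr -addrA ltrDl addr_gt0.
have [q2] : exists r' : rat, ratr r' \in `]x.2 - ratr r, x.2 + ratr r[.
  by apply: rat_in_itvoo; rewrite ltrBlDr -addrA ltrDl addr_gt0.
rewrite !in_itv/= => /andP[a1 a2] /andP[b1 b2].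
exists (pickle ((q1, q2), r)); [exact: Logic.I|rewrite /Q pickleK].
case: (pselect (B ((q1, q2), r) `<=` U)) => [?|[]] /=.
  by split => /=; rewrite ler_norml; lra.
move=> y [] /=; rewrite !ler_norml => y1 y2; apply: xeU; split; rewrite ler_norml; lra.
Qed.

Definition closed_sets : set (set (R * R)) := [set A | closed A].

(** Closed sets generate and are stable under intersection, as the monotone class argument of
    [It_closed0] requires. *)
Lemma measurable_closed_gen : @measurable _ mP = <<s closed_sets>>.
Proof.
apply/seteqP; split=> [A mA|A].
  have mco b : @measurable_fun _ _ (g_sigma_algebraType closed_sets) mR setT (co b).
    apply: (measurability _ (RGenOpens.measurableE R)).
    move=> _ [_ [a [c ->] <-]]; rewrite setTI -[X in measurable X]setCK.
    apply: measurableC; apply: sub_sigma_algebra; rewrite /closed_sets/=.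
    apply: open_closedC; apply: open_comp; last exact: interval_open.
    by move=> x _; exact: continuous_co.
  have := measurable_fun_pair (mco false) (mco true) measurableT mA.
  rewrite setTI (_ : _ @^-1` A = A)//; apply/seteqP.
  by split => x /=; rewrite -surjective_pairing.
apply: smallest_sub; first exact: sigma_algebra_measurable.
by move=> B; exact: closed_measurable2.
Qed.

Lemma intg_indicM A h : @measurable _ mP A -> intg h -> intg (fun x => \1_A x * h x).
Proof.
move=> mA ih; apply: (le_intg _ _ (intg_abs ih)).
  by apply: mfM; [exact: mf_indic|exact: intg_mf].
move=> x; rewrite normrM /indic; case: (_ \in _); by rewrite ?normr1 ?normr0 ?mul1r ?mul0r.
Qed.

Lemma ndseq_indic (F : nat -> set (R * R)) x : nondecreasing_seq F ->
  (\1_(F n) x : R) @[n --> \oo] --> (\1_(\bigcup_n F n) x : R).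
Proof.
move=> ndF; rewrite [X in _ --> X]/indic; case: (boolP (x \in _)) => [/set_mem[n _ Fnx]|].
  apply: cvg_near_cst; exists n => // m /= nm; rewrite /indic mem_set//.
  by have /subsetPset := ndF _ _ nm; apply.
rewrite notin_setE => nF; apply: cvg_near_cst; apply: nearW => m.
by rewrite /indic memNset// => Fmx; apply: nF; exists m.
Qed.

Lemma It_closed0 h : intg h -> (forall A, closed A -> It (fun x => \1_A x * h x) = 0) ->
  forall A, @measurable _ mP A -> It (fun x => \1_A x * h x) = 0.
Proof.
move=> ih H A; rewrite measurable_closed_gen => mA.
pose D : set (set (R * R)) := [set A | @measurable _ mP A /\ It (fun x => \1_A x * h x) = 0].
suff : D A by case.
have lD : lambda_system setT D.
  split.
  - by [].
  - by split; [exact: measurableT|apply: H; exact: closedT].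
  - move=> B1 B2 B21 [mB1 I1] [mB2 I2]; split; first exact: measurableD.
    transitivity (It (fun x => \1_B1 x * h x - \1_B2 x * h x)); last first.
      by rewrite ItB ?I1 ?I2 ?subrr//; exact: intg_indicM.
    congr It; apply/funext => x; rewrite -mulrBl; congr (_ * _).
    rewrite /indic in_setD; case: (boolP (x \in B2)) => [/set_mem/B21/mem_set->|_].
      by rewrite subrr.
    by rewrite subr0 andbT.
  - move=> F ndF DF; have mF n : @measurable _ mP (F n) by case: (DF n).
    have mU : @measurable _ mP (\bigcup_n F n) by exact: bigcup_measurable.
    split=> //.
    have cv : It (fun x => \1_(F n) x * h x) @[n --> \oo] --> It (fun x => \1_(\bigcup_n F n) x * h x).
      apply: (dct (f := fun x => `|h x|)).
      + by move=> n; apply: intg_mf; exact: intg_indicM.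
      + by apply: intg_mf; exact: intg_indicM.
      + by apply: aeW => x; apply: cvgM; [exact: ndseq_indic|exact: cvg_cst].
      + exact: intg_abs.
      + move=> n x; rewrite normrM /indic; case: (_ \in _).
          by rewrite normr1 mul1r.
        by rewrite normr0 mul0r.
    have E : (fun n => It (fun x => \1_(F n) x * h x)) = cst 0.
      by apply/funext => n; case: (DF n).
    by move: cv; rewrite E => /cvg_lim <-//; rewrite lim_cst.
have Gc : setI_closed closed_sets by move=> B1 B2; exact: closedI.
apply: (@lambda_system_subset _ closed_sets Gc setT D lD) mA; last by [].
by move=> B cB; split; [exact: closed_measurable2|exact: H].
Qed.

Lemma It_measurable0_ae h : intg h ->
  (forall A, @measurable _ mP A -> It (fun x => \1_A x * h x) = 0) -> {ae leb2, forall x, h x = 0}.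
Proof.
move=> ih H.
have := @integral_ae_eq _ _ _ (@leb2 R) setT measurableT (cst 0%E) (EFin \o h) ih (@measurable_cst _ _ _ _ _ _).
case=> [A _ mA|N [mN N0 hN]]; last first.
  by exists N; split => // x /= hx; apply: hN => /= hx0; apply: hx; have [] := hx0 Logic.I.
rewrite integral0 integral_mkcond.
transitivity (\int[leb2]_x (\1_A x * h x)%:E)%E; last first.
  by rewrite -(EFin_It (intg_indicM mA ih)) (H A mA).
apply: eq_integral => x _; rewrite /patch /indic; case: (x \in A) => /=.
  by rewrite mul1r.
by rewrite mul0r.
Qed.

(** Cutoffs carried by shrinking neighbourhoods of a compact [B] converge to its indicator, while a
    fixed cutoff [chi0] keeps everything dominated on one compact subset of [U]. So the integral of
    [h] over every compact subset vanishes, and [h] is 0 on each member of a compact exhaustion. *)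
Lemma du_Bois_Reymond U h : open U -> mf h ->
  (forall K, compact K -> K `<=` U -> intg (fun x => \1_K x * h x)) ->
  (forall phi, test_fun U phi -> It (fun x => h x * phi x) = 0) ->
  {ae leb2, forall x, U x -> h x = 0}.
Proof.
move=> oU mh lh H.
have HB B : compact B -> B `<=` U -> It (fun x => \1_B x * h x) = 0.
  move=> cB BU; have [chi0 [s0 b0 [V0 _ [BV0 c0]] [K0 cK0 [K0U z0]]]] := smooth_cutoff cB oU BU.
  have iK0 := lh _ cK0 K0U.
  pose V (n : nat) := \bigcup_(p in B) ball p (n.+1%:R^-1 : R).
  have oV n : open (V n).
    by apply: bigcup_open => p _; apply: ball_open; rewrite invr_gt0.
  have BV n : B `<=` V n.
    by move=> p Bp; exists p => //; apply: ballxx; rewrite invr_gt0.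
  have ex n : exists chi, smooth chi /\ (forall x, 0 <= chi x <= 1) /\ (forall x, B x -> chi x = 1) /\
      (forall x, ~ V n x -> chi x = 0).
    have [chi [sc bc [W _ [BW cW]] [K cK [KV zc]]]] := smooth_cutoff cB (oV n) (@BV n).
    exists chi; split => //; split => //; split => [x /BW/cW//|x nV].
    by apply: zc => /KV.
  have [chi hchi] := choice ex.
  have T n : test_fun U (fun x => chi n x * chi0 x).
    have [sc _] := hchi n.
    split; first exact: (smoothM sc s0).
    by exists K0; split => // x /z0 ->; rewrite mulr0.
  have cv : It (fun x => h x * (chi n x * chi0 x)) @[n --> \oo] --> It (fun x => \1_B x * h x).
    apply: (dct (f := fun x => `|\1_K0 x * h x|)).
    - move=> n; apply: mfM => //; have [sc _] := hchi n.
      by apply: continuous_mf; apply: smooth_continuous; exact: smoothM.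
    - by apply: mfM => //; apply: mf_indic; exact: closed_measurable2 (compact_closed2 cB).
    - apply: aeW => x; case: (pselect (B x)) => [Bx|nBx].
        apply: cvg_near_cst; apply: nearW => n; have [_ [_ [cB1 _]]] := hchi n.
        by rewrite cB1// c0; [rewrite /indic mem_set// !mul1r mulr1|exact: BV0].
      have [r r0 rB] : exists2 r, 0 < r & ball x r `<=` ~` B.
        have oB : open (~` B) by rewrite openC; exact: compact_closed2.
        by have /nbhs_ballP[r /= r0 rB] := open_nbhs_nbhs (conj oB nBx); exists r.
      apply: cvg_near_cst; have [N _ hN] := near_infty_natSinv_lt (PosNum r0).
      exists N => // n /hN /= nr; have [_ [_ [_ cV]]] := hchi n.
      rewrite cV ?mul0r ?mulr0 /indic ?memNset ?mul0r// => -[p Bp] /ball_sym pn.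
      by apply: (rB p) => //; apply: le_ball pn; exact: ltW.
    - exact: intg_abs.
    - move=> n x; rewrite !normrM; have [_ [bc _]] := hchi n.
      have /andP[h1 h2] := bc x; have /andP[h3 h4] := b0 x.
      rewrite mulrC ler_wpM2r// !ger0_norm// /indic.
      case: (boolP (x \in K0)) => [_|]; first by rewrite mulr_ile1.
      by rewrite notin_setE => /z0 ->; rewrite mulr0.
  have E : (fun n => It (fun x => h x * (chi n x * chi0 x))) = cst 0.
    by apply/funext => n; exact: H.
  by move: cv; rewrite E => /cvg_lim <-//; rewrite lim_cst.
have [Q [cQ UQ]] := open_sigma_compact oU.
have HQ n : {ae leb2, forall x, \1_(Q n) x * h x = 0}.
  have [cQn QnU] := cQ n; apply: It_measurable0_ae; first exact: lh.
  apply: It_closed0 => [|A cA]; first exact: lh.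
  have cAQ : compact (A `&` Q n).
    by rewrite setIC; apply: compact_closedI.
  rewrite -[RHS](HB _ cAQ); last by move=> x [_ /QnU].
  congr It; apply/funext => x; rewrite mulrA; congr (_ * _).
  by rewrite /indic in_setI -natrM mulnb.
apply: negligibleS (negligible_bigcup HQ) => x /= nx.
have [Ux hx] : U x /\ h x <> 0 by split; [apply: contrapT => ?; apply: nx|move=> ?; apply: nx].
move: Ux; rewrite UQ => -[n _ Qx]; exists n => //=.
by rewrite /indic mem_set// mul1r.
Qed.

End fundamental_lemma.

(** * Weak derivatives *)

Section sobolev_basics.
Context {R : realType}.
Local Notation mR := (measurableTypeR R).
Local Notation mP := (mR * mR)%type.
Implicit Types (h f g k w y z psi phi chi : R * R -> R) (A B U V K : set (R * R)) (x p q : R * R)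
  (b : bool) (m n : nat) (s : seq bool) (t u r d e : R).

Lemma test_fun_smooth U phi : test_fun U phi -> smooth phi. Proof. by case. Qed.

Lemma test_fun_pds U s phi : test_fun U phi -> test_fun U (pds s phi).
Proof.
move=> [sphi [K [cK KU z]]]; split; first exact: smooth_pds.
by exists K; split => //; exact: zero_off_pds (compact_closed2 cK) z.
Qed.

Lemma test_fun_sub U V phi : U `<=` V -> test_fun U phi -> test_fun V phi.
Proof.
by move=> UV [sphi [K [cK KU z]]]; split => //; exists K; split => //; exact: subset_trans UV.
Qed.

Lemma test_fun_L2 U phi : test_fun U phi -> L2 setT phi.
Proof.
move=> [sphi [K [cK KU z]]]; have cphi := smooth_continuous sphi.
split; first exact: continuous_mf.
apply: (intg_continuous cK); last by move=> x /z ->; rewrite expr0n.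
by move=> x; apply: (@continuous_comp _ _ _ phi (fun t => t ^+ 2)); [exact: cphi|exact: exprn_continuous].
Qed.

Lemma test_fun_off U phi x : test_fun U phi -> ~ U x -> phi x = 0.
Proof. by move=> [_ [K [_ KU z]]] nUx; apply: z => /KU. Qed.

Lemma patch_test U h phi : test_fun U phi ->
  (fun x => h x * phi x) \_ U = (fun x => (h \_ U) x * phi x).
Proof.
move=> tp; apply/funext => x; rewrite /patch; case: ifPn => // _.
by rewrite mul0r.
Qed.

Lemma wderivE U s y v : open U -> wderiv U s y v <->
  [/\ L2 setT (y \_ U), L2 setT (v \_ U) & forall phi, test_fun U phi ->
    It (fun x => (y \_ U) x * pds s phi x) = (-1) ^+ size s * It (fun x => (v \_ U) x * phi x)].
Proof.
move=> oU; have mU := open_measurable2 oU.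
split=> [[Ly Lv H]|[Ly Lv H]]; split; try exact/(L2_patch _ mU).
  move=> phi tp; have := H _ tp; rewrite !It_mkcond.
  by rewrite (patch_test _ tp) (patch_test _ (test_fun_pds s tp)).
move=> phi tp; have := H _ tp; rewrite !It_mkcond.
by rewrite (patch_test _ tp) (patch_test _ (test_fun_pds s tp)).
Qed.

Lemma patchT h : h \_ setT = h.
Proof. by apply/funext => x; rewrite patchE mem_set. Qed.

Lemma wderivTE s y v : wderiv setT s y v <->
  [/\ L2 setT y, L2 setT v & forall phi, test_fun setT phi ->
    It (fun x => y x * pds s phi x) = (-1) ^+ size s * It (fun x => v x * phi x)].
Proof. by rewrite (wderivE _ _ _ (@openT _)) !patchT. Qed.

Lemma wderiv_L2 U s y v : wderiv U s y v -> L2 U y /\ L2 U v. Proof. by case. Qed.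

Lemma L2_intg_test U h phi : open U -> L2 U h -> test_fun U phi ->
  intg (fun x => (h \_ U) x * phi x).
Proof.
move=> oU Lh tp; apply: L2_intgM; last exact: test_fun_L2 tp.
exact/(L2_patch _ (open_measurable2 oU)).
Qed.

Lemma L2_intg_compact K h : compact K -> L2 setT h -> intg (fun x => \1_K x * h x).
Proof.
move=> cK Lh; apply: L2_intgM => //; have mK := closed_measurable2 (compact_closed2 cK).
split; first exact: mf_indic.
have [r _ Kr] := compact_sub_box cK.
apply: (@intg_bounded _ _ 1 r).
- by apply: mf_sq; exact: mf_indic.
- by move=> x; rewrite /indic; case: (_ \in _); rewrite ?expr1n ?normr1 ?expr0n ?normr0.
- by move=> x nx; rewrite /indic memNset ?expr0n// => /Kr.
Qed.

Lemma L2_weak0 U h : open U -> L2 U h ->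
  (forall phi, test_fun U phi -> It (fun x => (h \_ U) x * phi x) = 0) ->
  {ae leb2, forall x, U x -> h x = 0}.
Proof.
move=> oU /(L2_patch _ (open_measurable2 oU)) Lh H.
have := du_Bois_Reymond oU (L2_mf Lh) (fun K cK _ => L2_intg_compact cK Lh) H.
by move/aeS; apply => x /[swap] Ux; rewrite patchE mem_set//; exact.
Qed.

Lemma ae_eq_patch U y z : {ae leb2, forall x, U x -> y x = z x} ->
  {ae leb2, forall x, (y \_ U) x = (z \_ U) x}.
Proof. by move/aeS; apply => x h; rewrite !patchE; case: ifPn => // /set_mem/h. Qed.

Lemma wderiv_ae_unique U s y z v w : open U -> wderiv U s y v -> wderiv U s z w ->
  {ae leb2, forall x, U x -> y x = z x} -> {ae leb2, forall x, U x -> v x = w x}.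
Proof.
move=> oU Dv Dw yz; have mU := open_measurable2 oU.
have [Ly Lv Hv] := (wderivE s y v oU).1 Dv; have [Lz Lw Hw] := (wderivE s z w oU).1 Dw.
have E : (fun x => v x - w x) \_ U = (fun x => (v \_ U) x - (w \_ U) x).
  by apply/funext => x; rewrite !patchE; case: ifP => // _; rewrite subrr.
have Lvw : L2 U (fun x => v x - w x) by apply/(L2_patch _ mU); rewrite E; exact: L2B.
have := L2_weak0 oU Lvw; move=> /(_ _)/aeS; apply; last first.
  by move=> x h /h/eqP; rewrite subr_eq0 => /eqP.
move=> phi tp; rewrite E.
have iv : intg (fun x => (v \_ U) x * phi x) by exact: L2_intgM (test_fun_L2 tp).
have iw : intg (fun x => (w \_ U) x * phi x) by exact: L2_intgM (test_fun_L2 tp).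
have -> : It (fun x => ((v \_ U) x - (w \_ U) x) * phi x) =
    It (fun x => (v \_ U) x * phi x - (w \_ U) x * phi x).
  by congr It; apply/funext => x; rewrite mulrBl.
rewrite ItB//; apply/eqP; rewrite subr_eq0; apply/eqP.
have n1 : (-1 : R) ^+ size s != 0 by rewrite signr_eq0.
apply: (mulfI n1); rewrite -Hv// -Hw//; apply: ae_eq_It.
- by apply: mfM; [exact: L2_mf|exact: L2_mf (test_fun_L2 (test_fun_pds s tp))].
- by apply: mfM; [exact: L2_mf|exact: L2_mf (test_fun_L2 (test_fun_pds s tp))].
- by apply: (aeS (ae_eq_patch yz)) => x ->.
Qed.

Lemma wderiv_ae U s y z v w : open U -> wderiv U s y v -> L2 U z -> L2 U w ->
  {ae leb2, forall x, U x -> y x = z x} -> {ae leb2, forall x, U x -> v x = w x} ->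
  wderiv U s z w.
Proof.
move=> oU Dv Lz Lw yz vw; have mU := open_measurable2 oU.
have [Ly Lv Hv] := (wderivE s y v oU).1 Dv.
have {}Lz := (L2_patch _ mU).1 Lz; have {}Lw := (L2_patch _ mU).1 Lw.
apply/(wderivE s z w oU); split => // phi tp.
have mp := L2_mf (test_fun_L2 tp); have mps := L2_mf (test_fun_L2 (test_fun_pds s tp)).
transitivity (It (fun x => (y \_ U) x * pds s phi x)).
  apply: ae_eq_It; [by apply: mfM => //; exact: L2_mf|by apply: mfM => //; exact: L2_mf|].
  by apply: (aeS (ae_eq_patch yz)) => x ->.
rewrite Hv//; congr (_ * _).
apply: ae_eq_It; [by apply: mfM => //; exact: L2_mf|by apply: mfM => //; exact: L2_mf|].
by apply: (aeS (ae_eq_patch vw)) => x ->.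
Qed.

Lemma wderiv_sub U V s y v : open U -> open V -> V `<=` U -> wderiv U s y v -> wderiv V s y v.
Proof.
move=> oU oV VU Dv; have mU := open_measurable2 oU; have mV := open_measurable2 oV.
have P h : L2 setT (h \_ U) -> L2 setT (h \_ V).
  move=> Lh; have mh : mf (h \_ V).
    rewrite (_ : h \_ V = (h \_ U) \_ V); last first.
      apply/funext => x; rewrite !patchE; case: ifP => // /set_mem/VU Ux.
      by rewrite mem_set.
    by apply/(mf_patch _ mV); apply: measurable_funS (L2_mf Lh).
  apply: (@L2_bnd _ 1 (h \_ U)) => // x; rewrite mul1r !patchE; case: ifPn => [/set_mem/VU Ux|_].
    by rewrite mem_set.
  by rewrite normr0.
have E h phi : test_fun V phi -> (fun x => (h \_ U) x * phi x) = (fun x => (h \_ V) x * phi x).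
  move=> tp; apply/funext => x; rewrite !patchE; case: (boolP (x \in V)) => [/set_mem/VU/mem_set->//|].
  by rewrite notin_setE => nV; rewrite (test_fun_off tp nV) !mulr0.
have [Ly Lv Hv] := (wderivE s y v oU).1 Dv; apply/(wderivE s y v oV); split; try exact: P.
move=> phi tp; have tU := test_fun_sub VU tp.
by rewrite -(E y _ (test_fun_pds s tp)) -(E v _ tp) Hv.
Qed.

Lemma wderiv_cons U b s y v w : open U -> wderiv U [:: b] y v -> wderiv U s v w ->
  wderiv U (b :: s) y w.
Proof.
move=> oU /(wderivE _ _ _ oU)[Ly Lv Hv] /(wderivE _ _ _ oU)[_ Lw Hw].
apply/(wderivE _ _ _ oU); split => // phi tp.
rewrite /= (Hv _ (test_fun_pds s tp)) /= expr1 Hw// exprS; ring.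
Qed.

Lemma wderiv_uncons U b s y v w : open U -> wderiv U (b :: s) y w -> wderiv U [:: b] y v ->
  wderiv U s v w.
Proof.
move=> oU /(wderivE _ _ _ oU)[Ly Lw Hw] /(wderivE _ _ _ oU)[_ Lv Hv].
apply/(wderivE _ _ _ oU); split => // phi tp.
have := Hw _ tp; rewrite /= (Hv _ (test_fun_pds s tp)) /= expr1 exprS !mulN1r mulNr.
by move=> /oppr_inj.
Qed.

Lemma wderiv_nil U y : L2 U y -> wderiv U [::] y y.
Proof. by move=> Ly; split => // phi tp; rewrite /= expr0 mul1r. Qed.

Lemma sobolev_L2 m U y : sobolev m U y -> L2 U y. Proof. by case. Qed.

Lemma sobolev0 U y : sobolev 0 U y <-> L2 U y.
Proof.
split=> [[]//|Ly]; split => // s; rewrite leqn0 size_eq0 => /eqP ->.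
by exists y; exact: wderiv_nil.
Qed.

(** Turns statements on all derivatives up to an order into inductions on first derivatives. *)
Lemma sobolevS m U y : open U -> sobolev m.+1 U y <->
  L2 U y /\ forall b, exists v, wderiv U [:: b] y v /\ sobolev m U v.
Proof.
move=> oU; split=> [[Ly H]|[Ly H]]; (split; first by []).
  move=> b; have [v Dv] := H [:: b] isT; exists v; split => //; split.
    by case: (wderiv_L2 Dv).
  move=> s sm; have [w Dw] := H (b :: s) sm; exists w; exact: wderiv_uncons Dw Dv.
case=> [_|b s sm]; first by exists y; exact: wderiv_nil.
have [v [Dv [_ Hv]]] := H b; have [w Dw] := Hv s sm; exists w; exact: wderiv_cons Dv Dw.
Qed.

Lemma sobolev_le m n U y : (m <= n)%N -> sobolev n U y -> sobolev m U y.
Proof. by move=> mn [Ly H]; split => // s sm; apply: H; exact: leq_trans mn. Qed.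

Lemma sobolev_sub m U V y : open U -> open V -> V `<=` U -> sobolev m U y -> sobolev m V y.
Proof.
move=> oU oV VU [Ly H]; split=> [|s sm].
  have [v Dv] := H [::] isT; by case: (wderiv_L2 (wderiv_sub oU oV VU Dv)).
by have [v Dv] := H s sm; exists v; exact: wderiv_sub Dv.
Qed.

Lemma sobolev_ae m U y z : open U -> sobolev m U y -> L2 U z ->
  {ae leb2, forall x, U x -> y x = z x} -> sobolev m U z.
Proof.
move=> oU [Ly H] Lz yz; split=> // s sm; have [v Dv] := H s sm; exists v.
apply: (wderiv_ae oU Dv) => //; first by case: (wderiv_L2 Dv).
exact: aeW.
Qed.

Lemma L2D_on U h f : open U -> L2 U h -> L2 U f -> L2 U (fun x => h x + f x).
Proof.
move=> oU /(L2_patch _ (open_measurable2 oU)) Lh /(L2_patch _ (open_measurable2 oU)) Lf.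
apply/(L2_patch _ (open_measurable2 oU)).
have -> : (fun x => h x + f x) \_ U = (fun x => (h \_ U) x + (f \_ U) x).
  by apply/funext => x; rewrite !patchE; case: ifP => // _; rewrite addr0.
exact: L2D.
Qed.

Lemma L2Z_on U a h : open U -> L2 U h -> L2 U (fun x => a * h x).
Proof.
move=> oU /(L2_patch _ (open_measurable2 oU)) Lh.
apply/(L2_patch _ (open_measurable2 oU)).
have -> : (fun x => a * h x) \_ U = (fun x => a * (h \_ U) x).
  by apply/funext => x; rewrite !patchE; case: ifP => // _; rewrite mulr0.
exact: L2Z.
Qed.

Lemma wderivDZ U s y z v w (a : R) : open U -> wderiv U s y v -> wderiv U s z w ->
  wderiv U s (fun x => y x + a * z x) (fun x => v x + a * w x).
Proof.
move=> oU Dv Dw.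
have [Ly Lv] := wderiv_L2 Dv; have [Lz Lw] := wderiv_L2 Dw.
have LL h f : L2 U h -> L2 U f -> L2 U (fun x => h x + a * f x).
  by move=> Lh Lf; apply: L2D_on => //; exact: L2Z_on.
have mU := open_measurable2 oU.
have Ly1 := LL _ _ Ly Lz; have Lv1 := LL _ _ Lv Lw.
apply/(wderivE _ _ _ oU); split; try exact/(L2_patch _ mU).
have E h f phi : L2 U h -> L2 U f -> test_fun U phi ->
    It (fun x => ((fun x => h x + a * f x) \_ U) x * phi x) =
    It (fun x => (h \_ U) x * phi x) + a * It (fun x => (f \_ U) x * phi x).
  move=> Lh Lf tp; rewrite -ItZ; last exact: L2_intg_test.
  rewrite -ItD; [|exact: L2_intg_test|by apply: intgZ; exact: L2_intg_test].
  congr It; apply/funext => x; rewrite !patchE; case: ifP => _; last by rewrite !mul0r mulr0 addr0.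
  by rewrite mulrDl mulrA.
move=> phi tp; rewrite !E//; last exact: test_fun_pds.
have [_ _ Hv] := (wderivE s y v oU).1 Dv; have [_ _ Hw] := (wderivE s z w oU).1 Dw.
rewrite Hv// Hw//; ring.
Qed.

Lemma sobolevDZ m U y z (a : R) : open U -> sobolev m U y -> sobolev m U z ->
  sobolev m U (fun x => y x + a * z x).
Proof.
move=> oU [Ly Hy] [Lz Hz]; split=> [|s sm].
  by apply: L2D_on => //; exact: L2Z_on.
have [v Dv] := Hy s sm; have [w Dw] := Hz s sm; exists (fun x => v x + a * w x).
exact: wderivDZ.
Qed.

Lemma sobolevD m U y z : open U -> sobolev m U y -> sobolev m U z ->
  sobolev m U (fun x => y x + z x).
Proof.
move=> oU Sy /(sobolevDZ 1 oU Sy); congr sobolev.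
by apply/funext => x; rewrite mul1r.
Qed.

End sobolev_basics.

(** * Products, localisation and transfer between open sets *)

Section sobolev_products.
Context {R : realType}.
Local Notation mR := (measurableTypeR R).
Local Notation mP := (mR * mR)%type.
Implicit Types (h f g k w y z v psi phi chi eta : R * R -> R) (A B U V K N : set (R * R)) (x p q : R * R)
  (b : bool) (m n : nat) (s : seq bool) (t u r d e : R).

Lemma zero_off_sub A B h : A `<=` B -> zero_off A h -> zero_off B h.
Proof. by move=> AB h0 x nB; apply: h0 => /AB. Qed.

(** Testing against C^1 functions is needed because the functions met below, such as products with
    C^k cutoffs or reflected test functions, are not smooth. They are approximated inside one
    compact set, on which the two functions are integrable. *)
Lemma wderiv_C1 U K b y v psi : open U -> wderiv U [:: b] y v -> compact K -> K `<=` U ->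
  class_C 1 setT psi -> zero_off K psi ->
  It (fun x => (y \_ U) x * pd b psi x) = - It (fun x => (v \_ U) x * psi x).
Proof.
move=> oU Dv cK KU Cpsi psi0.
have [K' cK' [K'U approx]] := smooth_approx cK oU KU Cpsi psi0.
have [Ly Lv Hv] := (wderivE _ _ _ oU).1 Dv.
have cKK : compact (K `|` K') by exact: compactU.
have iy := L2_intg_compact cKK Ly; have iv := L2_intg_compact cKK Lv.
set Cy := It (fun x => `|\1_(K `|` K') x * (y \_ U) x|).
set Cv := It (fun x => `|\1_(K `|` K') x * (v \_ U) x|).
have C0 : 0 <= Cy + Cv by rewrite addr_ge0// It_ge0.
have cpsi := class_C_continuous Cpsi; have cpd := class_C_continuous (class_C_pd b Cpsi).
have psi0' := zero_off_pd b (compact_closed2 cK) psi0.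
have Lc k A : compact A -> continuous k -> zero_off A k -> L2 setT k.
  move=> cA ck k0; split; first exact: continuous_mf.
  apply: (intg_continuous cA); last by move=> x /k0 ->; rewrite expr0n.
  by move=> x; apply: (@continuous_comp _ _ _ k (fun t => t ^+ 2)); [exact: ck|exact: exprn_continuous].
have i1 := L2_intgM Ly (Lc _ _ cK cpd psi0'); have i2 := L2_intgM Lv (Lc _ _ cK cpsi psi0).
apply/eqP; rewrite -addr_eq0; apply/eqP/eqP; rewrite -normr_le0; apply/ler_addgt0Pr => e e0.
rewrite add0r.
have ee : 0 < e / (Cy + Cv + 1) by rewrite divr_gt0//; lra.
have [phi [sphi phi0 happ]] := approx _ ee.
have tp : test_fun U phi by split => //; exists K'.
have Lphi := test_fun_L2 tp; have Lpd := test_fun_L2 (test_fun_pds [:: b] tp).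
have j1 := L2_intgM Ly Lpd; have j2 := L2_intgM Lv Lphi.
have := Hv _ tp; rewrite /= expr1 mulN1r => /eqP; rewrite -addr_eq0 => /eqP E0.
have -> : It (fun x => (y \_ U) x * pd b psi x) + It (fun x => (v \_ U) x * psi x) =
  It (fun x => (y \_ U) x * pd b psi x - (y \_ U) x * pd b phi x) +
  It (fun x => (v \_ U) x * psi x - (v \_ U) x * phi x).
  have alg (a c d l : R) : d + l = 0 -> a + c = (a - d) + (c - l).
    by move=> E; rewrite addrACA -opprD E subr0.
  apply: etrans (congr2 +%R (esym (ItB i1 j1)) (esym (ItB i2 j2))).
  exact: alg E0.
have bnd w k l : intg (fun x => \1_(K `|` K') x * w x) ->
   intg (fun x => w x * k x) -> intg (fun x => w x * l x) -> zero_off K k -> zero_off K' l ->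
   (forall x, `|l x - k x| <= e / (Cy + Cv + 1)) ->
   `|It (fun x => w x * k x - w x * l x)| <=
   e / (Cy + Cv + 1) * It (fun x => `|\1_(K `|` K') x * w x|).
  move=> iw ik il k0 l0 kl; rewrite -ItZ; last exact: intg_abs.
  apply: le_norm_It.
  - exact: (intg_mf (intgB ik il)).
  - by apply: intgZ; exact: intg_abs.
  move=> x; rewrite -mulrBr normrM.
  have [KKx|nKK] := pselect ((K `|` K') x).
    by rewrite /indic (mem_set KKx) mul1r distrC mulrC; apply: ler_wpM2r; [exact: normr_ge0|exact: kl].
  rewrite k0 ?l0 ?subrr ?normr0 ?mulr0; last 2 first.
  - by move=> ?; apply: nKK; right.
  - by move=> ?; apply: nKK; left.
  by rewrite mulr_ge0// ltW.
have b1 := bnd _ _ _ iy i1 j1 psi0' (zero_off_pd b (compact_closed2 cK') phi0)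
  (fun x => happ [:: b] x isT).
have b2 := bnd _ _ _ iv i2 j2 psi0 phi0 (fun x => happ [::] x isT).
apply: (le_trans (ler_normD _ _)).
apply: (le_trans (lerD b1 b2)); rewrite -mulrDr -/Cy -/Cv mulrAC ler_pdivrMr; last by lra.
by rewrite ler_pM2l//; lra.
Qed.

Lemma L2_mul_bounded U K chi y : open U -> compact K -> continuous chi -> zero_off K chi ->
  L2 U y -> L2 U (fun x => chi x * y x).
Proof.
move=> oU cK cchi chi0 /(L2_patch _ (open_measurable2 oU)) Ly.
apply/(L2_patch _ (open_measurable2 oU)).
have [M M0 hM] := continuous_zero_off_bounded cK cchi chi0.
have E : (fun x => chi x * y x) \_ U = (fun x => chi x * (y \_ U) x).
  by apply/funext => x; rewrite !patchE; case: ifP => // _; rewrite mulr0.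
rewrite E; apply: (L2_bnd (C := M) Ly).
  by apply: mfM; [exact: continuous_mf|exact: L2_mf].
by move=> x; rewrite normrM ler_wpM2r.
Qed.

Lemma wderiv_mul U K b chi y v : open U -> compact K -> class_C 1 setT chi -> zero_off K chi ->
  wderiv U [:: b] y v -> wderiv U [:: b] (fun x => chi x * y x) (fun x => pd b chi x * y x + chi x * v x).
Proof.
move=> oU cK Cchi chi0 Dv.
have cchi := class_C_continuous Cchi; have cpd := class_C_continuous (class_C_pd b Cchi).
have chi0' := zero_off_pd b (compact_closed2 cK) chi0.
have [Ly Lv] := wderiv_L2 Dv; have mU := open_measurable2 oU.
have L1 := L2_mul_bounded oU cK cchi chi0 Ly.
have L3 := L2_mul_bounded oU cK cpd chi0' Ly.
have L4 := L2_mul_bounded oU cK cchi chi0 Lv.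
have L5 := L2D_on oU L3 L4.
apply/(wderivE _ _ _ oU); split; try exact/(L2_patch _ mU).
move=> phi tp; have [sphi [K' [cK' K'U phi0]]] := tp.
have Cpsi : class_C 1 setT (fun x => chi x * phi x) by exact: (class_CM openT Cchi (sphi 1%N)).
have psi0 : zero_off K' (fun x => chi x * phi x) by move=> x /phi0 ->; rewrite mulr0.
have := wderiv_C1 oU Dv cK' K'U Cpsi psi0.
have -> : (fun x => (y \_ U) x * pd b (fun x => chi x * phi x) x) =
  (fun x => ((fun x => pd b chi x * y x) \_ U) x * phi x + ((fun x => chi x * y x) \_ U) x * pd b phi x).
  apply/funext => x; rewrite (pdM (class_C_derivable Cchi _) (class_C_derivable (sphi 1%N) Logic.I))//.
  by rewrite !patchE; case: ifP => _; [ring|rewrite !mul0r addr0].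
have -> : (fun x => (v \_ U) x * (chi x * phi x)) = (fun x => ((fun x => chi x * v x) \_ U) x * phi x).
  by apply/funext => x; rewrite !patchE; case: ifP => _; [ring|rewrite !mul0r].
have i1 := L2_intg_test oU L1 (test_fun_pds [:: b] tp).
have i3 := L2_intg_test oU L3 tp; have i4 := L2_intg_test oU L4 tp.
rewrite (ItD i3 i1) /= expr1 mulN1r => /eqP; rewrite -subr_eq0 opprK => /eqP E.
have -> : (fun x => ((fun x => pd b chi x * y x + chi x * v x) \_ U) x * phi x) =
  (fun x => ((fun x => pd b chi x * y x) \_ U) x * phi x + ((fun x => chi x * v x) \_ U) x * phi x).
  by apply/funext => x; rewrite !patchE; case: ifP => _; [ring|rewrite !mul0r addr0].
rewrite (ItD i3 i4); lra.
Qed.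

Lemma sobolev_mul m U K chi y : open U -> compact K -> class_C m setT chi -> zero_off K chi ->
  sobolev m U y -> sobolev m U (fun x => chi x * y x).
Proof.
move=> oU cK; elim: m chi y => [|m IH] chi y Cchi chi0.
  move=> /sobolev0 Ly; apply/sobolev0.
  by apply: (L2_mul_bounded oU cK _ chi0) => //; exact: class_C_continuous Cchi.
move=> Sy; have /(sobolevS _ _ oU)[Ly H] := Sy; apply/(sobolevS _ _ oU); split.
  by apply: (L2_mul_bounded oU cK _ chi0) => //; exact: class_C_continuous Cchi.
move=> b; have [v [Dv Sv]] := H b; exists (fun x => pd b chi x * y x + chi x * v x); split.
  by apply: (wderiv_mul oU cK) => //; exact: class_C_le Cchi.
apply: sobolevD => //; last by apply: IH => //; exact: class_C_le Cchi.
apply: IH; [exact: class_C_pd|exact: zero_off_pd (compact_closed2 cK) chi0|].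
exact: sobolev_le Sy.
Qed.

Lemma wderiv0 U s : open U -> wderiv U s (cst 0) (cst 0).
Proof.
move=> oU; have L0 : L2 setT (cst 0 : R * R -> R).
  split; first exact: measurable_cst.
  rewrite (_ : (fun x => _) = cst 0); last by apply/funext => x; rewrite /cst expr0n.
  by apply: (intg_continuous (@compact0 _)) => // x; exact: cst_continuous.
have E : (cst 0 : R * R -> R) \_ U = cst 0 by apply/funext => x; rewrite patchE; case: ifP.
apply/(wderivE _ _ _ oU); rewrite E; split => // phi tp.
by rewrite !It_eq0 ?mulr0// => x; rewrite mul0r.
Qed.

Lemma L2_indic U K h : open U -> closed K -> L2 U h -> L2 U (fun x => \1_K x * h x).
Proof.
move=> oU cK /(L2_patch _ (open_measurable2 oU)) Lh; apply/(L2_patch _ (open_measurable2 oU)).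
have E : (fun x => \1_K x * h x) \_ U = (fun x => \1_K x * (h \_ U) x).
  by apply/funext => x; rewrite !patchE; case: ifP => // _; rewrite mulr0.
rewrite E; apply: (L2_bnd (C := 1) Lh).
  by apply: mfM; [apply: mf_indic; exact: closed_measurable2|exact: L2_mf].
move=> x; rewrite normrM ler_wpM2r// /indic; case: (_ \in _); by rewrite ?normr1 ?normr0.
Qed.

(** Off [K] a weak derivative vanishes almost everywhere; multiplication by the indicator of [K]
    selects a representative that vanishes there at every point, so that supports can be tracked
    exactly. *)
Lemma wderiv_zero_off U K s y v : open U -> closed K -> zero_off K y -> wderiv U s y v ->
  exists w, [/\ wderiv U s y w, zero_off K w & {ae leb2, forall x, U x -> v x = w x}].
Proof.
move=> oU cK y0 Dv; have [Ly Lv] := wderiv_L2 Dv.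
pose W := U `&` ~` K; have oW : open W by apply: openI => //; rewrite openC.
have WU : W `<=` U by move=> x [].
have ae0 := wderiv_ae_unique oW (wderiv_sub oU oW WU Dv) (@wderiv0 _ s oW).
have {}ae0 : {ae leb2, forall x, U x -> v x = \1_K x * v x}.
  have := ae0; move=> /(_ _)/aeS; apply; first by apply: aeW => x [_ /y0].
  move=> x h Ux; rewrite /indic; case: (boolP (x \in K)) => [_|]; first by rewrite mul1r.
  by rewrite notin_setE mul0r => nK; apply: h.
exists (fun x => \1_K x * v x); split => //.
  by apply: (wderiv_ae oU Dv) => //; [exact: L2_indic|exact: aeW].
by move=> x nK; rewrite /indic memNset// mul0r.
Qed.

Lemma sobolevS_zero_off m U K y : open U -> closed K -> zero_off K y -> sobolev m.+1 U y ->
  forall b, exists v, [/\ wderiv U [:: b] y v, sobolev m U v & zero_off K v].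
Proof.
move=> oU cK y0 /(sobolevS _ _ oU)[Ly H] b; have [v [Dv Sv]] := H b.
have [w [Dw w0 vw]] := wderiv_zero_off oU cK y0 Dv.
exists w; split => //; apply: (sobolev_ae oU Sv) => //; by case: (wderiv_L2 Dw).
Qed.

Lemma sobolev_mul_zero_off m U K chi y : open U -> compact K -> class_C m setT chi -> zero_off K y ->
  sobolev m U y -> sobolev m U (fun x => chi x * y x).
Proof.
move=> oU cK Cchi y0 Sy.
have [eta [seta _ [W oW [KW eW]] [K' cK' [_ e0]]]] := smooth_cutoff cK (@openT (R * R)%type) (@subsetT _ K).
have -> : (fun x => chi x * y x) = (fun x => (chi x * eta x) * y x).
  apply/funext => x; have [Kx|/y0->] := pselect (K x); last by rewrite !mulr0.
  by rewrite eW ?mulr1//; exact: KW.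
apply: (sobolev_mul oU cK' _ _ Sy); first exact: (class_CM openT Cchi (seta m)).
by move=> x /e0 ->; rewrite mulr0.
Qed.

(** A function carried by [K] sees the open set only inside [N]: test functions are multiplied by a
    cutoff that is 1 near [K] and lives in [N]. This passes from a domain to the epigraph that
    describes it locally. *)
Lemma sobolev_transfer m U V N K y : open U -> open V -> open N -> compact K -> K `<=` N ->
  U `&` N = V `&` N -> zero_off K y -> sobolev m U y -> sobolev m V y.
Proof.
move=> oU oV oN cK KN UVN y0 [Ly H].
have UV x : K x -> (U x <-> V x).
  move=> /KN Nx; have E : (U `&` N) x = (V `&` N) x by rewrite UVN.
  by split => h; [have : (V `&` N) x by rewrite -E|have : (U `&` N) x by rewrite E]; case.
have E h : zero_off K h -> h \_ U = h \_ V.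
  move=> h0; apply/funext => x; rewrite !patchE; have [Kx|/h0->] := pselect (K x).
    case: (boolP (x \in U)) => [/set_mem/(UV x Kx)/mem_set->//|].
    by rewrite notin_setE => nU; rewrite memNset// => /(UV x Kx).
  by case: ifP => _; case: ifP.
have mU := open_measurable2 oU; have mV := open_measurable2 oV.
split=> [|s sm]; first by apply/(L2_patch _ mV); rewrite -E//; exact/(L2_patch _ mU).
have [v0 Dv0] := H s sm.
have [v [Dv v0' _]] := wderiv_zero_off oU (compact_closed2 cK) y0 Dv0.
have [L1 L3 Hv] := (wderivE _ _ _ oU).1 Dv.
have [eta [seta _ [W oW [KW eW]] [K' cK' [K'N e0]]]] := smooth_cutoff cK oN KN.
exists v; apply/(wderivE _ _ _ oV); rewrite -!E//; split => // phi tp.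
have [sphi [K1 [cK1 K1V phi0]]] := tp.
have tU : test_fun U (fun x => eta x * phi x).
  split; first exact: (smoothM seta sphi).
  exists (K' `&` K1); split; first by apply: compact_closedI => //; exact: compact_closed2.
    move=> x [/K'N Nx /K1V Vx]; have : (V `&` N) x by split.
    by rewrite -UVN => -[].
  move=> x nx; have [K'x|/e0->] := pselect (K' x); last by rewrite mul0r.
  by rewrite phi0 ?mulr0// => K1x; apply: nx.
have EK : forall x, W x -> phi x = eta x * phi x by move=> x /eW ->; rewrite mul1r.
transitivity (It (fun x => (y \_ U) x * pds s (fun x => eta x * phi x) x)).
  congr It; apply/funext => x; rewrite patchE; have [Kx|/y0->] := pselect (K x).
    by case: ifP => // _; rewrite (pds_ext s oW EK (KW _ Kx)).
  by case: ifP => // _; rewrite !mul0r.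
rewrite Hv//; congr (_ * It _); apply/funext => x; rewrite patchE.
have [Kx|/v0'->] := pselect (K x); last by case: ifP => // _; rewrite !mul0r.
by rewrite -(EK x (KW _ Kx)).
Qed.

End sobolev_products.

(** * The chain rule along curves and shears *)

Section chain_rule.
Context {R : realType}.
Local Notation mR := (measurableTypeR R).
Local Notation mP := (mR * mR)%type.
Implicit Types (h f g k phi psi : R * R -> R) (A B U V K : set (R * R)) (x p q : R * R)
  (b : bool) (m n : nat) (u v c : R -> R) (s t r d e a : R).

Lemma is_derive_small u t d e : is_derive t 1 u d -> 0 < e ->
  exists2 r, 0 < r & forall a, `|a - t| <= r -> `|u a - u t - (a - t) * d| <= e * `|a - t|.
Proof.
move=> [du Ed] e0.
have cv : (fun a : R => a^-1 *: ((u \o shift t) (a *: 1) - u t)) @ 0^' --> d.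
  by rewrite -Ed; exact: du.
have /cvgrPdist_le/(_ e e0) := cv => /nbhs_ballP[r /= r0 hr].
exists (r / 2); first by rewrite divr_gt0.
move=> a ar; have [->|at0] := eqVneq a t; first by rewrite !subrr mul0r subr0 normr0 mulr0.
have a0 : a - t != 0 by rewrite subr_eq0.
have := hr (a - t); rewrite /ball/= sub0r normrN => /(_ _ a0).
have lr : `|a - t| < r by apply: le_lt_trans ar _; lra.
move=> /(_ lr); rewrite /shift/= /GRing.scale/= mulr1 subrK.
have -> : d - (a - t)^-1 * (u a - u t) = - (u a - u t - (a - t) * d) / (a - t) by field.
by rewrite normrM normrN normfV ler_pdivrMr// normr_gt0.
Qed.

Lemma pd_mvt_on b h s t (u' : R) : (forall v : R, `|v - t| <= `|u' - t| -> derivable h (pt b s v) (dir b)) ->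
  exists v : R, `|v - t| <= `|u' - t| /\ h (pt b s u') - h (pt b s t) = pd b h (pt b s v) * (u' - t).
Proof.
move=> dh; have dl (v : R) : `|v - t| <= `|u' - t| ->
    is_derive v 1 (fun t => h (pt b s t)) (pd b h (pt b s v)).
  by move=> /dh/derivable_pd; exact: is_pd_line_at.
have cl (v : R) : `|v - t| <= `|u' - t| -> {for v, continuous (fun t => h (pt b s t))}.
  by move=> /dl[dv _]; apply: differentiable_continuous; apply/derivable1_diffP.
have [tu|ut] := leP t u'.
  have tv (v : R) : t <= v -> v <= u' -> `|v - t| <= `|u' - t| by move=> *; rewrite !ger0_norm; lra.
  have [| |v vtu ->] := @MVT_segment R (fun t => h (pt b s t)) (fun t => pd b h (pt b s t)) t u' tu.
  - by move=> v; rewrite in_itv/= => /andP[h1 h2]; apply: dl; apply: tv; exact: ltW.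
  - by apply: continuous_in_subspaceT => v /set_mem; rewrite /= in_itv/= => /andP[h1 h2]; apply: cl; exact: tv.
  by exists v; split => //; move: vtu; rewrite in_itv/= => /andP[h1 h2]; exact: tv.
have tv (v : R) : u' <= v -> v <= t -> `|v - t| <= `|u' - t| by move=> *; rewrite !ler0_norm; lra.
have [| |v vtu E] := @MVT_segment R (fun t => h (pt b s t)) (fun t => pd b h (pt b s t)) u' t (ltW ut).
- by move=> v; rewrite in_itv/= => /andP[h1 h2]; apply: dl; apply: tv; exact: ltW.
- by apply: continuous_in_subspaceT => v /set_mem; rewrite /= in_itv/= => /andP[h1 h2]; apply: cl; exact: tv.
exists v; split; last by rewrite -opprB E -mulrN opprB.
by move: vtu; rewrite in_itv/= => /andP[h1 h2]; exact: tv.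
Qed.

Lemma increment_le (x1 r a e : R) : `|x1 - r * a| <= e * `|r| -> `|x1| <= (`|a| + e) * `|r|.
Proof.
move=> h; rewrite -(subrK (r * a) x1) (le_trans (ler_normD _ _))// addrC mulrDl.
by apply: lerD => //; rewrite normrM mulrC.
Qed.

Lemma two_increments_le (A B A' B' x1 x2 a d r e1 e : R) :
  `|A' - A| <= e1 -> `|B' - B| <= e1 -> `|x1 - r * a| <= e1 * `|r| -> `|x2 - r * d| <= e1 * `|r| ->
  e1 <= 1 -> e1 * (`|a| + `|d| + `|A| + `|B| + 2) <= e ->
  `|B' * x2 + A' * x1 - r * (A * a + B * d)| <= e * `|r|.
Proof.
move=> hA hB h1 h2 e11 e1C; have e10 : 0 <= e1 by exact: le_trans hA.
have -> : B' * x2 + A' * x1 - r * (A * a + B * d) =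
  ((B' - B) * x2 + B * (x2 - r * d)) + ((A' - A) * x1 + A * (x1 - r * a)) by ring.
have N (F G f c : R) : `|F - G| <= e1 -> `|f - r * c| <= e1 * `|r| ->
    `|(F - G) * f + G * (f - r * c)| <= e1 * (`|c| + 1 + `|G|) * `|r|.
  move=> hF hf; apply: (le_trans (ler_normD _ _)); rewrite !normrM mulrDr mulrDl; apply: lerD.
    rewrite -mulrA; apply: ler_pM => //; apply: (le_trans (increment_le hf)).
    by apply: ler_wpM2r => //; rewrite lerD2l.
  by rewrite -mulrA mulrCA; apply: ler_wpM2l.
apply: (le_trans (ler_normD _ _)); apply: (le_trans (lerD (N _ _ _ _ hB h2) (N _ _ _ _ hA h1))).
rewrite -mulrDl -mulrDr; apply: ler_wpM2r => //; apply: le_trans e1C; apply: ler_wpM2l => //.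
by rewrite le_eqVlt; apply/orP; left; apply/eqP; ring.
Qed.

(** The increment is split along the two axes and the mean value theorem is applied to each part;
    continuity of the partial derivatives does the rest, so total differentiability never
    appears. *)
Lemma chain_rule U h u v t a d : open U -> class_C 1 U h -> U (u t, v t) ->
  is_derive t 1 u a -> is_derive t 1 v d ->
  is_derive t 1 (fun s => h (u s, v s)) (pd false h (u t, v t) * a + pd true h (u t, v t) * d).
Proof.
move=> oU Ch Up du dv; set p := (u t, v t); set A := pd false h p; set B := pd true h p.
apply: is_derive_small_o => e e0.
set C := `|a| + `|d| + `|A| + `|B| + 2.
have sums (u1 u2 u3 u4 : R) : 0 <= u1 -> 0 <= u2 -> 0 <= u3 -> 0 <= u4 -> 0 < u1 + u2 + u3 + u4 + 2 /\
    forall e', e' <= 1 -> u1 + e' <= u1 + u2 + u3 + u4 + 2 /\ u2 + e' <= u1 + u2 + u3 + u4 + 2.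
  by move=> ? ? ? ?; split=> [|e' ?]; [|split]; lra.
have [C0 adC] := sums _ _ _ _ (normr_ge0 a) (normr_ge0 d) (normr_ge0 A) (normr_ge0 B).
pose e1 := Num.min 1 (e / C).
have e10 : 0 < e1 by rewrite lt_min ltr01 divr_gt0.
have e11 : e1 <= 1 by rewrite ge_min lexx.
have e1C : e1 * C <= e by rewrite -ler_pdivlMr// ge_min lexx orbT.
have cb b : {for p, continuous (pd b h)} by have /class_CS[_ _ /(_ b)/class_C0] := Ch; exact.
have nb : nbhs p [set q | U q /\ forall b, `|pd b h q - pd b h p| <= e1].
  have U1 : nbhs p U by exact: open_nbhs_nbhs.
  have n1 b : nbhs p [set q | `|pd b h q - pd b h p| <= e1].
    have N (k : R * R -> R) : {for p, continuous k} -> nbhs p [set q | `|k q - k p| <= e1].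
      by move=> /cvgrPdist_le/(_ _ e10); apply: filterS => q; rewrite /= distrC.
    exact: (N _ (cb b)).
  apply: (filterS _ (filterI U1 (filterI (n1 false) (n1 true)))).
  by move=> q [Uq [h1 h2]]; split; [exact: Uq|case; [exact: h2|exact: h1]].
have [r0 r00 hr0] := nbhs_sqbox_sub nb.
have [ru ru0 hu] := is_derive_small du e10; have [rv rv0 hv] := is_derive_small dv e10.
exists (Num.min (Num.min ru rv) (r0 / C)).
  by rewrite !lt_min ru0 rv0 divr_gt0.
move=> s; rewrite !le_min => /andP[/andP[su sv] s0].
have {}hu := hu _ su; have {}hv := hv _ sv.
have st0 := normr_ge0 (s - t).
have lu := increment_le hu; have lv := increment_le hv.
have Cs : C * `|s - t| <= r0 by rewrite mulrC -ler_pdivlMr.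
have Ce (c f : R) : c + e1 <= C -> `|f| <= (c + e1) * `|s - t| -> `|f| <= r0.
  move=> h1 h2; apply: (le_trans h2); apply: le_trans Cs; exact: ler_wpM2r.
have [aC dC] := adC _ e11.
have ru1 : `|u s - u t| <= r0 by exact: Ce aC lu.
have rv1 : `|v s - v t| <= r0 by exact: Ce dC lv.
have dh q b : sqbox p r0 q -> derivable h q (dir b).
  by move=> /hr0[Uq _]; exact: class_C_derivable Ch Uq.
have [w [w1 E1]] : exists w, `|w - v t| <= `|v s - v t| /\
    h (pt true (u s) (v s)) - h (pt true (u s) (v t)) = pd true h (pt true (u s) w) * (v s - v t).
  apply: pd_mvt_on => w ww; apply: dh; split => //=; exact: le_trans ww rv1.
have [y [y1 E2]] : exists y, `|y - u t| <= `|u s - u t| /\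
    h (pt false (v t) (u s)) - h (pt false (v t) (u t)) = pd false h (pt false (v t) y) * (u s - u t).
  apply: pd_mvt_on => w' ww; apply: dh; split => //=; first exact: le_trans ww ru1.
  by rewrite subrr normr0 ltW.
have [_ /(_ true) hB] : [set q | U q /\ forall b, `|pd b h q - pd b h p| <= e1] (pt true (u s) w).
  by apply: hr0; split => //=; exact: le_trans w1 rv1.
have [_ /(_ false) hA] : [set q | U q /\ forall b, `|pd b h q - pd b h p| <= e1] (pt false (v t) y).
  by apply: hr0; split => /=; [exact: le_trans y1 ru1|rewrite subrr normr0 ltW].
rewrite -/A in hA; rewrite -/B in hB.
move: E1 E2 hA hB; rewrite /pt; set B' := pd true h _; set A' := pd false h _ => E1 E2 hA hB.
have -> : h (u s, v s) - h (u t, v t) = B' * (v s - v t) + A' * (u s - u t).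
  by rewrite -E1 -E2 addrA subrK.
exact: (two_increments_le hA hB hu hv e11 e1C).
Qed.

Lemma is_pd_shear b' b a c h x e : class_C 1 setT h -> is_derive (co (~~ b) x) 1 c e ->
  is_derive x (dir b') (h \o shear b a c)
    (if b' == b then a * pd b h (shear b a c x)
     else pd (~~ b) h (shear b a c x) + e * pd b h (shear b a c x)).
Proof.
move=> Ch dc.
have [->|/negPf bb'] := eqVneq b' b.
  apply/is_pd_line; rewrite /line /= /shear.
  have := @is_pd_linet R b h (co (~~ b) x) (a * co b x + c (co (~~ b) x)) 0 Ch => dl.
  have da : is_derive (co b x) 1 (fun t => a * t + c (co (~~ b) x)) a.
    by apply: is_derive_val; rewrite /GRing.scale/= ?mulr1 ?addr0.
  have := @is_derive1_comp R (fun t => h (pt b (co (~~ b) x) t)) _ (co b x) _ _ dl da.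
  move=> dd; rewrite [_ * pd _ _ _]mulrC; move: dd; congr is_derive.
  by apply/funext => t /=; rewrite co_pt co_ptN.
have E : b' = ~~ b by move: bb'; case: (b); case: (b').
rewrite E {E bb'}.
apply/is_pd_line; rewrite /line /= /shear negbK.
have da : is_derive (co (~~ b) x) 1 (fun t => a * co b x + c t) e.
  have := is_deriveD (is_derive_cst (a * co b x) (co (~~ b) x) 1) dc; rewrite add0r.
  by congr is_derive; apply/funext => t.
have di : is_derive (co (~~ b) x) 1 (@id R) 1 by exact: is_derive_id.
case: b da di dc => /= da di dc.
  by apply: (is_derive_val (@chain_rule setT h id (fun t => a * x.2 + c t) x.1 1 e openT Ch Logic.I di da)); rewrite mulr1 [e * _]mulrC.
apply: (is_derive_val (@chain_rule setT h (fun t => a * x.1 + c t) id x.2 e 1 openT Ch Logic.I da di)).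
by rewrite mulr1 addrC [e * _]mulrC.
Qed.

End chain_rule.

(** * Extension across the boundary *)

Section reflection.
Context {R : realType} (b : bool) (c : R -> R) (sg : R).
Context (Cc : class_C1d 4 c).
Local Notation mR := (measurableTypeR R).
Local Notation mP := (mR * mR)%type.
Implicit Types (W w v f g h k phi psi chi : R * R -> R) (A U K : set (R * R)) (x p q : R * R)
  (m n : nat) (l : seq (R * R)) (d : bool) (t r e a : R).

(* Points are moved along the coordinate [b], relatively to the graph x_b = c(x_(~~b)): [rf a] sends
   the height [tau x] to - a * tau x.  A function W vanishing outside [epi] is extended by
   W + sum of p.1 * (W o rf p.2), and [extend_dual] is the transposed operation on test functions. *)
Definition tau x : R := co b x - c (co (~~ b) x).
Definition epi : set (R * R) := [set x | 0 < sg * tau x].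
Definition rf (a : R) : R * R -> R * R := shear b (- a) (fun t => (1 + a) * c t).
Definition extend l W x : R := W x + \sum_(p <- l) p.1 * W (rf p.2 x).
Definition extend_dual l f x : R := f x + \sum_(p <- l) p.1 / p.2 * f (rf p.2^-1 x).
(** Since [rf a] multiplies [tau] by - a, differentiation along [b] multiplies each weight by - a,
    and thus shifts the moments [mom] by one. *)
Definition lder l : seq (R * R) := [seq (- p.2 * p.1, p.2) | p <- l].
Definition mom m l : R := \sum_(p <- l) p.1 * (- p.2) ^+ m.
(** The derivative tangent to the translates of the graph. It annihilates [tau], hence commutes with
    the reflections and with functions of [tau], which [pd (~~ b)] does not. *)
Definition tder f x : R := pd (~~ b) f x + derive1 c (co (~~ b) x) * pd b f x.
Definition wpos l := all (fun p => 0 < p.2) l.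

Lemma continuous_c : continuous c.
Proof. by case/class_C1dS: Cc. Qed.

Lemma continuous_rc a : continuous (fun t => (1 + a) * c t).
Proof. by case/class_C1dS: (class_C1dM (class_C1d_cst 4 (1 + a)) Cc). Qed.

Lemma derivable_c t : derivable c t 1.
Proof. by case/class_C1dS: Cc. Qed.

Lemma is_derive_c t : is_derive t 1 c (derive1 c t).
Proof. by rewrite derive1E; apply: derivableP; exact: derivable_c. Qed.

Lemma class_C_tau : class_C 4 setT tau.
Proof.
apply: class_CB; [exact: openT|exact: class_C_co|].
by apply: class_C_comp => //; [exact: openT|exact: class_C_co].
Qed.

Lemma continuous_tau : continuous tau.
Proof. exact: class_C_continuous class_C_tau. Qed.

Lemma pd_tau d x : pd d tau x = if d == b then 1 else - derive1 c (co (~~ b) x).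
Proof.
have dco d' : derivable (co d' : R * R -> R) x (dir d).
  exact: (class_C_derivable (@class_C_co R 1 setT d') Logic.I).
have Cco : class_C 1 setT (fun x => c (co (~~ b) x)).
  by apply: class_C_comp; [exact: openT|exact: class_C1d_le Cc|exact: class_C_co].
rewrite pdB; [|exact: dco|exact: (class_C_derivable Cco Logic.I)].
rewrite pd_comp; [|exact: derivable_c|exact: dco].
by rewrite !pd_co; case: (d) (b) => -[]/=; rewrite ?mulr0 ?mulr1 ?subr0 ?sub0r.
Qed.

Lemma open_epi : open epi.
Proof.
rewrite (_ : epi = (fun x => sg * tau x) @^-1` [set r | 0 < r])//.
apply: open_comp; last exact: open_gt.
by move=> x _; apply: continuousM; [exact: cst_continuous|exact: continuous_tau].
Qed.

Lemma co_rf a x : co (~~ b) (rf a x) = co (~~ b) x.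
Proof. by rewrite /rf /shear co_ptN. Qed.

Lemma cob_rf a x : co b (rf a x) = - a * co b x + (1 + a) * c (co (~~ b) x).
Proof. by rewrite /rf /shear co_pt. Qed.

Lemma tau_rf a x : tau (rf a x) = - a * tau x.
Proof. by rewrite /tau co_rf cob_rf; ring. Qed.

Lemma rfK a x : a != 0 -> rf a^-1 (rf a x) = x.
Proof.
move=> a0; rewrite -[RHS](pt_co b) {1}/rf /shear co_rf; congr pt.
by rewrite cob_rf; field.
Qed.

Lemma rf_graph a x : tau x = 0 -> rf a x = x.
Proof.
move=> t0; rewrite -[RHS](pt_co b) /rf /shear; congr pt.
by move/eqP: t0; rewrite subr_eq0 => /eqP ->; ring.
Qed.

Lemma epi_rf a x : 0 < a -> epi x -> ~ epi (rf a x).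
Proof.
rewrite /epi/= tau_rf => a0 Vx; apply/negP; rewrite -leNgt mulrCA mulNr oppr_le0.
by apply: mulr_ge0; exact: ltW.
Qed.

Lemma L2_rf a h : 0 < a -> L2 setT h -> L2 setT (h \o rf a).
Proof.
move=> a0 [mh ih]; have na : - a != 0 by rewrite oppr_eq0 gt_eqF.
have mc : @measurable_fun _ _ mR mR setT (fun t => (1 + a) * c t).
  by apply: continuous_measurable_fun; exact: continuous_rc.
split; first by apply: measurableT_comp mh _; exact: measurable_shear.
exact: (intg_shear b na mc ih).
Qed.

(** The Jacobian of the reflection is the origin of the weights p.1 / p.2 in [extend_dual]. *)
Lemma It_rf a h f : 0 < a -> L2 setT h -> L2 setT f ->
  It (fun x => h (rf a x) * f x) = a^-1 * It (fun x => h x * f (rf a^-1 x)).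
Proof.
move=> a0 Lh Lf; have na : - a != 0 by rewrite oppr_eq0 gt_eqF.
have mc : @measurable_fun _ _ mR mR setT (fun t => (1 + a) * c t).
  by apply: continuous_measurable_fun; exact: continuous_rc.
have a1 : 0 < a^-1 by rewrite invr_gt0.
have i1 : intg (fun x => h x * f (rf a^-1 x)) by apply: L2_intgM => //; exact: L2_rf a1 Lf.
have := It_shear b na mc i1; rewrite normrN gtr0_norm// => <-.
congr It; apply/funext => x; rewrite /= -/(rf a x) rfK//; exact: lt0r_neq0.
Qed.

Lemma extend_cons q l W x : extend (q :: l) W x = q.1 * W (rf q.2 x) + extend l W x.
Proof. by rewrite /extend big_cons addrCA. Qed.

Lemma extend_dual_cons q l f x :
  extend_dual (q :: l) f x = q.1 / q.2 * f (rf q.2^-1 x) + extend_dual l f x.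
Proof. by rewrite /extend_dual big_cons addrCA. Qed.

Lemma extend_nil W : extend [::] W = W.
Proof. by apply/funext => x; rewrite /extend big_nil addr0. Qed.

Lemma extend_dual_nil f : extend_dual [::] f = f.
Proof. by apply/funext => x; rewrite /extend_dual big_nil addr0. Qed.

Lemma L2_extend l W : wpos l -> L2 setT W -> L2 setT (extend l W).
Proof.
move=> + LW; elim: l => [_|q l IH /andP[q0 /IH Ll]]; first by rewrite extend_nil.
rewrite (_ : extend _ _ = fun x => q.1 * W (rf q.2 x) + extend l W x).
  by apply: L2D => //; apply: L2Z; exact: L2_rf.
by apply/funext => x; rewrite extend_cons.
Qed.

Lemma L2_extend_dual l f : wpos l -> L2 setT f -> L2 setT (extend_dual l f).
Proof.
move=> + Lf; elim: l => [_|q l IH /andP[q0 /IH Ll]]; first by rewrite extend_dual_nil.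
rewrite (_ : extend_dual _ _ = fun x => q.1 / q.2 * f (rf q.2^-1 x) + extend_dual l f x).
  by apply: L2D => //; apply: L2Z; apply: L2_rf => //; rewrite invr_gt0.
by apply/funext => x; rewrite extend_dual_cons.
Qed.

Lemma It_extend l W f : wpos l -> L2 setT W -> L2 setT f ->
  It (fun x => extend l W x * f x) = It (fun x => W x * extend_dual l f x).
Proof.
move=> + LW Lf; elim: l => [_|q l IH /andP[/= q0 wl]]; first by rewrite extend_nil extend_dual_nil.
have qV : 0 < q.2^-1 by rewrite invr_gt0.
have L1 := L2_rf q0 LW; have L3 := L2_rf qV Lf.
have i1 : intg (fun x => W (rf q.2 x) * f x) by exact: L2_intgM L1 Lf.
have i2 : intg (fun x => extend l W x * f x) by apply: L2_intgM => //; exact: L2_extend.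
have i3 : intg (fun x => W x * f (rf q.2^-1 x)) by exact: L2_intgM LW L3.
have i4 : intg (fun x => W x * extend_dual l f x) by apply: L2_intgM => //; exact: L2_extend_dual.
transitivity (It (fun x => q.1 * (W (rf q.2 x) * f x) + extend l W x * f x)).
  by congr It; apply/funext => x; rewrite extend_cons mulrDl mulrA.
transitivity (It (fun x => (q.1 / q.2) * (W x * f (rf q.2^-1 x)) + W x * extend_dual l f x)); last first.
  by congr It; apply/funext => x; rewrite extend_dual_cons [RHS]mulrDr [q.1 / _ * (W x * _)]mulrCA.
rewrite (ItD (intgZ _ i1) i2) (ItD (intgZ _ i3) i4) (ItZ _ i1) (ItZ _ i3) (IH wl) (It_rf q0 LW Lf).
by rewrite mulrA.
Qed.

Lemma mom_lder m l : mom m (lder l) = mom m.+1 l.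
Proof. by rewrite /mom /lder big_map; apply: eq_bigr => p _ /=; rewrite exprS; ring. Qed.

Lemma wpos_lder l : wpos (lder l) = wpos l. Proof. by rewrite /wpos /lder all_map. Qed.

(** All reflections fix the graph, where the sum reduces to (1 - mom 0 l) f. This vanishing is what
    suppresses the boundary term in [It_pd_graph]. *)
Lemma extend_dual_graph l f x : wpos l -> mom 0 l = 1 -> tau x = 0 -> extend_dual (lder l) f x = 0.
Proof.
move=> wl m1 t0; rewrite /extend_dual /lder big_map /=.
have -> : \sum_(j <- l) - j.2 * j.1 / j.2 * f (rf (j.2)^-1 x) = - mom 0 l * f x.
  rewrite /mom -sumrN mulr_suml big_seq [RHS]big_seq; apply: eq_bigr => p pl.
  have p0 : p.2 != 0 by apply: lt0r_neq0; exact: (allP wl).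
  by rewrite rf_graph// expr0; field.
by rewrite m1; ring.
Qed.

Lemma is_pd_rf a f d x : class_C 1 setT f -> is_derive x (dir d) (f \o rf a)
  (if d == b then - a * pd b f (rf a x)
   else pd (~~ b) f (rf a x) + (1 + a) * derive1 c (co (~~ b) x) * pd b f (rf a x)).
Proof.
move=> Cf; apply: is_pd_shear => //.
have := is_deriveZ (1 + a) (is_derive_c (co (~~ b) x)).
by [].
Qed.

Lemma continuous_rf a : continuous (rf a).
Proof.
move=> x; have cc d : {for x, continuous (co d)} by exact: continuous_co.
have c1 : {for x, continuous (fun x => - a * co b x + (1 + a) * c (co (~~ b) x))}.
  apply: continuousD; apply: continuousM; [exact: cst_continuous|exact: cc|exact: cst_continuous|].
  by apply: (@continuous_comp _ _ _ (co (~~ b)) c); [exact: cc|exact: continuous_c].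
rewrite /rf /shear; case: (b) cc c1 => /= cc c1.
  exact: (@cvg_pair _ _ _ (nbhs x) (nbhs x.1) (nbhs (- a * x.2 + (1 + a) * c x.1)) _ _ _ _ _ (cc false) c1).
exact: (@cvg_pair _ _ _ (nbhs x) (nbhs (- a * x.1 + (1 + a) * c x.2)) (nbhs x.2) _ _ _ _ _ c1 (cc true)).
Qed.

Lemma class_C1_rf a f : class_C 1 setT f -> class_C 1 setT (f \o rf a).
Proof.
move=> Cf; have cf := class_C_continuous Cf.
have cp d x : {for x, continuous (fun x => pd d f (rf a x))}.
  apply: (@continuous_comp _ _ _ (rf a) (pd d f)); first exact: continuous_rf.
  by apply: class_C_continuous; exact: class_C_pd Cf.
have cdc x : {for x, continuous (fun x => derive1 c (co (~~ b) x))}.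
  apply: (@continuous_comp _ _ _ (co (~~ b)) (derive1 c)); first exact: continuous_co.
  by have [_ _ /class_C1dS[+ _ _]] := (class_C1dS _ _).1 Cc; apply.
apply/class_CS; split.
- by move=> x _; apply: (@continuous_comp _ _ _ (rf a) f); [exact: continuous_rf|exact: cf].
- by move=> d x _; have [] := is_pd_rf a d x Cf.
move=> d; apply/class_C0 => x _.
have -> : pd d (f \o rf a) = (fun x => if d == b then - a * pd b f (rf a x)
   else pd (~~ b) f (rf a x) + (1 + a) * derive1 c (co (~~ b) x) * pd b f (rf a x)).
  by apply/funext => y; apply: is_pdE; exact: is_pd_rf.
case: (d == b); first by apply: continuousM; [exact: cst_continuous|exact: cp].
apply: continuousD; first exact: cp.
by apply: continuousM; [apply: continuousM; [exact: cst_continuous|exact: cdc]|exact: cp].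
Qed.

Lemma class_C1_extend_dual l f : class_C 1 setT f -> class_C 1 setT (extend_dual l f).
Proof.
move=> Cf; elim: l => [|q l IH]; first by rewrite extend_dual_nil.
rewrite (_ : extend_dual _ _ = fun x => q.1 / q.2 * (f \o rf q.2^-1) x + extend_dual l f x).
  apply: class_CD IH; first exact: openT.
  by apply: class_CZ; [exact: openT|exact: class_C1_rf].
by apply/funext => x; rewrite extend_dual_cons.
Qed.

Lemma tderDZ a f g x : class_C 1 setT f -> class_C 1 setT g ->
  tder (fun x => a * f x + g x) x = a * tder f x + tder g x.
Proof.
move=> Cf Cg; have df d := class_C_derivable Cf Logic.I : derivable f x (dir d).
have dg d := class_C_derivable Cg Logic.I : derivable g x (dir d).
have E d : pd d (fun x => a * f x + g x) x = a * pd d f x + pd d g x.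
  apply: is_pdE; apply: is_pdD; last exact: derivable_pd.
  by have := is_deriveZ a (derivable_pd (df d)).
rewrite /tder !E.
have alg (u1 u2 v1 v2 w : R) : a * u1 + v1 + w * (a * u2 + v2) = a * (u1 + w * u2) + (v1 + w * v2) by ring.
exact: alg.
Qed.

Lemma tder_extend_dual l f x : wpos l -> class_C 1 setT f ->
  tder (extend_dual l f) x = extend_dual l (tder f) x.
Proof.
move=> + Cf; elim: l => [|q l IH /andP[/= q0 wl]]; first by rewrite !extend_dual_nil.
rewrite (_ : extend_dual (q :: l) f = fun x => q.1 / q.2 * (f \o rf q.2^-1) x + extend_dual l f x).
  rewrite tderDZ; [|exact: class_C1_rf|exact: class_C1_extend_dual].
  rewrite (IH wl) extend_dual_cons; congr (q.1 / q.2 * _ + extend_dual l (tder f) x).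
  rewrite {1}/tder (is_pdE (is_pd_rf _ _ _ Cf)) (is_pdE (is_pd_rf _ _ _ Cf)) eqxx.
  have -> : (~~ b == b) = false by case: (b).
  rewrite /tder co_rf.
  have alg (u v k w : R) : u + (1 + k) * w * v + w * (- k * v) = u + w * v by ring.
  exact: alg.
by apply/funext => y; rewrite extend_dual_cons.
Qed.

Lemma pd_extend_dual l f x : wpos l -> class_C 1 setT f ->
  pd b (extend_dual (lder l) f) x = extend_dual l (pd b f) x.
Proof.
move=> + Cf; elim: l => [|q l IH /andP[/= q0 wl]]; first by rewrite /= !extend_dual_nil.
rewrite (_ : extend_dual _ f = fun x => - q.2 * q.1 / q.2 * (f \o rf q.2^-1) x + extend_dual (lder l) f x).
  apply: is_pdE; rewrite extend_dual_cons -IH//.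
  apply: is_pdD; last first.
    by apply: derivable_pd; exact: (class_C_derivable (class_C1_extend_dual (lder l) Cf) Logic.I).
  have := is_deriveZ (- q.2 * q.1 / q.2) (is_pd_rf q.2^-1 b x Cf); rewrite eqxx.
  set z := pd b f _; rewrite /GRing.scale/=.
  have -> : - q.2 * q.1 / q.2 * (- q.2^-1 * z) = q.1 / q.2 * z by field; exact: lt0r_neq0.
  by [].
by apply/funext => y; rewrite /= extend_dual_cons.
Qed.

(** For n > 0 this cutoff is 0 up to height 1/n above the graph and 1 from height 2/n on, on the
    side of [epi]; multiplying by it gives functions with compact support in the open set. *)
Definition theta n x : R := step (n%:R * (sg * tau x) - 1).

Lemma theta_arg_class_C n : class_C 4 setT (fun x => n%:R * (sg * tau x) - 1).
Proof.
apply: class_CB; [exact: openT| |exact: class_C_cst].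
by do 2 (apply: class_CZ; [exact: openT|]); exact: class_C_tau.
Qed.

Lemma class_C_theta n : class_C 1 setT (theta n).
Proof.
apply: class_C_comp; [exact: openT|exact: class_C1d_step|].
exact: class_C_le (theta_arg_class_C n).
Qed.

Lemma theta_bound n x : `|theta n x| <= 1.
Proof. by rewrite ger0_norm ?step_ge0// step_le1. Qed.

Lemma theta_near1 x : epi x -> \forall n \near \oo, 1 < n%:R * (sg * tau x) - 1.
Proof.
move=> Vx; near=> n; rewrite ltrBrDr -ltr_pdivrMr//.
near: n; exact: nbhs_infty_gtr.
Unshelve. all: by end_near. Qed.

Lemma theta_cvg W x : zero_off epi W -> theta n x * W x @[n --> \oo] --> W x.
Proof.
move=> W0; have [Vx|/W0->] := pselect (epi x); last first.
  by apply: cvg_near_cst; apply: nearW => n; rewrite mulr0.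
apply: cvg_near_cst; have := theta_near1 Vx; apply: filterS => n n1.
by rewrite /theta step_ge1 ?mul1r// ltW.
Qed.

Lemma It_theta h : intg h -> zero_off epi h -> It (fun x => theta n x * h x) @[n --> \oo] --> It h.
Proof.
move=> ih h0; apply: (@dct _ (fun n x => theta n x * h x) h (fun x => `|h x|)).
- by move=> n; apply: mfM; [apply: continuous_mf; exact: class_C_continuous (class_C_theta n)|exact: intg_mf].
- exact: intg_mf.
- by apply: aeW => x; exact: theta_cvg.
- exact: intg_abs.
- by move=> n x; rewrite normrM ler_piMl// theta_bound.
Qed.

Lemma lim_add_eqN (w u v : nat -> R) (a e : R) : w n @[n --> \oo] --> (0 : R) ->
  u n @[n --> \oo] --> a -> v n @[n --> \oo] --> e -> (forall n, w n + u n = - v n) -> a = - e.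
Proof.
move=> cw cu cv E.
have l1 : w n + u n @[n --> \oo] --> a by rewrite -[a]add0r; exact: cvgD.
have l2 : - v n @[n --> \oo] --> - e by exact: cvgN.
by rewrite (funext E) in l1; exact: cvg_unique l1 l2.
Qed.

Lemma derive1_step_eq0 t : t < 0 \/ 1 < t -> derive1 step t = 0.
Proof.
move=> h; rewrite derive1E.
have [d] : exists d : R, \near t, cst d t = step t.
  case: h => h; [exists 0|exists 1]; near=> u; rewrite /cst.
    by rewrite step_le0// ltW//; near: u; exact: lt_nbhsl.
  by rewrite step_ge1// ltW//; near: u; exact: lt_nbhsr.
by move=> /(is_derive_near (is_derive_cst d t 1)) [].
Unshelve. all: by end_near. Qed.

Lemma derive1_step_bounded : exists2 M : R, 0 < M & forall t, `|derive1 step t| <= M.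
Proof.
have [_ _ /class_C1d0 cs] := (class_C1dS 0 (@step R)).1 (class_C1d_step 1).
have [M hM] : exists M : R, forall x, box 1 x -> `|derive1 step (co true x)| <= M.
  apply: compact_bounded_fun; first exact: compact_box.
  apply: continuous_subspaceT => x; apply: (@continuous_comp _ _ _ (co true) (derive1 step)); [exact: continuous_co|exact: cs].
exists (`|M| + 1); first by rewrite ltr_wpDl.
move=> t; have [t1|t1] := leP `|t| 1.
  by rewrite (le_trans (hM (0, t) _))//; [split => //=; rewrite normr0|rewrite (le_trans (ler_norm _))// lerDl].
rewrite derive1_step_eq0 ?normr0 ?addr_ge0//.
by move: t1; rewrite ltr_normr => /orP[]; [right|left; lra].
Qed.

Lemma pd_theta d n x : pd d (theta n) x = derive1 step (n%:R * (sg * tau x) - 1) * (n%:R * sg) * pd d tau x.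
Proof.
rewrite /theta pd_comp; last 2 first.
- by case/class_C1dS: (@class_C1d_step R 1).
- exact: (class_C_derivable (theta_arg_class_C n) Logic.I).
rewrite -mulrA; congr (_ * _); apply: is_pdE.
have dt := derivable_pd (class_C_derivable class_C_tau Logic.I : derivable tau x (dir d)).
have := is_pdD (is_deriveZ (n%:R * sg) dt) (is_pd_cst d (- 1) x); rewrite addr0 /GRing.scale/=.
by congr is_derive; apply/funext => y; rewrite mulrA.
Qed.

Lemma zero_off_theta K n f : zero_off K f ->
  zero_off (K `&` [set x | 1 <= n%:R * (sg * tau x)]) (fun x => theta n x * f x).
Proof.
move=> f0 x nx; have [Kx|/f0->] := pselect (K x); last by rewrite mulr0.
rewrite /theta step_le0 ?mul0r//; have [h|h] := leP 1 (n%:R * (sg * tau x)); last by lra.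
by exfalso; apply: nx.
Qed.

Lemma compact_theta K n : compact K -> compact (K `&` [set x | 1 <= n%:R * (sg * tau x)]).
Proof.
move=> cK; apply: compact_closedI => //.
rewrite (_ : [set x | _] = (fun x => n%:R * (sg * tau x)) @^-1` [set r | 1 <= r])//.
apply: closed_comp; last exact: closed_ge.
have C : class_C 4 setT (fun x => n%:R * (sg * tau x)).
  by do 2 (apply: class_CZ; [exact: openT|]); exact: class_C_tau.
by move=> x _; exact: (class_C_continuous C).
Qed.

Lemma theta_sub_epi K n : (K `&` [set x | 1 <= n%:R * (sg * tau x)]) `<=` epi.
Proof.
move=> x [_ /=]; rewrite /epi/= => h; rewrite ltNge; apply/negP => t0.
have : n%:R * (sg * tau x) <= 0 by rewrite mulr_ge0_le0.
lra.
Qed.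

Lemma wderiv_theta K d n W v psi : zero_off epi W -> zero_off epi v -> wderiv epi [:: d] W v ->
  compact K -> class_C 1 setT psi -> zero_off K psi ->
  It (fun x => W x * (pd d (theta n) x * psi x + theta n x * pd d psi x)) =
  - It (fun x => v x * (theta n x * psi x)).
Proof.
move=> W0 v0 Dv cK Cpsi psi0.
have P h : zero_off epi h -> h \_ epi = h.
  by move=> h0; apply/funext => x; rewrite patchE; case: ifPn => //; rewrite notin_setE => /h0.
have := @wderiv_C1 _ _ _ _ _ _ (fun x => theta n x * psi x) open_epi Dv (@compact_theta K n cK) (@theta_sub_epi K n).
rewrite (P _ W0) (P _ v0) => <-.
- congr It; apply/funext => x; rewrite pdM//.
    exact: (class_C_derivable (class_C_theta n) Logic.I).
  exact: (class_C_derivable Cpsi Logic.I).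
- exact: (class_CM openT (class_C_theta n) Cpsi).
- exact: zero_off_theta.
Qed.

Lemma L2_zero_off_epi W : zero_off epi W -> L2 epi W -> L2 setT W.
Proof.
move=> W0 /(L2_patch _ (open_measurable2 open_epi)); congr L2.
by apply/funext => x; rewrite patchE; case: ifPn => //; rewrite notin_setE => /W0.
Qed.

Lemma L2_C0 K f : compact K -> continuous f -> zero_off K f -> L2 setT f.
Proof.
move=> cK cf f0; split; first exact: continuous_mf.
apply: (intg_continuous cK); last by move=> x /f0 ->; rewrite expr0n.
by move=> x; apply: (@continuous_comp _ _ _ f (fun t => t ^+ 2)); [exact: cf|exact: exprn_continuous].
Qed.

(** [W] need not vanish at the graph, but [psi] does, so it is O(tau). The derivative of [theta n]
    is O(n) and lives at heights between 1/n and 2/n: its product with [psi] is bounded and tends to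
    0 pointwise, and dominated convergence removes it. *)
Lemma It_pd_graph K W v psi : zero_off epi W -> zero_off epi v -> wderiv epi [:: b] W v ->
  compact K -> class_C 1 setT psi -> zero_off K psi -> (forall x, tau x = 0 -> psi x = 0) ->
  It (fun x => W x * pd b psi x) = - It (fun x => v x * psi x).
Proof.
move=> W0 v0 Dv cK Cpsi psi0 psig.
have [LW Lv] := wderiv_L2 Dv.
have {}LW := L2_zero_off_epi W0 LW; have {}Lv := L2_zero_off_epi v0 Lv.
have cpsi := class_C_continuous Cpsi; have cpd := class_C_continuous (class_C_pd b Cpsi).
have Lpsi := L2_C0 cK cpsi psi0.
have pd0 := zero_off_pd b (compact_closed2 cK) psi0.
have Lpd := L2_C0 cK cpd pd0.
have i1 := L2_intgM LW Lpd; have i2 := L2_intgM Lv Lpsi.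
have z1 : zero_off epi (fun x => W x * pd b psi x) by move=> x /W0 ->; rewrite mul0r.
have z2 : zero_off epi (fun x => v x * psi x) by move=> x /v0 ->; rewrite mul0r.
have lim1 := It_theta i1 z1; have lim2 := It_theta i2 z2.
have [L L0 hL] := continuous_zero_off_bounded cK cpd pd0.
have [M M0 hM] := derive1_step_bounded.
have tpd x : pd b tau x = 1 by rewrite pd_tau eqxx.
have psit x : `|psi x| <= L * `|tau x|.
  have := @lip_pd R b psi L x (c (co (~~ b) x)) Cpsi hL.
  rewrite psig ?sub0r ?normrN; last by rewrite /tau co_pt co_ptN subrr.
  by rewrite distrC.
pose h n x := W x * (pd b (theta n) x * psi x).
have hb n x : `|h n x| <= (2 * M * L) * `|\1_K x * W x|.
  rewrite /h; have [Kx|/psi0->] := pselect (K x); last first.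
    by rewrite !mulr0 normr0 mulr_ge0// ?mulr_ge0// ltW.
  rewrite /indic mem_set// mul1r normrM mulrC; apply: ler_wpM2r => //.
  rewrite pd_theta tpd mulr1; set u := n%:R * (sg * tau x) - 1.
  have [uo|uin] := pselect (u < 0 \/ 1 < u).
    by rewrite derive1_step_eq0// !mul0r normr0 ?mulr_ge0// ltW.
  have [u0 u1] : 0 <= u /\ u <= 1.
    by split; rewrite leNgt; apply/negP => ?; apply: uin; [left|right].
  have -> : 2 * M * L = M * (2 * L) by ring.
  rewrite -mulrA normrM; apply: ler_pM => //.
  rewrite normrM; apply: (le_trans (ler_wpM2l _ (psit x))) => //.
  rewrite mulrCA [leRHS]mulrC; apply: ler_wpM2l; first exact: ltW.
  rewrite -normrM -mulrA; rewrite /u in u0 u1.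
  by rewrite ger0_norm; lra.
have mth n : mf (pd b (theta n)).
  by apply: continuous_mf; apply: class_C_continuous; exact: class_C_pd (class_C_theta n).
have mh n : mf (h n).
  by apply: mfM; [exact: L2_mf|apply: mfM; [exact: mth|exact: continuous_mf]].
have iK := L2_intg_compact cK LW.
have ih n : intg (h n) by apply: le_intg (hb n) _ => //; apply: intgZ; exact: intg_abs.
have lim0 : It (h n) @[n --> \oo] --> (0 : R).
  rewrite -(@It_eq0 _ (cst 0))//; apply: (@dct _ h (cst 0) (fun x => (2 * M * L) * `|\1_K x * W x|)) => //.
  - exact: measurable_cst.
  - apply: aeW => x; apply: cvg_near_cst; have [Vx|/W0 Wx] := pselect (epi x); last first.
      by apply: nearW => n; rewrite /h Wx mul0r.
    have := theta_near1 Vx; apply: filterS => n n1.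
    by rewrite /h pd_theta derive1_step_eq0 ?mul0r ?mulr0//; right.
  - by apply: intgZ; exact: intg_abs.
have ith n : intg (fun x => theta n x * (W x * pd b psi x)).
  apply: le_intg (intg_abs i1); last by move=> x; rewrite normrM ler_piMl// theta_bound.
  by apply: mfM; [apply: continuous_mf; exact: class_C_continuous (class_C_theta n)|exact: intg_mf].
have Eq n : It (h n) + It (fun x => theta n x * (W x * pd b psi x)) =
   - It (fun x => theta n x * (v x * psi x)).
  rewrite -(ItD (ih n) (ith n)).
  have := @wderiv_theta K b n W v psi W0 v0 Dv cK Cpsi psi0.
  rewrite (_ : (fun x => v x * _) = (fun x => theta n x * (v x * psi x))); last first.
    by apply/funext => x; rewrite mulrCA.
  by move=> <-; congr It; apply/funext => x; rewrite /h mulrDr; congr (_ + _); rewrite mulrCA.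
exact: (lim_add_eqN lim0 lim1 lim2 Eq).
Qed.

(** Nothing is asked of [psi] on the graph: the tangential derivative of [theta n] is 0, so the
    formula holds with the cutoff for every [n], and passes to the limit. *)
Lemma It_tder K W va vb psi : zero_off epi W -> zero_off epi va -> zero_off epi vb ->
  wderiv epi [:: ~~ b] W va -> wderiv epi [:: b] W vb ->
  compact K -> class_C 1 setT psi -> zero_off K psi ->
  It (fun x => W x * tder psi x) =
  - It (fun x => (va x + derive1 c (co (~~ b) x) * vb x) * psi x).
Proof.
move=> W0 va0 vb0 Da Db cK Cpsi psi0.
set cp := fun x => derive1 c (co (~~ b) x).
have [LW La] := wderiv_L2 Da; have [_ Lb] := wderiv_L2 Db.
have {}LW := L2_zero_off_epi W0 LW; have {}La := L2_zero_off_epi va0 La; have {}Lb := L2_zero_off_epi vb0 Lb.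
have Ccp : class_C 3 setT cp.
  apply: class_C_comp; [exact: openT| |exact: class_C_co].
  by case/class_C1dS: Cc.
have cpsi := class_C_continuous Cpsi.
have Cg : class_C 1 setT (fun x => cp x * psi x).
  exact: (class_CM openT (class_C_le (isT : (1 <= 3)%N) Ccp) Cpsi).
have g0 : zero_off K (fun x => cp x * psi x) by move=> x /psi0 ->; rewrite mulr0.
have ccp := class_C_continuous Ccp.
have Lpsi := L2_C0 cK cpsi psi0.
have Lg := L2_C0 cK (class_C_continuous Cg) g0.
have cK2 := compact_closed2 cK.
have pd0 d := zero_off_pd d cK2 psi0.
have Lpd d : L2 setT (pd d psi).
  by apply: (L2_C0 cK) => //; apply: class_C_continuous; exact: class_C_pd Cpsi.
have Lcpd : L2 setT (fun x => cp x * pd b psi x).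
  apply: (L2_C0 cK) => [x|]; last by move=> x /pd0 ->; rewrite mulr0.
  by apply: continuousM; [exact: ccp|exact: class_C_continuous (class_C_pd b Cpsi) x].
have Lt : L2 setT (tder psi) by exact: L2D.
have i1 := L2_intgM LW Lt.
have i2 : intg (fun x => (va x + cp x * vb x) * psi x).
  have := intgD (L2_intgM La Lpsi) (L2_intgM Lb Lg).
  congr intg; apply/funext => x /=; ring.
have z1 : zero_off epi (fun x => W x * tder psi x) by move=> x /W0 ->; rewrite mul0r.
have z2 : zero_off epi (fun x => (va x + cp x * vb x) * psi x).
  by move=> x nx; rewrite va0// vb0//; ring.
have lim1 := It_theta i1 z1; have lim2 := It_theta i2 z2.
have thC n : class_C 1 setT (theta n) := class_C_theta n.
have mth n : mf (theta n) by apply: continuous_mf; exact: class_C_continuous (thC n).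
have pw d n x : pd d (fun y => theta n y * psi y) x = pd d (theta n) x * psi x + theta n x * pd d psi x.
  by rewrite pdM//; [exact: (class_C_derivable (thC n) Logic.I)|exact: (class_C_derivable Cpsi Logic.I)].
have E n : It (fun x => theta n x * (W x * tder psi x)) =
   - It (fun x => theta n x * ((va x + cp x * vb x) * psi x)).
  have Ea := @wderiv_theta K _ n W va psi W0 va0 Da cK Cpsi psi0.
  have Eb := @wderiv_theta K _ n W vb _ W0 vb0 Db cK Cg g0.
  have cpth d : continuous (pd d (theta n)) by apply: class_C_continuous; exact: class_C_pd (thC n).
  have cth : continuous (theta n) := class_C_continuous (thC n).
  have LL h f : continuous h -> continuous f -> zero_off K f -> L2 setT (fun x => h x * f x).
    move=> ch cf f0; apply: (L2_C0 cK) => [x|]; last by move=> x /f0 ->; rewrite mulr0.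
    by apply: continuousM; [exact: ch|exact: cf].
  have cpdp d f : class_C 1 setT f -> continuous (pd d f).
    by move=> Cf; apply: class_C_continuous; exact: class_C_pd Cf.
  have j d f : class_C 1 setT f -> zero_off K f ->
      intg (fun x => W x * (pd d (theta n) x * f x + theta n x * pd d f x)).
    move=> Cf f0; apply: (L2_intgM LW); apply: L2D; apply: LL; [exact: cpth|exact: class_C_continuous Cf|exact: f0|exact: cth|exact: cpdp|exact: zero_off_pd].
  have k1 : intg (fun x => va x * (theta n x * psi x)) by apply: L2_intgM => //; exact: LL.
  have k2 : intg (fun x => vb x * (theta n x * (cp x * psi x))).
    by apply: L2_intgM => //; apply: LL => //; exact: class_C_continuous Cg.
  transitivity (It (fun x => W x * (pd (~~ b) (theta n) x * psi x + theta n x * pd (~~ b) psi x)) +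
    It (fun x => W x * (pd b (theta n) x * (cp x * psi x) + theta n x * pd b (fun x => cp x * psi x) x))).
    rewrite -(ItD (j _ _ Cpsi psi0) (j _ _ Cg g0)); congr It; apply/funext => x.
    have pcp : pd b cp x = 0.
      rewrite /cp pd_comp ?pd_co; last 2 first.
      - have [_ _ C3] := (class_C1dS 3 c).1 Cc.
        by have [_ d2 _] := (class_C1dS 2 _).1 C3; exact: d2.
      - exact: (class_C_derivable (@class_C_co R 1 setT (~~ b)) Logic.I).
      by case: (b); rewrite mulr0.
    rewrite [X in _ = _ + W x * (_ + _ * X)]pdM ?pcp; last 2 first.
    - exact: (class_C_derivable Ccp Logic.I).
    - exact: (class_C_derivable Cpsi Logic.I).
    rewrite !pd_theta !pd_tau eqxx.
    have -> : (~~ b == b) = false by case: (b).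
    by rewrite /tder -/(cp x); ring.
  rewrite Ea Eb -opprD -(ItD k1 k2); congr (- It _); apply/funext => x; ring.
apply: (lim_add_eqN (cvg_cst 0) lim1 lim2) => n; rewrite add0r; exact: E.
Qed.

End reflection.

(** * Sobolev regularity of the reflected function *)

Section reflection_sobolev.
Context {R : realType} (b : bool) (c : R -> R) (sg : R).
Context (Cc : class_C1d 4 c).
Implicit Types (W w v f g h k phi psi chi : R * R -> R) (A U K T : set (R * R)) (x p q : R * R)
  (m n : nat) (l : seq (R * R)) (d : bool) (t r e a : R).
Local Notation rf := (rf b c).
Local Notation epi := (epi b c sg).
Local Notation extend := (extend b c).
Local Notation extend_dual := (extend_dual b c).
Local Notation tder := (tder b c).
Local Notation cp := (fun x => derive1 c (co (~~ b) x)).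

Lemma L2_mul_zero_off T h v : compact T -> continuous h -> zero_off T v -> L2 setT v ->
  L2 setT (fun x => h x * v x).
Proof.
move=> cT ch v0 Lv; have [M hM] := compact_bounded_fun cT (continuous_subspaceT ch).
apply: (@L2_bnd _ M v) => //; first by apply: mfM; [exact: continuous_mf|exact: L2_mf].
move=> x; rewrite normrM; have [/hM h1|/v0->] := pselect (T x); first exact: ler_wpM2r.
by rewrite normr0 !mulr0.
Qed.

Lemma extend_dual_zero_off K l f : wpos l -> compact K -> zero_off K f ->
  exists2 K', compact K' & zero_off K' (extend_dual l f).
Proof.
move=> + cK f0; elim: l => [_|q l IH /andP[/= q0 /IH[K' cK' h0]]].
  by exists K => //; rewrite extend_dual_nil.
exists (K' `|` rf q.2 @` K).
  apply: compactU => //; apply: continuous_compact cK.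
  by apply: continuous_subspaceT; exact: continuous_rf.
move=> x nx; rewrite extend_dual_cons h0; last by move=> ?; apply: nx; left.
rewrite f0 ?mulr0 ?addr0// => Kx; apply: nx; right; exists (rf q.2^-1 x) => //.
have := @rfK R b c q.2^-1 x; rewrite invrK; apply.
by rewrite invr_eq0; exact: lt0r_neq0.
Qed.

(** Transposition moves the reflections to the test function, which becomes
    [extend_dual (lder l) phi]. It vanishes on the graph because [mom 0 l = 1], and integration by
    parts in [epi] leaves no boundary term. *)
Lemma wderiv_extend_b l W v : wpos l -> mom 0 l = 1 -> zero_off epi W -> zero_off epi v ->
  wderiv epi [:: b] W v -> wderiv setT [:: b] (extend l W) (extend (lder l) v).
Proof.
move=> wl m1 W0 v0 Dv; have [LW Lv] := wderiv_L2 Dv.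
have {}LW := L2_zero_off_epi Cc W0 LW; have {}Lv := L2_zero_off_epi Cc v0 Lv.
have wl' : wpos (lder l) by rewrite wpos_lder.
apply/wderivTE; split; [exact: (L2_extend b Cc)|exact: (L2_extend b Cc)|].
move=> phi tp; have [sphi [K [cK _ phi0]]] := tp.
have Cphi : class_C 1 setT phi := sphi 1%N.
have [K' cK' h0] := extend_dual_zero_off wl' cK phi0.
have Lphi := test_fun_L2 tp; have Lpd := test_fun_L2 (test_fun_pds [:: b] tp).
rewrite /= expr1 mulN1r (It_extend b Cc wl LW Lpd) (It_extend b Cc wl' Lv Lphi).
rewrite -(@It_pd_graph R b c sg Cc K' W v (extend_dual (lder l) phi) W0 v0 Dv cK').
- by congr It; apply/funext => x; rewrite pd_extend_dual.
- exact: class_C1_extend_dual.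
- exact: h0.
- by move=> x t0; exact: extend_dual_graph.
Qed.

Lemma continuous_cp : continuous cp.
Proof.
move=> x; apply: (@continuous_comp _ _ _ (co (~~ b)) (derive1 c)); first exact: continuous_co.
by have [_ _ /class_C1dS[+ _ _]] := (class_C1dS 3 c).1 Cc; apply.
Qed.

Lemma class_C_cp : class_C 3 setT cp.
Proof.
apply: class_C_comp; [exact: openT| |exact: class_C_co].
by case/class_C1dS: Cc.
Qed.

Lemma pd_cp x : pd b cp x = 0.
Proof.
rewrite (@pd_comp R (derive1 c)) ?pd_co; last 2 first.
- have [_ _ C3] := (class_C1dS 3 c).1 Cc.
  by have [_ d2 _] := (class_C1dS 2 _).1 C3; exact: d2.
- exact: (class_C_derivable (@class_C_co R 1 setT (~~ b)) Logic.I).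
by case: (b); rewrite mulr0.
Qed.

Lemma extend_cp l v x : extend l (fun x => cp x * v x) x = cp x * extend l v x.
Proof.
elim: l => [|q l IH]; first by rewrite !extend_nil.
by rewrite !extend_cons IH co_rf; ring.
Qed.

Lemma extendD l v w x : extend l (fun x => v x + w x) x = extend l v x + extend l w x.
Proof.
elim: l => [|q l IH]; first by rewrite !extend_nil.
by rewrite !extend_cons IH; ring.
Qed.

(** Here [pd (~~ b)] is written as [tder] minus the slope times [pd b]: the first term commutes with
    the extension, the second is given by [wderiv_extend_b]. The difference of the two extensions of
    [vb] is the price of the curvature of the graph. The compact [T] makes the slope a bounded
    multiplier. *)
Lemma wderiv_extend_a T l W va vb : wpos l -> mom 0 l = 1 -> compact T -> zero_off T vb ->
  zero_off T (extend l vb) -> zero_off T (extend (lder l) vb) ->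
  zero_off epi W -> zero_off epi va -> zero_off epi vb ->
  wderiv epi [:: ~~ b] W va -> wderiv epi [:: b] W vb ->
  wderiv setT [:: ~~ b] (extend l W)
   (fun x => extend l va x + cp x * (extend l vb x + (- 1) * extend (lder l) vb x)).
Proof.
move=> wl m1 cT T0 z1 z2 W0 va0 vb0 Da Db; have DE := wderiv_extend_b wl m1 W0 vb0 Db.
have [LW La] := wderiv_L2 Da; have [_ Lb] := wderiv_L2 Db.
have {}LW := L2_zero_off_epi Cc W0 LW; have {}La := L2_zero_off_epi Cc va0 La.
have {}Lb := L2_zero_off_epi Cc vb0 Lb.
have wl' : wpos (lder l) by rewrite wpos_lder.
have LEW := L2_extend b Cc wl LW; have LEa := L2_extend b Cc wl La.
have LEb := L2_extend b Cc wl Lb; have LEb' := L2_extend b Cc wl' Lb.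
have Lc1 := L2_mul_zero_off cT continuous_cp z1 LEb.
have Lc2 := L2_mul_zero_off cT continuous_cp z2 LEb'.
apply/wderivTE; split => //.
  rewrite (_ : (fun x => _ + _) = fun x => extend l va x +
    (cp x * extend l vb x - cp x * extend (lder l) vb x)).
    by apply: L2D => //; exact: L2B.
  by apply/funext => x; ring.
move=> phi tp; have [sphi [K [cK _ phi0]]] := tp.
have Cphi : class_C 1 setT phi := sphi 1%N.
have [K' cK' h0] := extend_dual_zero_off wl cK phi0.
have Lphi := test_fun_L2 tp; have Lpd d := test_fun_L2 (test_fun_pds [:: d] tp).
have Ccphi : class_C 1 setT (fun x => cp x * phi x).
  exact: (class_CM openT (class_C_le (isT : (1 <= 3)%N) class_C_cp) Cphi).
have cphi0 : zero_off K (fun x => cp x * phi x) by move=> x /phi0 ->; rewrite mulr0.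
have Lcb : L2 setT (fun x => cp x * pd b phi x).
  apply: (L2_C0 cK) => [x|x]; last first.
    by move=> /(zero_off_pd b (compact_closed2 cK) phi0) ->; rewrite mulr0.
  by apply: (@continuousM _ _ cp (pd b phi) x); [exact: continuous_cp|exact: class_C_continuous (class_C_pd b Cphi) x].
have Lt : L2 setT (tder phi) by exact: L2D (Lpd (~~ b)) Lcb.
have Lcphi := L2_C0 cK (class_C_continuous Ccphi) cphi0.
have i1 := L2_intgM LEW Lt; have i2 := L2_intgM LEW Lcb.
have E2 : It (fun x => extend l W x * (cp x * pd b phi x)) =
    - It (fun x => extend (lder l) vb x * (cp x * phi x)).
  have := wderiv_C1 openT DE cK (@subsetT _ K) Ccphi cphi0; rewrite !patchT => <-.
  congr It; apply/funext => x; rewrite pdM ?pd_cp ?mul0r ?add0r//.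
    exact: (class_C_derivable class_C_cp Logic.I).
  exact: (class_C_derivable Cphi Logic.I).
have Lcvb : L2 setT (fun x => cp x * vb x) by exact: L2_mul_zero_off cT continuous_cp T0 Lb.
have E1 : It (fun x => extend l W x * tder phi x) =
    - It (fun x => extend l (fun x => va x + cp x * vb x) x * phi x).
  have LL : L2 setT (fun x => va x + cp x * vb x) by exact: L2D.
  rewrite (It_extend b Cc wl LW Lt) (It_extend b Cc wl LL Lphi).
  rewrite -(@It_tder R b c sg Cc K' W va vb (extend_dual l phi) W0 va0 vb0 Da Db cK').
  - by congr It; apply/funext => x; rewrite tder_extend_dual.
  - exact: class_C1_extend_dual.
  - exact: h0.
transitivity (It (fun x => extend l W x * tder phi x) - It (fun x => extend l W x * (cp x * pd b phi x))).
  rewrite -(ItB i1 i2); congr It; apply/funext => x /=; rewrite /tder; ring.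
have j1 : intg (fun x => extend l (fun x => va x + cp x * vb x) x * phi x).
  rewrite (_ : (fun x => _) = fun x => (extend l va x + cp x * extend l vb x) * phi x).
    by apply: L2_intgM => //; exact: L2D.
  by apply/funext => x; rewrite extendD extend_cp.
have j2 : intg (fun x => extend (lder l) vb x * (cp x * phi x)) by exact: L2_intgM.
rewrite E1 E2 /= expr1 mulN1r opprK.
have alg (a e f : R) : a - e = f -> - a + e = - f by move=> <-; rewrite opprB addrC.
apply: alg; rewrite -(ItB j1 j2); congr It; apply/funext => x.
by rewrite extendD extend_cp; ring.
Qed.

(** Each derivative along [b] replaces [l] by [lder l] and so consumes one moment condition; order
    [m] needs [m] of them. Parameters at least 1 keep every reflected function zero off the same
    compact [T]. *)
Lemma sobolev_extend m : (m <= 4)%N -> forall T l W, compact T ->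
  (forall a x, 1 <= a -> T (rf a x) -> T x) -> all (fun p => 1 <= p.2) l ->
  (forall i, (i < m)%N -> mom i l = 1) -> zero_off epi W -> zero_off T W ->
  sobolev m epi W -> sobolev m setT (extend l W).
Proof.
have oepi : open epi by exact: open_epi.
have wall l : all (fun p : R * R => 1 <= p.2) l -> wpos l.
  by move=> /allP h; apply/allP => p /h; exact: lt_le_trans.
have zE T l W : (forall a x, 1 <= a -> T (rf a x) -> T x) -> all (fun p => 1 <= p.2) l ->
    zero_off T W -> zero_off T (extend l W).
  move=> Tr + W0; elim: l => [_|q l IH /andP[/= q1 /IH l0]]; first by rewrite extend_nil.
  by move=> x nx; rewrite extend_cons l0// W0 ?mulr0 ?addr0// => /Tr-/(_ q1).
elim: m => [|m IH] m4 T l W cT Tr l1 lm W0 T0 SW.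
  move/sobolev0: SW => LW; apply/sobolev0; apply: L2_extend => //; first exact: wall.
  exact: (L2_zero_off_epi Cc W0 LW).
have wl := wall _ l1.
have l1' : all (fun p => 1 <= p.2) (lder l) by rewrite /lder all_map.
have wl' := wall _ l1'.
have [LW _] := (sobolevS _ _ oepi).1 SW.
have LW' := L2_zero_off_epi Cc W0 LW.
have D d : exists v, [/\ wderiv epi [:: d] W v, sobolev m epi v, zero_off epi v & zero_off T v].
  have [v [Dv Sv v0]] := sobolevS_zero_off oepi (compact_closed2 cT) T0 SW d.
  have ae : {ae leb2, forall x, epi x -> v x = (v \_ epi) x}.
    by apply: aeW => x Vx; rewrite patchE mem_set.
  have Lv : L2 epi (v \_ epi).
    apply/(L2_patch _ (open_measurable2 oepi)).
    rewrite (_ : (v \_ epi) \_ epi = v \_ epi).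
      by apply/(L2_patch _ (open_measurable2 oepi)); exact: sobolev_L2 Sv.
    by apply/funext => x; rewrite !patchE; case: (x \in epi).
  exists (v \_ epi); split.
  - by apply: (wderiv_ae oepi Dv) => //; exact: aeW.
  - exact: sobolev_ae oepi Sv Lv ae.
  - by move=> x nx; rewrite patchE memNset.
  - by move=> x nx; rewrite patchE; case: ifP => // _; exact: v0.
have [va [Da Sa a0 aT]] := D (~~ b); have [vb [Db Sb b0 bT]] := D b.
have lm' i : (i < m)%N -> mom i (lder l) = 1 by move=> im; rewrite mom_lder; exact: lm.
have {}lm i : (i < m.+1)%N -> mom i l = 1 by exact: lm.
have m1 := lm 0%N isT.
have SEa := IH (ltnW m4) T l va cT Tr l1 (fun i im => lm i (ltnW im)) a0 aT Sa.
have SEb := IH (ltnW m4) T l vb cT Tr l1 (fun i im => lm i (ltnW im)) b0 bT Sb.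
have SEb' := IH (ltnW m4) T (lder l) vb cT Tr l1' lm' b0 bT Sb.
apply/(sobolevS _ _ openT); split; first exact: (L2_extend b Cc).
move=> d; have [->|db] := eqVneq d b.
  by exists (extend (lder l) vb); split => //; exact: wderiv_extend_b.
have -> : d = ~~ b by move: db; case: (d); case: (b).
exists (fun x => extend l va x + cp x * (extend l vb x + (- 1) * extend (lder l) vb x)); split.
  by apply: (@wderiv_extend_a T) => //; exact: zE.
apply: sobolevD; [exact: openT|by []|].
apply: (sobolev_mul_zero_off openT cT); first by apply: class_C_le class_C_cp.
  by move=> x nx; rewrite (zE _ _ _ Tr l1 bT x nx) (zE _ _ _ Tr l1' bT x nx) mulr0 addr0.
exact: (sobolevDZ (-1) openT SEb SEb').
Qed.

(** A tube bounded in the base coordinate and in |tau|: for a >= 1 the map [rf a] can only increase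
    |tau|, so preimages of the tube stay in it. Compactness uses a bound of [c] over the base. *)
Lemma tube_cover K : compact K -> exists T, [/\ compact T, K `<=` T &
  forall a x, 1 <= a -> T (rf a x) -> T x].
Proof.
move=> cK.
have [r hr] := compact_bounded_fun cK (continuous_subspaceT (@continuous_co R (~~ b))).
have [M hM] := compact_bounded_fun cK (continuous_subspaceT (@continuous_tau R b c Cc)).
exists [set x | `|co (~~ b) x| <= r /\ `|tau b c x| <= M]; split.
- have [L hL] : exists L : R, forall x, box r x -> `|c (co true x)| <= L.
    apply: compact_bounded_fun; first exact: compact_box.
    apply: continuous_subspaceT => x; apply: (@continuous_comp _ _ _ (co true) c); first exact: continuous_co.
    exact: (continuous_c Cc).
  apply: (subclosed_compact _ (@compact_box R (Num.max r (M + L)))).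
    apply: closedI.
      apply: (@closed_comp _ _ (fun x => `|co (~~ b) x|) [set t : R | t <= r]); last exact: closed_le.
      by move=> x _; apply: continuous_comp; [exact: continuous_co|exact: norm_continuous].
    apply: (@closed_comp _ _ (fun x => `|tau b c x|) [set t : R | t <= M]); last exact: closed_le.
    by move=> x _; apply: continuous_comp; [exact: continuous_tau|exact: norm_continuous].
  move=> x [h1 h2].
  have h3 : `|c (co (~~ b) x)| <= L.
    apply: (hL (0, co (~~ b) x)); split => //=; rewrite normr0.
    exact: le_trans (normr_ge0 _) h1.
  have h4 : `|co b x| <= M + L.
    rewrite -(subrK (c (co (~~ b) x)) (co b x)) (le_trans (ler_normD _ _))//; exact: lerD.
  by move: h1 h4; rewrite /box; case: (b) => /= h1 h4; split; rewrite le_max ?h1 ?h4 ?orbT.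
- by move=> x Kx; split; [exact: hr|exact: hM].
- move=> a x a1; rewrite /= co_rf tau_rf => -[h1 h2]; split => //.
  apply: le_trans h2; rewrite normrM normrN ler_peMl//.
  by rewrite ger0_norm// (le_trans ler01).
Qed.

(* The weights solve sum_i l_i (- i)^m = 1 for m < 4, so that the four derivatives match on the graph. *)
Lemma sobolev_extend_epi K W : compact K -> zero_off epi W -> zero_off K W -> sobolev 4 epi W ->
  exists Y, sobolev 4 setT Y /\ forall x, epi x -> Y x = W x.
Proof.
move=> cK W0 K0 SW; have [T [cT KT Tr]] := tube_cover cK.
pose l : seq (R * R) := [:: (10, 1); (- 20, 2); (15, 3); (- 4, 4)].
exists (extend l W); split.
  apply: (sobolev_extend (leqnn 4) cT Tr) => //.
  - by rewrite /= lexx !ler1n.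
  - move=> i; rewrite /mom !big_cons big_nil /=.
    by do 4 (case: i => [|i]; first by [move=> _; rewrite ?expr0 ?expr1 ?exprS ?expr0; ring]).
  - by move=> x nx; apply: K0 => /KT.
have W0r a x : 0 < a -> epi x -> W (rf a x) = 0 by move=> a0 Vx; apply: W0; exact: epi_rf.
by move=> x Vx; rewrite !extend_cons extend_nil !W0r ?mulr0 ?add0r//= ltr0n.
Qed.

End reflection_sobolev.

(** * Gluing local extensions *)

Section extension.
Context {R : realType}.
Implicit Types (W w v y f g h k phi psi chi : R * R -> R) (A U V K T : set (R * R)) (x p q : R * R)
  (b d : bool) (m n : nat) (t r e a : R).

Lemma smooth_plateau p r : smooth (plateau p r). Proof. by move=> k; exact: class_C_plateau. Qed.

Lemma boundary_epi U p : open U -> boundary_C 4 U -> closure U p -> ~ U p ->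
  exists b c sg, class_C1d 4 c /\ \near p, U p <-> epi b c sg p.
Proof.
move=> oU bU clp nUp; have [|swap [neg [c [Cc]]]] := bU p.
  by split => //; rewrite (interior_id _).1.
exists (~~ swap), (if neg then (fun t => - c t) else c), (if neg then - 1 else 1); split.
  case: neg {b} => //.
  have := class_C1dM (class_C1d_cst 4 (-1)) Cc; congr class_C1d.
  by apply/funext => t; rewrite mulN1r.
move: b; apply: filterS => x /= ->; rewrite /epi/= /tau negbK.
case: neg; rewrite ?expr1 ?expr0 /co; case: swap => /=; split; lra.
Qed.

(** Stated for an arbitrary set [A] so as to be stable under unions: [compact_induction] then glues
    the pieces, and no partition of unity has to be chosen beforehand. *)
Definition local_extension U y A := exists eta Y K, [/\ smooth eta, forall x, A x -> eta x = 1,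
  compact K, sobolev 4 setT Y & zero_off K Y /\ forall x, U x -> Y x = eta x * y x].

Lemma local_extensionP U y p : open U -> boundary_C 4 U -> sobolev 4 U y -> closure U p ->
  exists2 V, nbhs p V & local_extension U y V.
Proof.
move=> oU bU Sy clp.
have mul r : 0 < r -> let w := (fun x => plateau p (r / 2) x * y x) \_ U in
    [/\ zero_off (sqbox p r) w, sobolev 4 U w & forall x, U x -> w x = plateau p (r / 2) x * y x].
  move=> r0 w.
  have pz : zero_off (sqbox p r) (plateau p (r / 2)).
    have E2 : 2 * (r / 2) = r by field.
    by have := @plateau_zero_off R p (r / 2); rewrite E2; apply; rewrite divr_gt0.
  have Sw : sobolev 4 U (fun x => plateau p (r / 2) x * y x).
    by apply: (sobolev_mul oU (@compact_sqbox R p r)) => //; exact: class_C_plateau.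
  have wE x : U x -> w x = plateau p (r / 2) x * y x by move=> Ux; rewrite /w patchE mem_set.
  split => //; first by move=> x nx; rewrite /w patchE; case: ifP => // _; rewrite pz// mul0r.
  apply: (sobolev_ae oU Sw); last by apply: aeW => x /wE.
  apply/(L2_patch _ (open_measurable2 oU)); have /(L2_patch _ (open_measurable2 oU)) := sobolev_L2 Sw.
  by congr L2; apply/funext => x; rewrite /w !patchE; case: (x \in U).
have r2 r : 0 < r -> nbhs p (sqbox p (r / 2)) /\ (forall x, sqbox p (r / 2) x -> plateau p (r / 2) x = 1).
  by move=> r0; split; [apply: nbhs_sqbox|move=> x; apply: plateau_eq1]; rewrite divr_gt0.
have [Up|nUp] := pselect (U p).
  have [r r0 rU] := nbhs_sqbox_sub (open_nbhs_nbhs (conj oU Up)).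
  have [w0 Sw wE] := mul _ r0; have [nV V1] := r2 _ r0; exists (sqbox p (r / 2)) => //.
  exists (plateau p (r / 2)), ((fun x => plateau p (r / 2) x * y x) \_ U), (sqbox p r).
  split => //; [exact: smooth_plateau|exact: compact_sqbox|].
  by apply: (sobolev_transfer oU openT oU (@compact_sqbox R p r) rU _ w0 Sw); rewrite setIid setTI.
have [b [c [sg [Cc nUV]]]] := boundary_epi oU bU clp nUp.
pose N := [set x | U x <-> epi b c sg x]°.
have oN : open N by exact: open_interior.
have Np : N p by exact: nUV.
have NE x : N x -> (U x <-> epi b c sg x) by move/interior_subset.
have [r r0 rN] := nbhs_sqbox_sub (open_nbhs_nbhs (conj oN Np)).
have [w0 Sw wE] := mul _ r0; have [nV V1] := r2 _ r0; exists (sqbox p (r / 2)) => //.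
move: w0 Sw wE; set w := (_ \_ _) => w0 Sw wE.
have cK := @compact_sqbox R p r.
have we : zero_off (epi b c sg) w.
  move=> x nx; have [Kx|/w0//] := pselect (sqbox p r x).
  by rewrite /w patchE memNset// => Ux; apply: nx; exact/(NE x (rN _ Kx)).
have oV := @open_epi R b c sg Cc.
have UV : U `&` N = epi b c sg `&` N.
  by apply/seteqP; split => x [h1 h2]; split => //; apply/(NE x h2).
have Se := sobolev_transfer oU oV oN cK rN UV w0 Sw.
have [Y0 [SY YE]] := sobolev_extend_epi Cc cK we w0 Se.
(* [Y0] agrees with [w] on the epigraph, which describes [U] only inside [N]; [chi] discards what
   lies outside [N]. *)
have [chi [schi _ [V' oV' [KV' chi1]] [K' cK' [K'N chi0]]]] := smooth_cutoff cK oN rN.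
exists (plateau p (r / 2)), (fun x => chi x * Y0 x), K'.
split; [exact: smooth_plateau|exact: V1|exact: cK'|exact: sobolev_mul openT cK' (schi 4%N) chi0 SY|].
split; first by move=> x /chi0 ->; rewrite mul0r.
move=> x Ux; rewrite -wE//; have [Nx|nNx] := pselect (N x).
  rewrite YE; last exact/(NE x Nx).
  have [Kx|/w0->] := pselect (sqbox p r x); last by rewrite mulr0.
  by rewrite chi1 ?mul1r//; exact: KV'.
by rewrite chi0 ?w0 ?mul0r// => [/rN|/K'N].
Qed.

Lemma closure_compact A : bounded_set A -> compact (closure A).
Proof.
move=> [M [Mr hM]]; pose r := `|M| + 1.
apply: (subclosed_compact _ (@compact_box R r)); first exact: closed_closure.
rewrite (closure_id (box r)).1; last exact: closed_box.
apply: closure_subset => x Ax; have : `|x| <= r.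
  by apply: (hM r) => //; rewrite /r (le_lt_trans (ler_norm _))// ltrDl.
by rewrite prod_normE ge_max => /andP[].
Qed.

Lemma sobolev_extension U y : open U -> bounded_set U -> boundary_C 4 U -> sobolev 4 U y ->
  exists Y K, [/\ compact K, sobolev 4 setT Y, zero_off K Y & forall x, U x -> Y x = y x].
Proof.
move=> oU bdU bU Sy.
have : local_extension U y (closure U).
  apply: compact_induction; first exact: closure_compact.
  - exists (cst 0), (cst 0), set0; split => //; [by move=> k; exact: class_C_cst|exact: compact0| |].
      split; first by have [] := wderiv_L2 (@wderiv0 R setT [::] openT).
      by move=> s _; exists (cst 0); apply: wderiv0; exact: openT.
    by split => // x _; rewrite mul0r.
  - move=> A B [e1 [Y1 [K1 [s1 h1 c1 S1 [z1 E1]]]]] [e2 [Y2 [K2 [s2 h2 c2 S2 [z2 E2]]]]].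
    (* The second extension is used only to the extent that [e1] is not yet 1. *)
    exists (fun x => e1 x + (1 - e1 x) * e2 x), (fun x => Y1 x + (1 - e1 x) * Y2 x), (K1 `|` K2).
    have s3 : smooth (fun x => 1 - e1 x) by exact: (smoothB (@smooth_cst R 1) s1).
    split.
    + exact: (smoothD s1 (smoothM s3 s2)).
    + by move=> x [/h1->|/h2->]; ring.
    + exact: compactU.
    + apply: sobolevD => //; first exact: openT.
      exact: (sobolev_mul_zero_off openT c2 (s3 4%N) z2 S2).
    + split => [x nx|x Ux]; last by rewrite E1// E2//; ring.
      by rewrite z1 ?z2; [ring| |] => ?; apply: nx; [right|left].
  - by move=> A B AB [e1 [Y1 [K1 [s1 h1 c1 S1 z1]]]]; exists e1, Y1, K1; split => // x /AB/h1.
  - by move=> p cp; exact: local_extensionP.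
move=> [eta [Y [K [_ h cK SY [z E]]]]]; exists Y, K; split => // x Ux.
by rewrite E// h ?mul1r//; exact: subset_closure.
Qed.

End extension.

(** * Sobolev embedding *)

Section embedding.
Context {R : realType}.
Local Notation mR := (measurableTypeR R).
Local Notation mP := (mR * mR)%type.
Implicit Types (W V w v f g h k phi psi chi : R * R -> R) (A U K T : set (R * R)) (x y p q : R * R)
  (b d : bool) (m n : nat) (s : seq bool) (t r e a M : R).

Lemma graph_null b (c : R -> R) : continuous c ->
  leb2 [set x | co b x = c (co (~~ b) x)] = 0%E.
Proof.
move=> cc.
have cl : closed [set x : R * R | co b x = c (co (~~ b) x)].
  rewrite (_ : [set x | _] = (fun x => co b x - c (co (~~ b) x)) @^-1` [set 0]).
    apply: closed_comp; last exact: closed_eq.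
    move=> x _; apply: (@continuousB _ _ _ (co b) (fun x => c (co (~~ b) x)) x); first exact: continuous_co.
    by apply: (@continuous_comp _ _ _ (co (~~ b)) c); [exact: continuous_co|exact: cc].
  apply/seteqP; split => x /=; first by move=> ->; rewrite subrr.
  by move/eqP; rewrite subr_eq0 => /eqP.
rewrite (leb2_bsection b (closed_measurable2 cl)); apply: integral0_eq => s _.
rewrite (_ : bsection b _ s = [set c s]) ?lebesgue_measure_set1//.
by apply/seteqP; split => t; rewrite /bsection/= co_pt co_ptN.
Qed.

Lemma null_ae A (P : R * R -> Prop) : @measurable _ mP A -> leb2 A = 0%E -> (forall x, ~ A x -> P x) ->
  {ae leb2, forall x, P x}.
Proof.
move=> mA A0 H; exists A; split => // x /= nP; apply: contrapT => nA; exact/nP/H.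
Qed.

Lemma ae_line b a : {ae leb2, forall x : R * R, co b x != a}.
Proof.
have cl : closed [set x : R * R | co b x = a].
  apply: (@closed_comp _ _ (co b) [set a]); last exact: closed_eq.
  by move=> x _; exact: continuous_co.
apply: (null_ae (closed_measurable2 cl)); last by move=> x /= /eqP.
by have := @graph_null b (cst a) (fun t => @cst_continuous _ _ a _).
Qed.

Lemma ae_nonempty U (P : R * R -> Prop) : open U -> U !=set0 -> {ae leb2, forall x, P x} ->
  exists x, U x /\ P x.
Proof.
move=> oU [p Up] [N [mN N0 PN]].
have [r r0 rU] := nbhs_sqbox_sub (open_nbhs_nbhs (conj oU Up)).
apply: contrapT => h.
have sN : sqbox p r `<=` N.
  by move=> x xr; apply: PN => /= Px; apply: h; exists x; split => //; exact: rU.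
have : (leb2 (sqbox p r) <= leb2 N)%E by apply: le_measure => //; rewrite inE//; exact: measurable_sqbox.
by rewrite leb2_sqbox// N0 lee_fin leNgt exprn_gt0// mulr_gt0.
Qed.

Lemma ae_eq_cont U h f : open U -> cont U h -> cont U f -> {ae leb2, forall x, U x -> h x = f x} ->
  forall x, U x -> h x = f x.
Proof.
move=> oU ch cf ae x Ux; apply/eqP/negPn/negP => ne.
have ne0 : 0 < `|h x - f x| by rewrite normr_gt0 subr_eq0.
have cd : {for x, continuous (fun x => `|h x - f x|)}.
  apply: (@continuous_comp _ _ _ (fun x => h x - f x) (fun t => `|t|)); last exact: norm_continuous.
  by apply: (@continuousB _ _ _ h f x); [exact: ch|exact: cf].
have n1 : nbhs x [set y | 0 < `|h y - f y|].
  exact: (cd _ (open_nbhs_nbhs (conj (@open_gt _ 0) ne0))).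
have n2 : nbhs x (U `&` [set y | 0 < `|h y - f y|]) by apply: filterI => //; exact: open_nbhs_nbhs.
have [p [ip hp]] := ae_nonempty (open_interior _) (ex_intro _ x n2) ae.
have [Up] := interior_subset ip; rewrite /= hp// subrr normr0 ltxx//.
Qed.

Lemma pd_conv_wderiv b V v phi : wderiv setT [:: b] V v -> intg V ->
  smooth phi -> (exists2 K, compact K & zero_off K phi) -> pd b (conv V phi) = conv v phi.
Proof.
move=> Dv iV sphi [K cK phi0]; have [_ ->//] := conv_smooth cK iV sphi phi0.
apply/funext => x; have [_ _ Hv] := (wderivTE _ _ _).1 Dv.
have := Hv _ (test_fun_refl x cK sphi phi0); rewrite /= expr1 mulN1r /conv => /(congr1 -%R).
rewrite opprK => <-; rewrite -ItN; last first.
  have := L2_intgM (proj1 (wderiv_L2 Dv)) (test_fun_L2 (test_fun_pds [:: b] (test_fun_refl x cK sphi phi0))).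
  by [].
by congr It; apply/funext => q; rewrite pd_refl ?mulrN ?opprK.
Qed.

Lemma mollified_increment_le (a1 a0 c1 c0 l m l0 h e e' : R) : c1 - c0 = l * h ->
  `|c1 - a1| <= e' / 2 -> `|c0 - a0| <= e' / 2 -> `|l - m| <= e / 2 -> `|m - l0| <= e / 2 ->
  `|a1 - a0 - h * l0| <= e * `|h| + e'.
Proof.
move=> E h1 h0 hl hm.
have -> : a1 - a0 - h * l0 = (l - m + (m - l0)) * h + ((a1 - c1) + (c0 - a0)).
  have -> : a1 = c1 - (c1 - a1) by ring.
  have -> : c1 = c0 + l * h by rewrite -E; ring.
  by ring.
apply: (le_trans (ler_normD _ _)); apply: lerD.
  by rewrite normrM; apply: ler_wpM2r => //; apply: (le_trans (ler_normD _ _)); lra.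
by apply: (le_trans (ler_normD _ _)); rewrite distrC; lra.
Qed.

(** The mean value theorem holds for the mollifications of [V] and [v] at a common scale. The error
    e' due to mollifying [V] is arbitrary for a fixed increment, while [e] only depends on the
    modulus of continuity of [v]. *)
Lemma cont_wderiv_classical K b V v x : compact K -> continuous V -> continuous v ->
  zero_off K V -> zero_off K v -> wderiv setT [:: b] V v -> is_derive x (dir b) V (v x).
Proof.
move=> cK cV cv V0 v0 Dv; apply/is_pd_line; apply: is_derive_small_o => e e0.
have e2 : 0 < e / 2 by rewrite divr_gt0.
have [d0 d00 hd0] := uniform_continuity_zero_off cK cv v0 e2.
have iV := intg_continuous cK cV V0; have iv := intg_continuous cK cv v0.
exists d0 => // u ud0; apply/ler_addgt0Pr => e' e'0.
have [d1 d10 hd1] := uniform_continuity_zero_off cK cV V0 (divr_gt0 e'0 (ltr0Sn R 1)).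
pose d := Num.min d0 d1.
have dp : 0 < d by rewrite lt_min d00.
have dd0 : d <= d0 by rewrite ge_min lexx.
have dd1 : d <= d1 by rewrite ge_min lexx orbT.
have mc : exists2 K, compact K & zero_off K (@moll R d).
  by exists (sqbox 0 d); [exact: compact_sqbox0|exact: moll_zero_off].
have [sV _] := conv_smooth (@compact_sqbox0 R d) iV (@moll_smooth R d) (moll_zero_off dp).
have clV y : `|conv V (moll d) y - V y| <= e' / 2.
  apply: conv_moll_le => // q; rewrite /sqbox/= !subr0 => -[h1 h2].
  by apply: hd1; rewrite distrC; [exact: le_trans h1 dd1|exact: le_trans h2 dd1].
have clv y : `|conv v (moll d) y - v y| <= e / 2.
  apply: conv_moll_le => // q; rewrite /sqbox/= !subr0 => -[h1 h2].
  by apply: hd0; rewrite distrC; [exact: le_trans h1 dd0|exact: le_trans h2 dd0].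
have [w [w1 E]] := pd_mvt b (co (~~ b) x) (co b x) u (sV 1%N).
rewrite (pd_conv_wderiv Dv iV (@moll_smooth R d) mc) pt_co in E.
have wx : `|v (pt b (co (~~ b) x) w) - v x| <= e / 2.
  have wd := le_trans w1 ud0.
  by apply: hd0; case: (b) wd => /= wd; rewrite ?subrr ?normr0// ltW.
rewrite /line pt_co; exact: (mollified_increment_le E (clV _) (clV _) (clv _) wx).
Qed.

Lemma leb_itv_indic (u : R -> R) (l r : R) :
  (\int[lebesgue_measure]_t ((if l <= t <= r then 1 else 0) * u t))%R =
  (\int[lebesgue_measure]_(t in `[l, r]) u t)%R.
Proof.
rewrite (@Rintegral_zero_off _ _ l r); last by move=> t /negP/negbTE ->; rewrite mul0r.
by apply: eq_Rintegral => t; rewrite inE/= in_itv/= => ->; rewrite mul1r.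
Qed.

(** A truncated fundamental solution of the mixed derivative: the indicator of a quadrant, cut at
    distance [M] to be integrable. *)
Definition corner M x : R := (if - M <= x.1 <= 0 then 1 else 0) * (if - M <= x.2 <= 0 then 1 else 0).

Lemma corner_bound M x : `|corner M x| <= 1.
Proof. by rewrite /corner; do 2 case: ifP; rewrite ?mulr0 ?mul0r ?mulr1 ?normr0 ?normr1. Qed.

Lemma mf_corner M : mf (corner M).
Proof.
have m1 b : mf (fun x => if - M <= co b x <= 0 then 1 else 0).
  apply: measurable_fun_ifT; [|exact: measurable_cst|exact: measurable_cst].
  by apply: measurable_and; apply: measurable_fun_ler => //; [exact: mf_co|exact: mf_co].
exact: mfM (m1 false) (m1 true).
Qed.

Lemma intg_corner M : 0 < M -> intg (corner M).
Proof.
move=> M0; apply: (@intg_bounded _ _ 1 M); [exact: mf_corner|exact: corner_bound|].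
move=> x nx; rewrite /corner; case: ifP => h1; rewrite ?mul0r ?mul1r//; case: ifP => h2//.
by exfalso; apply: nx; move: h1 h2 => /andP[? ?] /andP[? ?]; split; rewrite ler0_norm; lra.
Qed.

Lemma conv_refl h k q : intg (fun x => h (refl q x) * k x) -> conv h k q = It (fun x => h (refl q x) * k x).
Proof.
have E x : q - refl q x = x by rewrite /refl; case: (x) (q) => x1 x2 [y1 y2]; congr pair; rewrite /=; ring.
move=> iw; rewrite /conv -(@It_refl R q); first by congr It; apply/funext => x; rewrite E.
have := intg_refl q iw; congr intg; apply/funext => x; rewrite reflK; congr (_ * k _).
Qed.

Lemma conv_corner r r' phi q : 0 < r -> 0 < r' -> smooth phi -> zero_off (box r') phi -> box r q ->
  conv (corner (r + r' + 1)) (pds [:: false; true] phi) q = phi q.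
Proof.
move=> r0 r'0 sphi phi0 [q1 q2]; set M := r + r' + 1.
have M0 : 0 < M by rewrite /M; lra.
have s1 : smooth (pd true phi) by exact: smooth_pd.
have s2 : smooth (pds [:: false; true] phi) by exact: smooth_pds.
have z1 : zero_off (box r') (pd true phi) by exact: zero_off_pd (@closed_box R r') phi0.
have z2 := zero_off_pds [:: false; true] (@closed_box R r') phi0.
have iw : intg (fun x => corner M (refl q x) * pds [:: false; true] phi x).
  apply: (le_intg _ _ (intg_abs (intg_continuous (@compact_box R r') (smooth_continuous s2) z2))).
    apply: mfM; last by apply: continuous_mf; exact: smooth_continuous.
    by apply: measurableT_comp (mf_corner M) _; apply: measurable_fun_pair; apply: measurable_funB.
  by move=> x; rewrite normrM ler_piMl// corner_bound.
transitivity (It (fun x => corner M (refl q x) * pds [:: false; true] phi x)).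
  exact: (conv_refl iw).
rewrite (Fubini_It false iw).
(* [M] exceeds [r + r'], so that the far sides of the square based at [q] lie outside the support of
   [phi]; only the corner [q] contributes. *)
have off t c : q.1 + M <= t \/ q.2 + M <= c -> pd true phi (t, c) = 0 /\ phi (t, c) = 0.
  move=> h; have nb : ~ box r' (t, c).
    move: q1 q2; rewrite !ler_norml => /andP[? ?] /andP[? ?].
    move=> -[/=]; rewrite !ler_norml => /andP[? ?] /andP[? ?]; rewrite /M in h; case: h; lra.
  by rewrite z1// phi0.
transitivity (\int[lebesgue_measure]_s ((if q.2 <= s <= q.2 + M then 1 else 0) * - pd true phi (q.1, s)))%R.
  apply: eq_Rintegral => s _ /=.
  transitivity (\int[lebesgue_measure]_t ((if q.1 <= t <= q.1 + M then 1 else 0) *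
     ((if q.2 <= s <= q.2 + M then 1 else 0) * pd false (pd true phi) (t, s))))%R.
    apply: eq_Rintegral => t _ /=; rewrite /corner /refl /= mulrA.
    have -> : (- M <= q.1 - t <= 0) = (q.1 <= t <= q.1 + M) by apply/idP/idP => /andP[? ?]; apply/andP; split; lra.
    by have -> : (- M <= q.2 - s <= 0) = (q.2 <= s <= q.2 + M) by apply/idP/idP => /andP[? ?]; apply/andP; split; lra.
  rewrite leb_itv_indic.
  have dF t : is_derive t 1 (fun t => (if q.2 <= s <= q.2 + M then 1 else 0) * pd true phi (t, s))
     ((if q.2 <= s <= q.2 + M then 1 else 0) * pd false (pd true phi) (t, s)).
    have := is_deriveZ (if q.2 <= s <= q.2 + M then 1 else 0) (@is_pd_linet R false (pd true phi) s t 0 (s1 1%N)).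
    by [].
  rewrite (FTC_Rintegral _ dF); last 2 first.
  - by rewrite ltrDl.
  - move=> t; apply: (@continuousM _ _ (fun=> _) (fun t => pd false (pd true phi) (t, s)) t); first exact: cst_continuous.
    exact: (@continuous_line R false _ s (smooth_continuous s2)).
  by have [-> _] := off (q.1 + M) s (or_introl (lexx _)); rewrite mulr0 sub0r mulrN.
rewrite leb_itv_indic.
have dF t : is_derive t 1 (fun t => - phi (q.1, t)) (- pd true phi (q.1, t)).
  exact: (is_deriveN (@is_pd_linet R true phi q.1 t 0 (sphi 1%N))).
rewrite (FTC_Rintegral _ dF); last 2 first.
- by rewrite ltrDl.
- move=> t; exact: (cvgN (@continuous_line R true _ q.1 (smooth_continuous s1) t)).
have [_ ->] := off q.1 (q.2 + M) (or_intror (lexx _)).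
by rewrite oppr0 sub0r opprK; case: (q).
Qed.

Definition quad x q : R := if (q.1 <= x.1) && (q.2 <= x.2) then 1 else 0.

Lemma quad_bound x q : `|quad x q| <= 1.
Proof. by rewrite /quad; case: ifP; rewrite ?normr0 ?normr1. Qed.

Lemma measurable_quad : @measurable_fun _ _ (mP * mP)%type R setT (fun z => quad z.1 z.2).
Proof.
apply: measurable_fun_ifT; [|exact: measurable_cst|exact: measurable_cst].
by apply: measurable_and; apply: measurable_fun_ler;
  do 2 (apply: measurableT_comp => //; try exact: measurable_fst; try exact: measurable_snd).
Qed.

Lemma mf_quad x : mf (quad x).
Proof.
apply: measurable_fun_ifT; [|exact: measurable_cst|exact: measurable_cst].
by apply: measurable_and; apply: measurable_fun_ler.
Qed.

(** Along a sequence tending to [x] the indicators of quadrants converge off the two lines through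
    [x], which are negligible; dominated convergence contradicts a jump of size [e]. *)
Lemma quad_primitive_continuous w : intg w -> continuous (fun x => It (fun q => quad x q * w q)).
Proof.
move=> iw x; set v := fun x => _; apply/cvgrPdist_le => e e0.
apply: contrapT => nc.
have H n : exists y : R * R, sqbox x n.+1%:R^-1 y /\ e < `|v x - v y|.
  apply: contrapT => h; apply: nc; have n0 : 0 < n.+1%:R^-1 :> R by rewrite invr_gt0.
  apply: filterS (nbhs_sqbox x n0) => y xy; rewrite leNgt; apply/negP => ve.
  by apply: h; exists y.
have [y Hy] := choice H.
have cy b : co b (y n) @[n --> \oo] --> co b x.
  apply/cvgrPdist_le => d d0; near=> n; have [[h1 h2] _] := Hy n.
  apply: (@le_trans _ _ n.+1%:R^-1); first by rewrite distrC; case: (b) => /=.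
  rewrite -[leRHS]invrK lef_pV2 ?posrE ?invr_gt0//.
  near: n; exists (Num.trunc d^-1) => // n /= tn.
  by apply: ltW; apply: lt_le_trans (truncnS_gt _) _; rewrite ler_nat.
have lim : v (y n) @[n --> \oo] --> v x.
  apply: (@dct _ (fun n q => quad (y n) q * w q) _ (fun q => `|w q|)).
  - by move=> n; apply: mfM; [exact: mf_quad|exact: intg_mf].
  - by apply: mfM; [exact: mf_quad|exact: intg_mf].
  - apply: (aeS (aeI (ae_line false x.1) (ae_line true x.2))) => q [n1 n2].
    have E b : co b q != co b x -> \forall n \near \oo, (co b q <= co b (y n)) = (co b q <= co b x).
      rewrite neq_lt => /orP[lt|lt].
        apply: (filterS _ (cvgr_gt _ (cy b) _ lt)) => n' /= h.
        by rewrite (ltW h) (ltW lt).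
      apply: (filterS _ (cvgr_lt _ (cy b) _ lt)) => n' /= h.
      by rewrite !leNgt h lt.
    apply: cvg_near_cst; apply: (filterS _ (filterI (E false n1) (E true n2))) => n [/= h1 h2].
    by rewrite /quad h1 h2.
  - exact: intg_abs.
  - by move=> n q; rewrite normrM ler_piMl// quad_bound.
have /cvgrPdist_lt/(_ e e0)[N _ hN] := lim.
have := hN N (leqnn N); have [_] := Hy N; rewrite /= => h1 h2.
by have := lt_trans h1 h2; rewrite ltxx.
Unshelve. all: by end_near. Qed.

Local Lemma sub_itv (r r' l m : R) : `|l| <= r -> `|m| <= r' -> (- (r + r' + 1) <= l - m <= 0) = (l <= m).
Proof.
rewrite !ler_norml => /andP[? ?] /andP[? ?].
by apply/idP/idP => [/andP[? ?]|?]; [|apply/andP; split]; lra.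
Qed.

(* W is the integral of its derivative along [:: false; true] over a quadrant, by duality with test functions. *)
Lemma sobolev2_continuous K W : compact K -> zero_off K W -> sobolev 2 setT W ->
  exists V, [/\ continuous V, zero_off K V & {ae leb2, forall x, W x = V x}].
Proof.
move=> cK W0 SW; have cl := compact_closed2 cK.
have [w1 [D1 S1 z1]] := sobolevS_zero_off openT cl W0 SW false.
have [w [D2 S2 z2]] := sobolevS_zero_off openT cl z1 S1 true.
have D := wderiv_cons openT D1 D2.
have [LW Lw HD] := (wderivTE _ _ _).1 D.
have iw : intg w.
  have := L2_intg_compact cK Lw; congr intg; apply/funext => x.
  have [Kx|/z2->] := pselect (K x); last by rewrite mulr0.
  by rewrite /indic mem_set// mul1r.
pose v x := It (fun q => quad x q * w q).
have cv : continuous v by exact: quad_primitive_continuous.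
have vW : {ae leb2, forall x, (v x - W x) = 0}.
  have H := @du_Bois_Reymond R setT (fun x => v x - W x) openT.
  apply: (aeS (H _ _ _)) => [||| x]; last by apply.
  - by apply: mfB; [exact: continuous_mf|exact: L2_mf].
  - move=> K1 cK1 _; have mK1 := closed_measurable2 (compact_closed2 cK1).
    have [M hM] := compact_bounded_fun cK1 (continuous_subspaceT cv).
    have i1 : intg (fun x => \1_K1 x * v x).
      have [r _ Kr] := compact_sub_box cK1.
      apply: (@intg_bounded _ _ `|M| r).
      + by apply: mfM; [exact: mf_indic|exact: continuous_mf].
      + move=> x; have [Kx|nK] := pselect (K1 x).
          by rewrite /indic mem_set// mul1r (le_trans (hM _ Kx))// ler_norm.
        by rewrite /indic memNset// mul0r normr0.
      + by move=> x nx; rewrite /indic memNset ?mul0r// => /Kr.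
    have := intgB i1 (L2_intg_compact cK1 LW).
    by congr intg; apply/funext => x; rewrite -mulrBr.
  move=> phi tp; have [sphi [K1 [cK1 _ phi1]]] := tp.
  have iphi := intg_continuous cK1 (smooth_continuous sphi) phi1.
  have iv : intg (fun x => v x * phi x).
    apply: (intg_continuous cK1); last by move=> x /phi1 ->; rewrite mulr0.
    by move=> x; apply: (@continuousM _ _ v phi x); [exact: cv|exact: smooth_continuous].
  have iWp := L2_intgM LW (test_fun_L2 tp).
  have -> : It (fun x => (v x - W x) * phi x) = It (fun x => v x * phi x) - It (fun x => W x * phi x).
    by rewrite -(ItB iv iWp); congr It; apply/funext => x; rewrite mulrBl.
  apply/eqP; rewrite subr_eq0; apply/eqP.
  have [r r0 Kr] := compact_sub_box cK; have [r' r'0 Kr'] := compact_sub_box cK1.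
  set M := r + r' + 1; have M0 : 0 < M by rewrite /M; lra.
  have phi0 : zero_off (box r') phi by apply: zero_off_sub phi1.
  have iC := intg_corner M0.
  have [spsi _] := conv_smooth cK1 iC sphi phi1.
  set psi := conv (corner M) phi in spsi.
  (* [psi] is the primitive of [phi] to test with; [chi] makes it a test function without changing
     it near [K], where [W] and [w] live. *)
  have [chi [schi _ [V' oV' [KV' chi1]] [K' cK' [_ chi0]]]] := smooth_cutoff cK openT (@subsetT _ K).
  have tcp : test_fun setT (fun x => chi x * psi x).
    split; first exact: (smoothM schi spsi).
    by exists K'; split => // x /chi0 ->; rewrite mul0r.
  have E1 x : K x -> psi x = It (fun y => quad y x * phi y).
    move=> Kx; rewrite /psi /conv -(@It_refl R x); last first.
      apply: (le_intg _ _ (intgZ 1 (intg_abs (intg_refl x iphi)))).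
        apply: mfM; first exact: mf_corner.
        by apply: intg_mf; exact: (intg_refl x iphi).
      by move=> q; rewrite mul1r normrM ler_piMl ?corner_bound.
    congr It; apply/funext => y; have -> : x - refl x y = y.
      by rewrite /refl; case: (x) (y) => x1 x2 [y1 y2]; congr pair; rewrite /=; ring.
    have [yr|/phi0->] := pselect (box r' y); last by rewrite !mulr0.
    congr (_ * _); rewrite /corner /quad /refl /=.
    move: (Kr _ Kx) yr => [x1 x2] [y1 y2].
    rewrite /M (sub_itv x1 y1) (sub_itv x2 y2).
    by case: (_ <= _); case: (_ <= _); rewrite ?mulr0 ?mul0r ?mulr1.
  have F := @Fubini_kernel R 1 quad phi w measurable_quad quad_bound iphi iw.
  transitivity (It (fun x => phi x * v x)); first by congr It; apply/funext => x; rewrite mulrC.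
  rewrite F; transitivity (It (fun q => w q * (chi q * psi q))).
    congr It; apply/funext => q; have [Kq|/z2->] := pselect (K q); last by rewrite !mul0r.
    by rewrite -(E1 _ Kq) (chi1 _ (KV' _ Kq)) mul1r.
  have := HD _ tcp; rewrite /= expr2 mulrNN mulr1 mul1r => <-.
  congr It; apply/funext => q; have [Kq|/W0->] := pselect (K q); last by rewrite !mul0r.
  congr (_ * _).
  have EV : forall x, V' x -> chi x * psi x = psi x by move=> x /chi1 ->; rewrite mul1r.
  rewrite -[LHS]/(pds [:: false; true] (fun x => chi x * psi x) q) (pds_ext [:: false; true] oV' EV (KV' _ Kq)).
  rewrite /psi (pds_conv _ cK1 iC sphi phi1); exact: (conv_corner r0 r'0 sphi phi0 (Kr _ Kq)).
exists v; split => //; last by apply: (aeS vW) => x /eqP; rewrite subr_eq0 => /eqP.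
have oK : open (~` K) by rewrite openC.
have z0 : cont (~` K) (cst (0 : R)) by move=> x _; exact: cst_continuous.
move=> x nK; apply: (@ae_eq_cont (~` K) v (cst 0)) => //; first by move=> y _; exact: cv.
by apply: (aeS vW) => y /eqP; rewrite subr_eq0 => /eqP -> nKy; exact: W0.
Qed.

(** Two orders are lost, those of the mixed derivative. The continuous representatives of [W] and of
    its first derivatives are related classically by [cont_wderiv_classical], which carries the
    induction. *)
Lemma sobolev_class_C m K W : compact K -> zero_off K W -> sobolev m.+2 setT W ->
  exists V, [/\ class_C m setT V, zero_off K V & {ae leb2, forall x, W x = V x}].
Proof.
move=> cK; elim: m W => [|m IH] W W0 SW.
  have [V [cV V0 VW]] := sobolev2_continuous cK W0 SW.
  by exists V; split => //; apply/class_C0 => x _; exact: cV.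
have [V [cV V0 VW]] := sobolev2_continuous cK W0 (sobolev_le (isT : (2 <= m.+3)%N) SW).
exists V; split => //.
have LV : L2 setT V by exact: L2_C0 cK cV V0.
have Db b : exists v, [/\ class_C m setT v, zero_off K v & wderiv setT [:: b] V v].
  have [w [Dw Sw w0]] := sobolevS_zero_off openT (compact_closed2 cK) W0 SW b.
  have [v [Cv v0 vw]] := IH w w0 Sw; exists v; split => //.
  apply: (wderiv_ae openT Dw) => //.
  - by apply: (L2_C0 cK) v0; exact: class_C_continuous Cv.
  - by apply: (aeS VW) => x ->.
  - by apply: (aeS vw) => x ->.
apply/class_CS; split; first by move=> x _; exact: cV.
  move=> b x _; have [v [Cv v0 Dv]] := Db b.
  by have [] := cont_wderiv_classical x cK cV (class_C_continuous Cv) V0 v0 Dv.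
move=> b; have [v [Cv v0 Dv]] := Db b.
rewrite (_ : pd b V = v)//; apply/funext => x; apply: is_pdE.
exact: cont_wderiv_classical cK cV (class_C_continuous Cv) V0 v0 Dv.
Qed.

(** Each integration by parts removes the outermost derivative of [phi] and puts it on [V] first,
    hence the reversed list; [pds_rev] restores the order when it matters. *)
Lemma It_by_partss K s V phi : compact K -> class_C (size s) setT V -> smooth phi -> zero_off K phi ->
  It (fun x => V x * pds s phi x) = (-1) ^+ size s * It (fun x => pds (rev s) V x * phi x).
Proof.
move=> cK; elim: s V => [|b s IH] V CV sphi phi0; first by rewrite /= expr0 mul1r.
have CVb : class_C (size s) setT (pd b V) by exact: class_C_pd CV.
rewrite /= rev_cons pds_rcons exprS -mulrA -(IH _ CVb sphi phi0) mulN1r.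
have z := zero_off_pds s (compact_closed2 cK) phi0.
have C1 : class_C 1 setT V by exact: class_C_le CV.
have E := It_by_parts b cK (smooth_pds s sphi 1%N) C1 z.
transitivity (It (fun x => pd b (pds s phi) x * V x)).
  by congr It; apply/funext => x; rewrite mulrC.
apply: oppr_inj; rewrite -E opprK; congr It; apply/funext => x; exact: mulrC.
Qed.

Lemma wderiv_classical K s V : compact K -> class_C (size s) setT V -> zero_off K V ->
  wderiv setT (rev s) V (pds s V).
Proof.
move=> cK CV V0; apply/wderivTE; split.
- by apply: (L2_C0 cK) V0; exact: class_C_continuous CV.
- apply: (L2_C0 cK); last exact: zero_off_pds (compact_closed2 cK) V0.
  by apply: (@class_C_continuous _ 0); apply: class_C_pds; rewrite add0n.
move=> phi [sphi [K1 [cK1 _ phi1]]].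
by rewrite (It_by_partss cK1) ?size_rev// revK.
Qed.

End embedding.

(** * Level sets as graphs *)

Section implicit.
Context {R : realType}.
Implicit Types (f g h k G phi psi chi : R * R -> R) (A U V K T : set (R * R)) (x y p q : R * R)
  (b d : bool) (m n : nat) (c : R -> R) (s t r e a M : R).

Lemma class_C_mul_cutoff m U K chi g : open U -> compact K -> K `<=` U -> class_C m setT chi ->
  zero_off K chi -> class_C m U g -> class_C m setT (fun x => chi x * g x).
Proof.
move=> oU cK KU Cchi chi0 Cg.
have oK : open (~` K) by rewrite openC; exact: compact_closed2.
rewrite (_ : setT = U `|` ~` K); last first.
  by apply/seteqP; split => // x _; have [/KU|] := pselect (K x); [left|right].
apply: class_C_cup; first exact: (class_CM oU (class_C_sub (@subsetT _ U) Cchi) Cg).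
by apply: (class_C_ext oK _ (@class_C_cst R m _ 0)) => x /chi0 ->; rewrite mul0r.
Qed.

Lemma is_derive_graph b h c t e : class_C 1 setT h -> is_derive t 1 c e ->
  is_derive t 1 (fun a => h (pt b a (c a))) (pd (~~ b) h (pt b t (c t)) + pd b h (pt b t (c t)) * e).
Proof.
move=> Ch dc; have di : is_derive t 1 (@id R) 1 by exact: is_derive_id.
case: b; rewrite /pt /=.
  by have := @chain_rule R setT h id c t 1 e openT Ch Logic.I di dc; rewrite mulr1 => D; exact: D.
by have := @chain_rule R setT h c id t e 1 openT Ch Logic.I dc di; rewrite mulr1 addrC => D; exact: D.
Qed.

Lemma class_C1d_is_derive m c t : class_C1d m.+1 c -> is_derive t 1 c (derive1 c t).
Proof. by move=> /class_C1dS[_ dc _]; rewrite derive1E; apply: derivableP. Qed.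

Lemma class_C1d_continuous m c : class_C1d m c -> continuous c.
Proof. by move=> /(class_C1d_le (leq0n m))/class_C1d0. Qed.

Lemma class_C1dS_derive m c c' : (forall t, is_derive t 1 c (c' t)) -> class_C1d m c' -> class_C1d m.+1 c.
Proof.
move=> dc Cc'; apply/class_C1dS; split.
- by move=> t; have [dt _] := dc t; apply: differentiable_continuous; apply/derivable1_diffP.
- by move=> t; have [] := dc t.
- rewrite (_ : derive1 c = c')//; apply/funext => t; rewrite derive1E.
  by have [_ ->] := dc t.
Qed.

Lemma class_C1d_graph m b h c : class_C m setT h -> class_C1d m c -> class_C1d m (fun a => h (pt b a (c a))).
Proof.
elim: m h => [|m IH] h Ch Cc.
  apply/class_C1d0 => t; have cc := class_C1d_continuous Cc.
  apply: (@continuous_comp _ _ _ (fun a => pt b a (c a)) h); last exact: (@class_C_continuous R 0 h Ch (pt b t (c t))).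
  case: b; rewrite /pt.
    by apply: (@cvg_pair _ _ _ (nbhs t) (nbhs t) (nbhs (c t)) _ _ _ _ _ _ (cc t)).
  by apply: (@cvg_pair _ _ _ (nbhs t) (nbhs (c t)) (nbhs t) _ _ _ _ _ (cc t)).
apply: (@class_C1dS_derive _ _ (fun t => pd (~~ b) h (pt b t (c t)) + pd b h (pt b t (c t)) * derive1 c t)).
  by move=> t; apply: is_derive_graph; [exact: class_C_le Ch|exact: class_C1d_is_derive Cc].
have Cm := class_C1d_le (leqnSn m) Cc.
by apply: class_C1dD; [|apply: class_C1dM; last by case/class_C1dS: Cc];
  apply: IH => //; exact: class_C_pd.
Qed.

Lemma is_derive_inv c t e : c t != 0 -> is_derive t 1 c e ->
  is_derive t 1 (fun t => (c t)^-1) (- e * ((c t)^-1 * (c t)^-1)).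
Proof.
move=> c0 dc; have := is_deriveV c0 dc.
have -> : - (c t) ^- 2 *: e = - e * ((c t)^-1 * (c t)^-1).
  by rewrite /GRing.scale/= -invfM -expr2; ring.
by [].
Qed.

Lemma class_C1d_inv m c : (forall t, c t != 0) -> class_C1d m c -> class_C1d m (fun t => (c t)^-1).
Proof.
move=> c0; elim: m => [|m IH] Cc.
  apply/class_C1d0 => t; apply: (@continuousV _ _ c t); [exact: c0|exact: class_C1d_continuous Cc t].
apply: (@class_C1dS_derive m (fun t => (c t)^-1) (fun t => - derive1 c t * ((c t)^-1 * (c t)^-1))).
  by move=> t; apply: is_derive_inv => //; exact: class_C1d_is_derive Cc.
have I := IH (class_C1d_le (leqnSn m) Cc).
apply: class_C1dM; last exact: class_C1dM.
have [_ _ C'] := (class_C1dS _ _).1 Cc.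
have := class_C1dM (class_C1d_cst m (-1)) C'; congr class_C1d.
by apply/funext => t; rewrite mulN1r.
Qed.

Lemma pd_increment_ge b G (m : R) s t u : class_C 1 setT G -> (forall x, m <= pd b G x) -> t <= u ->
  m * (u - t) <= G (pt b s u) - G (pt b s t).
Proof.
move=> CG mG tu; have [v [_ ->]] := pd_mvt b s t u CG.
by apply: ler_wpM2r => //; rewrite subr_ge0.
Qed.

(** A slope at least [m] forces a change of sign within |G(a, 0)| / m of height 0. The global lower
    bound gives a globally defined [c], with no neighbourhoods to manage. *)
Lemma implicit_exists b G (m : R) : class_C 1 setT G -> 0 < m -> (forall x, m <= pd b G x) ->
  exists c, forall a, G (pt b a (c a)) = 0.
Proof.
move=> CG m0 mG; suff H a : exists t, G (pt b a t) = 0 by have [c Hc] := choice H; exists c.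
have [t _ ?] : exists2 t, t \in `[- (`|G (pt b a 0)| / m), `|G (pt b a 0)| / m] & G (pt b a t) = 0.
  have n0 : 0 <= `|G (pt b a 0)| / m by rewrite divr_ge0// ltW.
  have h1 := pd_increment_ge a CG mG n0.
  have h2 : m * (0 - - (`|G (pt b a 0)| / m)) <= G (pt b a 0) - G (pt b a (- (`|G (pt b a 0)| / m))).
    by apply: pd_increment_ge => //; rewrite oppr_le0.
  rewrite subr0 mulrC divfK ?gt_eqF// in h1; rewrite sub0r opprK mulrC divfK ?gt_eqF// in h2.
  have ab := ler_norm (G (pt b a 0)); have ab' := ler_norm (- G (pt b a 0)).
  rewrite normrN in ab'.
  apply: IVT; first by lra.
    by apply: continuous_subspaceT; apply: continuous_line; exact: class_C_continuous CG.
  by rewrite ge_min le_max; apply/andP; split; apply/orP; [left|right]; lra.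
by exists t.
Qed.

Lemma implicit_sign b G (m : R) c : class_C 1 setT G -> 0 < m -> (forall x, m <= pd b G x) ->
  (forall a, G (pt b a (c a)) = 0) -> forall x,
  [/\ m * `|tau b c x| <= `|G x|, tau b c x < 0 -> G x < 0 & 0 < tau b c x -> 0 < G x].
Proof.
move=> CG m0 mG Gc x; rewrite /tau; set a := co (~~ b) x.
have xE : pt b a (co b x) = x by exact: pt_co.
have [h|h] := leP (c a) (co b x).
  have := pd_increment_ge a CG mG h; rewrite xE Gc subr0 => h1.
  have t0 : 0 <= co b x - c a by rewrite subr_ge0.
  have G0 : 0 <= G x by apply: le_trans h1; rewrite mulr_ge0// ltW.
  rewrite !ger0_norm//; split => //; first by lra.
  by move=> t1; apply: lt_le_trans h1; rewrite mulr_gt0.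
have := pd_increment_ge a CG mG (ltW h); rewrite xE Gc sub0r => h1.
have t0 : co b x - c a < 0 by rewrite subr_lt0.
have G0 : G x < 0 by rewrite -oppr_gt0; apply: lt_le_trans h1; rewrite mulr_gt0// subr_gt0.
rewrite !ltr0_norm// opprB; split => //; lra.
Qed.

Lemma implicit_continuous b G (m : R) c : class_C 1 setT G -> 0 < m -> (forall x, m <= pd b G x) ->
  (forall a, G (pt b a (c a)) = 0) -> continuous c.
Proof.
move=> CG m0 mG Gc a; apply/cvgrPdist_le => e e0.
have cg : {for a, continuous (fun a' => G (pt b a' (c a)))}.
  have := @continuous_line R (~~ b) G (c a) (class_C_continuous CG) a.
  by case: (b).
have em : 0 < m * e by exact: mulr_gt0.
have := cg; rewrite /prop_for /continuous_at /= Gc => /cvgrPdist_le/(_ _ em); apply: filterS => a'.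
rewrite sub0r normrN => h; have [+ _ _] := implicit_sign CG m0 mG Gc (pt b a' (c a)).
rewrite /tau co_pt co_ptN => h2.
by rewrite -(ler_pM2l m0); exact: le_trans h2 h.
Qed.

Lemma implicit_is_derive b G (m : R) c a : class_C 1 setT G -> 0 < m -> (forall x, m <= pd b G x) ->
  (forall a, G (pt b a (c a)) = 0) ->
  is_derive a 1 c (- pd (~~ b) G (pt b a (c a)) * (pd b G (pt b a (c a)))^-1).
Proof.
move=> CG m0 mG Gc; have cc := implicit_continuous CG m0 mG Gc.
set p := pt b a (c a); set A := pd (~~ b) G p; set B := pd b G p.
apply: is_derive_small_o => e e0.
have B0 : 0 < B by exact: lt_le_trans (mG p).
set C := `|A| + B + 1; have C0 : 0 < C by rewrite /C; have := normr_ge0 A; lra.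
(* The two difference quotients differ by (A (B' - B) - B (A' - A)) / (B B'), which is at most e1 C
   / m^2. *)
pose e1 := e * (m * m) / C.
have e10 : 0 < e1 by rewrite divr_gt0// mulr_gt0// mulr_gt0.
have cpd d : continuous (pd d G) by apply: class_C_continuous; exact: class_C_pd CG.
have nb d : nbhs p [set q | `|pd d G q - pd d G p| <= e1].
  have /cvgrPdist_le/(_ e1 e10) := cpd d p; apply: filterS => q /=; by rewrite distrC.
have [r r0 hr] := nbhs_sqbox_sub (filterI (nb b) (nb (~~ b))).
have [r1 r10 hr1] : exists2 r1, 0 < r1 & forall a', `|a' - a| <= r1 -> `|c a' - c a| <= r.
  have /cvgrPdist_le/(_ r r0)/nbhs_ballP[r2 /= r20 h] := cc a.
  exists (r2 / 2); first by rewrite divr_gt0.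
  move=> a' aa; rewrite distrC; apply: h; rewrite /ball/= distrC.
  by apply: le_lt_trans aa _; lra.
exists (Num.min r r1); first by rewrite lt_min r0.
move=> a'; rewrite le_min => /andP[ar ar1]; have cr := hr1 _ ar1.
have [v [v1 E1]] := pd_mvt b a' (c a) (c a') CG.
have [w [w1 E2]] := pd_mvt (~~ b) (c a) a a' CG.
have E12 : pt (~~ b) (c a) a' = pt b a' (c a) /\ pt (~~ b) (c a) a = p by rewrite /p; case: (b).
rewrite !(proj1 E12) (proj2 E12) in E1 E2; rewrite Gc sub0r in E1; rewrite {1}/p Gc subr0 in E2.
set B' := pd b G _ in E1; set A' := pd (~~ b) G _ in E2.
have sB : sqbox p r (pt b a' v).
  by rewrite /p /sqbox /pt; case: (b) => /=; split => //; exact: le_trans v1 cr.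
have sA : sqbox p r (pt (~~ b) (c a) w).
  by rewrite /p /sqbox /pt; case: (b) => /=; split; rewrite ?subrr ?normr0 ?(ltW r0)//; exact: le_trans w1 ar.
have [hB _] := hr _ sB; have [_ hA] := hr _ sA.
rewrite /= -/B' -/B in hB; rewrite /= -/A' -/A in hA.
have mB : m <= B by exact: mG.
have mB' : m <= B' by exact: mG.
have B'0 : 0 < B' by exact: lt_le_trans mB'.
have -> : c a' - c a = - (A' / B') * (a' - a).
  have : B' * (c a' - c a) = - (A' * (a' - a)) by rewrite -E2 -E1.
  move=> /(congr1 (fun t => B'^-1 * t)); rewrite mulKf ?gt_eqF// => ->; ring.
have -> : - (A' / B') * (a' - a) - (a' - a) * (- A * B^-1) =
   (A * (B' - B) - B * (A' - A)) / (B * B') * (a' - a) by field; rewrite !gt_eqF.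
rewrite normrM; apply: ler_wpM2r => //.
rewrite normrM normfV [`|B * B'|]gtr0_norm ?mulr_gt0// ler_pdivrMr ?mulr_gt0//.
apply: (@le_trans _ _ (e1 * C)).
  have nB (s1 s2 l1 l2 : R) : 0 < l1 -> `|s1 * s2 - l1 * l2| <= `|s1| * `|s2| + l1 * `|l2|.
    by move=> l10; rewrite (le_trans (ler_normB _ _))// !normrM (gtr0_norm l10).
  apply: (le_trans (nB _ _ _ _ B0)); rewrite /C.
  have := ler_wpM2l (normr_ge0 A) hB; have := ler_wpM2l (ltW B0) hA => k1 k2.
  apply: (le_trans (lerD k2 k1)); rewrite -subr_ge0.
  have alg (f1 f2 f3 : R) : f1 * (f2 + f3 + 1) - (f2 * f1 + f3 * f1) = f1 by ring.
  by rewrite alg; exact: ltW.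
rewrite /e1 divfK ?gt_eqF//; apply: ler_wpM2l; first exact: ltW.
by apply: ler_pM => //; exact: ltW.
Qed.

(** The formula for the derivative of [c] involves [c] itself, composed with derivatives of [G]:
    each pass through it gains one order. *)
Lemma implicit_class_C1d n b G (m : R) c : class_C n.+1 setT G -> 0 < m -> (forall x, m <= pd b G x) ->
  (forall a, G (pt b a (c a)) = 0) -> class_C1d n.+1 c.
Proof.
move=> CG m0 mG Gc; have C1 : class_C 1 setT G by exact: class_C_le CG.
have H j : (j <= n.+1)%N -> class_C1d j c.
  elim: j => [_|j IH jk]; first by apply/class_C1d0; exact: implicit_continuous C1 m0 mG Gc.
  apply: class_C1dS_derive => [a|]; first exact: implicit_is_derive C1 m0 mG Gc.
  have Cj := IH (ltnW jk).
  have CA d : class_C1d j (fun a => pd d G (pt b a (c a))).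
    by apply: class_C1d_graph => //; apply: (@class_C_le R n j) => //; exact: class_C_pd.
  apply: class_C1dM; last first.
    by apply: class_C1d_inv => // t; rewrite gt_eqF//; exact: lt_le_trans (mG _).
  have := class_C1dM (class_C1d_cst j (-1)) (CA (~~ b)); congr class_C1d.
  by apply/funext => t; rewrite mulN1r.
exact: H.
Qed.

Local Opaque step.

Lemma derive1_plateau1 M a r t : 0 < r -> (forall t, `|derive1 (@step R) t| <= M) ->
  exists2 e, is_derive t 1 (plateau1 a r) e & `|e| <= 2 * M / r.
Proof.
move=> r0 hM.
have ds (u : R) : is_derive u 1 (@step R) (derive1 step u) by exact: class_C1d_is_derive (class_C1d_step 1).
have aff (e : R) : is_derive t 1 (fun t => 2 + e * (t - a)) e.
  have := is_deriveD (is_derive_cst (2 - e * a) t 1) (is_deriveZ e (is_derive_id t 1)).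
  rewrite add0r /GRing.scale/= mulr1; congr is_derive.
  apply/funext => u; change (2 - e * a + e * u = 2 + e * (u - a)); ring.
have d1 (e : R) : is_derive t 1 (fun t => step (2 + e * (t - a))) (derive1 step (2 + e * (t - a)) * e).
  have := @is_derive1_comp R (@step R) (fun t => 2 + e * (t - a)) t _ _ (ds _) (aff e).
  by [].
have E : plateau1 a r = fun t => step (2 + (- r^-1) * (t - a)) * step (2 + r^-1 * (t - a)).
  by apply/funext => u; rewrite /plateau1 mulNr ![r^-1 * _]mulrC.
rewrite E; eexists; first exact: is_derive1M (d1 _) (d1 _).
have s1 u : `|step u| <= 1 :> R by rewrite (ger0_norm (step_ge0 u)); exact: step_le1.
have rV : 0 <= r^-1 by rewrite invr_ge0 ltW.
have M0 : 0 <= M by exact: le_trans (hM 0).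
have bnd (e1 e2 u1 u2 : R) : `|e1| <= M -> `|e2| <= M -> `|u1| <= 1 -> `|u2| <= 1 ->
    `|e1 * - r^-1 * u2 + u1 * (e2 * r^-1)| <= 2 * M / r.
  move=> h1 h2 h3 h4; apply: (le_trans (ler_normD _ _)); rewrite !normrM normrN (ger0_norm rV).
  have -> : 2 * M / r = M / r * 1 + 1 * (M / r) by field; exact: lt0r_neq0.
  apply: lerD; apply: ler_pM.
  - by rewrite mulr_ge0.
  - exact: normr_ge0.
  - exact: ler_wpM2r.
  - exact: h4.
  - exact: normr_ge0.
  - by rewrite mulr_ge0.
  - exact: h3.
  - exact: ler_wpM2r.
exact: (bnd _ _ _ _ (hM _) (hM _) (s1 _) (s1 _)).
Qed.

Lemma pd_plateau_bound M b p r x : 0 < r -> (forall t, `|derive1 (@step R) t| <= M) ->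
  `|pd b (plateau p r) x| <= 2 * M / r.
Proof.
move=> r0 hM.
have [e de he] := derive1_plateau1 (co b p) (co b x) r0 hM.
have -> : pd b (plateau p r) x = e * plateau1 (co (~~ b) p) r (co (~~ b) x).
  apply: is_pdE; apply/is_pd_line.
  have -> : line b x (plateau p r) = fun t => plateau1 (co b p) r t * plateau1 (co (~~ b) p) r (co (~~ b) x).
    by apply/funext => t; rewrite /line /plateau; case: (b); [exact: mulrC|].
  have M1 (u : R -> R) (t d k : R) : is_derive t 1 u d -> is_derive t 1 (fun s => u s * k) (d * k).
    by move=> du; have := is_derive1M du (is_derive_cst k t 1); rewrite mulr0 addr0.
  exact: M1 de.
rewrite normrM -[leRHS]mulr1; apply: ler_pM.
- exact: normr_ge0.
- exact: normr_ge0.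
- exact: he.
- by rewrite (ger0_norm (plateau1_ge0 _ _ _)); exact: plateau1_le1.
Qed.

Lemma sqbox_increment U h q r e x : class_C 1 U h -> sqbox q r `<=` U ->
  (forall d x, sqbox q r x -> `|pd d h x| <= e) -> sqbox q r x ->
  `|h x - h q| <= e * (`|x.1 - q.1| + `|x.2 - q.2|).
Proof.
move=> Ch qU he [x1 x2]; have r0 : 0 <= r by exact: le_trans (normr_ge0 _) x1.
have dh y d : sqbox q r y -> derivable h y (dir d) by move=> /qU; exact: class_C_derivable Ch.
have [v [v1 E1]] : exists v : R, `|v - q.2| <= `|x.2 - q.2| /\
    h (pt true x.1 x.2) - h (pt true x.1 q.2) = pd true h (pt true x.1 v) * (x.2 - q.2).
  by apply: pd_mvt_on => v vv; apply: dh; split => //=; exact: le_trans vv x2.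
have [w [w1 E2]] : exists v : R, `|v - q.1| <= `|x.1 - q.1| /\
    h (pt false q.2 x.1) - h (pt false q.2 q.1) = pd false h (pt false q.2 v) * (x.1 - q.1).
  by apply: pd_mvt_on => v' vv; apply: dh; split => /=; [exact: le_trans vv x1|rewrite subrr normr0].
have -> : h x - h q = h (x.1, x.2) - h (x.1, q.2) + (h (x.1, q.2) - h (q.1, q.2)).
  by rewrite addrA subrK; case: (x); case: (q).
rewrite E1 E2 addrC [leRHS]mulrDr; apply: (le_trans (ler_normD _ _)); rewrite !normrM.
apply: lerD; apply: ler_wpM2r => //; apply: he; split => //=.
- exact: le_trans w1 x1.
- by rewrite subrr normr0.
- exact: le_trans v1 x2.
Qed.

(* Near q, G is h itself; elsewhere it is the linear part of h at q, whence the global bound from below. *)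
Lemma blend U h q b : open U -> class_C 4 U h -> U q -> h q = 0 -> 0 < pd b h q ->
  exists G (m : R), [/\ class_C 4 setT G, 0 < m, forall x, m <= pd b G x & \near q, G q = h q].
Proof.
move=> oU Ch Uq h0 b0; set be := pd b h q; set al := pd (~~ b) h q.
pose L x := be * (co b x - co b q) + al * (co (~~ b) x - co (~~ b) q).
have CL m : class_C m setT L.
  by apply: class_CD; [exact: openT| |]; (apply: class_CZ; [exact: openT|]; apply: class_CB; [exact: openT|exact: class_C_co|exact: class_C_cst]).
have pL d x : pd d L x = pd d h q.
  have := @is_pdD R d _ _ x _ _ (is_deriveZ be (is_deriveB (is_pd_co d b x) (is_pd_cst d (co b q) x)))
    (is_deriveZ al (is_deriveB (is_pd_co d (~~ b) x) (is_pd_cst d (co (~~ b) q) x))).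
  move=> /is_pdE; rewrite /L => ->; rewrite /GRing.scale/= !subr0 /be /al.
  have K (k : bool -> R) (i j : bool) : k i * (if j == i then 1 else 0) + k (~~ i) * (if j == ~~ i then 1 else 0) = k j.
    by case: i; case: j; rewrite /= ?mulr1 ?mulr0 ?addr0 ?add0r.
  exact: (K (fun i => pd i h q)).
pose k x := h x - L x.
have Ck : class_C 4 U k by exact: (class_CB oU Ch (class_C_sub (@subsetT _ U) (CL 4%N))).
have k0 : k q = 0 by rewrite /k h0 /L !subrr !mulr0 addr0 subr0.
have pk d x : U x -> pd d k x = pd d h x - pd d h q.
  move=> Ux; rewrite /k pdB ?pL//; first exact: class_C_derivable Ch Ux.
  exact: class_C_derivable (CL 1%N) Logic.I.
have [M M0 hM] := @derive1_step_bounded R.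
(* With r0 = 2 r, the plateau has slope at most 2 M / r and |k| <= 2 e r0 on the square, so the
   perturbation of the slope is at most (8 M + 1) e, half of [be]. *)
pose e := be / (2 * (8 * M + 1)).
have e0 : 0 < e by rewrite divr_gt0// mulr_gt0//; lra.
have nb : nbhs q [set x | U x /\ forall d, `|pd d k x| <= e].
  have n1 d : nbhs q [set x | `|pd d h x - pd d h q| <= e].
    have /class_CS[_ _ /(_ d)/(class_C_le (leq0n 3))/class_C0/(_ q Uq) cd] := Ch.
    have N (f : R * R -> R) : {for q, continuous f} -> nbhs q [set x | `|f x - f q| <= e].
      by move=> /cvgrPdist_le/(_ _ e0); apply: filterS => x; rewrite /= distrC.
    exact: (N _ cd).
  have nU : nbhs q U by exact: open_nbhs_nbhs.
  apply: (filterS _ (filterI nU (filterI (n1 false) (n1 true)))).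
  by move=> x [Ux [h1 h2]]; split; [exact: Ux|case; rewrite (pk _ _ Ux); [exact: h2|exact: h1]].
have [r0 r00 hr0] := nbhs_sqbox_sub nb.
pose r := r0 / 2; have rp : 0 < r by rewrite divr_gt0.
have r2 : 2 * r = r0 by rewrite /r; field.
have chi0 : zero_off (sqbox q r0) (plateau q r) by rewrite -r2; exact: plateau_zero_off.
have qU : sqbox q r0 `<=` U by move=> x /hr0[].
have Cpk := class_C_mul_cutoff oU (@compact_sqbox R q r0) qU (@class_C_plateau R 4 q r) chi0 Ck.
exists (fun x => L x + plateau q r x * k x), (be / 2); split.
- exact: (class_CD openT (CL 4%N) Cpk).
- by rewrite divr_gt0.
- move=> x; rewrite pdD; [|exact: class_C_derivable (CL 1%N) Logic.I|exact: class_C_derivable Cpk Logic.I].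
  rewrite pL -/be; suff : `|pd b (fun x => plateau q r x * k x) x| <= be / 2.
    by rewrite ler_norml => /andP[]; lra.
  have [xr|nx] := pselect (sqbox q r0 x); last first.
    rewrite (@zero_off_pd R (sqbox q r0) b _ _ _ x nx) ?normr0; first by rewrite divr_ge0// ltW.
      exact: (compact_closed2 (@compact_sqbox R q r0)).
    by move=> y /chi0 ->; rewrite mul0r.
  have Ux := qU x xr.
  have C1k : class_C 1 U k by exact: class_C_le Ck.
  rewrite pdM; [|exact: class_C_derivable (@class_C_plateau R 1 q r) Logic.I|exact: class_C_derivable C1k Ux].
  have kx : `|k x| <= e * (r0 + r0).
    have := @sqbox_increment U k q r0 e x C1k qU _ xr; rewrite k0 subr0 => h1.
    apply: (le_trans (h1 _)); first by move=> d y /hr0[].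
    by case: xr => x1 x2; apply: ler_wpM2l; [exact: ltW|exact: lerD].
  have pkx : `|pd b k x| <= e by have [] := hr0 x xr.
  have ppx := @pd_plateau_bound M b q r x rp hM.
  apply: (le_trans (ler_normD _ _)); rewrite (normrM (pd b (plateau q r) x)) (normrM (plateau q r x)).
  have -> : be / 2 = 2 * M / r * (e * (r0 + r0)) + 1 * e.
    have be_e : be = e * (2 * (8 * M + 1)) by rewrite /e divfK// gt_eqF// mulr_gt0//; lra.
    by rewrite be_e -r2; field; exact: lt0r_neq0.
  apply: lerD; first exact: ler_pM.
  by apply: ler_pM => //; rewrite ger0_norm ?plateau_ge0// plateau_le1.
- apply: filterS (nbhs_sqbox q rp) => x xr; rewrite plateau_eq1// mul1r /k; ring.
Qed.

(** Besides the chart itself, the bound of |tau| by |g| / m is recorded: it converts orders of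
    vanishing at the graph into orders in [g]. *)
Lemma local_graph U g q : open U -> class_C 4 U g -> U q -> g q = 0 -> 0 < norm2 (grad g q) ->
  exists b c sg (m : R), [/\ class_C1d 4 c, sg * sg = 1, 0 < m &
    \forall x \near q, [/\ U x, (g x < 0 <-> epi b c sg x), m * `|tau b c x| <= `|g x| &
      (g x = 0 <-> tau b c x = 0)]].
Proof.
move=> oU Cg Uq g0 gr.
have [b nb] : exists b, pd b g q != 0.
  apply: contrapT => H; move: gr; rewrite /norm2 /grad /=.
  have z d : pd d g q = 0 by apply/eqP/negPn/negP => ?; apply: H; exists d.
  by rewrite !z expr0n addr0 sqrtr0 ltxx.
pose sg : R := if 0 < pd b g q then 1 else - 1.
have sg2 : sg * sg = 1 by rewrite /sg; case: ifP => _; rewrite ?mulr1// mulrNN mulr1.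
have Ch : class_C 4 U (fun x => sg * g x) by exact: class_CZ.
have ph : pd b (fun x => sg * g x) q = sg * pd b g q.
  have := is_deriveZ sg (derivable_pd (class_C_derivable Cg Uq : derivable g q (dir b))).
  by move=> /is_pdE.
have h0 : sg * g q = 0 by rewrite g0 mulr0.
have hp : 0 < pd b (fun x => sg * g x) q.
  rewrite ph /sg; case: ifPn; first by rewrite mul1r.
  by rewrite -leNgt le_eqVlt (negbTE nb)/= mulN1r oppr_gt0.
have [G [m [CG m0 mG Gh]]] := blend oU Ch Uq h0 hp.
have C1 : class_C 1 setT G by exact: class_C_le CG.
have [c Gc] := implicit_exists C1 m0 mG.
(* [sg] makes [sg] times g increase along [b], so the side {g < 0} is that of - sg. *)
exists b, c, (- sg), m; split => //.
- exact: implicit_class_C1d CG m0 mG Gc.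
- by rewrite mulrNN.
have nU : nbhs q U by exact: open_nbhs_nbhs.
apply: (filterS _ (filterI nU Gh)) => x [Ux /= Gx].
have [h1 h2 h3] := implicit_sign C1 m0 mG Gc x.
have gx : g x = sg * G x by rewrite Gx mulrA sg2 mul1r.
have ng : `|g x| = `|G x|.
  by rewrite gx normrM /sg; case: ifP; rewrite ?normr1 ?normrN1 mul1r.
have t0 : tau b c x = 0 -> G x = 0.
  rewrite /tau => /eqP; rewrite subr_eq0 => /eqP t0.
  by have := Gc (co (~~ b) x); rewrite -t0 pt_co.
have tri : [\/ tau b c x < 0 /\ G x < 0, tau b c x = 0 /\ G x = 0 | 0 < tau b c x /\ 0 < G x].
  have [lt|] := ltP (tau b c x) 0; first by constructor 1; split => //; exact: h2.
  rewrite le_eqVlt => /orP[/eqP/esym e|lt]; first by constructor 2; split; [exact: e|exact: t0].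
  by constructor 3; split => //; exact: h3.
split => //; last 2 first.
- by rewrite ng.
- rewrite gx; split => [/eqP|/t0 ->]; last by rewrite mulr0.
  rewrite mulf_eq0 => /orP[/eqP z|/eqP z]; first by move: sg2; rewrite z mul0r => /esym/eqP; rewrite oner_eq0.
  by case: tri => -[h4 h5] //; move: h5; rewrite z ltxx.
rewrite gx /epi/= /sg; clear -tri; case: ifP => _; case: tri => -[? ?]; split; nra.
Qed.

End implicit.

(** * Connectedness in the plane *)

Section connected_sets.
Context {R : realType}.
Implicit Types (f g h k : R * R -> R) (A B U V K : set (R * R)) (x y p q : R * R)
  (b d : bool) (m n : nat) (c : R -> R) (s t r e a : R) (I J : set R).

Lemma continuous_pt_r b t : continuous (fun s => pt b s t).
Proof.
move=> s; case: b; rewrite /pt.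
  exact: (@cvg_pair _ _ _ (nbhs s) (nbhs s) (nbhs t) _ _ _ _ _ (@cvg_id _ (nbhs s)) (@cvg_cst _ t _ (nbhs s) _)).
exact: (@cvg_pair _ _ _ (nbhs s) (nbhs t) (nbhs s) _ _ _ _ _ (@cvg_cst _ t _ (nbhs s) _) (@cvg_id _ (nbhs s))).
Qed.

Lemma connected_product b I J : connected I -> connected J ->
  connected [set x : R * R | I (co (~~ b) x) /\ J (co b x)].
Proof.
move=> cI cJ; set A := [set x | _].
have [->|/set0P[p [Ip Jp]]] := eqVneq A set0.
  by move=> B B0 [C _ E] _; move: B0; rewrite E set0I => -[].
suff -> : A = connected_component A p by exact: component_connected.
apply/seteqP; split; last exact: connected_component_sub.
move=> x [Ix Jx].
pose C1 := [set pt b (co (~~ b) p) t | t in J]; pose C2 := [set pt b s (co b x) | s in I].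
have cC : connected (C1 `|` C2).
  apply: connectedU.
  - exists (pt b (co (~~ b) p) (co b x)); split; first by exists (co b x).
    by exists (co (~~ b) p).
  - by apply: connected_continuous_connected => //; apply: continuous_subspaceT; exact: continuous_pt.
  - by apply: connected_continuous_connected => //; apply: continuous_subspaceT; exact: continuous_pt_r.
apply: (connected_component_max _ _ cC).
- by left; exists (co b p) => //; exact: pt_co.
- move=> y [[t Jt <-]|[s Is <-]]; rewrite /A/= co_pt co_ptN//.
- by right; exists (co (~~ b) x) => //; exact: pt_co.
Qed.

Lemma connected_sqbox p r : connected (sqbox p r).
Proof.
rewrite (_ : sqbox p r = [set x | [set` `[p.1 - r, p.1 + r]] (co (~~ true) x) /\
  [set` `[p.2 - r, p.2 + r]] (co true x)]); last first.
  apply/seteqP; split => x; rewrite /sqbox /= !in_itv/= => -[h1 h2].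
    by split; apply/andP; split; move: h1 h2; rewrite !ler_norml => /andP[? ?] /andP[? ?]; lra.
  by split; rewrite ler_norml; apply/andP; split; move: h1 h2 => /andP[? ?] /andP[? ?]; lra.
by apply: connected_product; apply/connected_intervalP; exact: interval_is_interval.
Qed.

Lemma connectedT_plane : connected (setT : set (R * R)).
Proof.
rewrite (_ : setT = [set x : R * R | (setT : set R) (co (~~ true) x) /\ (setT : set R) (co true x)]); last first.
  by apply/seteqP; split.
by apply: connected_product; apply/connected_intervalP.
Qed.

Lemma open_component A x : open A -> open (connected_component A x).
Proof.
move=> oA; rewrite openE => y Cy; have Ay : A y by exact: connected_component_sub Cy.
have [r r0 rA] := nbhs_sqbox_sub (open_nbhs_nbhs (conj oA Ay)).
apply: filterS (nbhs_sqbox y r0) => w wr.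
rewrite (same_connected_component Cy).
apply: (connected_component_max _ rA (@connected_sqbox y r)) => //.
by split; rewrite subrr normr0 ltW.
Qed.

(** Without boundary the set would be open and closed, hence the whole plane, which is unbounded. *)
Lemma bdry_nonempty A : open A -> A !=set0 -> A !=set0 -> bounded_set A -> bdry A !=set0.
Proof.
move=> oA A0 _ [M [Mr hM]]; apply: contrapT => nb.
have clA : closure A = A.
  apply/seteqP; split; last exact: subset_closure.
  move=> x cx; apply: contrapT => nA; apply: nb; exists x; split => //.
  by rewrite (interior_id A).1.
have AT : A = setT.
  apply: connectedT_plane => //; exists A; rewrite ?setTI//.
  by rewrite -clA; exact: closed_closure.
have /= := hM (`|M| + 1); rewrite ltr_pwDr ?ler_norm// => /(_ isT (`|M| + 2, 0)).
rewrite AT => /(_ Logic.I); rewrite prod_normE/= normr0 ge_max => /andP[+ _].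
by rewrite ger0_norm ?addr_ge0// lerD2l leNgt ltr1n.
Qed.

Lemma within_closure_le0 A B h q : {within A, continuous h} -> B `<=` A -> A q -> closure B q ->
  (forall x, B x -> h x <= 0) -> h q <= 0.
Proof.
move=> /subspace_continuousP ch BA Aq clq hB; rewrite leNgt; apply/negP => h0.
have N : nbhs q [set x | A x -> 0 < h x].
  exact: (ch q Aq _ (open_nbhs_nbhs (conj (@open_gt _ 0) h0))).
by have [x [Bx /(_ (BA _ Bx))]] := clq _ N; rewrite ltNge hB.
Qed.

Lemma within_closure_eq A h f q : {within closure A, continuous h} -> {within closure A, continuous f} ->
  (forall x, A x -> h x = f x) -> closure A q -> h q = f q.
Proof.
move=> /subspace_continuousP ch /subspace_continuousP cf E clq.
apply/eqP; rewrite -subr_eq0; apply/negPn/negP => ne.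
have cv := cvgB (ch q clq) (cf q clq).
have N : nbhs q [set x | closure A x -> h x - f x != 0].
  have oN : open [set r : R | r != 0].
    rewrite (_ : [set r | _] = ~` [set 0]); first by rewrite openC; exact: closed_eq.
    by apply/seteqP; split => r /= /eqP.
  exact: (cv _ _ (open_nbhs_nbhs (conj oN ne))).
have [x [Ax /(_ (subset_closure Ax))]] := clq _ N.
by rewrite E// subrr eqxx.
Qed.

Lemma connected_strip b c sg a0 r e : continuous c -> sg * sg = 1 ->
  connected [set x | `|co (~~ b) x - a0| < r /\ 0 < sg * tau b c x < e].
Proof.
move=> cc sg2; set A := [set x | _].
have -> : A = (fun y => pt b (co (~~ b) y) (sg * co b y + c (co (~~ b) y))) @`
    [set y | [set s | `|s - a0| < r] (co (~~ b) y) /\ [set t | 0 < t < e] (co b y)].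
  apply/seteqP; split => [x [h1 h2]|_ [y [/= h1 h2] <-]].
    exists (pt b (co (~~ b) x) (sg * tau b c x)); first by rewrite /= co_pt co_ptN.
    by rewrite co_pt co_ptN mulrA sg2 mul1r /tau subrK pt_co.
  by rewrite /A/= /tau co_pt co_ptN addrK mulrA sg2 mul1r.
apply: connected_continuous_connected.
  apply: connected_product; apply/connected_intervalP => x y /=.
    rewrite !ltr_norml => /andP[? ?] /andP[? ?] z /andP[? ?].
    by rewrite ltr_norml; apply/andP; split; lra.
  by move=> /andP[? ?] /andP[? ?] z /andP[? ?]; apply/andP; split; lra.
apply: continuous_subspaceT => y.
have c1 : {for y, continuous (fun y => sg * co b y + c (co (~~ b) y))}.
  apply: (@continuousD _ _ _ (fun y => sg * co b y) (fun y => c (co (~~ b) y)) y).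
    by apply: (@continuousM _ _ (fun=> sg) (co b) y); [exact: cst_continuous|exact: continuous_co].
  by apply: (@continuous_comp _ _ _ (co (~~ b)) c); [exact: continuous_co|exact: cc].
have c0 : {for y, continuous (co (~~ b))} by exact: continuous_co.
move: c0 c1; rewrite /pt; case: (b) => c0 c1.
  exact: (@cvg_pair _ _ _ (nbhs y) (nbhs y.1) (nbhs (sg * y.2 + c y.1)) _ _ _ _ _ c0 c1).
exact: (@cvg_pair _ _ _ (nbhs y) (nbhs (sg * y.1 + c y.2)) (nbhs y.2) _ _ _ _ _ c1 c0).
Qed.

End connected_sets.

(** * The domain Omega_g and its boundary *)

Section domain.
Context {R : realType} (D : set (R * R)) (x0 : R * R) (g : R * R -> R).
Context (oD : open D) (bD : bounded_set D) (CgD : class_C_closure 4 D g)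
  (gr : forall x, D x -> g x = 0 -> 0 < norm2 (grad g x))
  (gb : forall x, bdry D x -> 0 < g x)
  (bO : bdry (Omega D x0 g) = [set x | D x /\ g x = 0]).
Implicit Types (A B U V K : set (R * R)) (x y p q : R * R) (b d : bool) (c : R -> R) (s t r e a : R).
Local Notation Om := (Omega D x0 g).
Local Notation S := [set x | D x /\ g x < 0].
Local Notation G := [set x | D x /\ g x = 0].

Lemma Cg : class_C 4 D g. Proof. by case: CgD. Qed.

Lemma g_continuous x : D x -> {for x, continuous g}.
Proof. by have /(class_C_le (leq0n 4))/class_C0 := Cg; apply. Qed.

Lemma local_graphD q : D q -> g q = 0 -> exists b c sg (m : R), [/\ class_C1d 4 c, sg * sg = 1, 0 < m &
    \forall x \near q, [/\ D x, (g x < 0 <-> epi b c sg x), m * `|tau b c x| <= `|g x| &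
      (g x = 0 <-> tau b c x = 0)]].
Proof. by move=> Dq gq; exact: local_graph oD Cg Dq gq (gr Dq gq). Qed.

Lemma open_sublevel : open S.
Proof.
rewrite openE => x [Dx gx]; apply: (filterS _ (filterI (open_nbhs_nbhs (conj oD Dx)) _)); last first.
  exact: (g_continuous Dx (open_nbhs_nbhs (conj (@open_lt _ 0) gx))).
by move=> y [].
Qed.

Lemma interior_sublevel : [set x | D x /\ g x <= 0]° = S.
Proof.
apply/seteqP; split => x.
  move=> ix; have [Dx] := interior_subset ix; rewrite le_eqVlt => /orP[/eqP gx|//].
  have [b [c [sg [m [Cc sg2 m0 nx]]]]] := local_graphD Dx gx.
  have [r r00 hr] := nbhs_sqbox_sub (filterI ix nx).
  have tx : tau b c x = 0.
    by have [_ [_ _ _ [+ _]]] := nbhs_singleton (filterI ix nx); apply.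
  (* A point displaced to the side where g cannot be negative: if [x] were interior to {g <= 0},
     then g would vanish at [y], off the graph. *)
  pose y := pt b (co (~~ b) x) (co b x - sg * r).
  have sg1 : `|sg| = 1 by apply/eqP; rewrite -(@pexpr_eq1 _ _ 2)// -normrX expr2 sg2 normr1.
  have ty : sg * tau b c y = - r.
    rewrite /y /tau co_pt co_ptN.
    have -> : co b x - sg * r - c (co (~~ b) x) = tau b c x - sg * r by rewrite /tau; ring.
    by rewrite tx sub0r mulrN mulrA sg2 mul1r.
  have yr : sqbox x r y.
    have e : `|co b x - sg * r - co b x| <= r.
      by rewrite addrAC subrr sub0r normrN normrM sg1 mul1r gtr0_norm.
    by rewrite /y /sqbox /pt; move: e; case: (b) => /= e; rewrite subrr normr0 (ltW r00).
  have [[_ gy] [_ [_ h1] _ [h2 _]]] := hr y yr.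
  move: gy; rewrite le_eqVlt => /orP[/eqP/h2 z|gy].
    by move: ty; rewrite z mulr0 => /eqP; rewrite eq_sym oppr_eq0 gt_eqF.
  have [_ [+ _] _ _] : [/\ D y, (g y < 0 <-> epi b c sg y), m * `|tau b c y| <= `|g y| &
      (g y = 0 <-> tau b c y = 0)] by have [] := hr y yr.
  by move=> /(_ gy); rewrite /epi/= ty oppr_gt0 ltNge (ltW r00).
move=> Sx; apply: filterS (open_nbhs_nbhs (conj open_sublevel Sx)) => y [Dy gy].
by split => //; exact: ltW.
Qed.

(** Positivity of g on the boundary of [D] keeps [q] inside [D]; if g were negative at [q], a whole
    square around [q] would be absorbed by the component. *)
Lemma sublevel_bdry_component x q : S x -> bdry (connected_component S x) q -> G q.
Proof.
move=> Sx [clq niq]; set C := connected_component S x in clq niq.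
have CS : C `<=` S by exact: connected_component_sub.
have clD : closure D q by apply: closure_subset clq => y /CS[].
have [_ gc _] := CgD.
have CD : C `<=` closure D by move=> y /CS[Dy _]; exact: subset_closure.
have gq : g q <= 0 by apply: (within_closure_le0 gc CD clD clq) => y /CS[_ /ltW].
have Dq : D q.
  apply: contrapT => nD; have : bdry D q by split => //; rewrite (interior_id D).1.
  by move/gb; rewrite ltNge gq.
split => //; move: gq; rewrite le_eqVlt => /orP[/eqP//|gq]; exfalso.
have [r r00 rS] := nbhs_sqbox_sub (open_nbhs_nbhs (conj open_sublevel (conj Dq gq))).
have qr := nbhs_sqbox q r00.
have [y [Cy yr]] := clq _ qr; apply: niq; apply: filterS qr => w wr.
rewrite /C (same_connected_component Cy).
exact: (connected_component_max yr rS (@connected_sqbox R q r)).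
Qed.

(** A bounded component [C] of {g < 0} has a boundary point [q], where g = 0. By [bO] this [q] is
    also in the boundary of Omega_g. Near [q] the set {g < 0} is a strip above a graph, hence
    connected: it meets both [C] and Omega_g, so [C] is the component of a point of Omega_g and has
    [x0] on its boundary. *)
Lemma OmegaE : Om = S.
Proof.
have EO : Om = [set x | S x /\ bdry (connected_component S x) x0].
  by rewrite /Omega interior_sublevel.
apply/seteqP; split => [x|x Sx]; first by rewrite EO => -[].
rewrite EO; split => //; set C := connected_component S x.
have oC : open C by apply: open_component; exact: open_sublevel.
have Cx : C x by exact: connected_component_refl.
have CS : C `<=` S by exact: connected_component_sub.
have bC : bounded_set C.
  have [M [Mr hM]] := bD; exists M; split => // M' h y /CS[Dy _]; exact: hM.
have [q qC] := bdry_nonempty oC (ex_intro _ x Cx) (ex_intro _ x Cx) bC.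
have Gq := sublevel_bdry_component Sx qC; have [Dq gq] := Gq.
have qO : bdry Om q by rewrite bO.
have [b [c [sg [m [Cc sg2 m0 nq]]]]] := local_graphD Dq gq.
have tq : tau b c q = 0 by have [_ _ _ [+ _]] := nbhs_singleton nq; apply.
have [r r00 hr] := nbhs_sqbox_sub nq.
have cc := class_C1d_continuous Cc.
have [e e0 he] : exists2 e, 0 < e & forall s, `|s - co (~~ b) q| <= e -> `|c s - c (co (~~ b) q)| <= r / 2.
  have r2 : 0 < r / 2 by rewrite divr_gt0.
  have /cvgrPdist_le/(_ _ r2)/nbhs_ballP[e /= e0 h] := cc (co (~~ b) q).
  exists (e / 2); first by rewrite divr_gt0.
  move=> s se; rewrite distrC; apply: h; rewrite /ball/= distrC; lra.
have e'0 : 0 < Num.min e r by rewrite lt_min e0.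
(* [P] is a curvilinear rectangle along the graph, connected because it is the image of a true
   rectangle; its width is cut to [e] so that it stays in the square where the chart is valid. *)
pose P := [set x | `|co (~~ b) x - co (~~ b) q| < Num.min e r /\ 0 < sg * tau b c x < r / 2].
have sg1 : `|sg| = 1 by apply/eqP; rewrite -(@pexpr_eq1 _ _ 2)// -normrX expr2 sg2 normr1.
have cq : co b q = c (co (~~ b) q) by move/eqP: tq; rewrite subr_eq0 => /eqP.
have box1 x' : `|co (~~ b) x' - co (~~ b) q| < Num.min e r -> `|tau b c x'| < r / 2 -> sqbox q r x'.
  rewrite lt_min => /andP[h1 h2] h3; have := he _ (ltW h1) => h4.
  have h5 : `|co b x' - co b q| <= r.
    have -> : co b x' - co b q = tau b c x' + (c (co (~~ b) x') - c (co (~~ b) q)) by rewrite cq /tau; ring.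
    apply: (le_trans (ler_normD _ _)); lra.
  by move: (ltW h2) h5; rewrite /sqbox; case: (b).
have cP : connected P by exact: connected_strip.
have PS : P `<=` S.
  move=> y [y1 y2]; have yr : sqbox q r y.
    apply: box1 => //; move: y2 => /andP[y2 y3].
    suff : `|sg * tau b c y| < r / 2 by rewrite normrM sg1 mul1r.
    by rewrite gtr0_norm.
  have [Dy [_ h] _ _] := hr y yr; split => //; apply: h.
  by case/andP: y2.
have N : nbhs q [set y | `|co (~~ b) y - co (~~ b) q| < Num.min e r /\ `|tau b c y| < r / 2].
  apply: filterI.
    have := @continuous_co R (~~ b) q => /cvgrPdist_lt/(_ _ e'0).
    by apply: filterS => y /=; rewrite distrC.
  have r2 : 0 < r / 2 by rewrite divr_gt0.
  have ct : {for q, continuous (tau b c)} by exact: continuous_tau.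
  have := ct => /cvgrPdist_lt/(_ _ r2).
  by apply: filterS => y /=; rewrite tq sub0r normrN.
have SP y : S y -> `|co (~~ b) y - co (~~ b) q| < Num.min e r -> `|tau b c y| < r / 2 -> P y.
  move=> [Dy gy] y1 y2; split => //; have [_ [h _] _ _] := hr y (box1 y y1 y2).
  have V := h gy; rewrite /epi/= in V; apply/andP; split => //.
  by rewrite -[X in X < _]gtr0_norm// normrM sg1 mul1r.
have [y1 [Cy1 [Ny1 Ny1']]] := proj1 qC _ N.
have [y2 [Oy2 [Ny2 Ny2']]] := proj1 qO _ N.
have Py1 := SP y1 (CS _ Cy1) Ny1 Ny1'.
move: Oy2; rewrite EO => -[Sy2 b2].
have Py2 := SP y2 Sy2 Ny2 Ny2'.
have E1 : C = connected_component S y1 by exact: same_connected_component.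
have E2 : connected_component S y1 = connected_component S y2.
  by apply: same_connected_component; exact: (connected_component_max Py1 PS cP).
by rewrite E1 E2.
Qed.

Lemma open_Omega : open Om. Proof. rewrite OmegaE; exact: open_sublevel. Qed.

Lemma Omega_D : Om `<=` D. Proof. by rewrite OmegaE => x []. Qed.

Lemma closure_Omega : closure Om = [set x | D x /\ g x <= 0].
Proof.
apply/seteqP; split => x.
  move=> cx; have [ix|nx] := pselect (Om° x).
    by have := interior_subset ix; rewrite OmegaE => -[Dx /ltW].
  have : bdry Om x by split.
  by rewrite bO => -[Dx gx]; split => //=; rewrite gx.
move=> [Dx]; rewrite le_eqVlt => /orP[/eqP gx|gx].
  have : bdry Om x by rewrite bO.
  by case.
by apply: subset_closure; rewrite OmegaE.
Qed.

Lemma bounded_Omega : bounded_set Om.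
Proof. have [M [Mr hM]] := bD; exists M; split => // M' h y /Omega_D Dy; exact: hM. Qed.

Lemma compact_closure_Omega : compact (closure Om).
Proof. exact: closure_compact bounded_Omega. Qed.

Lemma closure_Omega_D : closure Om `<=` D. Proof. by rewrite closure_Omega => x []. Qed.

Lemma compact_zero : compact G.
Proof.
rewrite -bO; apply: (subclosed_compact _ compact_closure_Omega); last by move=> x [].
by rewrite /bdry setDE; apply: closedI; [exact: closed_closure|apply: open_closedC; exact: open_interior].
Qed.

Lemma boundary_C_Omega : boundary_C 4 Om.
Proof.
move=> q; rewrite bO => -[Dq gq].
have [b [c [sg [m [Cc sg2 m0 nq]]]]] := local_graphD Dq gq.
have sgE : sg = 1 \/ sg = - 1.
  have : (sg - 1) * (sg + 1) = 0.
    have -> : (sg - 1) * (sg + 1) = sg * sg - 1 by ring.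
    by rewrite sg2 subrr.
  by move/eqP; rewrite mulf_eq0 subr_eq0 addr_eq0 => /orP[/eqP|/eqP]; [left|right].
have E x : [/\ D x, (g x < 0 <-> epi b c sg x), m * `|tau b c x| <= `|g x| &
      (g x = 0 <-> tau b c x = 0)] -> (Om x <-> epi b c sg x).
  by move=> [Dx <- _ _]; rewrite OmegaE; split => [[]|].
case: sgE => sgE; rewrite sgE in nq E.
  exists (~~ b), false, c; split => //; apply: filterS nq => x /E ->.
  by rewrite /epi/= /tau expr0 !mul1r subr_gt0 /co; case: (b).
exists (~~ b), true, (fun t => - c t); split.
  have := class_C1dM (class_C1d_cst 4 (-1)) Cc; congr class_C1d.
  by apply/funext => t; rewrite mulN1r.
apply: filterS nq => x /E ->.
rewrite /epi/= /tau expr1 !mulN1r oppr_gt0 subr_lt0 ltrN2 /co; by case: (b).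
Qed.

Lemma zero_null : leb2 G = 0%E.
Proof.
have mG : measurable (G : set (measurableTypeR R * measurableTypeR R)) := closed_measurable2 (compact_closed2 compact_zero).
suff [N [mN N0 GN]] : exists N, [/\ @measurable _ (measurableTypeR R * measurableTypeR R)%type N, leb2 N = 0%E & G `&` G `<=` N].
  apply/eqP; rewrite -measure_le0 -N0; apply: le_measure; rewrite ?inE//.
  by move: GN; rewrite setIid.
apply: (compact_induction (P := fun A => exists N, [/\ @measurable _ (measurableTypeR R * measurableTypeR R)%type N, leb2 N = 0%E & A `&` G `<=` N]) compact_zero).
- by exists set0; split => //; rewrite set0I.
- move=> A B [N1 [m1 z1 s1]] [N2 [m2 z2 s2]]; exists (N1 `|` N2); split.
  + exact: measurableU.
  + apply/eqP; rewrite -measure_le0; apply: (le_trans (measureU2 _ m1 m2)).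
    by rewrite [X in (X + _)%E]z1 [X in (_ + X)%E]z2 adde0.
  + by move=> x [[Ax|Bx] Gx]; [left; apply: s1|right; apply: s2].
- by move=> A B AB [N [m1 z1 s1]]; exists N; split => // x [/AB Bx Gx]; apply: s1.
move=> q [Dq gq]; have [b [c [sg [m [Cc sg2 m0 nq]]]]] := local_graphD Dq gq.
eexists; first exact: nq.
exists [set x | co b x = c (co (~~ b) x)]; split.
- apply: closed_measurable2.
  rewrite (_ : [set x | _] = tau b c @^-1` [set 0]).
    apply: closed_comp; last exact: closed_eq.
    by move=> x _; exact: continuous_tau.
  apply/seteqP; split => x; rewrite /tau/=; first by move=> ->; rewrite subrr.
  by move/eqP; rewrite subr_eq0 => /eqP.
- by apply: graph_null; exact: class_C1d_continuous Cc.
- move=> x [[_ _ _ [h _]] [_ /h]]; rewrite /tau/= => /eqP.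
  by rewrite subr_eq0 => /eqP.
Qed.

End domain.

(** * The space H^2_0 *)

Section representatives.
Context {R : realType}.
Local Notation mR := (measurableTypeR R).
Local Notation mP := (mR * mR)%type.
Implicit Types (f g h k V W phi psi chi : R * R -> R) (A B U K : set (R * R)) (x y p q : R * R)
  (b d : bool) (m n : nat) (s : seq bool) (c : R -> R) (t r e a : R).

Lemma second_difference d h x (l l' : R) : class_C 2 setT h -> exists y,
  [/\ `|co (~~ d) y - co (~~ d) x| <= `|l|, `|co d y - co d x| <= `|l'| &
  h (pt d (co (~~ d) x + l) (co d x + l')) - h (pt d (co (~~ d) x + l) (co d x)) -
   (h (pt d (co (~~ d) x) (co d x + l')) - h x) = pd d (pd (~~ d) h) y * l * l'].
Proof.
move=> Ch; have C1 : class_C 1 setT h by exact: class_C_le Ch.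
pose S := shear d 1 (fun=> l').
pose k y := (h \o S) y - h y.
have dk y : is_derive y (dir (~~ d)) k (pd (~~ d) h (S y) - pd (~~ d) h y).
  have d1 := is_pd_shear (~~ d) 1 C1 (is_derive_cst l' (co (~~ d) y) 1).
  have E : (~~ d == d) = false by case: (d).
  rewrite E mul0r addr0 in d1.
  exact: (is_deriveB d1 (derivable_pd (class_C_derivable C1 Logic.I))).
have [v [v1 E1]] : exists v : R, `|v - co (~~ d) x| <= `|co (~~ d) x + l - co (~~ d) x| /\
    k (pt (~~ d) (co d x) (co (~~ d) x + l)) - k (pt (~~ d) (co d x) (co (~~ d) x)) =
    pd (~~ d) k (pt (~~ d) (co d x) v) * (co (~~ d) x + l - co (~~ d) x).
  by apply: pd_mvt_on => v _; have [] := dk (pt (~~ d) (co d x) v).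
rewrite addrAC subrr add0r in v1 E1.
set z := pt (~~ d) (co d x) v in E1.
have C1a : class_C 1 setT (pd (~~ d) h) by exact: class_C_pd.
have [w [w1 E2]] := pd_mvt d (co (~~ d) z) (co d z) (co d z + l') C1a.
rewrite (is_pdE (dk z)) in E1.
rewrite pt_co (addrAC (co d z)) subrr add0r in w1 E2.
have zc : co d z = co d x /\ co (~~ d) z = v by rewrite /z; case: (d).
exists (pt d (co (~~ d) z) w); split.
- by rewrite co_ptN (proj2 zc).
- by rewrite co_pt -(proj1 zc).
have ES : S z = pt d (co (~~ d) z) (co d z + l') by rewrite /S /shear mul1r.
rewrite ES E2 in E1; rewrite mulrAC -E1 /k /S /shear /=.
have sw u w' : pt (~~ d) u w' = pt d w' u by case: (d).
by rewrite !sw !co_pt !co_ptN !mul1r pt_co.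
Qed.

Lemma half_triangle (u v v' w e : R) : `|v - u| <= e / 2 -> `|v' - w| <= e / 2 -> v = v' -> `|u - w| <= e.
Proof.
move=> h1 h2 E; have -> : u - w = - (v - u) + (v' - w) by rewrite E; ring.
by apply: (le_trans (ler_normD _ _)); rewrite normrN; lra.
Qed.

(** The second difference over a small square, read in either order, is the mixed derivative in that
    order at some point of the square. *)
Lemma pd_swap h x : class_C 2 setT h -> pd true (pd false h) x = pd false (pd true h) x.
Proof.
move=> Ch; have cc d d' : {for x, continuous (pd d (pd d' h))}.
  by apply: class_C_continuous; exact: class_C_pd (class_C_pd _ Ch).
apply/eqP; rewrite -subr_eq0 -normr_le0; apply/ler_addgt0Pr => e e0.
rewrite add0r; have e2 : 0 < e / 2 by rewrite divr_gt0.
have nb d d' : nbhs x [set y | `|pd d (pd d' h) y - pd d (pd d' h) x| <= e / 2].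
  have N (k : R * R -> R) : {for x, continuous k} -> nbhs x [set y | `|k y - k x| <= e / 2].
    by move=> /cvgrPdist_le/(_ _ e2); apply: filterS => y; rewrite /= distrC.
  exact: (N _ (cc d d')).
have [r r0 hr] := nbhs_sqbox_sub (filterI (nb true false) (nb false true)).
have [y [y1 y2 E1]] := second_difference true x r r Ch.
have [z [z1 z2 E2]] := second_difference false x r r Ch.
rewrite (gtr0_norm r0) /= in y1 y2 z1 z2.
have yr : sqbox x r y by split; [exact: y1|exact: y2].
have zr : sqbox x r z by split; [exact: z2|exact: z1].
have [hy _] := hr _ yr; have [_ hz] := hr _ zr.
have alg (u v w t : R) : u - v - (w - t) = u - w - (v - t) by ring.
have E : pd true (pd false h) y = pd false (pd true h) z.
  apply: (mulIf (lt0r_neq0 r0)); apply: (mulIf (lt0r_neq0 r0)).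
  exact: etrans (esym E1) (etrans (alg _ _ _ _) E2).
exact: (half_triangle hy hz E).
Qed.

Lemma pds_rev s h : (size s <= 2)%N -> class_C 2 setT h -> pds (rev s) h = pds s h.
Proof.
move=> s2 Ch; case: s s2 => [|b [|d [|? ?]]] s2; [exact: erefl|exact: erefl| |by []].
apply/funext => x; rewrite -[LHS]/(pd d (pd b h) x) -[RHS]/(pd b (pd d h) x).
clear s2; case: b; case: d; [exact: erefl|exact: (esym (pd_swap x Ch))|exact: pd_swap|exact: erefl].
Qed.

Lemma C2_representative U h : open U -> bounded_set U -> boundary_C 4 U -> sobolev 4 U h ->
  exists V K, [/\ compact K, class_C 2 setT V, zero_off K V & {ae leb2, forall x, U x -> h x = V x}].
Proof.
move=> oU bU bdU Sh; have [Y [K [cK SY Y0 YE]]] := sobolev_extension oU bU bdU Sh.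
have [V [CV V0 YV]] := sobolev_class_C cK Y0 SY.
by exists V, K; split => //; apply: (aeS YV) => x <- /YE.
Qed.

Lemma wderiv_representative U h V K s : open U -> (size s <= 2)%N -> compact K -> class_C 2 setT V ->
  zero_off K V -> L2 U h -> {ae leb2, forall x, U x -> h x = V x} -> wderiv U s h (pds s V).
Proof.
move=> oU s2 cK CV V0 Lh hV.
have := wderiv_classical (s := rev s) cK _ V0; rewrite size_rev revK pds_rev//.
move=> /(_ (class_C_le s2 CV)) /(wderiv_sub openT oU (@subsetT _ U)) D.
have [_ Ls] := wderiv_L2 D.
by apply: (wderiv_ae oU D) => //; [apply: (aeS hV) => x E /E|exact: aeW].
Qed.

Lemma within_cont U h : open U -> {within closure U, continuous h} -> cont U h.
Proof.
move=> oU /subspace_continuousP ch x Ux A nA.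
have h1 : nbhs x [set y | closure U y -> A (h y)] by exact: (ch x (subset_closure Ux) A nA).
by apply: (filterS _ (filterI h1 (open_nbhs_nbhs (conj oU Ux)))) => y [+ /subset_closure]; exact.
Qed.

(** Two functions continuous up to the boundary that agree almost everywhere in an open set agree on
    its closure, so the choice made by [xget] does not matter. *)
Lemma cderiv_representative U h V K s x : open U -> (size s <= 2)%N -> compact K -> class_C 2 setT V ->
  zero_off K V -> L2 U h -> {ae leb2, forall x, U x -> h x = V x} -> closure U x ->
  cderiv U s h x = pds s V x.
Proof.
move=> oU s2 cK CV V0 Lh hV clx.
have D := wderiv_representative oU s2 cK CV V0 Lh hV.
have cV : continuous (pds s V).
  by apply: (@class_C_continuous _ 0); apply: class_C_pds; apply: class_C_le CV; rewrite add0n.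
have cVc : {within closure U, continuous (pds s V)} by exact: continuous_subspaceT.
have ex : exists v, wderiv U s h v /\ {within closure U, continuous v} by exists (pds s V).
have [D' c'] : wderiv U s h (cderiv U s h) /\ {within closure U, continuous (cderiv U s h)}.
  exact: (xgetPex (fun=> 0) ex).
apply: (within_closure_eq c' cVc _ clx).
apply: (ae_eq_cont oU); [exact: within_cont|by move=> y _; exact: cV|].
by apply: (wderiv_ae_unique oU D' D); exact: aeW.
Qed.

Lemma patch_L2_C0 U K h : open U -> compact K -> continuous h -> zero_off K h -> L2 U h.
Proof.
move=> oU cK ch h0; apply/(L2_patch _ (open_measurable2 oU)).
have Lh := L2_C0 cK ch h0.
have mU := open_measurable2 oU.
apply: (@L2_bnd _ 1 h) => //.
  by apply/(mf_patch _ mU); exact: measurable_funS (L2_mf Lh).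
by move=> x; rewrite mul1r patchE; case: ifP => // _; rewrite normr0.
Qed.

(** The definition of [H20] asks for smooth approximants; by mollification C^2 functions with
    compact support in [U] are enough, and classical derivatives of [V] replace arbitrary weak
    ones. *)
Lemma H20_C2_approx U V K : open U -> compact K -> class_C 2 setT V -> zero_off K V ->
  (forall e, 0 < e -> exists psi K', [/\ compact K', K' `<=` U, class_C 2 setT psi, zero_off K' psi &
     forall s, (size s <= 2)%N -> It ((fun x => (pds s V x - pds s psi x) ^+ 2) \_ U) < e]) ->
  H20 U V.
Proof.
move=> oU cK CV V0 H; have mU := open_measurable2 oU.
have cs s (h : R * R -> R) : (size s <= 2)%N -> class_C 2 setT h -> continuous (pds s h).
  by move=> s2 Ch; apply: (@class_C_continuous _ 0); apply: class_C_pds; apply: class_C_le Ch; rewrite add0n.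
have LV : L2 U V by apply: (patch_L2_C0 oU cK) V0; exact: class_C_continuous CV.
have DV s : (size s <= 2)%N -> wderiv U s V (pds s V).
  by move=> s2; apply: (wderiv_representative oU s2 cK CV V0 LV); exact: aeW.
split; first by split => // s s2; exists (pds s V); exact: DV.
move=> e e0; have e4 : 0 < e / 4 by rewrite divr_gt0.
have [psi [K1 [cK1 K1U Cpsi psi0 Hpsi]]] := H _ e4.
have [K2 cK2 [K2U Hphi]] := smooth_approx cK1 oU K1U Cpsi psi0.
have cK12 : compact (K1 `|` K2) by exact: compactU.
have cl12 := compact_closed2 cK12.
have i12 : intg (\1_(K1 `|` K2) : R * R -> R).
  have [r _ Kr] := compact_sub_box cK12.
  apply: (@intg_bounded _ _ 1 r).
  - by apply: mf_indic; exact: closed_measurable2.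
  - by move=> x; rewrite /indic; case: (_ \in _); rewrite ?normr1 ?normr0.
  - by move=> x nx; rewrite /indic memNset// => /Kr.
set C := It (\1_(K1 `|` K2) : R * R -> R).
have C0 : 0 <= C by apply: It_ge0 => x; rewrite /indic; case: (_ \in _).
(* Twice e / 4 from [psi] and twice eta^2 C from its mollification add up to at most [e], C being
   the area of the two supports. *)
pose eta := Num.min 1 (e / (4 * (C + 1))).
have eta0 : 0 < eta by rewrite lt_min ltr01 divr_gt0// mulr_gt0//; lra.
have etaC : eta ^+ 2 * C <= e / 4.
  have h1 : eta <= 1 by rewrite ge_min lexx.
  have h2 : eta <= e / (4 * (C + 1)) by rewrite ge_min lexx orbT.
  apply: (@le_trans _ _ (eta * (C + 1))).
    rewrite expr2 -mulrA; apply: ler_wpM2l; first exact: ltW.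
    by apply: (@le_trans _ _ (1 * C)); [apply: ler_wpM2r|lra].
  apply: (le_trans (ler_wpM2r _ h2)); first by lra.
  by rewrite le_eqVlt; apply/orP; left; apply/eqP; field; rewrite gt_eqF//; lra.
have [phi [sphi phi0 happ]] := Hphi _ eta0.
have tp : test_fun U phi by split => //; exists K2.
exists phi; split => // s v s2 Dv.
have vV : {ae leb2, forall x, U x -> v x = pds s V x}.
  by apply: (wderiv_ae_unique oU Dv (DV _ s2)); exact: aeW.
have Lv := proj2 (wderiv_L2 Dv); have LVs := proj2 (wderiv_L2 (DV _ s2)).
have Lphi := test_fun_L2 (test_fun_pds s tp).
have Lpsi : L2 setT (pds s psi).
  by apply: (L2_C0 cK1); [exact: cs|exact: zero_off_pds (compact_closed2 cK1) psi0].
have LU h : L2 setT h -> L2 setT (h \_ U).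
  move=> Lh; apply: (@L2_bnd _ 1 h) => //.
    by apply/(mf_patch _ mU); exact: measurable_funS (L2_mf Lh).
  by move=> x; rewrite mul1r patchE; case: ifP => // _; rewrite normr0.
have Ld1 : L2 setT ((pds s V \_ U) \- (pds s psi \_ U)).
  by apply: L2B; [exact/(L2_patch _ mU)|exact: LU].
have i1 := L2_sq Ld1.
have Lvp : L2 setT (fun x => (v \_ U) x - (pds s phi \_ U) x).
  by apply: L2B; [exact/(L2_patch _ mU)|exact: LU].
have ivp := L2_sq Lvp.
have -> : (\int[leb2]_(x in U) ((v x - pds s phi x) ^+ 2)%:E)%E =
  (It (fun x => ((v \_ U) x - (pds s phi \_ U) x) ^+ 2))%:E.
  rewrite (EFin_It ivp) integral_mkcond; apply: eq_integral => x _.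
  by rewrite !patchE; case: ifP => //; rewrite subrr expr0n.
rewrite lte_fin.
pose F x := 2 * ((pds s V \_ U) x - (pds s psi \_ U) x) ^+ 2 + 2 * (eta ^+ 2 * (\1_(K1 `|` K2) x : R)).
have iF : intg F by apply: intgD; apply: intgZ => //; exact: intgZ.
have : It (fun x => ((v \_ U) x - (pds s phi \_ U) x) ^+ 2) <= It F.
  pose G x := ((pds s V \_ U) x - (pds s phi \_ U) x) ^+ 2.
  have LG : L2 setT (fun x => (pds s V \_ U) x - (pds s phi \_ U) x).
    by apply: L2B; [exact/(L2_patch _ mU)|exact: LU].
  have iG : intg G by exact: L2_sq LG.
  rewrite (_ : It _ = It G).
    apply: le_It => // x; rewrite /G /F.
    have key (v1 v2 v3 et : R) : (v2 - v3) ^+ 2 <= et -> (v1 - v3) ^+ 2 <= 2 * (v1 - v2) ^+ 2 + 2 * et.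
      move=> h; have -> : v1 - v3 = (v1 - v2) + (v2 - v3) by ring.
      by have := sqr_ge0 ((v1 - v2) - (v2 - v3)); nra.
    apply: key; rewrite !patchE; case: ifP => _; last first.
      by rewrite subrr expr0n mulr_ge0// ?sqr_ge0// /indic; case: (_ \in _).
    have [xK|nK] := pselect ((K1 `|` K2) x).
      rewrite /indic mem_set// mulr1 -real_normK ?num_real// distrC.
      by apply: ler_pM => //; exact: happ.
    rewrite (zero_off_pds s (compact_closed2 cK1) psi0) ?(zero_off_pds s (compact_closed2 cK2) phi0).
      by rewrite subrr expr0n mulr_ge0// ?sqr_ge0// /indic; case: (_ \in _).
    - by move=> ?; apply: nK; right.
    - by move=> ?; apply: nK; left.
  apply: ae_eq_It; [exact: intg_mf|exact: intg_mf|].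
  by apply: (aeS (ae_eq_patch vV)) => x ->.
move=> /le_lt_trans; apply.
rewrite /F (ItD (intgZ 2 i1) (intgZ 2 (intgZ (eta ^+ 2) i12))) (ItZ _ i1) (ItZ _ (intgZ _ i12)) (ItZ _ i12) -/C.
have := Hpsi s s2.
have -> : It ((fun x => (pds s V x - pds s psi x) ^+ 2) \_ U) =
  It (fun x => ((pds s V \_ U) x - (pds s psi \_ U) x) ^+ 2).
  congr It; apply/funext => x; rewrite !patchE; case: ifP => // _.
  by rewrite subrr expr0n.
rewrite /=; lra.
Qed.

Lemma H20_C2_compact U V K : open U -> compact K -> K `<=` U -> class_C 2 setT V -> zero_off K V ->
  H20 U V.
Proof.
move=> oU cK KU CV V0; apply: (H20_C2_approx oU cK CV V0) => e e0.
exists V, K; split => // s _; rewrite It_eq0// => x.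
by rewrite patchE; case: ifP => // _; rewrite subrr expr0n.
Qed.

Lemma H20_ae U h V : open U -> L2 U h -> {ae leb2, forall x, U x -> h x = V x} -> H20 U V -> H20 U h.
Proof.
move=> oU Lh hV [SV HV].
have Vh : {ae leb2, forall x, U x -> V x = h x} by apply: (aeS hV) => x E /E.
split; first exact: (sobolev_ae oU SV Lh Vh).
move=> e /HV[phi [tp Hp]]; exists phi; split => // s v s2 Dv; apply: Hp => //.
apply: (wderiv_ae oU Dv); [exact: sobolev_L2 SV|by have [] := wderiv_L2 Dv|exact: hV|exact: aeW].
Qed.

End representatives.

Lemma nonneg_sums {R : realType} (v1 v2 v3 v4 : R) : 0 < v1 -> 0 <= v2 -> 0 <= v3 -> 0 <= v4 ->
  [/\ 0 < v1 + v2 + v2 + v3 + v4, v1 <= v1 + v2 + v2 + v3 + v4, v1 + v4 <= v1 + v2 + v2 + v3 + v4 &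
      v1 + v2 + v2 + v3 <= v1 + v2 + v2 + v3 + v4].
Proof. by move=> *; split; lra. Qed.

Lemma product_error1 {R : realType} (w v h d1 l1 l2 : R) : `|(1 - h) * w| <= l1 -> `|d1 * v| <= l2 ->
  `|w - (d1 * v + h * w)| <= l1 + l2.
Proof.
move=> h1 h2; have -> : w - (d1 * v + h * w) = (1 - h) * w - d1 * v by ring.
by apply: (le_trans (ler_normB _ _)); exact: lerD.
Qed.

Lemma product_error2 {R : realType} (w v h v1 v2 d1 d2 dd l1 l2 l3 : R) : `|(1 - h) * w| <= l1 ->
  `|d1 * v2| <= l2 -> `|d2 * v1| <= l2 -> `|dd * v| <= l3 ->
  `|w - (dd * v + d1 * v2 + (d2 * v1 + h * w))| <= l1 + l2 + l2 + l3.
Proof.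
move=> h1 h2 h3 h4.
have -> : w - (dd * v + d1 * v2 + (d2 * v1 + h * w)) = (1 - h) * w - d1 * v2 - d2 * v1 - dd * v by ring.
apply: (le_trans (ler_normB _ _)); apply: lerD => //.
apply: (le_trans (ler_normB _ _)); apply: lerD => //.
by apply: (le_trans (ler_normB _ _)); exact: lerD.
Qed.

(** * From zero boundary values and gradient to H^2_0 *)

Section zero_trace.
Context {R : realType} (D : set (R * R)) (x0 : R * R) (g : R * R -> R).
Context (oD : open D) (bD : bounded_set D) (CgD : class_C_closure 4 D g)
  (gr : forall x, D x -> g x = 0 -> 0 < norm2 (grad g x))
  (gb : forall x, bdry D x -> 0 < g x)
  (bO : bdry (Omega D x0 g) = [set x | D x /\ g x = 0]).
Implicit Types (f h k V psi phi : R * R -> R) (A B U K : set (R * R)) (x y p q : R * R) (b d : bool)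
  (m n : nat) (c : R -> R) (s : seq bool) (t r e a : R).
Local Notation Om := (Omega D x0 g).
Local Notation G := [set x | D x /\ g x = 0].

Let oOm : open Om := open_Omega oD bD CgD gr gb bO.
Let OmE : Om = [set x | D x /\ g x < 0] := OmegaE oD bD CgD gr gb bO.
Let clOm : closure Om = [set x | D x /\ g x <= 0] := closure_Omega oD bD CgD gr gb bO.
Let cOm : compact (closure Om) := compact_closure_Omega oD bD CgD gr gb bO.
Let clOmD : closure Om `<=` D := closure_Omega_D oD bD CgD gr gb bO.

(** Away from the boundary |g| is bounded below. Near it, [V] and its gradient vanish at the foot of
    [x] on the graph, so the mean value theorem bounds them by tau^2 and |tau|, that is by g^2 and
    |g| through [local_graph]. Compactness of the closure makes the constant uniform. *)
Lemma zero_trace_bound K V : compact K -> class_C 2 setT V -> zero_off K V ->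
  (forall x, G x -> V x = 0) -> (forall x b, G x -> pd b V x = 0) ->
  exists2 C, 0 < C & forall x, Om x -> `|V x| <= C * g x ^+ 2 /\ forall b, `|pd b V x| <= C * `|g x|.
Proof.
move=> cK CV V0 VG pVG.
have clK := compact_closed2 cK.
have CVb b : class_C 1 setT (pd b V) by exact: class_C_pd.
have cV := class_C_continuous CV.
have cVb b := class_C_continuous (CVb b).
have cVbd b d : continuous (pd d (pd b V)) by apply: class_C_continuous; exact: class_C_pd (CVb b).
have z1 b := zero_off_pd b clK V0.
have z2 b d := zero_off_pd d clK (z1 b).
have [L0 L00 hL0] := continuous_zero_off_bounded cK cV V0.
have H1 b := continuous_zero_off_bounded cK (cVb b) (z1 b).
have H2 b d := continuous_zero_off_bounded cK (cVbd b d) (z2 b d).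
have [L L00' [hL hL2]] : exists2 L : R, 0 < L & (forall x, `|V x| <= L) /\
    forall b x, `|pd b V x| <= L /\ forall d, `|pd d (pd b V) x| <= L.
  have [l1 p1 h1] := H1 false; have [l2 p2 h2] := H1 true.
  have [l3 p3 h3] := H2 false false; have [l4 p4 h4] := H2 false true.
  have [l5 p5 h5] := H2 true false; have [l6 p6 h6] := H2 true true.
  exists (L0 + (l1 + (l2 + (l3 + (l4 + (l5 + l6)))))); first by lra.
  split; first by move=> x; apply: (le_trans (hL0 x)); lra.
  by case=> x; split; [apply: (le_trans (h2 x)); lra|case; [apply: (le_trans (h6 x)); lra|apply: (le_trans (h5 x)); lra]
    |apply: (le_trans (h1 x)); lra|case; [apply: (le_trans (h4 x)); lra|apply: (le_trans (h3 x)); lra]].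
have key : exists2 C, 0 < C & forall x, closure Om x -> Om x ->
    `|V x| <= C * g x ^+ 2 /\ forall b, `|pd b V x| <= C * `|g x|.
  pose P A := exists2 C, 0 < C & forall x, A x -> Om x ->
    `|V x| <= C * g x ^+ 2 /\ forall b, `|pd b V x| <= C * `|g x|.
  apply: (compact_induction (P := P) cOm).
  - by exists 1.
  - move=> A B [C1 C10 h1] [C2 C20 h2]; exists (C1 + C2); first exact: addr_gt0.
    have s0 x : 0 <= g x ^+ 2 by exact: sqr_ge0.
    move=> x [Ax|Bx] Ox.
      have [a1 a2] := h1 x Ax Ox; split; first by apply: (le_trans a1); apply: ler_wpM2r => //; lra.
      by move=> b; apply: (le_trans (a2 b)); apply: ler_wpM2r => //; lra.
    have [a1 a2] := h2 x Bx Ox; split; first by apply: (le_trans a1); apply: ler_wpM2r => //; lra.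
    by move=> b; apply: (le_trans (a2 b)); apply: ler_wpM2r => //; lra.
  - by move=> A B AB [C C0 h]; exists C => // x /AB; exact: h.
  move=> q; rewrite clOm => -[Dq]; rewrite le_eqVlt => /orP[/eqP gq|gq]; last first.
    have d0 : 0 < - g q / 2 by rewrite divr_gt0// oppr_gt0.
    set dl := - g q / 2 in d0.
    exists [set x | dl < - g x].
      have cg : {for q, continuous g} by exact: (g_continuous CgD Dq).
      have dq : g q < - dl by rewrite /dl; lra.
      have nn : nbhs q [set x | g x < - dl] by exact: (cg _ (open_nbhs_nbhs (conj (@open_lt _ (- dl)) dq))).
      by apply: (filterS _ nn) => x /=; rewrite ltrNr.
    exists (L / dl ^+ 2 + L / dl).
      by rewrite addr_gt0// divr_gt0// exprn_gt0.
    move=> x /= gx Ox; have gd : dl <= `|g x| by rewrite -normrN ger0_norm; [exact: ltW|apply: ltW; exact: lt_trans gx].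
    have i1 : 0 <= L / dl ^+ 2 by rewrite divr_ge0 ?ltW// exprn_gt0.
    have i2 : 0 <= L / dl by rewrite divr_ge0 ?ltW.
    split.
      apply: (le_trans (hL x)); apply: (@le_trans _ _ (L / dl ^+ 2 * g x ^+ 2)); last first.
        by apply: ler_wpM2r; [exact: sqr_ge0|lra].
      rewrite -mulrA ler_peMr ?(ltW L00')// mulrC ler_pdivlMr ?exprn_gt0// mul1r.
      by rewrite -[g x ^+ 2]real_normK ?num_real// ler_sqr ?nnegrE// ltW.
    move=> b; apply: (le_trans (proj1 (hL2 b x))); apply: (@le_trans _ _ (L / dl * `|g x|)); last first.
      by apply: ler_wpM2r => //; lra.
    by rewrite -mulrA ler_peMr ?(ltW L00')// mulrC ler_pdivlMr// mul1r.
  have [b0 [c [sg [m [Cc sg2 m0 nq]]]]] := local_graphD oD CgD gr Dq gq.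
  have tq : tau b0 c q = 0 by have [_ _ _ [+ _]] := nbhs_singleton nq; apply.
  pose ft x := pt b0 (co (~~ b0) x) (c (co (~~ b0) x)).
  have cft : {for q, continuous ft}.
    have cc := class_C1d_continuous Cc.
    have c1 : {for q, continuous (fun x => c (co (~~ b0) x))}.
      by apply: (@continuous_comp _ _ _ (co (~~ b0)) c); [exact: continuous_co|exact: cc].
    have c2 : {for q, continuous (co (~~ b0))} by exact: continuous_co.
    move: c1 c2; rewrite /ft /pt; case: (b0) => c1 c2.
      exact: (@cvg_pair _ _ _ (nbhs q) (nbhs q.1) (nbhs (c q.1)) _ _ _ _ _ c2 c1).
    exact: (@cvg_pair _ _ _ (nbhs q) (nbhs (c q.2)) (nbhs q.2) _ _ _ _ _ c1 c2).
  have ftq : ft q = q.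
    by move/eqP: tq; rewrite subr_eq0 => /eqP E; rewrite /ft -E pt_co.
  (* The neighbourhood must be one where both [x] and its foot [ft x] lie in the domain of the
     chart. *)
  eexists.
    apply: filterI; first exact: nq.
    by move: (cft); rewrite /prop_for /continuous_at ftq => cf; exact: (cf _ nq).
  exists (L / m ^+ 2 + L / m); first by rewrite addr_gt0// divr_gt0// exprn_gt0.
  move=> x [[Dx _ mt _] [Df _ _ [_ gf]]] Ox.
  have {}gf : g (ft x) = 0 by apply: gf; rewrite /tau /ft co_pt co_ptN subrr.
  have Gf : G (ft x) by split.
  have VF : V (ft x) = 0 := VG _ Gf.
  have pF b : pd b V (ft x) = 0 := pVG _ b Gf.
  have i1 : 0 <= L / m ^+ 2 by rewrite divr_ge0 ?ltW// exprn_gt0.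
  have i2 : 0 <= L / m by rewrite divr_ge0 ?ltW.
  have ct : c (co (~~ b0) x) - co b0 x = - tau b0 c x by rewrite opprB.
  have tg : `|tau b0 c x| <= `|g x| / m by rewrite ler_pdivlMr// mulrC.
  have Lt : `|V x| <= L * `|tau b0 c x| * `|tau b0 c x|.
    have [v [v1 E]] := pd_mvt b0 (co (~~ b0) x) (c (co (~~ b0) x)) (co b0 x) (class_C_le (isT : (1 <= 2)%N) CV).
    have {}E : V x = pd b0 V (pt b0 (co (~~ b0) x) v) * tau b0 c x.
      by rewrite /tau -E pt_co -/(ft x) VF subr0.
    rewrite -/(tau b0 c x) in v1.
    rewrite E normrM; apply: ler_wpM2r => //.
    have := @lip_pd R b0 (pd b0 V) L (ft x) v (CVb b0) (fun y => proj2 (hL2 b0 y) b0).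
    rewrite pF subr0 /ft !co_ptN !co_pt => /le_trans; apply.
    by apply: ler_wpM2l => //; exact: ltW.
  split.
    apply: (le_trans Lt); apply: (@le_trans _ _ (L / m ^+ 2 * g x ^+ 2)); last first.
      by apply: ler_wpM2r; [exact: sqr_ge0|lra].
    have -> : L / m ^+ 2 * g x ^+ 2 = L * (`|g x| / m * (`|g x| / m)).
      by rewrite -[g x ^+ 2]real_normK ?num_real//; field; exact: lt0r_neq0.
    by rewrite -mulrA; apply: ler_wpM2l; [exact: ltW|exact: ler_pM].
  move=> b; have := @lip_pd R b0 (pd b V) L x (c (co (~~ b0) x)) (CVb b) (fun y => proj2 (hL2 b y) b0).
  rewrite -/(ft x) pF sub0r normrN ct normrN => /le_trans; apply.
  apply: (@le_trans _ _ (L / m * `|g x|)); last by apply: ler_wpM2r => //; lra.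
  by rewrite -mulrA [m^-1 * _]mulrC; apply: ler_wpM2l; [exact: ltW|].
have [C C0 h] := key; exists C => // x Ox; apply: h => //; exact: subset_closure.
Qed.

Lemma derive2_step_bounded : exists2 M : R, 0 < M & forall t, `|derive1 (derive1 (@step R)) t| <= M.
Proof.
have C2 := @class_C1d_step R 2.
have [_ _ C1] := (class_C1dS _ _).1 C2; have [_ _ C0] := (class_C1dS _ _).1 C1.
have cs := (class_C1d0 _).1 C0.
have [M hM] : exists M : R, forall x, box 1 x -> `|derive1 (derive1 (@step R)) (co true x)| <= M.
  apply: compact_bounded_fun; first exact: compact_box.
  by apply: continuous_subspaceT => x; apply: (@continuous_comp _ _ _ (co true) (derive1 (derive1 step))); [exact: continuous_co|exact: cs].
exists (`|M| + 1); first by rewrite ltr_wpDl.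
move=> t; have [t1|t1] := leP `|t| 1.
  apply: (@le_trans _ _ M); first by apply: (hM (0, t)); split => //=; rewrite normr0.
  by apply: (le_trans (ler_norm M)); rewrite lerDl.
have z : forall u, u < 0 \/ 1 < u -> derive1 (@step R) u = 0 by move=> u; exact: derive1_step_eq0.
have -> : derive1 (derive1 (@step R)) t = 0.
  rewrite derive1E.
  have n0 : \near t, cst 0 t = derive1 (@step R) t.
    move: t1; rewrite ltr_normr => /orP[t1|t1]; near=> u; rewrite z//.
      by right; near: u; exact: lt_nbhsr.
    by left; near: u; apply: lt_nbhsl; lra.
  by have [_ ->] := is_derive_near (is_derive_cst 0 t 1) n0.
by rewrite normr0 addr_ge0.
Unshelve. all: by end_near. Qed.

Lemma derive2_step_eq0 t : t < 0 \/ 1 < t -> derive1 (derive1 (@step R)) t = 0.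
Proof.
move=> t1; rewrite derive1E.
have n0 : \near t, cst 0 t = derive1 (@step R) t.
  case: t1 => t1; near=> u; rewrite derive1_step_eq0//.
    by left; near: u; exact: lt_nbhsl.
  by right; near: u; exact: lt_nbhsr.
by have [_ ->] := is_derive_near (is_derive_cst 0 t 1) n0.
Unshelve. all: by end_near. Qed.

(** [F] is only felt where 1 <= n a <= 2, so that a^j absorbs the factor n^j. It is applied to the
    first two derivatives of [step], with a = - g. *)
Lemma step_scaled_bound (M : R) (F : R -> R) (j : nat) (a n : R) : (forall t, `|F t| <= M) ->
  (forall t, t < 0 \/ 1 < t -> F t = 0) -> 0 <= a -> 0 <= n ->
  `|n ^+ j * F (n * a - 1)| * a ^+ j <= 2 ^+ j * M.
Proof.
move=> FM F0 a0 n0; have M0 : 0 <= M by exact: le_trans (FM 0).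
have [uo|uin] := pselect (n * a - 1 < 0 \/ 1 < n * a - 1).
  by rewrite F0// mulr0 normr0 mul0r mulr_ge0// exprn_ge0.
rewrite normrM normrX (ger0_norm n0) mulrAC -exprMn; apply: ler_pM => //.
  by rewrite exprn_ge0// mulr_ge0.
apply: lerXn2r; rewrite ?nnegrE ?mulr_ge0//.
by rewrite leNgt; apply/negP => h; apply: uin; right; lra.
Qed.

(** g is regular only inside [D]; cut off near the closure of Omega_g it becomes a C^4 function on
    the plane with bounded derivatives, and the same germ along the boundary. *)
Lemma global_defining : exists gt K W, [/\ class_C 4 setT gt, compact K, zero_off K gt, open W &
  closure Om `<=` W /\ forall x, W x -> D x /\ gt x = g x].
Proof.
have [chi [schi _ [V' oV' [KV' chi1]] [K' cK' [K'D chi0]]]] := smooth_cutoff cOm oD clOmD.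
exists (fun x => chi x * g x), K', (V' `&` D); split.
- exact: (class_C_mul_cutoff oD cK' K'D (schi 4%N) chi0 (Cg CgD)).
- by [].
- by move=> x /chi0 ->; rewrite mul0r.
- exact: openI.
split; first by move=> x cx; split; [exact: KV'|exact: clOmD].
by move=> x [/chi1-> Dx]; rewrite mul1r.
Qed.

(* Multiply V by step (- n g - 1).  As V = O(g^2) and pd V = O(g) near the boundary, the factors n and n^2
   produced by the cutoff, which live where |g| is of order 1/n, are compensated: the derivatives of the
   products are bounded and converge pointwise. *)
Lemma H20_zero_trace K V : compact K -> class_C 2 setT V -> zero_off K V ->
  (forall x, G x -> V x = 0) -> (forall x b, G x -> pd b V x = 0) -> H20 Om V.
Proof.
move=> cK CV V0 VG pVG; apply: (H20_C2_approx oOm cK CV V0) => e e0.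
have [C C0 hC] := zero_trace_bound cK CV V0 VG pVG.
have [gt [Kg [W [Cgt cKg gt0 oW [clW Wg]]]]] := global_defining.
have mO := open_measurable2 oOm.
have OW : Om `<=` W by move=> x /(@subset_closure _ _ x)/clW.
have gneg x : Om x -> g x < 0 by rewrite OmE => -[].
have clK := compact_closed2 cK; have clKg := compact_closed2 cKg.
have Cgt2 : class_C 2 setT gt by exact: class_C_le Cgt.
have C1gt : class_C 1 setT gt by exact: class_C_le Cgt.
have CV1 : class_C 1 setT V by exact: class_C_le CV.
have cont2 (h : R * R -> R) s : (size s <= 2)%N -> class_C 2 setT h -> continuous (pds s h).
  by move=> s2 Ch; apply: (@class_C_continuous _ 0); apply: class_C_pds; apply: class_C_le Ch; rewrite add0n.
have bnd (h : R * R -> R) (K0 : set (R * R)) : compact K0 -> class_C 2 setT h -> zero_off K0 h ->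
    exists2 L : R, 0 < L & forall s x, (size s <= 2)%N -> `|pds s h x| <= L.
  move=> cK0 Ch h0.
  have B s : (size s <= 2)%N -> exists2 L : R, 0 < L & forall x, `|pds s h x| <= L.
    move=> s2; apply: (continuous_zero_off_bounded cK0); first exact: cont2.
    exact: zero_off_pds (compact_closed2 cK0) h0.
  have [s s2|s d d' dd h1 d'0 x|d d0 hd] := @uniform_lists R 2 (fun s (d : R) => 0 < d -> forall x, `|pds s h x| <= d^-1).
  - by have [l l0 hl] := B s s2; exists l^-1; rewrite ?invr_gt0// invrK.
  - apply: (le_trans (h1 (lt_le_trans d'0 dd) x)); rewrite lef_pV2 ?posrE//; exact: lt_le_trans dd.
  exists d^-1; first by rewrite invr_gt0.
  by move=> s x /hd; apply.
have [L L0 hL] := bnd V K cK CV V0; have [Lg Lg0 hLg] := bnd gt Kg cKg Cgt2 gt0.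
have [M M0 hM] := @derive1_step_bounded R; have [M2 M20 hM2] := derive2_step_bounded.
pose th n x := step (n%:R * (- gt x) - 1).
have Carg n : class_C 4 setT (fun x => n%:R * (- gt x) - 1).
  apply: class_CB; [exact: openT| |exact: class_C_cst].
  by apply: class_CZ; [exact: openT|apply: class_CN => //; exact: openT].
have Cth n : class_C 2 setT (th n).
  apply: class_C_comp; [exact: openT|exact: class_C1d_step|].
  exact: class_C_le (Carg n).
have C1th n : class_C 1 setT (th n) by exact: class_C_le (Cth n).
pose Kn n := closure Om `&` [set x | 1 <= n%:R * (- gt x)].
have cKn n : compact (Kn n).
  apply: compact_closedI => //.
  apply: (@closed_comp _ _ (fun x => n%:R * - gt x) [set r : R | 1 <= r]); last exact: closed_ge.
  have Cn : class_C 4 setT (fun x => n%:R * - gt x) by apply: class_CZ; [exact: openT|apply: class_CN => //; exact: openT].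
  by move=> x _; exact: (class_C_continuous Cn).
have KnO n : Kn n `<=` Om.
  move=> x [cx /= hx]; have [Dx gx] := Wg x (clW _ cx); rewrite OmE; split => //.
  move: cx; rewrite clOm => -[_]; rewrite le_eqVlt => /orP[/eqP gz|//].
  by move: hx; rewrite gx gz oppr0 mulr0 ler10.
(* The sign of [gt] far from Omega_g is not controlled, so the product is set to 0 off Omega_g by
   hand; it remains C^2 because it is carried by the compact [Kn n] inside Omega_g. *)
pose psi n x := if x \in Om then th n x * V x else 0.
have psiO n x : Om x -> psi n x = th n x * V x by move=> Ox; rewrite /psi mem_set.
have psi0 n : zero_off (Kn n) (psi n).
  move=> x nx; rewrite /psi; case: ifPn => [/set_mem Ox|//].
  rewrite /th step_le0 ?mul0r//; have [h|h] := leP 1 (n%:R * - gt x); last by lra.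
  by exfalso; apply: nx; split => //; exact: subset_closure.
have Cpsi n : class_C 2 setT (psi n).
  rewrite (_ : setT = Om `|` ~` Kn n); last first.
    by apply/seteqP; split => // x _; have [/KnO|] := pselect (Kn n x); [left|right].
  have oK : open (~` Kn n) by rewrite openC; exact: compact_closed2.
  apply: class_C_cup.
    apply: (@class_C_ext _ 2 Om (fun x => th n x * V x)) => //; first by move=> x /(psiO n) ->.
    by apply: class_C_sub (class_CM openT (Cth n) CV).
  by apply: (class_C_ext oK _ (@class_C_cst R 2 _ 0)) => x /psi0 ->.
pose E s n x := (pds s V x - pds s (psi n) x) ^+ 2.
have pdth d n x : pd d (th n) x = - (n%:R * derive1 step (n%:R * (- gt x) - 1) * pd d gt x).
  rewrite /th pd_comp; last 2 first.
  - by case/class_C1dS: (@class_C1d_step R 1).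
  - exact: (class_C_derivable (Carg n) Logic.I).
  have -> : pd d (fun x => n%:R * - gt x - 1) x = - (n%:R * pd d gt x).
    apply: is_pdE.
    have dg := derivable_pd (class_C_derivable C1gt Logic.I : derivable gt x (dir d)).
    have := is_pdD (is_deriveZ (- n%:R) dg) (is_pd_cst d (- 1) x); rewrite addr0 /GRing.scale/= mulNr.
    by congr is_derive; apply/funext => y; change (- n%:R * gt y - 1 = n%:R * - gt y - 1); rewrite mulNr mulrN.
  have alg (u v w : R) : u * - (v * w) = - (v * u * w) by ring.
  exact: alg.
have argO n x : Om x -> gt x = g x by move=> /OW/Wg[].
have gp x : Om x -> 0 <= - gt x by move=> Ox; rewrite (argO 0%N x Ox) oppr_ge0; exact: (ltW (gneg x Ox)).
have ga x : Om x -> `|g x| = - gt x by move=> Ox; rewrite (argO 0%N x Ox) (ltr0_norm (gneg x Ox)).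
have sb1 n x : Om x -> `|n%:R * derive1 step (n%:R * (- gt x) - 1)| * - gt x <= 2 * M.
  move=> Ox; have := @step_scaled_bound M (derive1 step) 1 (- gt x) n%:R hM (@derive1_step_eq0 R) (gp x Ox) (ler0n _ _).
  by rewrite !expr1.
have pb1 d n x : Om x -> `|pd d (th n) x| * `|g x| <= 2 * M * Lg.
  move=> Ox; rewrite pdth normrN normrM mulrAC (ga x Ox).
  by apply: ler_pM (sb1 n x Ox) (hLg [:: d] x isT); [rewrite mulr_ge0 ?gp|].
have pb2 d d' n x : Om x -> `|pd d (pd d' (th n)) x| * g x ^+ 2 <= 4 * M2 * (Lg * Lg) + 2 * M * Lg * Lg.
  move=> Ox; have gx := gneg x Ox.
  have E2 : pd d (pd d' (th n)) x = (n%:R ^+ 2 * derive1 (derive1 step) (n%:R * (- gt x) - 1)) * (pd d gt x * pd d' gt x) -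
      (n%:R ^+ 1 * derive1 step (n%:R * (- gt x) - 1)) * pd d (pd d' gt) x.
    have Eth : pd d' (th n) = fun x => (- n%:R) * (derive1 step (n%:R * (- gt x) - 1) * pd d' gt x).
      by apply/funext => y; rewrite pdth; ring.
    rewrite Eth; apply: is_pdE.
    have dst : derivable (derive1 (@step R)) (n%:R * (- gt x) - 1) 1.
      by have [_ _ /class_C1dS[_ + _]] := (class_C1dS _ _).1 (@class_C1d_step R 2); apply.
    have Ds : is_derive x (dir d) (fun x => derive1 step (n%:R * (- gt x) - 1))
       (derive1 (derive1 step) (n%:R * (- gt x) - 1) * (- (n%:R * pd d gt x))).
      have dg := derivable_pd (class_C_derivable C1gt Logic.I : derivable gt x (dir d)).
      have da : is_derive x (dir d) (fun x => n%:R * (- gt x) - 1) (- (n%:R * pd d gt x)).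
        have := is_pdD (is_deriveZ (- n%:R) dg) (is_pd_cst d (- 1) x); rewrite addr0 /GRing.scale/= mulNr.
        by congr is_derive; apply/funext => y; change (- n%:R * gt y - 1 = n%:R * - gt y - 1); rewrite mulNr mulrN.
      apply: (is_pd_comp _ da); rewrite derive1E; exact: derivableP.
    have Cg' : class_C 1 setT (pd d' gt) by exact: class_C_pd Cgt2.
    have Dg' := derivable_pd (class_C_derivable Cg' Logic.I : derivable (pd d' gt) x (dir d)).
    have := is_deriveZ (- n%:R) (is_pdM Ds Dg').
    set z1 := derive1 (derive1 step) _; set z2 := derive1 step _; set z3 := pd d (pd d' gt) x.
    set z4 := pd d gt x; set z5 := pd d' gt x; rewrite /GRing.scale/=.
    have -> : - n%:R * (z1 * - (n%:R * z4) * z5 + z2 * z3) = n%:R ^+ 2 * z1 * (z4 * z5) - n%:R ^+ 1 * z2 * z3 by ring.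
    by [].
  have s2 := @step_scaled_bound M2 (derive1 (derive1 step)) 2 (- gt x) n%:R hM2 derive2_step_eq0 (gp x Ox) (ler0n _ _).
  have s1 := @step_scaled_bound M (derive1 step) 1 (- gt x) n%:R hM (@derive1_step_eq0 R) (gp x Ox) (ler0n _ _).
  rewrite E2 -(argO n x Ox); move: s1 s2.
  have := hLg [:: d] x isT; have := hLg [:: d'] x isT; have := hLg [:: d; d'] x isT; rewrite /=.
  set u2 := _ ^+ 2 * derive1 (derive1 step) _; set u1 := _ ^+ 1 * derive1 step _.
  set z3 := pd d (pd d' gt) x; set z4 := pd d gt x; set z5 := pd d' gt x => h3 h5 h4 s1 s2.
  have gL : `|gt x| <= Lg by exact: (hLg [::] x isT).
  have {}gp := gp x Ox.
  have g2 : gt x ^+ 2 = (- gt x) ^+ 2 by rewrite sqrrN.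
  apply: (@le_trans _ _ ((`|u2| * (- gt x) ^+ 2) * (`|z4| * `|z5|) + (`|u1| * (- gt x) ^+ 1) * (`|z3| * (- gt x)))).
    rewrite g2 !expr2 expr1.
    have alg (l1 l2 l3 l4 l5 s : R) : l2 * (s * s) * (l4 * l5) + l1 * s * (l3 * s) = (l2 * (l4 * l5) + l1 * l3) * (s * s) by ring.
    rewrite alg; apply: ler_wpM2r; first exact: mulr_ge0.
    rewrite -(normrM z4 z5) -(normrM u2) -(normrM u1); exact: ler_normB.
  have gpL : - gt x <= Lg by apply: le_trans gL; rewrite -normrN; exact: ler_norm.
  have n2 : 0 <= `|u2| * (- gt x) ^+ 2 by rewrite mulr_ge0// exprn_ge0.
  have n1 : 0 <= `|u1| * (- gt x) ^+ 1 by rewrite mulr_ge0// exprn_ge0.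
  apply: lerD.
    have -> : (4 : R) = 2 ^+ 2 by rewrite expr2 -natrM.
    exact: (ler_pM n2 (mulr_ge0 (normr_ge0 z4) (normr_ge0 z5)) s2 (ler_pM (normr_ge0 z4) (normr_ge0 z5) h4 h5)).
  rewrite -[leRHS]mulrA; apply: ler_pM; [exact: n1|exact: mulr_ge0|exact: s1|exact: ler_pM].
have thb n x : `|1 - th n x| <= 1.
  by rewrite ger0_norm; have := @step_ge0 R (n%:R * - gt x - 1); have := @step_le1 R (n%:R * - gt x - 1); rewrite /th; lra.
have [B B0 hB] : exists2 B : R, 0 < B & forall s n x, (size s <= 2)%N -> Om x -> `|pds s V x - pds s (psi n) x| <= B.
  (* [Q] bounds the second derivative of the cutoff times g^2, and [PB] its first derivative times a
     derivative of [V]; the sum collects the terms of the product rule up to order two. *)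
  pose Q := 4 * M2 * (Lg * Lg) + 2 * M * Lg * Lg.
  have Q0 : 0 <= Q by rewrite /Q !addr_ge0// !mulr_ge0// ltW.
  pose PB := 2 * M * Lg * C.
  have P0 : 0 <= PB by rewrite /PB !mulr_ge0// ltW.
  have QC0 : 0 <= Q * C by rewrite mulr_ge0// ltW.
  have PL0 : 0 <= PB * Lg by rewrite mulr_ge0// ltW.
  have [ns1 ns2 ns3 ns4] := nonneg_sums L0 P0 QC0 PL0.
  exists (L + PB + PB + Q * C + PB * Lg) => //.
  move=> s n x s2 Ox.
  have Es : pds s (psi n) x = pds s (fun x => th n x * V x) x by exact: (pds_ext s oOm (psiO n) Ox).
  have [hV hpV] := hC x Ox; have gx := gneg x Ox.
  have g0 : 0 < `|g x| by rewrite normr_gt0 lt_eqF.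
  have dth d y : derivable (th n) y (dir d) by exact: (class_C_derivable (C1th n) Logic.I).
  have dV d y : derivable V y (dir d) by exact: (class_C_derivable CV1 Logic.I).
  have t0 : `|(1 - th n x) * pds s V x| <= L.
    by rewrite normrM -[leRHS]mul1r; apply: ler_pM => //; exact: hL.
  have t1 d (v : R) : `|v| <= C * `|g x| -> `|pd d (th n) x * v| <= 2 * M * Lg * C.
    move=> hv; rewrite normrM; apply: (le_trans (ler_wpM2l _ hv)) => //.
    rewrite mulrCA [leRHS]mulrC; apply: ler_wpM2l; first exact: ltW.
    exact: pb1.
  have t2 d d' : `|pd d (pd d' (th n)) x * V x| <= Q * C.
    rewrite normrM; apply: (le_trans (ler_wpM2l _ hV)) => //.
    rewrite mulrCA [leRHS]mulrC; apply: ler_wpM2l; first exact: ltW.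
    exact: pb2.
  rewrite Es; case: s s2 t0 {Es} => [|d' [|d [|? ?]]] s2 t0; last by [].
  - rewrite /= mulrBl mul1r in t0 *; apply: (le_trans t0).
    exact: ns2.
  - rewrite /= in t0 *; rewrite pdM//.
    have h1 : `|pd d' (th n) x * V x| <= PB * Lg.
      rewrite normrM; apply: (le_trans (ler_wpM2l _ hV)) => //.
      have -> : `|pd d' (th n) x| * (C * g x ^+ 2) = (`|pd d' (th n) x| * `|g x|) * C * `|g x|.
        by rewrite -[g x ^+ 2]real_normK ?num_real//; ring.
      apply: ler_pM => //; first by rewrite !mulr_ge0// ltW.
        by apply: ler_wpM2r; [exact: ltW|exact: pb1].
      by rewrite -(argO n x Ox); exact: (hLg [::] x isT).
    exact: (le_trans (product_error1 t0 h1) ns3).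
  - rewrite /= in t0 *.
    have CthV : class_C 1 setT (pd d (th n)) by exact: class_C_pd (Cth n).
    have CVd : class_C 1 setT (pd d V) by exact: class_C_pd CV.
    have -> : pd d (fun x => th n x * V x) = fun x => pd d (th n) x * V x + th n x * pd d V x.
      by apply/funext => y; rewrite pdM.
    have D1 := is_pdM (derivable_pd (class_C_derivable CthV Logic.I : derivable (pd d (th n)) x (dir d'))) (derivable_pd (dV d' x)).
    have D2 := is_pdM (derivable_pd (dth d' x)) (derivable_pd (class_C_derivable CVd Logic.I : derivable (pd d V) x (dir d'))).
    rewrite (is_pdE (is_pdD D1 D2)).
    exact: (le_trans (product_error2 t0 (t1 d _ (hpV d')) (t1 d' _ (hpV d)) (t2 d' d)) ns4).
have lim s : (size s <= 2)%N -> It ((E s n) \_ Om) @[n --> \oo] --> (0 : R).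
  move=> s2; rewrite -(@It_eq0 R (cst 0))//.
  have cE n : continuous (E s n).
    move=> x; apply: (@continuous_comp _ _ _ (fun x => pds s V x - pds s (psi n) x) (fun t => t ^+ 2)); last exact: exprn_continuous.
    exact: (@continuousB _ _ _ (pds s V) (pds s (psi n)) x (cont2 V s s2 CV x) (cont2 (psi n) s s2 (Cpsi n) x)).
  apply: (@dct R (fun n => (E s n) \_ Om) (cst 0) ((fun=> B ^+ 2) \_ Om)).
  - by move=> n; apply/(mf_patch _ mO); apply: measurable_funS (continuous_mf (cE n)).
  - exact: measurable_cst.
  - apply: aeW => x; apply: cvg_near_cst; have [Ox|nO] := pselect (Om x); last first.
      by apply: nearW => n; rewrite patchE memNset.
    have gx := gneg x Ox.
    near=> n; rewrite patchE mem_set// /E.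
    have hn : 1 < n%:R * (- gt x) - 1.
      rewrite ltrBrDr -ltr_pdivrMr; last by rewrite (argO n x Ox) oppr_gt0.
      near: n; exact: nbhs_infty_gtr.
    (* On this open set the cutoff is 1, so every derivative of [psi n] coincides with that of [V]
       at [x] once [n] is large. *)
    pose N := Om `&` [set y | 1 < n%:R * (- gt y) - 1].
    have oN : open N.
      apply: openI => //; apply: (@open_comp _ _ (fun y => n%:R * (- gt y) - 1) [set r : R | 1 < r]); last exact: open_gt.
      by move=> y _; exact: (class_C_continuous (Carg n)).
    have EN y : N y -> psi n y = V y.
      by move=> [Oy hy]; rewrite psiO// /th step_ge1 ?mul1r// ltW.
    by rewrite (pds_ext s oN EN) ?subrr ?expr0n.
  - have [r _ hr] := compact_sub_box cOm.
    apply: (@intg_bounded R _ (B ^+ 2) r).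
    + by apply/(mf_patch _ mO); exact: measurable_cst.
    + by move=> x; rewrite patchE; case: ifP => _; rewrite ?normr0 ?sqr_ge0// ger0_norm// sqr_ge0.
    + by move=> x nx; rewrite patchE memNset// => Ox; apply: nx; apply: hr; exact: subset_closure.
  - move=> n x; rewrite !patchE; case: ifPn => [/set_mem Ox|_]; last by rewrite normr0.
    rewrite /E ger0_norm ?sqr_ge0// -real_normK ?num_real//.
    by rewrite ler_sqr ?nnegrE// ?(ltW B0)//; exact: hB.
have [s s2|s d d' dd h1 n hn|d d0 hd] := @uniform_lists R 2 (fun s (d : R) => forall n, n.+1%:R^-1 <= d -> It ((E s n) \_ Om) < e).
- have /cvgrPdist_lt/(_ e e0)[N _ hN] := lim s s2.
  exists N.+1%:R^-1; first by rewrite invr_gt0.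
  move=> n; rewrite lef_pV2 ?posrE// ler_nat ltnS => Nn.
  by have := hN n Nn; rewrite /= sub0r normrN => /(le_lt_trans (ler_norm _)).
- by apply: h1; exact: le_trans hn dd.
pose n := Num.trunc d^-1.
have nd : n.+1%:R^-1 <= d.
  rewrite -[leRHS]invrK lef_pV2 ?posrE ?invr_gt0//; apply: ltW; exact: truncnS_gt.
exists (psi n), (Kn n); split; [exact: cKn|exact: (@KnO n)|exact: Cpsi|exact: psi0|].
by move=> s s2; exact: hd.
Unshelve. all: by end_near. Qed.

End zero_trace.

(** * Traces and the uniqueness of the clamped plate *)

Section traces.
Context {R : realType}.
Local Notation mR := (measurableTypeR R).
Local Notation mP := (mR * mR)%type.
Implicit Types (f h k F V psi phi : R * R -> R) (A B U K : set (R * R)) (x y p q : R * R) (b d : bool)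
  (m n : nat) (c : R -> R) (s : seq bool) (t r e a : R).

(** The fundamental theorem of calculus on each line in direction [b], from the graph to beyond the
    support. The graph is negligible, so closed half-lines may replace open ones. *)
Lemma It_patch_epi b c sg F K : continuous c -> sg = 1 \/ sg = - 1 -> class_C 1 setT F -> compact K ->
  zero_off K F -> It ((pd b F) \_ (epi b c sg)) =
  (\int[lebesgue_measure]_u (- sg * F (pt b u (c u))))%R.
Proof.
move=> cc sgE CF cK F0; have clK := compact_closed2 cK.
have pF0 := zero_off_pd b clK F0; have cpF := class_C_continuous (class_C_pd b CF).
have cF := class_C_continuous CF.
have [r r0 Kr] := compact_sub_box cK.
have ct : continuous (tau b c).
  move=> x; apply: (@continuousB _ _ _ (co b) (fun x => c (co (~~ b) x)) x); first exact: continuous_co.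
  by apply: (@continuous_comp _ _ _ (co (~~ b)) c); [exact: continuous_co|exact: cc].
have cst' : continuous (fun x => sg * tau b c x).
  by move=> x; apply: (@continuousM _ _ (fun=> sg) (tau b c) x); [exact: cst_continuous|exact: ct].
pose A := [set x | 0 <= sg * tau b c x].
have mA : @measurable _ mP A.
  apply: closed_measurable2; apply: (@closed_comp _ _ (fun x => sg * tau b c x) [set t | 0 <= t]); last exact: closed_ge.
  by move=> x _; exact: cst'.
have mE : @measurable _ mP (epi b c sg).
  apply: open_measurable2; apply: (@open_comp _ _ (fun x => sg * tau b c x) [set t | 0 < t]); last exact: open_gt.
  by move=> x _; exact: cst'.
have mG : @measurable _ mP [set x | co b x = c (co (~~ b) x)].
  apply: closed_measurable2; rewrite (_ : [set x | _] = tau b c @^-1` [set 0]).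
    by apply: closed_comp; [move=> x _; exact: ct|exact: closed_eq].
  apply/seteqP; split => x; rewrite /tau/=; first by move=> ->; rewrite subrr.
  by move/eqP; rewrite subr_eq0 => /eqP.
have mp B : @measurable _ mP B -> mf ((pd b F) \_ B).
  by move=> mB; apply/(mf_patch _ mB); apply: measurable_funS (continuous_mf cpF).
transitivity (It ((pd b F) \_ A)).
  apply: ae_eq_It; [exact: mp|exact: mp|].
  apply: (null_ae mG (graph_null b cc)) => x nG; rewrite !patchE.
  have tn : sg * tau b c x != 0.
    rewrite mulf_eq0 negb_or; apply/andP; split.
      by case: sgE => ->; rewrite ?oppr_eq0 oner_eq0.
    by apply/eqP => t0; apply: nG; move/eqP: t0; rewrite subr_eq0 => /eqP.
  have -> : (x \in A) = (x \in epi b c sg); last by [].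
  by apply/idP/idP => /set_mem h; apply/mem_set; move: h; rewrite /A /epi/= le_eqVlt eq_sym (negbTE tn).
have iA : intg ((pd b F) \_ A).
  apply: le_intg (mp _ mA) _ (intg_abs (intg_continuous cK cpF pF0)) => x.
  by rewrite patchE; case: ifP => // _; rewrite normr0.
rewrite (Fubini_It b iA); apply: eq_Rintegral => u _.
pose f t := pd b F (pt b u t).
have off t : r < `|t| -> f t = 0 /\ F (pt b u t) = 0.
  move=> rt; have nK : ~ K (pt b u t) by move=> /Kr/(co_box b); rewrite co_pt leNgt rt.
  by rewrite /f pF0// F0.
have dF t : is_derive t 1 (fun t => F (pt b u t)) (f t) by exact: (@is_pd_linet R b F u t 0 CF).
have cf : continuous f by exact: continuous_line.
have E t : ((pd b F) \_ A) (pt b u t) = (if 0 <= sg * (t - c u) then 1 else 0) * f t.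
  rewrite patchE; have -> : (pt b u t \in A) = (0 <= sg * (t - c u)).
    by apply/idP/idP => [/set_mem|h]; [|apply/mem_set]; rewrite /A/= /tau co_pt co_ptN.
  by case: ifP => _; rewrite ?mul1r ?mul0r.
transitivity (\int[lebesgue_measure]_t ((if 0 <= sg * (t - c u) then 1 else 0) * f t))%R.
  by apply: eq_Rintegral => t _; exact: E.
case: sgE => sgE; rewrite sgE.
  pose M := Num.max (c u) r + 1.
  have cM : c u < M by rewrite /M (le_lt_trans (_ : _ <= Num.max (c u) r)) ?le_max ?lexx// ltrDl.
  have rM : r < M by rewrite /M (le_lt_trans (_ : _ <= Num.max (c u) r)) ?le_max ?lexx ?orbT// ltrDl.
  transitivity (\int[lebesgue_measure]_t ((if c u <= t <= M then 1 else 0) * f t))%R.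
    apply: eq_Rintegral => t _; rewrite mul1r subr_ge0.
    case: (leP (c u) t) => //= _; case: (leP t M) => // Mt.
    by have [-> _] := off t (lt_le_trans (lt_trans rM Mt) (ler_norm t)); rewrite !mulr0.
  rewrite leb_itv_indic (FTC_Rintegral cM dF cf).
  by have [_ ->] := off M (lt_le_trans rM (ler_norm M)); rewrite sub0r mulN1r.
pose M := Num.min (c u) (- r) - 1.
have cM : M < c u by rewrite /M (lt_le_trans (_ : _ < Num.min (c u) (- r))) ?ge_min ?lexx// ltrBlDr ltrDl.
have rM : M < - r by rewrite /M (lt_le_trans (_ : _ < Num.min (c u) (- r))) ?ge_min ?lexx ?orbT// ltrBlDr ltrDl.
have nrm t : t <= M -> r < `|t| by move=> tM; apply: (@lt_le_trans _ _ (- t)); [lra|rewrite -normrN; exact: ler_norm].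
transitivity (\int[lebesgue_measure]_t ((if M <= t <= c u then 1 else 0) * f t))%R.
  apply: eq_Rintegral => t _; rewrite mulN1r opprB subr_ge0 andbC.
  case: (leP t (c u)) => //= _; case: (leP M t) => // Mt.
  by have [-> _] := off t (nrm t (ltW Mt)); rewrite !mulr0.
rewrite leb_itv_indic (FTC_Rintegral cM dF cf).
by have [_ ->] := off M (nrm M (lexx M)); rewrite subr0 opprK mul1r.
Qed.

Lemma integral_gt0 (k : R -> R) (a e t0 : R) : continuous k -> (forall t, 0 <= k t) -> a < e ->
  a <= t0 <= e -> 0 < k t0 -> (0 < \int[lebesgue_measure]_(t in `[a, e]) (k t)%:E)%E.
Proof.
move=> ck k0 ae /andP[at0 t0e] kt0; have kh : 0 < k t0 / 2 by rewrite divr_gt0.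
have [r r0 hr] : exists2 r, 0 < r & forall t, `|t - t0| <= r -> k t0 / 2 <= k t.
  have /cvgrPdist_le/(_ _ kh)/nbhs_ballP[r /= r0 hr] := ck t0.
  exists (r / 2); first by rewrite divr_gt0.
  move=> t tr; have := hr t; rewrite /ball/= distrC => /(_ (le_lt_trans tr _)).
  move=> h; have /h : r / 2 < r by lra.
  by rewrite ler_norml => /andP[_]; lra.
pose u := Num.max a (t0 - r); pose v := Num.min e (t0 + r).
have uv : u < v by rewrite /u /v gt_max !lt_min; apply/andP; split; apply/andP; split; lra.
have [ua ur] : a <= u /\ t0 - r <= u by rewrite !le_max !lexx orbT.
have [ve vr] : v <= e /\ v <= t0 + r by rewrite !ge_min !lexx orbT.
pose J : set mR := [set` `[u, v]]; pose I : set mR := [set` `[a, e]].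
have mI (i : interval R) : @measurable _ mR [set` i] by exact: measurable_itv.
have JI : J `<=` I by move=> t; rewrite /J /I /= !in_itv/= => /andP[h1 h2]; apply/andP; split; lra.
have mk (B : set mR) : @measurable _ mR B -> @measurable_fun _ _ mR _ B (EFin \o k).
  by move=> mB; apply/measurable_EFinP; apply: measurable_funTS; exact: continuous_measurable_fun.
have lJ : lebesgue_measure J = (v - u)%:E by rewrite lebesgue_measure_itv/= lte_fin uv EFinB.
apply: (@lt_le_trans _ _ ((k t0 / 2)%:E * lebesgue_measure J)%E).
  by rewrite [X in (_ * X)%E]lJ -EFinM lte_fin mulr_gt0// subr_gt0.
rewrite -(@integral_cst _ mR R lebesgue_measure _ (mI _)).
apply: (@le_trans _ _ (\int[lebesgue_measure]_(t in J) (k t)%:E)%E).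
  apply: ge0_le_integral => //.
  - by move=> t _; rewrite lee_fin ltW.
  - by apply: mk.
  - move=> t; rewrite /J/= in_itv/= => /andP[h1 h2]; rewrite lee_fin; apply: hr.
    by rewrite ler_norml; apply/andP; split; lra.
apply: (@ge0_subset_integral _ mR R lebesgue_measure _ _ (mI _) (mI _) _ (mk _ (mI _)) _ JI).
by move=> t _; rewrite lee_fin.
Qed.

Lemma Rintegral_gt0 (k : R -> R) (a e t0 : R) : continuous k -> (forall t, 0 <= k t) ->
  (forall t, ~ (a <= t <= e) -> k t = 0) -> 0 < k t0 -> 0 < (\int[lebesgue_measure]_t k t)%R.
Proof.
move=> ck k0 koff kt0; rewrite (@Rintegral_zero_off _ _ (a - 1) (e + 1)); last first.
  by move=> t ht; apply: koff => /andP[h1 h2]; apply: ht; apply/andP; split; lra.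
have /andP[at0 t0e] : a <= t0 <= e by apply: contrapT => /koff h; move: kt0; rewrite h ltxx.
have ik : lebesgue_measure.-integrable `[a - 1, e + 1] (EFin \o k).
  by apply: continuous_compact_integrable; [exact: segment_compact|exact: continuous_subspaceT].
rewrite /Rintegral; apply: fine_gt0; apply/andP; split.
  by apply: (@integral_gt0 k _ _ t0) => //; [|apply/andP; split]; lra.
have mI : @measurable _ mR [set` `[a - 1, e + 1]] by exact: measurable_itv.
have := integrable_fin_num mI ik.
by rewrite ge0_fin_numE//; apply: integral_ge0 => t _; rewrite lee_fin.
Qed.

Lemma It_patch_epi_neq0 b c sg F K q : continuous c -> sg = 1 \/ sg = - 1 -> class_C 1 setT F ->
  compact K -> zero_off K F -> (forall x, 0 <= F x) -> tau b c q = 0 -> 0 < F q ->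
  It ((pd b F) \_ (epi b c sg)) <> 0.
Proof.
move=> cc sgE CF cK F0 Fp tq Fq; rewrite (It_patch_epi b cc sgE CF cK F0) => E.
pose k u := F (pt b u (c u)).
have ck : continuous k.
  have Ck : class_C1d 0 k.
    by apply: class_C1d_graph; [exact: class_C_le CF|exact/class_C1d0].
  exact/class_C1d0.
have [r r0 Kr] := compact_sub_box cK.
have koff t : ~ (- r <= t <= r) -> k t = 0.
  move=> nt; apply: F0 => /Kr/(co_box (~~ b)); rewrite co_ptN ler_norml => /andP[h1 h2].
  by apply: nt; rewrite h1.
have kq : 0 < k (co (~~ b) q).
  rewrite /k; have -> : c (co (~~ b) q) = co b q by move/eqP: tq; rewrite subr_eq0 => /eqP.
  by rewrite pt_co.
have pos := Rintegral_gt0 ck (fun t => Fp _) koff kq.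
have ik : lebesgue_measure.-integrable setT (EFin \o k).
  have ikc : lebesgue_measure.-integrable `[- r, r] (EFin \o k).
    by apply: continuous_compact_integrable; [exact: segment_compact|exact: continuous_subspaceT].
  move: ikc; rewrite integrable_mkcond//; congr (_.-integrable _ _).
  apply/funext => t; rewrite patchE; case: ifPn => //.
  by rewrite notin_setE/= in_itv/= => /koff /= ->.
move: E; rewrite RintegralZl// => /eqP; rewrite mulf_eq0 => /orP[/eqP|/eqP E].
  by case: sgE => -> => /eqP; rewrite ?opprK ?oppr_eq0 oner_eq0.
by move: pos; rewrite E ltxx.
Qed.

Lemma H20_It U h e : open U -> H20 U h -> 0 < e -> exists phi, test_fun U phi /\
  forall s v, (size s <= 2)%N -> wderiv U s h v -> It (fun x => ((v \_ U) x - pds s phi x) ^+ 2) < e.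
Proof.
move=> oU [_ H] e0; have [phi [tp Hp]] := H e e0; exists phi; split => // s v s2 Dv.
have Lv := (L2_patch _ (open_measurable2 oU)).1 (proj2 (wderiv_L2 Dv)).
have := Hp s v s2 Dv; rewrite -lte_fin EFin_It; last first.
  by apply: L2_sq; apply: L2B => //; exact: test_fun_L2 (test_fun_pds s tp).
congr (_ < _)%E; rewrite integral_mkcond; apply: eq_integral => x _; rewrite !patchE; case: ifPn => //.
by rewrite notin_setE => nU; rewrite (test_fun_off (test_fun_pds s tp) nU) subrr expr0n.
Qed.

(** The integral is 0 for a test function in place of [V], and depends continuously on its H^2 norm.
    One derivative is spent by the divergence, hence lists of length at most 1. *)
Lemma H20_divergence U h V K b s psi K' : open U -> H20 U h -> compact K -> class_C 2 setT V ->
  zero_off K V -> {ae leb2, forall x, U x -> h x = V x} -> (size s <= 1)%N -> class_C 1 setT psi ->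
  compact K' -> zero_off K' psi -> It ((pd b (fun x => pds s V x * psi x)) \_ U) = 0.
Proof.
move=> oU H cK CV V0 hV s1 Cpsi cK' psi0.
have mU := open_measurable2 oU.
have Lh := sobolev_L2 (proj1 H).
have s2 : (size s <= 2)%N by exact: leq_trans s1 _.
have bs2 : (size (b :: s) <= 2)%N by [].
have Ds := wderiv_representative oU s2 cK CV V0 Lh hV.
have Dbs := wderiv_representative oU bs2 cK CV V0 Lh hV.
have Ls := (L2_patch _ mU).1 (proj2 (wderiv_L2 Ds)).
have Lbs := (L2_patch _ mU).1 (proj2 (wderiv_L2 Dbs)).
have CVs : class_C 1 setT (pds s V) by apply: class_C_pds; apply: class_C_le CV; rewrite add1n ltnS.
have Lpsi := L2_C0 cK' (class_C_continuous Cpsi) psi0.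
have Lpd : L2 setT (pd b psi).
  by apply: (L2_C0 cK'); [exact: class_C_continuous (class_C_pd b Cpsi)|exact: zero_off_pd (compact_closed2 cK') psi0].
set P := It (fun x => psi x ^+ 2); set P' := It (fun x => pd b psi x ^+ 2).
have P0 : 0 <= P by apply: It_ge0 => x; exact: sqr_ge0.
have P'0 : 0 <= P' by apply: It_ge0 => x; exact: sqr_ge0.
set X := It _; apply/eqP; rewrite -sqrf_eq0 -normr_le0; apply/ler_addgt0Pr => e e0; rewrite add0r.
(* [X] is a sum u + v with u^2 <= e' P and v^2 <= e' P' by Cauchy-Schwarz, and (u + v)^2 <= 2 u^2 +
   2 v^2. *)
have e1 : 0 < e / (2 * P + 2 * P' + 1) by rewrite divr_gt0//; lra.
have [phi [tp Hp]] := H20_It oU H e1.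
have [sphi [K2 [cK2 K2U phi0]]] := tp.
have Ca : class_C 1 setT (pds s phi) by exact: (smooth_pds s sphi 1%N).
pose a x := (pds s V \_ U) x - pds s phi x; pose a' x := (pds (b :: s) V \_ U) x - pds (b :: s) phi x.
have Lp (l : seq bool) := test_fun_L2 (test_fun_pds l tp).
have La : L2 setT a by exact: L2B Ls (Lp s).
have La' : L2 setT a' by exact: L2B Lbs (Lp (b :: s)).
have z0 : It (pd b (fun x => pds s phi x * psi x)) = 0.
  apply: (It_pd0 b cK'); first by apply: class_CM => //; exact: openT.
  by move=> x /psi0 ->; rewrite mulr0.
have dsum (k : R * R -> R) x : class_C 1 setT k -> pd b (fun x => k x * psi x) x = pd b k x * psi x + k x * pd b psi x.
  move=> Ck; rewrite pdM//; first exact: (class_C_derivable Ck Logic.I).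
  exact: (class_C_derivable Cpsi Logic.I).
have XE : X = It (fun x => a' x * psi x) + It (fun x => a x * pd b psi x).
  have i1 := L2_intgM La' Lpsi; have i2 := L2_intgM La Lpd.
  have i3 : intg (pd b (fun x => pds s phi x * psi x)).
    have := intgD (L2_intgM (Lp (b :: s)) Lpsi) (L2_intgM (Lp s) Lpd).
    by congr intg; apply/funext => x; rewrite dsum.
  rewrite -(ItD i1 i2) -[RHS]addr0 -z0 -(ItD (intgD i1 i2 : intg (fun x => a' x * psi x + a x * pd b psi x)) i3); congr It; apply/funext => x.
  have alg (u1 u2 v1 v2 w w' : R) : u1 * w + u2 * w' = (u1 - v1) * w + (u2 - v2) * w' + (v1 * w + v2 * w') by ring.
  rewrite (dsum _ _ Ca) patchE; case: ifPn => xU.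
    by rewrite /a /a' !patchE xU (dsum _ _ CVs); exact: alg.
  rewrite /a /a' !patchE (negbTE xU).
  by transitivity (0 * psi x + 0 * pd b psi x); [rewrite !mul0r addr0|exact: alg].
have CS1 := CauchySchwarz La' Lpsi; have CS2 := CauchySchwarz La Lpd.
have h1 := Hp _ _ bs2 Dbs; have h2 := Hp _ _ s2 Ds.
rewrite ger0_norm ?sqr_ge0// XE.
move: CS1 CS2 h1 h2; rewrite -/P -/P'.
set u := It (fun x => a' x * psi x); set v := It (fun x => a x * pd b psi x).
rewrite -/(It (fun x => a' x ^+ 2)) -/(It (fun x => a x ^+ 2)).
set n1 := It (fun x => a' x ^+ 2); set n2 := It (fun x => a x ^+ 2).
move=> CS1 CS2 h1 h2; set e' := e / _ in h1 h2 e1.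
have eE : e = e' * (2 * P + 2 * P' + 1) by rewrite /e' divfK// gt_eqF//; lra.
clearbody u v n1 n2 P P' e'.
have k1 : n1 * P <= e' * P by apply: ler_wpM2r => //; exact: ltW.
have k2 : n2 * P' <= e' * P' by apply: ler_wpM2r => //; exact: ltW.
have := sqr_ge0 (u - v); rewrite eE; nra.
Qed.

Lemma It_sqD_le f h : L2 setT f -> L2 setT h ->
  It (fun x => (f x + h x) ^+ 2) <= 2 * It (fun x => f x ^+ 2) + 2 * It (fun x => h x ^+ 2).
Proof.
move=> Lf Lh; rewrite -(ItZ 2 (L2_sq Lf)) -(ItZ 2 (L2_sq Lh)) -(ItD (intgZ 2 (L2_sq Lf)) (intgZ 2 (L2_sq Lh))).
apply: le_It; [exact: L2_sq (L2D Lf Lh)|exact: intgD (intgZ 2 (L2_sq Lf)) (intgZ 2 (L2_sq Lh))|].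
by move=> x /=; have := sqr_ge0 (f x - h x); nra.
Qed.

Definition lap phi x := pds [:: false; false] phi x + pds [:: true; true] phi x.

(** Writing 1 as the derivative of x_1, an integration by parts gives |phi|^2 <= 4 r^2 |pd false
    phi|^2 in L2 norm. Another one gives |grad phi|^2 <= |phi| |lap phi|. Eliminating the gradient
    yields 16 r^4. *)
Lemma poincare U phi r : U `<=` box r -> 0 < r -> test_fun U phi ->
  It (fun x => phi x ^+ 2) <= 16 * r ^+ 4 * It (fun x => lap phi x ^+ 2).
Proof.
move=> Ur r0 tp; have [sphi [K [cK KU phi0]]] := tp.
have clK := compact_closed2 cK.
have C1 : class_C 1 setT phi := sphi 1%N.
have sd b : smooth (pd b phi) by exact: smooth_pd.
have L s := test_fun_L2 (test_fun_pds s tp).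
set A := It (fun x => phi x ^+ 2); set B := It (fun x => lap phi x ^+ 2).
pose G b := It (fun x => pd b phi x ^+ 2).
have A0 : 0 <= A by apply: It_ge0 => x; exact: sqr_ge0.
have B0 : 0 <= B by apply: It_ge0 => x; exact: sqr_ge0.
have G0 b : 0 <= G b by apply: It_ge0 => x; exact: sqr_ge0.
have Lx : L2 setT (fun x => pd false phi x * co false x).
  apply: (@L2_bnd _ r (pd false phi)); first exact: (L [:: false]).
    by apply: mfM; [exact: L2_mf (L [:: false])|exact: mf_co].
  move=> x; rewrite normrM mulrC; have [Kx|nK] := pselect (K x).
    by apply: ler_wpM2r => //; exact: (co_box false (Ur _ (KU _ Kx))).
  by rewrite (zero_off_pd false clK phi0 nK) normr0 !mulr0.
have h1 : A = - 2 * It (fun x => phi x * (pd false phi x * co false x)).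
  have Cs : class_C 1 setT (fun x => phi x * phi x) by apply: class_CM => //; exact: openT.
  have z : zero_off K (fun x => phi x * phi x) by move=> x /phi0 ->; rewrite mulr0.
  have := It_by_parts false cK Cs (@class_C_co R 1 setT false) z.
  have -> : It (fun x => phi x * phi x * pd false (co false) x) = A.
    by congr It; apply/funext => x; rewrite pd_co eqxx mulr1 expr2.
  move=> ->; rewrite mulNr; congr (- _); rewrite -(ItZ 2 (L2_intgM (L [::]) Lx)); congr It; apply/funext => x.
  rewrite pdM; [|exact: (class_C_derivable C1 Logic.I)|exact: (class_C_derivable C1 Logic.I)].
  by rewrite /=; set u := pd _ _ _; ring.
have cs1 := CauchySchwarz (L [::]) Lx.
have h2 : It (fun x => (pd false phi x * co false x) ^+ 2) <= r ^+ 2 * G false.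
  rewrite -(ItZ _ (L2_sq (L [:: false]))); apply: le_It; [exact: L2_sq|by apply: intgZ; exact: L2_sq (L [:: false])|].
  move=> x; rewrite exprMn mulrC; have [Kx|nK] := pselect (K x).
    apply: ler_wpM2r; first exact: sqr_ge0.
    rewrite -[co false x ^+ 2]real_normK ?num_real// ler_sqr ?nnegrE//; last exact: ltW.
    exact: (co_box false (Ur _ (KU _ Kx))).
  by rewrite /= (zero_off_pd false clK phi0 nK) expr0n !mulr0.
have h3 : G false + G true = - It (fun x => phi x * lap phi x).
  have ip b : G b = - It (fun x => phi x * pds [:: b; b] phi x).
    have z := zero_off_pd b clK phi0.
    have := It_by_parts b cK (sd b 1%N) C1 z => E.
    rewrite /G (_ : It _ = It (fun x => pd b phi x * pd b phi x)); last by congr It; apply/funext => x; rewrite expr2.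
    by rewrite E; congr (- It _); apply/funext => x; exact: mulrC.
  rewrite !ip -opprD -(ItD (L2_intgM (L [::]) (L [:: false; false])) (L2_intgM (L [::]) (L [:: true; true]))).
  by congr (- It _); apply/funext => x; rewrite /lap mulrDr.
have Ll : L2 setT (lap phi) by exact: L2D (L [:: false; false]) (L [:: true; true]).
have cs2 := CauchySchwarz (L [::]) Ll.
rewrite -/A -/B /= in cs1 cs2; move: h1 h2 h3 cs1 cs2 (G0 false) (G0 true).
rewrite -/A; set X := It (fun x => phi x * (pd false phi x * co false x)).
set Y := It (fun x => phi x * lap phi x); set Z := It (fun x => (pd false phi x * co false x) ^+ 2).
move: (G false) (G true) => g1 g2; clearbody A B X Y Z; clear -A0 B0 r0.
move=> h1 h2 h3 cs1 cs2 g10 g20.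
have r20 : 0 <= 4 * r ^+ 2 by rewrite mulr_ge0// sqr_ge0.
have a1 : A <= 4 * r ^+ 2 * g1.
  have [->|An] := eqVneq A 0; first exact: mulr_ge0.
  have Ap : 0 < A by rewrite lt_def An.
  have e1 : A * A <= A * (4 * (r ^+ 2 * g1)).
    have -> : A * A = 4 * X ^+ 2 by rewrite h1; ring.
    have : A * Z <= A * (r ^+ 2 * g1) by apply: ler_wpM2l.
    by move: cs1; clear; nra.
  by rewrite -mulrA -(ler_pM2l Ap).
have a2 : (g1 + g2) * (g1 + g2) <= A * B.
  by have -> : (g1 + g2) * (g1 + g2) = Y ^+ 2 by rewrite h3; ring.
have a3 : g1 <= 4 * r ^+ 2 * B.
  have [->|gn] := eqVneq g1 0; first by rewrite mulr_ge0.
  have gp : 0 < g1 by rewrite lt_def gn.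
  rewrite -(ler_pM2l gp).
  apply: (@le_trans _ _ (A * B)); first by apply: le_trans a2; apply: ler_pM => //; rewrite lerDl.
  have := ler_wpM2r B0 a1; rewrite [g1 * _]mulrC => h; apply: (le_trans h).
  by rewrite le_eqVlt; apply/orP; left; apply/eqP; ring.
apply: (le_trans a1).
have -> : 16 * r ^+ 4 * B = 4 * r ^+ 2 * (4 * r ^+ 2 * B) by ring.
exact: ler_wpM2l.
Qed.

Lemma L2_sq0_ae U h : open U -> L2 U h -> It (fun x => (h \_ U) x ^+ 2) <= 0 ->
  {ae leb2, forall x, U x -> h x = 0}.
Proof.
move=> oU Lh I0; have Lp := (L2_patch _ (open_measurable2 oU)).1 Lh.
apply: (L2_weak0 oU Lh) => phi tp; have Lphi := test_fun_L2 tp.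
have P0 : 0 <= It (fun x => phi x ^+ 2) by apply: It_ge0 => x; exact: sqr_ge0.
apply/eqP; rewrite -sqrf_eq0 eq_le sqr_ge0 andbT.
by apply: (le_trans (CauchySchwarz Lp Lphi)); apply: mulr_le0_ge0.
Qed.

Lemma wlap_lap U h w phi : open U -> wlap U h w -> L2 U w -> test_fun U phi ->
  It (fun x => (h \_ U) x * lap phi x) = It (fun x => (w \_ U) x * phi x).
Proof.
move=> oU [v1 [v2 [D1 D2 wE]]] Lw tp; have mU := open_measurable2 oU.
have [Lh L1 H1] := (wderivE _ _ _ oU).1 D1; have [_ L2' H2] := (wderivE _ _ _ oU).1 D2.
have Lww := (L2_patch _ mU).1 Lw.
have Lp s := test_fun_L2 (test_fun_pds s tp).
have i1 := L2_intgM L1 (Lp [::]); have i2 := L2_intgM L2' (Lp [::]).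
transitivity (It (fun x => (h \_ U) x * pds [:: false; false] phi x + (h \_ U) x * pds [:: true; true] phi x)).
  by congr It; apply/funext => x; rewrite /lap mulrDr.
apply: etrans (ItD (L2_intgM Lh (Lp [:: false; false])) (L2_intgM Lh (Lp [:: true; true]))) _.
apply: etrans (congr2 +%R (H1 _ tp) (H2 _ tp)) _.
have -> : (-1) ^+ size [:: false; false] = 1 :> R by rewrite /= expr2 mulrNN mulr1.
rewrite !mul1r; apply: etrans (esym (ItD i1 i2)) _.
apply: ae_eq_It; [exact: intg_mf (intgD i1 i2)|by apply: mfM; [exact: L2_mf|exact: L2_mf (Lp [::])]|].
apply: (aeS wE) => x E; rewrite -mulrDl !patchE; case: ifPn => [/set_mem/E->//|_].
by congr (_ * _); exact: addr0.
Qed.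

Lemma wlap_L2 U h w (v : R * R -> R) : wlap U h w -> wlap U w v -> L2 U w.
Proof. by move=> _ [v1 [v2 [D1 _ _]]]; have [] := wderiv_L2 D1. Qed.

Lemma clamped_plate_weak U f h : open U -> L2 U f -> clamped_plate U f h -> exists w, [/\ wlap U h w, L2 U w &
  forall phi, test_fun U phi -> It (fun x => (w \_ U) x * lap phi x) = It (fun x => (f \_ U) x * phi x)].
Proof.
move=> oU Lf [Sh Hh [w [b [W1 W2 bf]]]]; exists w; split => //; first exact: wlap_L2 W1 W2.
move=> phi tp; have [v1 [v2 [D1 D2 bE]]] := W2.
apply: (wlap_lap oU _ Lf tp); exists v1, v2; split => //.
by apply: (aeS (aeI bE bf)) => x [E1 E2] Ux; rewrite -E2// E1.
Qed.

Local Lemma double_sum_le4 (u v w e : R) : u <= 2 * v + 2 * w -> v < e -> w < e -> u <= 4 * e.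
Proof. lra. Qed.

Local Lemma double_sum_le16 (u v e : R) : u <= 4 * e -> v <= 4 * e -> 2 * u + 2 * v <= 16 * e.
Proof. lra. Qed.

Local Lemma scaled_constant (q e : R) : 0 <= q -> 0 < e -> exists2 d, 0 < d & e = d * (8 + 128 * q + 1).
Proof.
move=> q0 e0; have p0 : 0 < 8 + 128 * q + 1 by lra.
by exists (e / (8 + 128 * q + 1)); rewrite ?divr_gt0// divfK// gt_eqF.
Qed.

(** The constant is 2 * 4 + 2 q (2 * 16 + 2 * 16), from three applications of (a + b)^2 <= 2 a^2 + 2
    b^2; the extra 1 keeps it positive. *)
Local Lemma energy_sum (q d zz zp pp lp lw n : R) : 0 <= q -> 0 < d -> zz <= 2 * zp + 2 * pp -> zp <= 4 * d ->
  pp <= q * lp -> lp <= 2 * lw + 2 * n -> lw <= 16 * d -> n <= 16 * d -> zz <= d * (8 + 128 * q + 1).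
Proof.
move=> q0 d0 h1 h2 h3 h4 h5 h6; have h7 : q * lp <= q * (64 * d) by apply: ler_wpM2l => //; lra.
lra.
Qed.

(* The Laplacian of the difference is orthogonal to the Laplacians of test functions and is a limit of such. *)
Lemma clamped_plate_unique U f h1 h2 : open U -> bounded_set U -> L2 U f -> clamped_plate U f h1 ->
  clamped_plate U f h2 -> {ae leb2, forall x, U x -> h1 x = h2 x}.
Proof.
move=> oU bU Lf P1 P2; have mU := open_measurable2 oU.
have [w1 [W1 Lw1 T1]] := clamped_plate_weak oU Lf P1.
have [w2 [W2 Lw2 T2]] := clamped_plate_weak oU Lf P2.
have [S1 H1 _] := P1; have [S2 H2 _] := P2.
have [r r0 Ur] : exists2 r, 0 < r & U `<=` box r.
  have [r r0 hr] := compact_sub_box (closure_compact bU); exists r => // x Ux.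
  by apply: hr; exact: subset_closure.
have pL h : L2 U h -> L2 setT (h \_ U) by exact: (L2_patch _ mU).1.
have Lh1 := pL _ (sobolev_L2 S1); have Lh2 := pL _ (sobolev_L2 S2).
have Lw1' := pL _ Lw1; have Lw2' := pL _ Lw2.
pose z x := (h1 \_ U) x - (h2 \_ U) x; pose w x := (w1 \_ U) x - (w2 \_ U) x.
have Lz : L2 setT z by exact: L2B. have Lw : L2 setT w by exact: L2B.
have T phi : test_fun U phi -> It (fun x => w x * lap phi x) = 0.
  move=> tp; have Lp s := test_fun_L2 (test_fun_pds s tp).
  have Ll : L2 setT (lap phi) by exact: L2D (Lp [:: false; false]) (Lp [:: true; true]).
  transitivity (It (fun x => (w1 \_ U) x * lap phi x - (w2 \_ U) x * lap phi x)).
    by congr It; apply/funext => x; rewrite /w mulrBl.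
  by rewrite (ItB (L2_intgM Lw1' Ll) (L2_intgM Lw2' Ll)) T1// T2// subrr.
have app e : 0 < e -> exists phi, [/\ test_fun U phi, It (fun x => (z x - phi x) ^+ 2) <= 4 * e &
    It (fun x => (w x - lap phi x) ^+ 2) <= 16 * e].
  move=> e0; have [p1 [t1 E1]] := H20_It oU H1 e0; have [p2 [t2 E2]] := H20_It oU H2 e0.
  have s1 := test_fun_smooth t1; have s2 := test_fun_smooth t2.
  have t12 : test_fun U (fun x => p1 x - p2 x).
    split; first exact: (smoothB s1 s2).
    have [_ [K1 [c1 u1 z1]]] := t1; have [_ [K2 [c2 u2 z2]]] := t2.
    exists (K1 `|` K2); split; [exact: compactU|by move=> x [/u1|/u2]|].
    by move=> x nx; rewrite z1 ?z2 ?subrr// => ?; apply: nx; [right|left].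
  have dB s x : pds s (fun x => p1 x - p2 x) x = pds s p1 x - pds s p2 x.
    elim: s x => //= b s IH x; have -> : pds s (fun x => p1 x - p2 x) = fun x => pds s p1 x - pds s p2 x by apply/funext.
    rewrite pdB//; exact: (class_C_derivable (smooth_pds s _ 1%N) Logic.I).
  exists (fun x => p1 x - p2 x); split => //.
    have D1 := wderiv_nil (sobolev_L2 S1); have D2 := wderiv_nil (sobolev_L2 S2).
    have L1 : L2 setT (fun x => (h1 \_ U) x - p1 x) by apply: L2B => //; exact: test_fun_L2 t1.
    have L2' : L2 setT (fun x => p2 x - (h2 \_ U) x) by apply: L2B => //; exact: test_fun_L2 t2.
    have := It_sqD_le L1 L2'.
    have -> : It (fun x => ((h1 \_ U) x - p1 x + (p2 x - (h2 \_ U) x)) ^+ 2) = It (fun x => (z x - (p1 x - p2 x)) ^+ 2).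
      by congr It; apply/funext => x; rewrite /z; congr (_ ^+ 2); ring.
    have -> : It (fun x => (p2 x - (h2 \_ U) x) ^+ 2) = It (fun x => ((h2 \_ U) x - p2 x) ^+ 2).
      by congr It; apply/funext => x; rewrite -sqrrN opprB.
    move=> /le_trans; apply; have := E1 [::] _ isT D1; have := E2 [::] _ isT D2; rewrite /=; lra.
  have D (h : R * R -> R) (w' : R * R -> R) (p : R * R -> R) : test_fun U p -> wlap U h w' -> L2 U w' ->
      (forall s v, (size s <= 2)%N -> wderiv U s h v -> It (fun x => ((v \_ U) x - pds s p x) ^+ 2) < e) ->
      It (fun x => ((w' \_ U) x - lap p x) ^+ 2) <= 4 * e.
    move=> tp [v1 [v2 [D1 D2 wE]]] Lw' E.
    have L1 := pL _ (proj2 (wderiv_L2 D1)); have L2' := pL _ (proj2 (wderiv_L2 D2)).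
    have Lp s := test_fun_L2 (test_fun_pds s tp).
    have La : L2 setT (fun x => (v1 \_ U) x - pds [:: false; false] p x) by exact: L2B.
    have Lb : L2 setT (fun x => (v2 \_ U) x - pds [:: true; true] p x) by exact: L2B.
    have := It_sqD_le La Lb; set X := It _ => h3.
    have -> : It (fun x => ((w' \_ U) x - lap p x) ^+ 2) = X.
      apply: ae_eq_It.
      - by apply: mf_sq; apply: mfB; [exact: L2_mf (pL _ Lw')|apply: mfD; exact: L2_mf].
      - by apply: mf_sq; exact: L2_mf (L2D La Lb).
      apply: (aeS wE) => x Ex; congr (_ ^+ 2); rewrite /lap !patchE; case: ifPn => [/set_mem/Ex->|_].
        by rewrite opprD; exact: addrACA.
      by rewrite addrACA -opprD; congr (_ - _); exact: (esym (addr0 (0 : R))).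
        exact: (double_sum_le4 h3 (E [:: false; false] _ isT D1) (E [:: true; true] _ isT D2)).
  have k1 := D _ _ _ t1 W1 Lw1 E1; have k2 := D _ _ _ t2 W2 Lw2 E2.
  have Lp s := test_fun_L2 (test_fun_pds s t1); have Lq s := test_fun_L2 (test_fun_pds s t2).
  have L1 : L2 setT (fun x => (w1 \_ U) x - lap p1 x) by apply: L2B => //; exact: L2D.
  have L2' : L2 setT (fun x => lap p2 x - (w2 \_ U) x) by apply: L2B => //; exact: L2D.
  have := It_sqD_le L1 L2'.
  have -> : It (fun x => ((w1 \_ U) x - lap p1 x + (lap p2 x - (w2 \_ U) x)) ^+ 2) =
     It (fun x => (w x - lap (fun x => p1 x - p2 x) x) ^+ 2).
    congr It; apply/funext => x; rewrite /w /lap !dB; congr (_ ^+ 2).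
    set u1 := pds _ _ _; set u2 := pds _ _ _; set u3 := pds _ _ _; set u4 := pds _ _ _; ring.
  have -> : It (fun x => (lap p2 x - (w2 \_ U) x) ^+ 2) = It (fun x => ((w2 \_ U) x - lap p2 x) ^+ 2).
    by congr It; apply/funext => x; rewrite -sqrrN opprB.
  by move=> /le_trans; apply; exact: (double_sum_le16 k1 k2).
set N := It (fun x => w x ^+ 2).
have N0 : 0 <= N by apply: It_ge0 => x; exact: sqr_ge0.
(* By orthogonality [N] is the integral of w (w - lap phi), so N^2 <= 16 e N by Cauchy-Schwarz. *)
have Nle e : 0 < e -> N <= 16 * e.
  move=> e0; have [phi [tp _ hw]] := app e e0.
  have Lp s := test_fun_L2 (test_fun_pds s tp).
  have Ll : L2 setT (lap phi) by exact: L2D (Lp [:: false; false]) (Lp [:: true; true]).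
  have Lwl : L2 setT (fun x => w x - lap phi x) by exact: L2B.
  have E : N = It (fun x => w x * (w x - lap phi x)).
    transitivity (It (fun x => w x * w x) - It (fun x => w x * lap phi x)).
      by rewrite T// subr0; congr It; apply/funext => x; rewrite expr2.
    rewrite -(ItB (L2_intgM Lw Lw) (L2_intgM Lw Ll)); congr It; apply/funext => x.
    exact: (esym (mulrBr (w x) (w x) (lap phi x))).
  have := CauchySchwarz Lw Lwl; rewrite -E -/N => cs.
  have [->|Nn] := eqVneq N 0; first by rewrite mulr_ge0// ltW.
  have Np : 0 < N by rewrite lt_def Nn.
  rewrite -(ler_pM2l Np) -expr2; apply: (le_trans cs); exact: ler_wpM2l.
have Zle : It (fun x => ((fun x => h1 x - h2 x) \_ U) x ^+ 2) <= 0.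
  have -> : It (fun x => ((fun x => h1 x - h2 x) \_ U) x ^+ 2) = It (fun x => z x ^+ 2).
    congr It; apply/funext => x; rewrite /z !patchE; case: ifP => // _; congr (_ ^+ 2).
    by symmetry; exact: subr0.
  apply/ler_addgt0Pr => e e0; rewrite add0r.
  set Q := 16 * r ^+ 4; have Q0 : 0 <= Q by rewrite mulr_ge0// exprn_ge0// ltW.
  have [d d0 dE] := scaled_constant Q0 e0.
  have [phi [tp hz hw]] := app d d0.
  have Lp s := test_fun_L2 (test_fun_pds s tp).
  have Ll : L2 setT (lap phi) by exact: L2D (Lp [:: false; false]) (Lp [:: true; true]).
  have Lzp : L2 setT (fun x => z x - phi x) by exact: L2B Lz (Lp [::]).
  have h3 := It_sqD_le Lzp (Lp [::]).
  have E1 : It (fun x => (z x - phi x + pds [::] phi x) ^+ 2) = It (fun x => z x ^+ 2).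
    by congr It; apply/funext => x; rewrite subrK.
  rewrite E1 in h3.
  have Llw : L2 setT (fun x => lap phi x - w x) by exact: L2B.
  have h4 := It_sqD_le Llw Lw.
  have E2 : It (fun x => (lap phi x - w x + w x) ^+ 2) = It (fun x => lap phi x ^+ 2).
    by congr It; apply/funext => x; rewrite subrK.
  have E3 : It (fun x => (lap phi x - w x) ^+ 2) = It (fun x => (w x - lap phi x) ^+ 2).
    by congr It; apply/funext => x; rewrite -sqrrN opprB.
  rewrite E2 E3 -/N in h4.
  have h5 := poincare Ur r0 tp; rewrite -/Q in h5.
  have h6 := Nle d d0.
  by rewrite dE; exact: (energy_sum Q0 d0 h3 hz h5 h4 hw h6).
have L12 : L2 U (fun x => h1 x - h2 x).
  have := L2D_on oU (sobolev_L2 S1) (L2Z_on (-1) oU (sobolev_L2 S2)).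
  by congr L2; apply/funext => x; rewrite mulN1r.
by apply: (aeS (L2_sq0_ae oU L12 Zle)) => x h /h/eqP; rewrite subr_eq0 => /eqP.
Qed.

End traces.

(** * Zero trace and gradient of functions of H^2_0 *)

Section domain_trace.
Context {R : realType} (D : set (R * R)) (x0 : R * R) (g : R * R -> R).
Context (oD : open D) (bD : bounded_set D) (CgD : class_C_closure 4 D g)
  (gr : forall x, D x -> g x = 0 -> 0 < norm2 (grad g x))
  (gb : forall x, bdry D x -> 0 < g x)
  (bO : bdry (Omega D x0 g) = [set x | D x /\ g x = 0]).
Local Notation Om := (Omega D x0 g).

(* Otherwise the integral over Omega of a derivative of pds s V times a bump at q would be the nonzero
   boundary integral [It_patch_epi], while it is 0 for a limit of test functions. *)
Lemma H20_trace (h V : R * R -> R) (K : set (R * R)) (q : R * R) (s : seq bool) : H20 Om h -> compact K ->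
  class_C 2 setT V -> zero_off K V -> {ae leb2, forall x, Om x -> h x = V x} -> (size s <= 1)%N ->
  D q -> g q = 0 -> pds s V q = 0.
Proof.
move=> Hh cK CV V0 hV s1 Dq gq.
have oOm := open_Omega oD bD CgD gr gb bO.
have [b0 [c [sg [m [Cc sg2 m0 nq]]]]] := local_graphD oD CgD gr Dq gq.
have sgE : sg = 1 \/ sg = - 1.
  have : (sg - 1) * (sg + 1) = 0.
    have -> : (sg - 1) * (sg + 1) = sg * sg - 1 by ring.
    by rewrite sg2 subrr.
  by move/eqP; rewrite mulf_eq0 subr_eq0 addr_eq0 => /orP[/eqP|/eqP]; [left|right].
have tq : tau b0 c q = 0 by have [_ _ _ [+ _]] := nbhs_singleton nq; apply.
have Ck : class_C 1 setT (pds s V) by apply: class_C_pds; apply: class_C_le CV; rewrite add1n ltnS.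
set k := pds s V in Ck *; apply/eqP/negPn/negP => kq.
pose sk := if 0 < k q then 1 else - 1 : R.
have skq : 0 < sk * k q.
  rewrite /sk; case: ifPn; first by rewrite mul1r.
  by rewrite -leNgt le_eqVlt (negbTE kq)/= mulN1r oppr_gt0.
have Csk : class_C 1 setT (fun x => sk * k x) by apply: class_CZ => //; exact: openT.
have nk : nbhs q [set x | 0 < sk * k x].
  have ck : {for q, continuous (fun x => sk * k x)} by exact: class_C_continuous Csk q.
  exact: (ck _ (open_nbhs_nbhs (conj (@open_gt _ 0) skq))).
have [r r0 hr] := nbhs_sqbox_sub (filterI nq nk).
(* The sign [sk] makes k psi nonnegative near [q], so that nothing can cancel in the boundary
   integral. *)
pose psi x := sk * plateau q (r / 2) x.
have r2 : 0 < r / 2 by rewrite divr_gt0.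
have pl0 : zero_off (sqbox q r) (plateau q (r / 2)).
  have E2 : 2 * (r / 2) = r by field.
  by have := @plateau_zero_off R q (r / 2) r2; rewrite E2.
have Cpsi : class_C 1 setT psi by apply: class_CZ; [exact: openT|exact: class_C_plateau].
have cB := @compact_sqbox R q r.
have psi0 : zero_off (sqbox q r) psi by move=> x /pl0; rewrite /psi => ->; rewrite mulr0.
have I0 := H20_divergence b0 oOm Hh cK CV V0 hV s1 Cpsi cB psi0.
pose F x := k x * psi x.
have CF : class_C 1 setT F by apply: class_CM => //; exact: openT.
have F0 : zero_off (sqbox q r) F by move=> x /psi0; rewrite /F => ->; rewrite mulr0.
have Fp x : 0 <= F x.
  have [xr|/F0->//] := pselect (sqbox q r x); have [_ /= h1] := hr x xr.
  by rewrite /F /psi mulrCA mulrA mulr_ge0 ?plateau_ge0// ltW.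
have Fq : 0 < F q.
  rewrite /F /psi mulrCA mulrA plateau_eq1 ?mulr1//.
  by split; rewrite subrr normr0 ltW.
apply: (It_patch_epi_neq0 (class_C1d_continuous Cc) sgE CF cB F0 Fp tq Fq).
rewrite -I0; congr It; apply/funext => x; rewrite !patchE.
have pF0 := zero_off_pd b0 (compact_closed2 cB) F0.
have [xr|nx] := pselect (sqbox q r x); last first.
  by rewrite -/F pF0//; case: ifP; case: ifP.
have [[Dx E _ _] _] := hr x xr.
have -> : (x \in epi b0 c sg) = (x \in Om); last by [].
apply/idP/idP => /set_mem xe; apply/mem_set.
  by rewrite (OmegaE oD bD CgD gr gb bO); split => //; exact/E.
by apply/E; move: xe; rewrite (OmegaE oD bD CgD gr gb bO) => -[].
Qed.

End domain_trace.

(** * Hamiltonian trajectories *)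

Section curves.
Context {R : realType}.
Implicit Types (z w : R -> R * R) (t u s T : R) (h : R * R -> R) (x q v : R * R).

Definition has_velocity z w := forall b t, is_derive t 1 (fun r => co b (z r)) (co b (w t)).

(** What the length computation uses of a trajectory: C^1, of positive speed, injective over one
    period. The flow itself is forgotten from there on. *)
Definition regular_loop z w T := [/\ 0 < T, has_velocity z w, continuous w,
  (forall t, 0 < norm2 (w t)) & (forall t, z (t + T) = z t) /\
  forall t u, 0 <= t < T -> 0 <= u < T -> z t = z u -> t = u].

Lemma co_ext x v : (forall b, co b x = co b v) -> x = v.
Proof. by move=> e; rewrite -(pt_co true x) -(pt_co true v) !e. Qed.

Lemma continuous_plane z : (forall b, continuous (fun r => co b (z r))) -> continuous z.
Proof.
move=> c t; rewrite (_ : z = fun r => ((z r).1, (z r).2)); last by apply/funext => r; case: (z r).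
exact: (@cvg_pair _ _ _ (nbhs t) (nbhs (z t).1) (nbhs (z t).2) _ _ _ _ _ (c false t) (c true t)).
Qed.

Lemma is_derive_continuous (c c' : R -> R) : (forall t, is_derive t 1 c (c' t)) -> continuous c.
Proof.
by move=> dc t; apply: differentiable_continuous; apply/derivable1_diffP; have [] := dc t.
Qed.

Lemma velocity_continuous z w : has_velocity z w -> continuous z.
Proof. by move=> zw; apply: continuous_plane => b; exact: is_derive_continuous (zw b). Qed.

Lemma continuous_norm2 (w : R -> R * R) : continuous w -> continuous (norm2 \o w).
Proof.
move=> cw t; apply: (@continuous_comp _ _ _ (fun r => (w r).1 ^+ 2 + (w r).2 ^+ 2) (@Num.sqrt R)); last exact: sqrt_continuous.
have c b : {for t, continuous (fun r => co b (w r) ^+ 2)}.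
  apply: (@continuous_comp _ _ _ (fun r => co b (w r)) (fun s => s ^+ 2)); last exact: exprn_continuous.
  by apply: (@continuous_comp _ _ _ w (co b)); [exact: cw|exact: continuous_co].
by apply: (@continuousD _ _ _ (fun r => co false (w r) ^+ 2) (fun r => co true (w r) ^+ 2) t); exact: c.
Qed.

Lemma velocity_chain U h z w t : open U -> class_C 1 U h -> U (z t) -> has_velocity z w ->
  is_derive t 1 (h \o z) (pd false h (z t) * (w t).1 + pd true h (z t) * (w t).2).
Proof.
move=> oU Ch Uz zw; have := @chain_rule R U h _ _ t _ _ oU Ch _ (zw false t) (zw true t).
rewrite /= -!surjective_pairing => /(_ Uz); congr is_derive.
by apply/funext => r; rewrite -surjective_pairing.
Qed.

Lemma mvt (f f' : R -> R) t u : (forall r : R, is_derive r 1 f (f' r)) -> t <= u ->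
  exists2 r, t <= r <= u & f u - f t = f' r * (u - t).
Proof.
move=> df tu; have [r] := @MVT_segment R f f' t u tu (fun r _ => df r) (continuous_subspaceT (is_derive_continuous df)).
by rewrite in_itv; exists r.
Qed.

(* phi e^(M(t0 - t)) decreases and phi e^(M(t - t0)) increases. *)
Lemma gronwall_eq0 (phi phi' : R -> R) (M t0 t : R) : (forall r : R, is_derive r 1 phi (phi' r)) ->
  (forall r, 0 <= phi r) -> (forall r, `|phi' r| <= M * phi r) -> phi t0 = 0 -> phi t = 0.
Proof.
move=> dphi phi0 phiM p0.
have D (k r : R) : is_derive r 1 (fun r => phi r * expR (k * r)) ((phi' r + k * phi r) * expR (k * r)).
  have dk : is_derive r 1 (fun r : R => k * r) k.
    by have := is_deriveZ k (is_derive_id r 1); rewrite /GRing.scale/= mulr1.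
  have de := is_derive1_comp (is_derive_expR (k * r)) dk.
  have := is_deriveM (dphi r) de; rewrite /GRing.scale/= => h; apply: is_derive_eq h _.
  by ring.
have e0 (r : R) : 0 < expR r by exact: expR_gt0.
apply/eqP; rewrite eq_le phi0 andbT.
have [tt|tt] := leP t0 t.
  have [r _] := mvt (D (- M)) tt; rewrite p0 mul0r subr0 => E.
  rewrite -(pmulr_lle0 _ (e0 (- M * t))) E mulr_le0_ge0 ?subr_ge0//.
  apply: mulr_le0_ge0; last exact: ltW.
  by have := phiM r; rewrite ler_norml => /andP[_]; lra.
have [r _] := mvt (D M) (ltW tt); rewrite p0 mul0r sub0r => E.
rewrite -(pmulr_lle0 _ (e0 (M * t))) -oppr_ge0 E mulr_ge0 ?subr_ge0 ?(ltW tt)//.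
apply: mulr_ge0; last exact: ltW.
by have := phiM r; rewrite ler_norml => /andP[+ _]; lra.
Qed.

Lemma loop_reduce z T t : 0 < T -> (forall t, z (t + T) = z t) -> exists2 u, 0 <= u < T & z u = z t.
Proof.
move=> T0 zT; pose k := Num.floor (t / T); exists (t - k%:~R * T).
  have /andP[h1 h2] := floor_itv (t / T); rewrite -/k in h1 h2.
  rewrite ler_pdivlMr// in h1; rewrite intrD ltr_pdivrMr// mulrDl mul1r in h2.
  by apply/andP; split; lra.
have P (n : nat) s : z (s + n%:R * T) = z s.
  elim: n => [|n IH]; first by rewrite mul0r addr0.
  by rewrite -natr1 mulrDl mul1r addrA zT.
case: k => n; first by rewrite -[in RHS](subrK (n%:R * T) t) P.
by rewrite NegzE mulrNz mulNr opprK P.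
Qed.

End curves.

(** * Trajectories on the zero set of g *)

Section flow.
Context {R : realType} (D : set (R * R)) (x0 : R * R) (g : R * R -> R).
Context (oD : open D) (bD : bounded_set D) (CgD : class_C_closure 4 D g)
  (gr : forall x, D x -> g x = 0 -> 0 < norm2 (grad g x))
  (gb : forall x, bdry D x -> 0 < g x)
  (bO : bdry (Omega D x0 g) = [set x | D x /\ g x = 0]).
Local Notation Om := (Omega D x0 g).
Local Notation G := [set x | D x /\ g x = 0].
Implicit Types (z : R -> R * R) (p q : R * R).

Definition hamiltonian_field (q : R * R) : R * R := (- pd true g q, pd false g q).

Lemma norm2_hamiltonian q : norm2 (hamiltonian_field q) = norm2 (grad g q).
Proof.
have K (a c : R) : norm2 (- c, a) = norm2 (a, c) by rewrite /norm2/= sqrrN addrC.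
exact: K.
Qed.

Lemma flow_velocity p z : hamiltonian_flow D g p z -> has_velocity z (hamiltonian_field \o z).
Proof. by move=> [_ zt] [] t; have [] := zt t. Qed.

Let C1 : class_C 1 D g := class_C_le (isT : 1 <= 4)%N (Cg CgD).

Lemma flow_zero p z t : G p -> hamiltonian_flow D g p z -> G (z t).
Proof.
move=> [_ gp] hz; have Dz s : D (z s) by have [_ /(_ s)[]] := hz.
split => //; rewrite -gp; have [<- _] := hz.
apply: (@is_derive_0_is_cst _ (g \o z)) => s.
have := velocity_chain oD C1 (Dz s) (flow_velocity hz); rewrite /hamiltonian_field/=.
have K (a c : R) : a * - c + c * a = 0 by ring.
by move=> h; apply: (is_derive_eq h); exact: K.
Qed.

Lemma speed_flow p z t : hamiltonian_flow D g p z -> speed z t = norm2 (hamiltonian_field (z t)).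
Proof.
move=> /flow_velocity zw; rewrite /speed !derive1E.
by have [_ ->] := zw false t; have [_ ->] := zw true t.
Qed.

Lemma field_continuous p z : hamiltonian_flow D g p z -> continuous (hamiltonian_field \o z).
Proof.
move=> hz; have Dz s : D (z s) by have [_ /(_ s)[]] := hz.
have c b : continuous (pd b g \o z).
  move=> t; apply: continuous_comp; first exact: (velocity_continuous (flow_velocity hz)).
  by have [h _] := C1; exact: (h [:: b]).
apply: continuous_plane => -[]; first exact: c.
by move=> t; apply: (@continuousN _ _ _ (pd true g \o z) t); exact: c.
Qed.

(** Gronwall's lemma for the squared distance of two time shifts of [z]. The field of g is only
    given in [D]; that of its cutoff from [global_defining] is Lipschitz on the plane, and the two
    agree on the zero set, which the trajectory never leaves. *)
Lemma flow_unique p z t1 t2 s : G p -> hamiltonian_flow D g p z -> z t1 = z t2 -> z (t1 + s) = z (t2 + s).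
Proof.
move=> Gp hz z12; have [gt [K [W [Cgt cK gt0 oW [clW Wg]]]]] := global_defining oD bD CgD gr gb bO.
have GW x : G x -> W x by move=> [Dx gx]; apply: clW; rewrite (closure_Omega oD bD CgD gr gb bO)/= gx.
have Ct b : class_C 2 setT (pd b gt) by apply: class_C_pd; apply: class_C_le Cgt.
have pt0 b := zero_off_pd b (compact_closed2 cK) gt0.
have [L L0 hL] : exists2 L : R, 0 < L & forall b b' x, `|pd b' (pd b gt) x| <= L.
  have B b b' : exists2 L : R, 0 < L & forall x, `|pd b' (pd b gt) x| <= L.
    apply: (continuous_zero_off_bounded cK); first exact: class_C_continuous (class_C_pd b' (Ct b)).
    exact: zero_off_pd (compact_closed2 cK) (pt0 b).
  have [L1 p1 h1] := B true true; have [L2 p2 h2] := B true false.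
  have [L3 p3 h3] := B false true; have [L4 p4 h4] := B false false.
  exists (L1 + L2 + L3 + L4); first by rewrite !addr_gt0.
  by move=> [] [] x; [have := h1 x|have := h2 x|have := h3 x|have := h4 x]; lra.
have pgt b r : pd b gt (z r) = pd b g (z r).
  by apply: (pd_ext b oW (fun x Wx => proj2 (Wg x Wx))); apply: GW; exact: (flow_zero r Gp hz).
have lip b x y : `|pd b gt x - pd b gt y| <= L * `|x.1 - y.1| + L * `|x.2 - y.2|.
  have C1t : class_C 1 setT (pd b gt) by exact: class_C_le (Ct b).
  have l1 := lip_pd (x.1, y.2) x.2 C1t (hL b true); have l2 := lip_pd y x.1 C1t (hL b false).
  rewrite /pt/co/= -surjective_pairing in l1 l2.
  apply: (le_trans (ler_distD (pd b gt (x.1, y.2)) _ _)); lra.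
pose u b r := co b (z (t1 + r)) - co b (z (t2 + r)).
pose f b r := co b (hamiltonian_field (z (t1 + r))) - co b (hamiltonian_field (z (t2 + r))).
have zw := flow_velocity hz.
have dsh (t : R) b (r : R) : is_derive r 1 (fun r => co b (z (t + r))) (co b (hamiltonian_field (z (t + r)))).
  have ds : is_derive r 1 (fun r : R => t + r) 1.
    by have := is_deriveD (is_derive_cst t r 1) (is_derive_id r 1); rewrite add0r.
  by have := is_derive1_comp (zw b (t + r)) ds; rewrite mulr1.
have du b (r : R) : is_derive r 1 (u b) (f b r) by exact: is_deriveB.
pose phi r := u false r ^+ 2 + u true r ^+ 2.
pose phi' r := 2 * (u false r * f false r) + 2 * (u true r * f true r).
have dphi (r : R) : is_derive r 1 phi (phi' r).
  have sq b : is_derive r 1 (fun r => u b r ^+ 2) (2 * (u b r * f b r)).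
    have := is_deriveM (du b r) (du b r); rewrite /GRing.scale/= => h.
    by apply: is_derive_eq h _; ring.
  exact: is_deriveD.
have fb b r : `|f b r| <= L * `|u false r| + L * `|u true r|.
  have h := lip (~~ b) (z (t1 + r)) (z (t2 + r)); rewrite !pgt in h.
  by case: b h => // h; rewrite /f/= -opprD normrN.
have phi0 r : 0 <= phi r by rewrite addr_ge0// sqr_ge0.
have phib r : `|phi' r| <= 4 * L * phi r.
  have h1 := fb false r; have h2 := fb true r; apply: (le_trans (ler_normD _ _)).
  rewrite !normrM (ger0_norm (ler0n _ 2)) /phi -[u false r ^+ 2]real_normK ?num_real// -[u true r ^+ 2]real_normK ?num_real//.
  move: h1 h2 (normr_ge0 (u false r)) (normr_ge0 (u true r)).
  set a := `|u _ _|; set c := `|u _ _|; set a' := `|f _ _|; set c' := `|f _ _| => h1 h2 a0 c0.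
  have k1 : a * a' <= a * (L * a + L * c) by exact: ler_wpM2l.
  have k2 : c * c' <= c * (L * a + L * c) by exact: ler_wpM2l.
  have k3 : 0 <= L * (a - c) ^+ 2 by rewrite mulr_ge0 ?sqr_ge0// ltW.
  have k4 : L * (a - c) ^+ 2 = L * a ^+ 2 - 2 * L * (a * c) + L * c ^+ 2 by ring.
  by clearbody a c a' c'; lra.
have p0 : phi 0 = 0 by rewrite /phi /u !addr0 z12 !subrr !expr0n addr0.
have ps := gronwall_eq0 s dphi phi0 phib p0.
have sF := sqr_ge0 (u false s); have sT := sqr_ge0 (u true s).
apply: co_ext => b; apply/eqP; rewrite -subr_eq0 -/(u b s) -sqrf_eq0; apply/eqP.
by case: b; move: ps; rewrite /phi; lra.
Qed.

(** By uniqueness a return at two times of one period would make their difference a period, against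
    the minimality of [T]. *)
Lemma flow_regular_loop p z T : G p -> hamiltonian_flow D g p z -> main_period z T ->
  regular_loop z (hamiltonian_field \o z) T.
Proof.
move=> Gp hz [T0 zT minT]; split => //.
- exact: flow_velocity hz.
- exact: field_continuous hz.
- by move=> t; rewrite /= norm2_hamiltonian; have [Dz gz] := flow_zero t Gp hz; exact: gr.
split => //; have H t u : 0 <= t < T -> 0 <= u < T -> t < u -> z t <> z u.
  move=> /andP[t0 tT] /andP[u0 uT] tu e.
  have hS : 0 < u - t < T by apply/andP; split; lra.
  have [s] := minT _ hS; apply.
  have -> : s + (u - t) = u + (s - t) by ring.
  by rewrite -(flow_unique (s - t) Gp hz e); congr z; ring.
move=> t u ht hu e; have [tu|tu|//] := ltgtP t u.
  by case: (H _ _ ht hu tu).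
by case: (H _ _ hu ht tu).
Qed.

(* Near a point of the curve, {g = 0} is a graph over the coordinate [~~ b], which is strictly
   monotone at that time along the curve; conclude by the intermediate value theorem. *)
Lemma flow_image_near p z t0 : G p -> hamiltonian_flow D g p z ->
  \forall x \near z t0, G x -> exists t, z t = x.
Proof.
move=> Gp hz; have [Dq gq] := flow_zero t0 Gp hz; set q := z t0 in Dq gq *.
have [b [c [sg [m [Cc sg2 m0 nq]]]]] := local_graphD oD CgD gr Dq gq.
have zw := flow_velocity hz; have cz := velocity_continuous zw.
pose a r := co (~~ b) (z r); pose d := co (~~ b) (hamiltonian_field q).
have da : is_derive t0 1 a d by exact: zw.
have ca : continuous a by exact: is_derive_continuous (zw (~~ b)).
have [r0 r00 hr0] : exists2 r, 0 < r & forall t, `|t - t0| < r -> co b (z t) = c (a t).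
  have nz := cz t0 _ nq; case/nbhs_ballP: nz => r /= r0 hr; exists r => // t tr.
  have [] := hr t; first by rewrite /ball/= distrC.
  move=> _ _ _ [/(_ (proj2 (flow_zero t Gp hz))) + _].
  by rewrite /tau => /eqP; rewrite subr_eq0 => /eqP.
(* On the graph the coordinate [b] is a function of the other one: if the latter had speed 0, both
   would, and the gradient of g would vanish. *)
have d0 : d != 0.
  apply/eqP => dz; have [c' dc] : exists e, is_derive (a t0) 1 c e by exists (derive1 c (a t0)); exact: class_C1d_is_derive Cc.
  have d2 := is_derive1_comp dc da; rewrite dz mulr0 in d2.
  have d3 : is_derive t0 1 (fun r => co b (z r)) 0.
    apply: (near_eq_is_derive _ d2).
    by apply/nbhs_ballP; exists r0 => //= t; rewrite /ball/= distrC => /hr0.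
  have e2 : co b (hamiltonian_field q) = 0 by have [_ <-] := zw b t0; have [_ ->] := d3.
  have := gr Dq gq; rewrite -norm2_hamiltonian.
  have -> : hamiltonian_field q = 0.
    apply: co_ext => b'; have [->|nb] := eqVneq b' b; first by rewrite e2; case: (b).
    have -> : b' = ~~ b by case: (b) (b') nb => [] [].
    by rewrite -/d dz; case: (b).
  by rewrite /norm2/= expr0n addr0 sqrtr0 ltxx.
have d20 : 0 < `|d| / 2 by rewrite divr_gt0// normr_gt0.
have [r1 r10 hr1] := is_derive_small da d20.
(* The linear approximation errs by at most |d| r / 2, so a(t0 - r) and a(t0 + r) lie strictly on
   opposite sides of a(t0). *)
pose r := Num.min (r0 / 2) r1; have rp : 0 < r by rewrite lt_min r10 divr_gt0.
have rr1 : r <= r1 by rewrite ge_min lexx orbT.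
have rr0 : r < r0 by apply: (@le_lt_trans _ _ (r0 / 2)); [rewrite ge_min lexx|lra].
have h1 := hr1 (t0 + r); have h2 := hr1 (t0 - r).
have e1 : t0 + r - t0 = r by ring.
have e2 : t0 - r - t0 = - r by ring.
rewrite e1 (gtr0_norm rp) in h1; rewrite e2 normrN (gtr0_norm rp) in h2.
have {}h1 := h1 rr1; have {}h2 := h2 rr1.
have na : \forall x \near q, Num.min (a (t0 - r)) (a (t0 + r)) <= co (~~ b) x <= Num.max (a (t0 - r)) (a (t0 + r)).
  have O : open [set x : R * R | Num.min (a (t0 - r)) (a (t0 + r)) < co (~~ b) x < Num.max (a (t0 - r)) (a (t0 + r))].
    rewrite (_ : [set x | _] = co (~~ b) @^-1` [set` `](Num.min (a (t0 - r)) (a (t0 + r))), (Num.max (a (t0 - r)) (a (t0 + r)))[]).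
      by apply: open_comp; [move=> x _; exact: continuous_co|exact: interval_open].
    by apply/seteqP; split => x /=; rewrite in_itv.
  apply: (filterS _ (open_nbhs_nbhs (conj O _ : open_nbhs q _))) => [x /=|].
    by move=> /andP[k1 k2]; rewrite !ltW.
  rewrite /= -/(a t0) gt_min lt_max; move: h1 h2; rewrite !ler_norml.
  have [dp|dn] := ltP 0 d.
    rewrite (gtr0_norm dp) => /andP[k1 _] /andP[_ k2]; have k3 := mulr_gt0 dp rp.
    by apply/andP; split; apply/orP; [left|right]; lra.
  have {}dn : d < 0 by rewrite lt_neqAle d0.
  rewrite (ltr0_norm dn) => /andP[_ k1] /andP[k2 _]; have k3 : 0 < - d * r by rewrite mulr_gt0// oppr_gt0.
  by apply/andP; split; apply/orP; [right|left]; lra.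
apply: (@filterS _ (nbhs q) _ _ _ _ (filterI nq na)) => x [[_ _ _ [gt _]] hx] [Dx gx].
have le : t0 - r <= t0 + r by lra.
have [t] := IVT le (continuous_subspaceT ca) hx; rewrite in_itv/= => /andP[k1 k2] at'.
exists t; have ht : `|t - t0| < r0 by apply: (@le_lt_trans _ _ r) => //; rewrite ler_norml; apply/andP; split; lra.
apply: co_ext => b'; have [->|nb] := eqVneq b' b.
  by rewrite (hr0 t ht) at'; have /eqP := gt gx; rewrite subr_eq0 => /eqP.
by have -> : b' = ~~ b by case: (b) (b') nb => [] [].
Qed.

(** The trajectory is closed, being the image of one period, and relatively open in the zero set by
    [flow_image_near]; so it exhausts the component it meets. *)
Lemma flow_image p z T q : G p -> hamiltonian_flow D g p z -> main_period z T ->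
  connected_component G p q <-> exists2 t, 0 <= t < T & z t = q.
Proof.
move=> Gp hz [T0 zT _]; have cz := velocity_continuous (flow_velocity hz).
have red t := loop_reduce t T0 zT; have zp : z 0 = p by have [] := hz.
have IG : range z `<=` G by move=> _ [t _ <-]; exact: (flow_zero t Gp hz).
have Ip : range z p by exists 0.
split => [Cq|[t _ <-]]; last first.
  exists (range z); last by exists t.
  split => //; apply: connected_continuous_connected; last exact: continuous_subspaceT.
  by apply/connected_intervalP => u v _ _ w _.
have IE : range z = z @` `[0, T].
  apply/seteqP; split => _ [t _ <-]; last by exists t.
  by have [u /andP[u0 /ltW uT] <-] := red t; exists u => //; rewrite /= in_itv/= u0.
have clI : closed (range z).
  rewrite IE; apply: compact_closed2; apply: continuous_compact; last exact: segment_compact.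
  exact: continuous_subspaceT.
have CG : connected_component G p `<=` G by exact: connected_component_sub.
have CI : connected_component G p `&` range z = connected_component G p.
  apply: (@component_connected _ G p).
  - by exists p; split => //; exact: connected_component_refl.
  - pose W := (range z `|` ~` G)°; exists W; first exact: open_interior.
    apply/seteqP; split => x [Cx Ix]; split => //.
      have [t _ zt] := Ix; rewrite -zt; apply: (filterS _ (flow_image_near t Gp hz)) => y h.
      by have [/h[u zu]|] := pselect (G y); [left; exists u|right].
    by have [//|] := interior_subset Ix; case; exact: CG.
  - by exists (range z).
by move: Cq; rewrite -CI => -[_ [t _ <-]]; have [u hu <-] := red t; exists u.
Qed.

End flow.

(** * Arc length *)

Section hausdorff_borel.
Context {R : realType}.
Local Notation mR := (measurableTypeR R).
Local Notation mP := (mR * mR)%type.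
Local Notation H := (@hausdorff1 R).
Local Notation cara := (caratheodory_type (@hausdorff1_outer R)).
Implicit Types (A B X Y : set (R * R)) (x y v : R * R) (b : bool) (n k : nat) (d e : R).
Local Open Scope ereal_scope.

Lemma diam2_ub A x y : A x -> A y -> (norm2 (x - y)%R)%:E <= diam2 A.
Proof. by move=> Ax Ay; apply: ereal_sup_ubound; right; exists x, y. Qed.

Lemma le_diam2 A (r : \bar R) : 0 <= r -> (forall x y, A x -> A y -> (norm2 (x - y)%R)%:E <= r) -> diam2 A <= r.
Proof. by move=> r0 h; apply: ge_ereal_sup => _ [->//|[x [y [Ax Ay ->]]]]; exact: h. Qed.

Lemma diam_le_mono d e A B : (e <= d)%R -> A `<=` B -> diam_le d A <= diam_le e B.
Proof.
move=> ed AB; rewrite /diam_le; case: (leP (diam2 B)) => [h|_]; last by rewrite leey.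
have AleB : diam2 A <= diam2 B by apply: le_diam2 => [|x y /AB Bx /AB By]; [exact: diam2_ge0|exact: diam2_ub].
by rewrite (le_trans AleB)// (le_trans h)// lee_fin.
Qed.

Lemma mu_ext_diam_le d A : (0 < d)%R -> @measurable _ mP A -> mu_ext (diam_le d) A <= diam_le d A.
Proof.
move=> d0 mA; pose F n : set (R * R) := if n is 0 then A else set0.
have -> : diam_le d A = \sum_(0 <= k <oo) diam_le d (F k).
  rewrite nneseries_recl//; last by move=> *; exact: diam_le_ge0.
  rewrite eseries0 ?adde0// => -[//|k] _ _; exact: diam_le_set0.
apply: ereal_inf_lbound; exists F => //; split => [[|k]|x Ax]; [exact: mA|exact: measurable0|by exists 0%N].
Qed.

(* At scale below the separation of A and B no covering set meets both. *)
Lemma hausdorff1_separated A B e : (0 < e)%R -> (forall x y, A x -> B y -> (e <= norm2 (x - y))%R) ->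
  H A + H B <= H (A `|` B).
Proof.
move=> e0 sep; have [->|HU] := eqVneq (H (A `|` B)) +oo; first by rewrite leey.
have Hfin Y : Y `<=` A `|` B -> H Y \is a fin_num.
  move=> YU; rewrite ge0_fin_numE ?hausdorff1_ge0//; apply: (le_lt_trans (le_hausdorff1 YU)).
  by rewrite ltey.
have fA : H A \is a fin_num by apply: Hfin; exact: subsetUl.
have fB : H B \is a fin_num by apply: Hfin; exact: subsetUr.
rewrite -leeBrDr//; apply: ge_ereal_sup => _ [d1 /= d10 <-]; rewrite leeBrDr// addeC.
have f1 : mu_ext (diam_le d1) A \is a fin_num.
  rewrite ge0_fin_numE; last by apply: mu_ext_ge0 => *; exact: diam_le_ge0.
  apply: (@le_lt_trans _ _ (H A)); last by rewrite ltey_eq fA.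
  by apply: ereal_sup_ubound; exists d1.
rewrite -leeBrDr//; apply: ge_ereal_sup => _ [d2 /= d20 <-]; rewrite leeBrDr// addeC.
pose d := Num.min (Num.min d1 d2) (e / 2)%R.
have d0 : (0 < d)%R by rewrite !lt_min d10 d20 divr_gt0.
have dd1 : (d <= d1)%R by rewrite !ge_min lexx.
have dd2 : (d <= d2)%R by rewrite !ge_min lexx orbT.
have de : (d < e)%R by apply: (@le_lt_trans _ _ (e / 2)%R); [rewrite ge_min lexx orbT|lra].
apply: (@le_trans _ _ (mu_ext (diam_le d) (A `|` B))); last by apply: ereal_sup_ubound; exists d.
apply: le_ereal_inf_tmp => _ [F [mF FU] <-].
pose part Y k := if `[< F k `&` Y !=set0 >] then F k else set0.
have mp Y k : @measurable _ mP (part Y k) by rewrite /part; case: asboolP => _; [exact: (mF k)|exact: measurable0].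
have cov Y dY : (0 < dY)%R -> Y `<=` A `|` B -> mu_ext (diam_le dY) Y <= \sum_(0 <= k <oo) diam_le dY (part Y k).
  move=> _ YU; apply: ereal_inf_lbound; exists (part Y) => //; split => [k|x Yx]; first exact: mp.
  have [k _ Fk] := FU _ (YU _ Yx); exists k => //; rewrite /part; case: asboolP => // -[].
  by exists x.
apply: (le_trans (leeD (cov A d1 d10 (@subsetUl _ _ _)) (cov B d2 d20 (@subsetUr _ _ _)))).
rewrite -nneseriesD; [|by move=> *; exact: diam_le_ge0..].
apply: lee_nneseries => [k _ _|k _]; first by rewrite adde_ge0 ?diam_le_ge0.
rewrite /part; case: asboolP => [[x [Fx Ax]]|_]; last first.
  rewrite diam_le_set0// add0e; case: asboolP => _; first exact: diam_le_mono.
  by rewrite diam_le_set0// diam_le_ge0.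
case: asboolP => [[y [Fy By]]|_]; last by rewrite diam_le_set0// adde0; exact: diam_le_mono.
rewrite [leRHS]/diam_le; case: ifPn => [h|_]; last by rewrite leey.
have := le_trans (diam2_ub Fx Fy) h; rewrite lee_fin => h2.
by have := lt_le_trans de (le_trans (sep _ _ Ax By) h2); rewrite ltxx.
Qed.

Lemma ge_norm2_co b x y : (co b x - co b y <= norm2 (x - y))%R.
Proof.
apply: (le_trans (ler_norm _)); rewrite -sqrtr_sqr /norm2 ler_wsqrtr//.
by case: b => /=; rewrite ?lerDr ?lerDl sqr_ge0.
Qed.

(* Caratheodory's shells: the slices at distance about 1/k from the line are separated in pairs, so the
   lengths of the remote parts of X converge to the length of the open side. *)
Lemma halfplane_caratheodory b (c : R) : caratheodory_measurable (@hausdorff1_outer R) [set x | (c < co b x)%R].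
Proof.
apply: le_caratheodory_measurable => X; set P := [set x | _]; change (H (X `&` P) + H (X `&` ~` P) <= H X).
have [->|HX] := eqVneq (H X) +oo; first by rewrite leey.
have Hfin Y : Y `<=` X -> H Y \is a fin_num.
  move=> YX; rewrite ge0_fin_numE ?hausdorff1_ge0//; apply: (le_lt_trans (le_hausdorff1 YX)).
  by rewrite ltey.
pose r n : R := (n.+1%:R^-1)%R.
have r0 n : (0 < r n)%R by rewrite invr_gt0.
have rS n : (r n.+1 < r n)%R by rewrite ltf_pV2 ?posrE// ltr_nat.
pose A n := X `&` [set x | (c + r n <= co b x)%R].
pose S n := X `&` [set x | (c + r n.+1 <= co b x < c + r n)%R].
have AX n : A n `<=` X by move=> x [].
have SX n : S n `<=` X by move=> x [].
pose a n := fine (H (A n)); pose s n := fine (H (S n)).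
have aE n : H (A n) = (a n)%:E by rewrite fineK// Hfin.
have sE n : H (S n) = (s n)%:E by rewrite fineK// Hfin.
pose h := fine (H X); have hE : H X = h%:E by rewrite fineK// Hfin.
pose h' := fine (H (X `&` ~` P)); have h'E : H (X `&` ~` P) = h'%:E by rewrite fineK// Hfin// => x [].
(* [A n] and the slice [S n.+1] are separated by the slice [S n] between them, and both are
   contained in [A n.+2]. *)
have step n : (s n.+1 + a n <= a n.+2)%R.
  suff : H (A n) + H (S n.+1) <= H (A n.+2) by rewrite sE !aE -EFinD lee_fin addrC.
  apply: (@le_trans _ _ (H (A n `|` S n.+1))); last first.
    apply: le_hausdorff1 => x [[Xx /= h1]|[Xx /= /andP[h1 _]]]; split => //=.
    by have := rS n; have := rS n.+1; lra.
  apply: (@hausdorff1_separated _ _ (r n - r n.+1)%R); first by rewrite subr_gt0.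
  move=> x y [_ /= h1] [_ /= /andP[_ h2]]; apply: (le_trans _ (ge_norm2_co b x y)); lra.
have top n : (h' + a n <= h)%R.
  rewrite -lee_fin EFinD -h'E -aE -hE.
  apply: (@le_trans _ _ (H ((X `&` ~` P) `|` A n))); last by apply: le_hausdorff1 => x [[]|[]].
  rewrite setUC addeC; apply: (@hausdorff1_separated _ _ (r n)); first exact: r0.
  move=> x y [_ /= h1] [_ /= h2]; apply: (le_trans _ (ge_norm2_co b x y)).
  by have := r0 n; move/negP: h2; rewrite -leNgt; lra.
have L0 : has_sup (range a).
  split; first by exists (a 0%N), 0%N.
  by exists (h - h')%R => _ [n _ <-]; have := top n; lra.
set L := sup (range a); have aL n : (a n <= L)%R by apply: (sup_upper_bound L0); exists n.
have hL : (h' + L <= h)%R.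
  have : (L <= h - h')%R by apply: ge_sup => [|_ [n _ <-]]; [case: L0|have := top n; lra].
  by lra.
(* [step] relates indices two apart, so the sum telescopes with two terms at each end; hence the 2 L
   in [tail], one of them to be compensated by a(n). *)
have sum n N : (\sum_(0 <= k < N) s (n + k).+1 + a n + a n.+1 <= a (n + N)%N + a (n + N).+1)%R.
  elim: N => [|N IH]; first by rewrite addn0 big_geq// add0r.
  rewrite addnS big_nat_recr/=//; have := step (n + N)%N; lra.
have tail n : \sum_(0 <= k <oo) H (S (n + k).+1) <= (2 * L - a n - a n.+1)%:E.
  apply: lime_le; first by apply: is_cvg_nneseries => *; exact: hausdorff1_ge0.
  apply: nearW => N; under eq_bigr do rewrite sE.
  by rewrite sumEFin lee_fin; have := sum n N; have := aL (n + N)%N; have := aL (n + N).+1; lra.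
rewrite h'E hE addeC -leeBrDl//; apply/lee_addgt0Pr => e e0.
have [_ [n _ <-] hn] := sup_adherent e0 L0.
have cov : X `&` P `<=` A n.+1 `|` \bigcup_k S (n + k).+1.
  move=> x [Xx /= Px]; have [h1|h1] := leP (c + r n.+1)%R (co b x); first by left.
  right; have t0 : (0 < co b x - c)%R by rewrite subr_gt0.
  have ex : exists m, (c + r m <= co b x)%R.
    exists (Num.trunc (co b x - c)^-1); have := truncnS_gt (co b x - c)^-1.
    by rewrite -ltf_pV2 ?posrE ?invr_gt0// invrK -/(r _); lra.
  case: (ex_minnP ex) => -[|m] hm mmin.
    exfalso; have rr : (r n.+1 <= r 0%N)%R by rewrite lef_pV2 ?posrE// ler_nat.
    by move: hm h1 rr; lra.
  have nm : (n.+1 <= m)%N.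
    rewrite leqNgt; apply/negP => mn; have rr : (r n.+1 <= r m.+1)%R by rewrite lef_pV2 ?posrE// ler_nat.
    by move: h1 hm rr; lra.
  exists (m - n.+1)%N => //; rewrite -addSn subnKC//; split => //=; rewrite hm/= ltNge.
  by apply/negP => /mmin; rewrite ltnn.
apply: (le_trans (le_hausdorff1 cov)).
apply: (le_trans (outer_measureU2 (@hausdorff1_outer R) _ _)).
apply: (@le_trans _ _ ((a n.+1)%:E + (2 * L - a n - a n.+1)%:E)).
  apply: leeD; first by rewrite -aE.
  apply: le_trans (tail n).
  exact: (outer_measure_sigma_subadditive (@hausdorff1_outer R)).
by rewrite -!EFinD lee_fin; move: hn hL; rewrite -/L; lra.
Qed.

(** Half-planes generate the Borel sets, so [halfplane_caratheodory] makes all of them measurable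
    for [arclength]. *)
Lemma measurable_id_cara : @measurable_fun _ _ cara mP setT id.
Proof.
have mc b : @measurable_fun _ _ cara mR setT (co b).
  apply: (@measurability _ _ cara mR setT (co b) _ (RGenOInfty.measurableE R)) => _ [_ [c ->] <-].
  rewrite setTI (_ : _ @^-1` _ = [set x | (c < co b x)%R]); first exact: halfplane_caratheodory.
  by apply/seteqP; split => x; rewrite /= in_itv/= andbT.
rewrite (_ : id = fun x : cara => (co false x, co true x)); last by apply/funext => -[].
exact: (measurable_fun_pair (mc false) (mc true)).
Qed.

Lemma borel_cara B : @measurable _ mP B -> @measurable _ cara B.
Proof. by move=> mB; have := measurable_id_cara measurableT mB; rewrite setTI. Qed.

Lemma hausdorff1_cap_setD X B : @measurable _ mP B -> H X = H (X `&` B) + H (X `&` ~` B).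
Proof. by move=> /borel_cara; exact. Qed.

End hausdorff_borel.

(** * Length of short arcs *)

Section arcs.
Context {R : realType}.
Local Notation mR := (measurableTypeR R).
Local Notation mP := (mR * mR)%type.
Local Notation H := (@hausdorff1 R).
Implicit Types (z w : R -> R * R) (t u s r e d T : R) (x y v : R * R) (B : set (R * R)) (b : bool).

Definition dot x y := x.1 * y.1 + x.2 * y.2.

Lemma norm2_ge0 x : 0 <= norm2 x. Proof. exact: sqrtr_ge0. Qed.

Lemma norm2_sq x : norm2 x ^+ 2 = dot x x.
Proof. by rewrite sqr_sqrtr -?expr2// addr_ge0// sqr_ge0. Qed.

Lemma dot_le x y : dot x y <= norm2 x * norm2 y.
Proof.
apply: (le_trans (ler_norm _)); rewrite -sqrtr_sqr -sqrtrM ?addr_ge0 ?sqr_ge0//.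
rewrite ler_wsqrtr// /dot; have := sqr_ge0 (x.1 * y.2 - x.2 * y.1).
set a := x.1; set c := x.2; set f := y.1; set k := y.2; nra.
Qed.

Lemma norm2_le_sub x y : norm2 x <= norm2 y + norm2 (x - y).
Proof.
have [->|x0] := eqVneq (norm2 x) 0; first by rewrite addr_ge0 ?norm2_ge0.
have xp : 0 < norm2 x by rewrite lt_def x0 norm2_ge0.
rewrite -(ler_pM2l xp) -expr2 norm2_sq mulrDr.
have -> : dot x x = dot x y + dot x (x - y) by rewrite /dot/=; ring.
by apply: lerD; exact: dot_le.
Qed.

Lemma norm2N x : norm2 (- x) = norm2 x. Proof. by rewrite /norm2/= !sqrrN. Qed.

Lemma norm2_le_sum x : norm2 x <= `|x.1| + `|x.2|.
Proof.
rewrite -[leRHS]ger0_norm ?addr_ge0// -sqrtr_sqr ler_wsqrtr//.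
rewrite -[x.1 ^+ 2]real_normK ?num_real// -[x.2 ^+ 2]real_normK ?num_real//.
have := mulr_ge0 (normr_ge0 x.1) (normr_ge0 x.2); set a := `|_|; set c := `|_|; nra.
Qed.

Lemma dot_increment z w v t u : has_velocity z w -> t <= u ->
  exists2 r, t <= r <= u & dot (z u - z t) v = (u - t) * dot (w r) v.
Proof.
move=> zw tu.
have D (r : R) : is_derive r 1 (fun r => dot (z r) v) (dot (w r) v).
  have Db b : is_derive r 1 (fun r => co b (z r) * co b v) (co b (w r) * co b v).
    have := is_deriveZ (co b v) (zw b r); rewrite /GRing.scale/= mulrC.
    by congr is_derive; apply/funext => q; rewrite mulrC.
  exact: (is_deriveD (Db false) (Db true)).
have [r hr E] := mvt D tu; exists r => //; rewrite mulrC -E /dot/=; ring.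
Qed.

Lemma curve_uniform_continuity w s t e : continuous w -> 0 < e -> exists2 d, 0 < d &
  forall u r, s <= u <= t -> `|r - u| <= d -> norm2 (w r - w u) <= e.
Proof.
move=> cw e0; have e4 : 0 < e / 4 by rewrite divr_gt0.
pose P d u := forall r b, `|r - u| <= d -> `|co b (w r) - co b (w u)| <= e / 2.
have [|d [/= dP d0]] := @filter_ex _ (0 : R)^'+ _ _ (filterI ((compact_near_coveringP _).1 (@segment_compact R s t) R (0 : R)^'+ P _ _) (nbhs_right_gt 0)).
  move=> u _; have cb b : exists2 r, 0 < r & forall q, `|q - u| < r -> `|co b (w q) - co b (w u)| <= e / 4.
    have cbw : {for u, continuous (fun r => co b (w r))}.
      by apply: (@continuous_comp _ _ _ w (co b)); [exact: cw|exact: continuous_co].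
    have /cvgrPdist_le/(_ _ e4)/nbhs_ballP[r /= r0 hr] := cbw; exists r => // q qr.
    by rewrite distrC; apply: hr; rewrite /ball/= distrC.
  have [r1 r10 h1] := cb false; have [r2 r20 h2] := cb true.
  pose r := Num.min r1 r2; have r0 : 0 < r by rewrite lt_min r10.
  have h b q : `|q - u| < r -> `|co b (w q) - co b (w u)| <= e / 4.
    by rewrite lt_min => /andP[]; case: b; [move=> _ /h2|move=> /h1].
  have r20' : 0 < r / 2 by rewrite divr_gt0.
  exists (ball u (r / 2), [set d | d < r / 2]).
    by split; [exact: nbhsx_ballx|exact: nbhs_right_lt].
  move=> [q d] /= []; rewrite /ball/= distrC => qr dr p b pq.
  have k1 := h b q; have k2 := h b p; have k3 := ler_distD q p u; have k4 := ler_distD (co b (w u)) (co b (w p)) (co b (w q)).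
  rewrite [`|co b (w u) - _|]distrC in k4.
  have {}k1 : `|co b (w q) - co b (w u)| <= e / 4 by apply: k1; lra.
  have {}k2 : `|co b (w p) - co b (w u)| <= e / 4 by apply: k2; lra.
  by apply: (le_trans k4); lra.
exists d => // u r hu hr; apply: (le_trans (norm2_le_sum _)).
have hP := dP u; rewrite /= in_itv/= in hP; have := hP hu r false hr; have := hP hu r true hr; rewrite /=; lra.
Qed.

(** A subdivision of [0, T] into steps no longer than [d], traversed one step at a time: estimates
    valid on short arcs add up without sums over the subdivision. *)
Lemma chain_induction (P : R -> Prop) T d : 0 < T -> 0 < d -> P 0 ->
  (forall s t, 0 <= s -> s < t -> t <= T -> t - s <= d -> P s -> P t) -> P T.
Proof.
move=> T0 d0 P0 PS; pose N := (Num.trunc (T / d)).+1.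
have N0 : 0 < N%:R :> R by rewrite ltr0n.
have Nd : T / N%:R <= d.
  have := truncnS_gt (T / d); rewrite -/N ltr_pdivrMr// => h.
  by rewrite ler_pdivrMr// mulrC ltW.
pose p i := T * (i%:R / N%:R).
have pN : p N = T by rewrite /p divff ?mulr1// gt_eqF.
have pS i : p i.+1 = p i + T / N%:R by rewrite /p -natr1; field; rewrite gt_eqF.
have TN : 0 < T / N%:R by rewrite divr_gt0.
have p0 i : 0 <= p i by rewrite /p !mulr_ge0 ?invr_ge0 ?ler0n// ltW.
have H i : (i <= N)%N -> P (p i).
  elim: i => [|i IH] iN; first by rewrite /p mul0r mulr0.
  apply: PS (IH (ltnW iN)) => //; rewrite pS; [lra| |lra].
  by rewrite -pS -[leRHS]mulr1 ler_wpM2l ?(ltW T0)// ler_pdivrMr// mul1r ler_nat.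
by rewrite -pN; exact: H.
Qed.

Local Open Scope ereal_scope.
Local Notation I w A := (\int[@lebesgue_measure R]_(t in A) (norm2 (w t))%:E).

Lemma measurable_itvR (i : interval R) : @measurable _ mR [set` i].
Proof. exact: measurable_itv. Qed.

Lemma continuous_measurable_on_R (f : R -> R) (A : set R) : continuous f -> @measurable_fun _ _ mR mR A f.
Proof. by move=> cf; apply: measurable_funTS; exact: continuous_measurable_fun. Qed.

Lemma measurable_speed w (A : set R) : continuous w -> @measurable_fun _ _ mR _ A (fun t => (norm2 (w t))%:E).
Proof. by move=> /continuous_norm2 cw; apply/measurable_EFinP; exact: continuous_measurable_on_R. Qed.

Lemma measurable_curve z : continuous z -> @measurable_fun _ _ mR mP setT z.
Proof.
move=> cz; rewrite (_ : z = fun t => (co false (z t), co true (z t))); last first.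
  by apply/funext => t; case: (z t).
have c b : continuous (fun t => co b (z t)).
  by move=> t; apply: (@continuous_comp _ _ _ z (co b)); [exact: cz|exact: continuous_co].
by apply: measurable_fun_pair; apply: continuous_measurable_on_R.
Qed.

Lemma measurable_curve_preimage z B : continuous z -> @measurable _ mP B -> @measurable _ mR (z @^-1` B).
Proof. by move=> /measurable_curve mz mB; rewrite -[_ @^-1` _]setTI; exact: mz. Qed.

Lemma measurable_arc z s t : continuous z -> @measurable _ mP (z @` `[s, t]).
Proof.
move=> cz; apply: closed_measurable2; apply: compact_closed2; apply: continuous_compact.
  exact: continuous_subspaceT.
exact: segment_compact.
Qed.

Lemma measurable_arc_o z s t : continuous z -> @measurable _ mP (z @` `[s, t[).
Proof.
move=> cz; rewrite (_ : _ @` _ = \bigcup_n z @` `[s, (t - n.+1%:R^-1)%R]%classic).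
  by apply: bigcup_measurable => n _; exact: measurable_arc.
apply/seteqP; split => [_ [u /= + <-]|_ [n _ [u /= + <-]]]; rewrite in_itv/= => /andP[su ut].
  have d0 : (0 < t - u)%R by rewrite subr_gt0.
  exists (Num.trunc (t - u)^-1)%N => //; exists u => //=; rewrite in_itv/= su/=.
  have := truncnS_gt (t - u)^-1; rewrite -ltf_pV2 ?posrE ?invr_gt0// invrK => h.
  by rewrite lerBrDl -lerBrDr ltW.
exists u => //=; rewrite in_itv/= su/=; apply: (le_lt_trans ut).
by rewrite ltrBlDr ltrDl invr_gt0.
Qed.

Lemma le_leb (A C : set R) : @measurable _ mR A -> @measurable _ mR C -> A `<=` C ->
  lebesgue_measure (A : set mR) <= lebesgue_measure (C : set mR).
Proof. by move=> mA mC; apply: (@le_measure _ R mR (@lebesgue_measure R)); rewrite inE. Qed.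

Lemma lebesgue_itvco s t : (s <= t)%R -> lebesgue_measure (`[s, t[%classic : set mR) = (t - s)%:E.
Proof.
rewrite le_eqVlt => /predU1P[->|st]; last by rewrite lebesgue_measure_itv/= lte_fin st EFinB.
by rewrite lebesgue_measure_itv/= lte_fin ltxx subrr.
Qed.

(* Each covering set meets the arc in times spread over at most its diameter divided by the speed, as is seen
   by projecting on the direction w s. *)
Lemma arc_lower z w s t e B : has_velocity z w -> continuous w -> (s < t)%R -> (0 < e)%R ->
  (forall r, (s <= r <= t)%R -> (norm2 (w r - w s) <= e)%R) -> (e < norm2 (w s))%R -> @measurable _ mP B ->
  I w (`[s, t[ `&` z @^-1` B) <= H (B `&` z @` `[s, t[) + (2 * e * (t - s))%:E.
Proof.
move=> zw cw st e0 hw ew mB; have cz := velocity_continuous zw.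
set A := _ `&` _; set V := norm2 (w s) in ew *; set C := B `&` _.
have mA : @measurable _ mR A by apply: measurableI; [exact: measurable_itvR|exact: measurable_curve_preimage].
pose k := (V - e)%R; have k0 : (0 < k)%R by rewrite subr_gt0.
have V0 : (0 <= V)%R by exact: norm2_ge0.
have lA : lebesgue_measure (A : set mR) <= (t - s)%:E.
  by rewrite -(lebesgue_itvco (ltW st)); apply: (le_leb mA (measurable_itvR _)) => r [].
have AI r : A r -> (s <= r <= t)%R by move=> [/=]; rewrite in_itv/= => /andP[-> /ltW ->].
have h1 : I w A <= (V + e)%:E * lebesgue_measure (A : set mR).
  rewrite -(@integral_cst _ mR R lebesgue_measure _ mA); apply: ge0_le_integral => //.
  - by move=> r _; rewrite lee_fin norm2_ge0.
  - exact: measurable_speed.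
  - move=> r Ar; rewrite lee_fin; apply: (le_trans (norm2_le_sub _ (w s))).
    by rewrite lerD2l hw// AI.
apply: (le_trans h1).
have -> : (V + e)%:E = k%:E + (2 * e)%:E by rewrite -EFinD; congr (_%:E); rewrite /k; ring.
rewrite ge0_muleDl ?lee_fin ?(ltW k0) ?mulr_ge0 ?(ltW e0)//; apply: leeD; last first.
  by rewrite [leRHS]EFinM lee_wpmul2l// lee_fin mulr_ge0// ltW.
apply: (@le_trans _ _ (mu_ext (diam_le 1%R) C)); last by apply: ereal_sup_ubound; exists 1%R => /=.
apply: le_ereal_inf_tmp => _ [F [mF CF] <-].
have mAF n : @measurable _ mR (A `&` z @^-1` F n).
  by apply: measurableI => //; apply: measurable_curve_preimage => //; exact: mF.
have cov : lebesgue_measure (A : set mR) <= \sum_(0 <= n <oo) lebesgue_measure ((A `&` z @^-1` F n) : set mR).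
  apply: (@measure_sigma_subadditive _ R mR (@lebesgue_measure R) A _ mAF mA) => r Ar; have Cz : C (z r) by split; [case: Ar|exists r => //; case: Ar].
  by have [n _ Fn] := CF _ Cz; exists n.
apply: (@le_trans _ _ (k%:E * \sum_(0 <= n <oo) lebesgue_measure ((A `&` z @^-1` F n) : set mR))).
  by rewrite lee_wpmul2l// lee_fin ltW.
rewrite -nneseriesZl//.
apply: lee_nneseries => [n _ _|n _]; first by rewrite mule_ge0 ?lee_fin ?(ltW k0)// measure_ge0.
rewrite /diam_le; case: ifPn => [dF|_]; last by rewrite leey.
set E := A `&` _; have dfin : diam2 (F n) \is a fin_num.
  by rewrite ge0_fin_numE ?diam2_ge0// (le_lt_trans dF)// ltey.
pose d := fine (diam2 (F n)); have dE : diam2 (F n) = d%:E by rewrite fineK.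
have d0 : (0 <= d)%R by rewrite -lee_fin -dE diam2_ge0.
(* The projection of the chord on the direction [w s] grows at a rate at least [k], and its length
   is at most the diameter of the covering set. *)
have inc u r : E u -> E r -> (k * (r - u) <= d)%R.
  move=> [Au Fu] [Ar Fr]; have [ru|ru] := leP r u.
    by apply: le_trans d0; rewrite mulr_ge0_le0 ?(ltW k0)// subr_le0.
  have Vp : (0 < V)%R by exact: lt_trans ew.
  apply: (@le_trans _ _ (norm2 (z r - z u)%R)); last by rewrite -lee_fin -dE; exact: diam2_ub.
  rewrite -(ler_pM2r Vp); apply: le_trans (dot_le _ _).
  have [q /andP[uq qr] ->] := dot_increment (w s) zw (ltW ru).
  rewrite -mulrA mulrCA ler_pM2l ?subr_gt0//.
  have hq : (norm2 (w q - w s) <= e)%R.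
    by apply: hw; have /andP[su _] := AI _ Au; have /andP[_ rt] := AI _ Ar; apply/andP; split; lra.
  have := dot_le (w s - w q)%R (w s); rewrite -opprB norm2N -/V => h.
  have h2 : (norm2 (w q - w s) * V <= e * V)%R by rewrite ler_wpM2r.
  have h3 : dot (- (w q - w s))%R (w s) = (V ^+ 2 - dot (w q) (w s))%R by rewrite norm2_sq /dot/=; ring.
  by rewrite h3 in h; rewrite /k mulrBl -expr2; lra.
rewrite dE; have [->|/set0P[u0 Eu0]] := eqVneq E set0; first by rewrite measure0 mule0 lee_fin.
have hE : has_inf E by split; [exists u0|exists s => r [/AI/andP[]]].
pose m := inf E.
have sub : E `<=` `[m, (m + d / k)%R]%classic.
  move=> r Er; rewrite /= in_itv/= ge_inf//=; last by case: hE.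
  rewrite -lerBlDr; apply: lb_le_inf; first by case: hE.
  move=> u Eu; have := inc u r Eu Er; rewrite lerBlDr -lerBlDl ler_pdivlMr// mulrC//.
have dk0 : (0 <= d / k)%R by rewrite divr_ge0// ltW.
apply: (@le_trans _ _ (k%:E * lebesgue_measure (`[m, (m + d / k)%R]%classic : set mR))).
  by rewrite lee_wpmul2l ?lee_fin ?(ltW k0)//; exact: (le_leb (mAF n) (measurable_itvR _) sub).
rewrite lebesgue_measure_itv/= lte_fin ltrDl; case: ifPn => [dk|_]; last by rewrite mule0 lee_fin.
rewrite -EFinB -EFinM lee_fin; have -> : (k * (m + d / k - m) = d)%R by field; rewrite gt_eqF.
exact: lexx.
Qed.

(** The closed arc is itself a covering by one set, whose diameter is at most (V + e)(t - s); the
    integral of the speed is at least (V - e)(t - s). *)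
Lemma arc_upper z w s t e d : has_velocity z w -> continuous w -> (s < t)%R -> (0 < e)%R ->
  (forall r, (s <= r <= t)%R -> (norm2 (w r - w s) <= e)%R) -> (0 < d)%R ->
  ((norm2 (w s) + e) * (t - s) <= d)%R ->
  mu_ext (diam_le d) (z @` `[s, t[) <= I w `[s, t[ + (2 * e * (t - s))%:E.
Proof.
move=> zw cw st e0 hw d0 hd; have cz := velocity_continuous zw; set V := norm2 (w s) in hd *.
have ts : (0 <= t - s)%R by rewrite subr_ge0 ltW.
have V0 : (0 <= V)%R by exact: norm2_ge0.
have dm : diam2 (z @` `[s, t]) <= ((V + e) * (t - s))%:E.
  have K u r : (s <= u)%R -> (u <= r)%R -> (r <= t)%R -> (norm2 (z r - z u) <= (V + e) * (t - s))%R.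
    move=> su ur rt; set y := (z r - z u)%R; have [->|y0] := eqVneq (norm2 y) 0%R.
      by rewrite mulr_ge0// addr_ge0// ltW.
    have yp : (0 < norm2 y)%R by rewrite lt_def y0 norm2_ge0.
    have [q /andP[uq qr] E] := dot_increment y zw ur.
    rewrite -(ler_pM2r yp) -expr2 norm2_sq E.
    apply: (@le_trans _ _ ((r - u) * ((V + e) * norm2 y))%R); last first.
      by rewrite mulrCA mulrA ler_wpM2r ?norm2_ge0// ler_wpM2l ?addr_ge0 ?(ltW e0)//; lra.
    apply: ler_wpM2l; first by rewrite subr_ge0.
    apply: (le_trans (dot_le _ _)); rewrite ler_wpM2r ?norm2_ge0//.
    apply: (le_trans (norm2_le_sub _ (w s))); rewrite lerD2l; apply: hw; apply/andP; split; lra.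
  apply: le_diam2 => [|x y [u /= + <-] [r /= + <-]]; first by rewrite lee_fin mulr_ge0// addr_ge0// ltW.
  rewrite !in_itv/= => /andP[su ut] /andP[sr rt]; rewrite lee_fin.
  by have [ur|/ltW ru] := leP u r; [rewrite -norm2N opprB|]; exact: K.
apply: (@le_trans _ _ (mu_ext (diam_le d) (z @` `[s, t]))).
  apply: le_mu_ext => _ [u /= + <-]; rewrite in_itv/= => /andP[su /ltW ut].
  by exists u => //=; rewrite in_itv/= su.
apply: (le_trans (mu_ext_diam_le d0 (measurable_arc _ _ cz))).
rewrite /diam_le (le_trans dm) ?lee_fin//; apply: (le_trans dm).
have hI : ((V - e) * (t - s))%:E <= I w `[s, t[.
  rewrite EFinM -(lebesgue_itvco (ltW st)); have mI := measurable_itvR `[s, t[.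
  have [Ve|/ltW Ve] := leP V e.
    apply: (@le_trans _ _ 0); last by apply: integral_ge0 => r _; rewrite lee_fin norm2_ge0.
    by rewrite mule_le0_ge0 ?measure_ge0// lee_fin subr_le0.
  rewrite -(@integral_cst _ mR R lebesgue_measure _ mI); apply: ge0_le_integral => //.
  - by move=> r _; rewrite lee_fin subr_ge0.
  - exact: measurable_speed.
  - move=> r /=; rewrite in_itv/= => /andP[sr /ltW rt]; rewrite lee_fin lerBlDr.
    apply: (le_trans (norm2_le_sub (w s) (w r))); rewrite lerD2l -norm2N opprB hw// sr//.
have -> : ((V + e) * (t - s))%:E = ((V - e) * (t - s))%:E + (2 * e * (t - s))%:E.
  by rewrite -EFinD; congr (_%:E); ring.
exact: leeD.
Qed.

End arcs.

(** * Integration along a loop *)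

Section line_integral.
Import HBNNSimple.
Context {R : realType}.
Local Notation mR := (measurableTypeR R).
Local Notation mP := (mR * mR)%type.
Local Notation H := (@hausdorff1 R).
Local Notation cara := (caratheodory_type (@hausdorff1_outer R)).
Implicit Types (z w : R -> R * R) (t u s r e T : R) (x y v : R * R) (B : set (R * R)).
Local Open Scope ereal_scope.
Local Notation I w A := (\int[@lebesgue_measure R]_(t in A) (norm2 (w t))%:E).

Lemma itvco_cat s t r (B : set R) : (s <= r)%R -> (r <= t)%R ->
  `[s, t[ `&` B = (`[s, r[ `&` B) `|` (`[r, t[ `&` B).
Proof.
move=> sr rt; apply/seteqP; split => u /=; rewrite !in_itv/=.
  move=> [/andP[su ut] Bu]; have [ru|ur] := leP r u; first by right; split => //; apply/andP.
  by left; split => //; apply/andP.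
by move=> [] [/andP[h1 h2] Bu]; split => //; apply/andP; split; lra.
Qed.

Lemma speed_additive w s t r (B : set R) : continuous w -> @measurable _ mR B -> (s <= r)%R -> (r <= t)%R ->
  I w (`[s, t[ `&` B) = I w (`[s, r[ `&` B) + I w (`[r, t[ `&` B).
Proof.
move=> cw mB sr rt; rewrite (itvco_cat _ sr rt); apply: ge0_integral_setU.
- by apply: measurableI => //; exact: measurable_itvR.
- by apply: measurableI => //; exact: measurable_itvR.
- exact: measurable_speed.
- by move=> u _; rewrite lee_fin norm2_ge0.
apply/disj_setPS => u [[/= + _] [/= + _]]; rewrite !in_itv/= => /andP[_ ur] /andP[ru _].
by have := lt_le_trans ur ru; rewrite ltxx.
Qed.

Lemma mu_extU2 d A B : (0 < d)%R -> mu_ext (diam_le d) (A `|` B) <= mu_ext (diam_le d) A + mu_ext (@diam_le R d) B.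
Proof.
move=> d0; have ge0 (X : set (R * R)) : 0 <= mu_ext (diam_le d) X by apply: mu_ext_ge0 => *; exact: diam_le_ge0.
rewrite -bigcup2E; apply: (le_trans (mu_ext_sigma_subadditive _ _)); first exact: diam_le_ge0.
rewrite nneseries_recl// (_ : \sum_(1 <= k <oo) _ = mu_ext (diam_le d) B)//.
rewrite (@nneseries_split _ _ 1 1)// big_nat1 eseries0 ?adde0// => -[|[|k]]// _ _.
by rewrite /bigcup2/= mu_ext0// ?diam_le_set0// => *; exact: diam_le_ge0.
Qed.

Lemma small_constant (a b e : R) : (0 < a)%R -> (0 < b)%R -> (0 < e)%R ->
  exists2 e', (0 < e' < a)%R & (2 * e' * b <= e)%R.
Proof.
move=> a0 b0 e0; exists (Num.min (a / 2) (e / (2 * b)))%R.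
  have e2 : (0 < e / (2 * b))%R by rewrite divr_gt0// mulr_gt0.
  by apply/andP; split; [rewrite lt_min e2 divr_gt0|rewrite gt_min; apply/orP; left; lra].
have k : (Num.min (a / 2) (e / (2 * b)) <= e / (2 * b))%R by rewrite ge_min lexx orbT.
rewrite [leRHS](_ : e = (2 * (e / (2 * b)) * b)%R); last by field; rewrite gt_eqF.
by rewrite ler_pM2r// ler_pM2l.
Qed.

Section loop.
Context (z w : R -> R * R) (T : R) (L : regular_loop z w T).
Local Notation curve := (z @` `[0%R, T[).

Let T0 : (0 < T)%R. Proof. by have [] := L. Qed.
Let zw : has_velocity z w. Proof. by have [] := L. Qed.
Let cw : continuous w. Proof. by have [] := L. Qed.
Let cz : continuous z := velocity_continuous zw.

Lemma speed_bounds : exists m M, [/\ (0 < m)%R, (0 < M)%R & forall t, (0 <= t <= T)%R -> (m <= norm2 (w t) <= M)%R].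
Proof.
have cn := continuous_subspaceT (A := `[0%R, T]%classic) (continuous_norm2 cw).
have [c1 _ h1] := EVT_min (ltW T0) cn; have [c2 _ h2] := EVT_max (ltW T0) cn.
have [_ _ _ wp _] := L; exists (norm2 (w c1)), (norm2 (w c2)); split=> // t tT.
by have := h1 t; have := h2 t; rewrite /= !in_itv/= => -> // ->.
Qed.

Lemma measurable_loop : @measurable _ mP curve. Proof. exact: measurable_arc_o. Qed.

Lemma loop_finite : I w `[0%R, T[ < +oo.
Proof.
have [m [M [_ M0 hM]]] := speed_bounds; have mI := measurable_itvR `[0%R, T[.
apply: (@le_lt_trans _ _ (M%:E * T%:E)); last by rewrite -EFinM ltry.
have -> : T%:E = lebesgue_measure (`[0%R, T[%classic : set mR) by rewrite lebesgue_itvco ?ltW// subr0.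
rewrite -(@integral_cst _ mR R lebesgue_measure _ mI); apply: ge0_le_integral => //.
- by move=> r _; rewrite lee_fin norm2_ge0.
- exact: measurable_speed.
- move=> r /=; rewrite in_itv/= => /andP[r0 /ltW rT]; rewrite lee_fin.
  by have /andP[_] := hM r (introT andP (conj r0 rT)).
Qed.

Lemma loop_lower B : @measurable _ mP B -> I w (`[0%R, T[ `&` z @^-1` B) <= H (B `&` curve).
Proof.
move=> mB; have [m [M [m0 M0 hM]]] := speed_bounds; have mzB := measurable_curve_preimage cz mB.
apply/lee_addgt0Pr => e' e'0; have [e /andP[e0 em] ee'] := small_constant m0 T0 e'0.
apply: (@le_trans _ _ (H (B `&` curve) + (2 * e * T)%:E)); last by rewrite leeD2l// lee_fin.
have [d d0 hd] := curve_uniform_continuity 0 T cw e0.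
apply: (chain_induction (P := fun s => I w (`[0%R, s[ `&` z @^-1` B) <= H (B `&` z @` `[0%R, s[) + (2 * e * s)%:E) T0 d0).
  by rewrite set_itvco0 set0I integral_set0 mulr0 adde0 hausdorff1_ge0.
move=> s t s0 st tT ts IH; rewrite (speed_additive cw mzB s0 (ltW st)).
have sT : (0 <= s <= T)%R by rewrite s0; apply: ltW; exact: lt_le_trans tT.
have step : I w (`[s, t[ `&` z @^-1` B) <= H (B `&` z @` `[s, t[) + (2 * e * (t - s))%:E.
  apply: arc_lower => // [r /andP[sr rt]|].
    by apply: hd => //; rewrite ger0_norm ?subr_ge0//; apply: le_trans ts; rewrite lerB.
  by apply: (lt_le_trans em); have /andP[] := hM s sT.
apply: (le_trans (leeD IH step)).
have -> : (2 * e * t)%:E = (2 * e * s)%:E + (2 * e * (t - s))%:E by rewrite -EFinD; congr (_%:E); ring.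
rewrite addeACA leeD2r//.
(* The Borel arc up to time [s] splits the set into two pieces whose lengths add; by injectivity the
   arc from [s] to [t] lies entirely in the second. *)
rewrite [leRHS](hausdorff1_cap_setD _ (measurable_arc_o 0 s cz)); apply: leeD; apply: le_hausdorff1.
  move=> x [Bx [u hu zu]]; split; last by exists u.
  split => //; exists u => //=; move: hu; rewrite /= !in_itv/= => /andP[-> us]; exact: lt_trans us st.
move=> x [Bx [u /= hu zu]]; move: hu; rewrite in_itv/= => /andP[su ut].
split; first by split => //; exists u => //=; rewrite in_itv/= ut (le_trans s0).
rewrite -zu => -[r /= + zr]; rewrite in_itv/= => /andP[r0 rs]; have [_ _ _ _ [_ inj]] := L.
have ru : r = u.
  apply: inj => //; apply/andP; split => //; [|exact: le_trans s0 su|exact: lt_le_trans ut tT].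
  by apply: (lt_le_trans rs); have /andP[] := sT.
by move: rs; rewrite ru ltNge su.
Qed.

Lemma loop_upper : H curve <= I w `[0%R, T[.
Proof.
have [m [M [m0 M0 hM]]] := speed_bounds.
apply: ge_ereal_sup => _ [d /= d0 <-]; apply/lee_addgt0Pr => e' e'0.
have [e /andP[e0 _] ee'] := small_constant (@ltr01 R) T0 e'0.
apply: (@le_trans _ _ (I w `[0%R, T[ + (2 * e * T)%:E)); last by rewrite leeD2l// lee_fin.
have [d1 d10 hd] := curve_uniform_continuity 0 T cw e0.
have Me : (0 < M + e)%R by rewrite addr_gt0.
have d20 : (0 < Num.min d1 (d / (M + e)))%R by rewrite lt_min d10 divr_gt0.
apply: (chain_induction (P := fun s => mu_ext (diam_le d) (z @` `[0%R, s[) <= I w `[0%R, s[ + (2 * e * s)%:E) T0 d20).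
  rewrite set_itvco0 image_set0 integral_set0 mulr0 adde0 mu_ext0//; first by rewrite diam_le_set0.
  exact: diam_le_ge0.
move=> s t s0 st tT; rewrite le_min => /andP[ts tsd] IH.
have sT : (0 <= s <= T)%R by rewrite s0; apply: ltW; exact: lt_le_trans tT.
have step : mu_ext (diam_le d) (z @` `[s, t[) <= I w `[s, t[ + (2 * e * (t - s))%:E.
  apply: arc_upper => // [r /andP[sr rt]|].
    by apply: hd => //; rewrite ger0_norm ?subr_ge0//; apply: le_trans ts; rewrite lerB.
  rewrite ler_pdivlMr// mulrC in tsd; apply: le_trans tsd.
  by rewrite ler_wpM2r ?subr_ge0 ?(ltW st)// lerD2r; have /andP[] := hM s sT.
have Iadd : I w `[0%R, t[ = I w `[0%R, s[ + I w `[s, t[.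
  by have := speed_additive cw (@measurableT _ mR) s0 (ltW st); rewrite !setIT.
have -> : (2 * e * t)%:E = (2 * e * s)%:E + (2 * e * (t - s))%:E by rewrite -EFinD; congr (_%:E); ring.
rewrite Iadd addeACA; apply: le_trans (leeD IH step); apply: le_trans (mu_extU2 _ _ d0).
apply: le_mu_ext => _ [u /= + <-]; rewrite in_itv/= => /andP[u0 ut].
have [su|us] := leP s u; [right|left]; exists u => //=; rewrite in_itv/=; first by rewrite su ut.
by rewrite u0 us.
Qed.

(* The lower bounds for B and its complement add up to the upper bound for the whole curve. *)
Lemma loop_hausdorff B : @measurable _ mP B -> H (B `&` curve) = I w (`[0%R, T[ `&` z @^-1` B).
Proof.
move=> mB; apply/eqP; rewrite eq_le loop_lower// andbT.
have mC := measurableC mB; have lC := loop_lower mC; have up := loop_upper.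
rewrite (hausdorff1_cap_setD curve mB) ![curve `&` _]setIC in up.
have mz := measurable_curve_preimage cz mB.
have Isplit : I w `[0%R, T[ = I w (`[0%R, T[ `&` z @^-1` B) + I w (`[0%R, T[ `&` z @^-1` (~` B)).
  rewrite -ge0_integral_setU.
  - by rewrite -setIUr -preimage_setU setUv preimage_setT setIT.
  - by apply: measurableI => //; exact: measurable_itvR.
  - by apply: measurableI; [exact: measurable_itvR|exact: measurable_curve_preimage].
  - exact: measurable_speed.
  - by move=> u _; rewrite lee_fin norm2_ge0.
  - by apply/disj_setPS => u [[_ /= h] [_ /= nh]].
have fin : I w (`[0%R, T[ `&` z @^-1` (~` B)) \is a fin_num.
  rewrite ge0_fin_numE; last by apply: integral_ge0 => u _; rewrite lee_fin norm2_ge0.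
  by apply: le_lt_trans loop_finite; rewrite Isplit leeDr// integral_ge0// => u _; rewrite lee_fin norm2_ge0.
rewrite -(leeD2rE _ _ fin) -Isplit; apply: le_trans up; exact: leeD2l.
Qed.

End loop.

(** The right-hand side depends on the measure, [A], [phi] and [k] only through the weights of the
    preimages of level sets of simple functions. Two such integrals with the same weights on Borel
    sets are therefore equal, as [loop_integral] needs for [arclength] and the time integral. *)
Lemma weighted_integral (d : measure_display) (X : measurableType d) (mu : {measure set X -> \bar R}) (A : set X)
    (phi : X -> mP) (k : X -> R) (F : mP -> \bar R) (mF : measurable_fun setT F) : measurable A ->
  measurable_fun setT phi -> measurable_fun setT k -> (forall x : X, 0 <= k x)%R -> (forall x, 0 <= F x) ->
  \int[mu]_(x in A) (F (phi x) * (k x)%:E) =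
  limn (fun n => let f := nnsfun_approx measurableT mF n in
    \sum_(y \in range f) (y%:E * \int[mu]_(x in A `&` phi @^-1` (f @^-1` [set y])) (k x)%:E)).
Proof.
move=> mA mphi mk k0 F0; set f := nnsfun_approx measurableT mF.
have mkE (B : set X) : measurable_fun B (EFin \o k) by apply/measurable_EFinP; exact: measurable_funTS.
have E n : \int[mu]_(x in A) ((f n (phi x))%:E * (k x)%:E) =
    \sum_(y \in range (f n)) (y%:E * \int[mu]_(x in A `&` phi @^-1` (f n @^-1` [set y])) (k x)%:E).
  have mpre (y : R) : measurable (phi @^-1` (f n @^-1` [set y])).
    by rewrite -[_ @^-1` _]setTI; apply: mphi => //; rewrite -[_ @^-1` _]setTI; exact: measurable_funP.
  have y0 (y : R) : range (f n) y -> (0 <= y)%R by move=> [x _ <-].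
  pose G (y : R) (x : X) := (y * \1_(f n @^-1` [set y]) (phi x))%:E * (k x)%:E.
  have GE (y : R) (x : X) : G y x = y%:E * ((EFin \o k) \_ (phi @^-1` (f n @^-1` [set y]))) x.
    rewrite /G patchE indicE EFinM -muleA; congr (_ * _).
    have -> : (phi x \in f n @^-1` [set y]) = (x \in phi @^-1` (f n @^-1` [set y])) by [].
    by case: ifP => _; rewrite ?mul1e ?mul0e.
  have mG (y : R) : measurable_fun A (G y).
    rewrite (_ : G y = fun x : X => y%:E * ((EFin \o k) \_ (phi @^-1` (f n @^-1` [set y]))) x); last by apply/funext => x; exact: GE.
    apply: measurable_funeM; apply: measurable_funTS; apply/(measurable_restrictT _ (mpre y)).
    exact: mkE.
  have fin := @fimfunP _ _ (f n).
  transitivity (\int[mu]_(x in A) (\sum_(y \in range (f n)) G y x)).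
    apply: eq_integral => x _; rewrite fimfunE -fsumEFin// ge0_mule_fsuml// => y.
    rewrite lee_fin indicE; case: (boolP (phi x \in _)) => [/set_mem /= <-|_]; last by rewrite mulr0.
    by rewrite mulr1.
  have G0 (y : R) (x : X) : 0 <= G y x.
    rewrite /G indicE; case: (boolP (phi x \in _)) => [/set_mem /= <-|_]; last by rewrite mulr0 mul0e.
    by rewrite mulr1 mule_ge0// lee_fin.
  rewrite ge0_integral_fsum//; apply: eq_fsbigr => y /set_mem ry.
  rewrite integral_mkcondr -ge0_integralZl_EFin//; last 3 first.
  - by move=> x _; rewrite patchE; case: ifP => // _; rewrite lee_fin.
  - by apply: measurable_funTS; apply/(measurable_restrictT _ (mpre y)); exact: mkE.
  - exact: y0.
  by apply: eq_integral => x _; exact: GE.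
rewrite -(_ : (fun n => \int[mu]_(x in A) ((f n (phi x))%:E * (k x)%:E)) = (fun n => _)); last by apply/funext => n; exact: E.
rewrite -monotone_convergence//.
- apply: eq_integral => x _; apply/esym/cvg_lim => //.
  apply: cvgeZr => //; exact: (cvg_nnsfun_approx measurableT mF (fun x _ => F0 x) Logic.I).
- move=> n; apply: emeasurable_funM; last exact: mkE.
  by apply/measurable_EFinP; apply: measurable_funTS; exact: measurableT_comp.
- by move=> n x _; rewrite mule_ge0 ?lee_fin.
move=> x _ n m nm; rewrite lee_wpmul2r ?lee_fin//.
by have /lefP := nd_nnsfun_approx measurableT mF nm; apply.
Qed.

Lemma loop_integral z w T (F : mP -> \bar R) : regular_loop z w T -> measurable_fun setT F -> (forall x, 0 <= F x) ->
  \int[@arclength R]_(x in z @` `[0%R, T[) F x = \int[lebesgue_measure]_(t in `[0%R, T]) (F (z t) * (norm2 (w t))%:E).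
Proof.
move=> L mF F0; have [_ zw cw _ _] := L; have cz := velocity_continuous zw.
have mz := measurable_curve cz; have mw : @measurable_fun _ _ mR mR setT (norm2 \o w).
  by apply: continuous_measurable_on_R; exact: continuous_norm2.
rewrite -integral_itv_bndo_bndc; last first.
  by apply: measurable_funTS; apply: emeasurable_funM; [exact: measurableT_comp|apply/measurable_EFinP].
have mC := borel_cara (measurable_loop L).
transitivity (\int[@arclength R]_(x in z @` `[0%R, T[) (F x * ((fun=> 1%R) x)%:E)).
  by apply: eq_integral => x _; rewrite mule1.
rewrite (weighted_integral (@arclength R) mF mC (@measurable_id_cara R) _ _ F0)//.
rewrite (weighted_integral lebesgue_measure mF (measurable_itvR `[0%R, T[) mz mw _ F0); last by move=> t; exact: norm2_ge0.
congr (lim (_ @ \oo)); apply/funext => n /=; apply: eq_fsbigr => y _; congr (_ * _).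
set B := _ @^-1` [set y]; have mB : @measurable _ mP B by rewrite -[B]setTI; exact: measurable_funP.
have mCB : @measurable _ cara (z @` `[0%R, T[ `&` id @^-1` B) by apply: measurableI => //; exact: borel_cara.
rewrite (integral_cst (@arclength R) mCB 1) mul1e.
by rewrite -(loop_hausdorff L mB) setIC.
Qed.

End line_integral.

(** * The boundary costs *)

Section boundary.
Context {R : realType} (D : set (R * R)) (x0 : R * R) (g : R * R -> R).
Context (oD : open D) (bD : bounded_set D) (CgD : class_C_closure 4 D g)
  (gr : forall x, D x -> g x = 0 -> 0 < norm2 (grad g x))
  (gb : forall x, bdry D x -> 0 < g x)
  (bO : bdry (Omega D x0 g) = [set x | D x /\ g x = 0]).
Local Notation mR := (measurableTypeR R).
Local Notation mP := (mR * mR)%type.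
Local Notation cara := (caratheodory_type (@hausdorff1_outer R)).
Local Notation Om := (Omega D x0 g).
Local Notation G := [set x | D x /\ g x = 0].
Context (n : nat) (p : 'I_n -> R * R) (z : 'I_n -> R -> R * R) (T : 'I_n -> R)
  (zT : boundary_param D x0 g p z T).
Local Notation w i := (hamiltonian_field g \o z i).

Let Gp i : G (p i). Proof. by have [+ _ _ _ _] := zT; move=> /(_ i); rewrite bO. Qed.
Let hz i : hamiltonian_flow D g (p i) (z i). Proof. by have [_ _ _ + _] := zT; exact. Qed.
Let zG i t : G (z i t). Proof. exact: (flow_zero oD CgD t (Gp i) (hz i)). Qed.

Lemma boundary_loop i : regular_loop (z i) (w i) (T i).
Proof.
by have [_ _ _ _ per] := zT; exact: (flow_regular_loop oD bD CgD gr gb bO (Gp i) (hz i) (per i)).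
Qed.

Lemma boundary_point q : G q -> exists i t, 0 <= t < T i /\ z i t = q.
Proof.
move=> Gq; have [_ + _ _ per] := zT; rewrite bO => /(_ q Gq)[i [Ci _]]; exists i.
have [+ _] := flow_image oD CgD gr q (Gp i) (hz i) (per i).
by move=> /(_ Ci)[t ht zt]; exists t.
Qed.

Let measurable_G : @measurable _ mP G.
Proof. apply: closed_measurable2; apply: compact_closed2; exact: (compact_zero oD bD CgD gr gb bO). Qed.

Lemma boundary_integral (F : mP -> \bar R) : measurable_fun setT F -> (forall x, 0 <= F x)%E ->
  (\int[@arclength R]_(x in G) F x = \sum_(i < n) \int[lebesgue_measure]_(t in `[0%R, T i])
     (F (z i t) * (speed (z i) t)%:E))%E.
Proof.
move=> mF F0; pose C (i : 'I_n) := z i @` `[0%R, T i[.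
have GE : (G : set cara) = \big[setU/set0]_(i <- index_enum 'I_n) C i.
  rewrite -bigcup_seq; apply/seteqP; split => [q /boundary_point[i [t [ht zt]]]|q [i _ [t _ <-]]].
    by exists i; [exact: mem_index_enum|exists t; rewrite //= in_itv].
  exact: zG.
rewrite GE ge0_integral_bigsetU//.
- apply: eq_bigr => i _; rewrite (loop_integral (boundary_loop i) mF F0); apply: eq_integral => t _.
  by rewrite (speed_flow t (hz i)).
- by move=> i; apply: borel_cara; exact: measurable_loop (boundary_loop i).
- exact: index_enum_uniq.
(* A common point of two loops would lie in the components of both starting points, which
   [boundary_param] allows for a single index only. *)
- move=> i k _ _ [q [[t ht zt] [s hs zs]]]; have [_ + _ _ per] := zT; rewrite bO => U.
  have Gq : G q by rewrite -zt; exact: zG.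
  have [l [_ hl]] := U q Gq.
  have K m r : z m r = q -> (r \in `[0, T m[) -> l = m.
    move=> e hr; apply: hl; apply/(flow_image oD CgD gr q (Gp m) (hz m) (per m)).
    by exists r => //; rewrite in_itv/= in hr.
  by rewrite -(K i t zt ht) -(K k s zs hs).
by apply: measurable_funTS; exact: (measurableT_comp mF (@measurable_id_cara R)).
Qed.

(* v is rounded down to multiples of 1/(k+1). *)
Lemma measurable_density (j : R * R -> R -> R) (v : R * R -> R) : caratheodory_fun D j -> continuous v ->
  @measurable_fun _ _ mP R G (fun x => j x (v x)).
Proof.
move=> [mj cj] cv; pose q k x := (Num.floor (k.+1%:R * v x))%:~R / k.+1%:R : R.
have k0 (k : nat) : 0 < k.+1%:R :> R by rewrite ltr0n.
have qE k x : q k x <= v x < q k x + k.+1%:R^-1.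
  have /andP[h1 h2] := floor_itv (k.+1%:R * v x); rewrite /q; apply/andP; split.
    by rewrite ler_pdivrMr// [leRHS]mulrC.
  by rewrite -[X in _ + X]mul1r -mulrDl ltr_pdivlMr// [ltLHS]mulrC; rewrite intrD in h2.
apply: (@measurable_fun_cvg _ mP R G (fun k x => j x (q k x))) => [k|x [Dx _]]; last first.
  apply: (@cvg_comp _ _ _ (fun k => q k x) (j x) _ (nbhs (v x))); last exact: (cj x Dx (v x)).
  apply/cvgrPdist_lt => e e0; near=> k; have /andP[h1 h2] := qE k x.
  rewrite ger0_norm ?subr_ge0// ltrBlDl; apply: (lt_le_trans h2); rewrite lerD2l.
  near: k; exists (Num.trunc e^-1) => // k /= kN; rewrite -[leRHS]invrK lef_pV2 ?posrE ?invr_gt0//.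
  by apply: ltW (lt_le_trans (truncnS_gt _) _); rewrite ler_nat.
move=> _ Y mY.
rewrite (_ : _ `&` _ = \bigcup_(m : int) (G `&` (v @^-1` `[m%:~R / k.+1%:R, (m + 1)%:~R / k.+1%:R[ `&`
   (D `&` (j ^~ (m%:~R / k.+1%:R)) @^-1` Y)))).
  apply: (@countable_bigcupT_measurable _ mP); first exact: countableP.
  move=> m; apply: measurableI => //; apply: measurableI; last by apply: mj => //; exact: open_measurable2.
  by rewrite -[_ @^-1` _]setTI; apply: (continuous_mf cv) => //; exact: measurable_itv.
apply/seteqP; split => [x [Gx Yx]|x [m _ [Gx [+ [_ Yx]]]]].
  exists (Num.floor (k.+1%:R * v x)) => //; split => //; split; last by split => //; case: Gx.
  by rewrite /= in_itv/= intrD mulrDl mul1r; exact: qE.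
rewrite /= in_itv/= => /andP[h1 h2]; split => //=.
suff -> : q k x = m%:~R / k.+1%:R by [].
rewrite /q; congr (_%:~R / _); apply: floor_def.
by rewrite ler_pdivrMr// in h1; rewrite ltr_pdivlMr// in h2; rewrite mulrC h1 h2.
Unshelve. all: by end_near. Qed.

Local Open Scope ereal_scope.

Lemma defined_iff (I : finType) (a c : I -> \bar R) : (forall i, 0 <= a i) -> (forall i, 0 <= c i) ->
  ((forall i, a i < +oo) \/ (forall i, c i < +oo)) <-> (\sum_i a i < +oo \/ \sum_i c i < +oo).
Proof.
move=> a0 c0; have K (e : I -> \bar R) : (forall i, 0 <= e i) -> (forall i, e i < +oo) <-> \sum_i e i < +oo.
  move=> e0; split => [h|h i]; first exact: lte_sum_pinfty.
  by apply: le_lt_trans h; rewrite (bigD1 i)//= leeDl// sume_ge0.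
by rewrite (K a a0) (K c c0).
Qed.

Lemma sumeB_defined (I : finType) (a c : I -> \bar R) : (forall i, 0 <= a i) -> (forall i, 0 <= c i) ->
  \sum_i (a i - c i) = \sum_i a i - \sum_i c i.
Proof.
move=> a0 c0; rewrite big_split/= sumeN// => i k _ _.
by rewrite ge0_adde_def// inE.
Qed.

(** Definedness and value of both costs are functions of the same 2n numbers, the time integrals [c]
    of the positive and negative parts of the density. The density is extended by 0 off the zero
    set, because [boundary_integral] takes functions that are Borel on the whole plane. *)
Lemma equal_costs_density (j : R * R -> R -> R) (v y yO : R * R -> R) : caratheodory_fun D j -> continuous v ->
  (forall x, G x -> clap D y x = v x) -> (forall x, G x -> clap Om yO x = v x) ->
  equal_costs j D Om z T y yO.
Proof.
move=> jcar cv yv Ov; have mj := measurable_density jcar cv.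
pose F := (fun x => j x (v x)) \_ G.
have mF : @measurable_fun _ _ mP R setT F by apply/(measurable_restrictT _ measurable_G).
have FE x : G x -> F x = j x (v x) by move=> Gx; rewrite /F patchE mem_set.
pose N (sg : R) x := (Num.max (sg * F x) 0)%:E.
have N0 sg x : 0 <= N sg x by rewrite lee_fin le_max lexx orbT.
have mN sg : @measurable_fun _ _ mP _ setT (N sg).
  apply/measurable_EFinP; apply: measurable_maxr; last exact: measurable_cst.
  by apply: measurable_funM => //; exact: measurable_cst.
pose c sg i := \int[lebesgue_measure]_(t in `[0%R, T i]) (N sg (z i t) * (speed (z i) t)%:E).
have s0 i t : (0 <= speed (z i) t)%R by exact: norm2_ge0.
have c0 sg i : 0 <= c sg i by apply: integral_ge0 => t _; rewrite mule_ge0 ?N0 ?lee_fin.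
have IE sg : \int[@arclength R]_(x in G) N sg x = \sum_(i < n) c sg i by exact: boundary_integral.
have densE i t : control_density j D y (z i) t = (F (z i t) * speed (z i) t)%R.
  by rewrite /control_density yv// FE.
have pE (f : R -> R) (s : R) (u : R) : (0 <= s)%R -> maxe ((u * s)%:E) 0 = (Num.max u 0 * s)%:E.
  by move=> s0'; rewrite maxr_pMl// mul0r EFin_max.
have cP i : \int[lebesgue_measure]_(t in `[0%R, T i]) ((EFin \o control_density j D y (z i))^\+ t) = c 1%R i.
  by apply: eq_integral => t _; rewrite funeposE/= densE pE// /N mul1r EFinM.
have cN i : \int[lebesgue_measure]_(t in `[0%R, T i]) ((EFin \o control_density j D y (z i))^\- t) = c (- 1)%R i.
  by apply: eq_integral => t _; rewrite funenegE/= densE -mulNr pE// /N mulN1r EFinM.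
have shE x : G x -> shape_density j Om yO x = F x by move=> Gx; rewrite /shape_density Ov// FE.
have sP : \int[@arclength R]_(x in G) ((EFin \o shape_density j Om yO)^\+ x) = \sum_(i < n) c 1%R i.
  by rewrite -IE; apply: eq_integral => x /set_mem Gx; rewrite funeposE/= (shE x Gx) /N mul1r EFin_max.
have sN : \int[@arclength R]_(x in G) ((EFin \o shape_density j Om yO)^\- x) = \sum_(i < n) c (- 1)%R i.
  by rewrite -IE; apply: eq_integral => x /set_mem Gx; rewrite funenegE/= (shE x Gx) /N mulN1r EFin_max.
have mctl i : @measurable_fun _ _ mR R `[0%R, T i] (control_density j D y (z i)).
  apply: measurable_funTS; rewrite (_ : control_density _ _ _ _ = fun t => F (z i t) * speed (z i) t)%R; last first.
    by apply/funext => t; exact: densE.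
  have [_ zw cw _ _] := boundary_loop i; have cz := velocity_continuous zw.
  apply: measurable_funM; first exact: (measurableT_comp mF (measurable_curve cz)).
  rewrite (_ : speed (z i) = norm2 \o w i); last by apply/funext => t; rewrite (speed_flow t (hz i)).
  by apply: continuous_measurable_on_R; exact: continuous_norm2.
have msh : measurable_fun (G : set cara) (shape_density j Om yO).
  have mFc : @measurable_fun _ _ cara R G F.
    by apply: measurable_funTS; exact: (measurableT_comp mF (@measurable_id_cara R)).
  by apply: eq_measurable_fun mFc => x /set_mem Gx; rewrite shE.
have iffD : control_cost_defined j D z T y <-> shape_cost_defined j Om yO.
  rewrite /control_cost_defined /shape_cost_defined /integral_defined bO sP sN.
  have eP : (forall i, \int[lebesgue_measure]_(t in `[0%R, T i]) ((EFin \o control_density j D y (z i))^\+ t) < +oo) <->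
      (forall i, c 1%R i < +oo) by split => h i; have := h i; rewrite cP.
  have eN : (forall i, \int[lebesgue_measure]_(t in `[0%R, T i]) ((EFin \o control_density j D y (z i))^\- t) < +oo) <->
      (forall i, c (- 1)%R i < +oo) by split => h i; have := h i; rewrite cN.
  rewrite eP eN (defined_iff (c0 1%R) (c0 (- 1)%R)).
  by split => -[_ h]; split.
split => // _; rewrite /control_cost /shape_cost bO [RHS]integralE sP sN -sumeB_defined//.
by apply: eq_bigr => i _; rewrite integralE cP cN.
Qed.

(** * The constraints as vanishing boundary data *)

Section constraints.
Context (y V : R * R -> R) (K : set (R * R)) (cK : compact K) (CV : class_C 2 setT V) (V0 : zero_off K V)
  (Ly : L2 D y) (yV : {ae leb2, forall x, D x -> y x = V x}).

Let normal x := ((pd false V x * pd false g x + pd true V x * pd true g x) / norm2 (grad g x))%R.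

Let constraintsE : constraints D g z T y <->
  (\sum_(i < n) \int[lebesgue_measure]_(t in `[0%R, T i]) (`|V (z i t)| ^+ 2 * speed (z i) t)%:E = 0) /\
  (\sum_(i < n) \int[lebesgue_measure]_(t in `[0%R, T i]) (`|normal (z i t)| ^+ 2 * speed (z i) t)%:E = 0).
Proof.
have cd s i t : (size s <= 2)%N -> cderiv D s y (z i t) = pds s V (z i t).
  move=> s2; apply: (cderiv_representative oD s2 cK CV V0 Ly yV); apply: subset_closure.
  by case: (zG i t).
have iff2 (a b a' b' : \bar R) : a = a' -> b = b' -> (a = 0 /\ b = 0 <-> a' = 0 /\ b' = 0) by move=> -> ->.
apply: iff2.
- by apply: eq_bigr => i _; apply: eq_integral => t _; rewrite cd.
- by apply: eq_bigr => i _; apply: eq_integral => t _; rewrite /normal_deriv !cd.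
Qed.

Let sum_zero (k : 'I_n -> R -> R) : (forall i, continuous (k i)) -> (forall i t, 0 <= k i t)%R ->
  \sum_(i < n) \int[lebesgue_measure]_(t in `[0%R, T i]) (k i t)%:E = 0 -> forall i t, (0 <= t <= T i)%R -> k i t = 0%R.
Proof.
move=> ck k0 S0 i t ht; apply/eqP/negPn/negP => kt; have [T0 _ _ _ _] := boundary_loop i.
(* A positive value of a continuous nonnegative integrand makes its integral positive, and the other
   summands cannot compensate. *)
have kp : (0 < k i t)%R by rewrite lt_def kt k0.
have pos := integral_gt0 (ck i) (k0 i) T0 ht kp.
move: S0; rewrite (bigD1 i)//= => E.
suff : 0 < (0 : \bar R) by rewrite ltxx.
rewrite -[X in _ < X]E; apply: (lt_le_trans pos); rewrite leeDl// sume_ge0// => m _.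
by apply: integral_ge0 => r _; rewrite lee_fin.
Qed.

Lemma constraints_trace : constraints D g z T y <-> forall x, G x -> V x = 0%R /\ forall b, pd b V x = 0%R.
Proof.
have C1 : class_C 1 setT V by exact: class_C_le CV.
rewrite constraintsE; split; last first.
  move=> h; split; apply: big1 => i _; rewrite -(integral0 lebesgue_measure `[0%R, T i]%classic);
    apply: eq_integral => t _; have [Vt dV] := h _ (zG i t); first by rewrite Vt normr0 expr0n mul0r.
  by rewrite /normal !dV !mul0r addr0 mul0r normr0 expr0n mul0r.
have cz i : continuous (z i) by have [_ /velocity_continuous] := boundary_loop i.
have cw i : continuous (w i) by have [] := boundary_loop i.
have cs i : continuous (speed (z i)).
  rewrite (_ : speed (z i) = norm2 \o w i); first exact: continuous_norm2.
  by apply/funext => t; rewrite (speed_flow t (hz i)).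
have sp i t : (0 < speed (z i) t)%R by rewrite (speed_flow t (hz i)); have [_ _ _ + _] := boundary_loop i; exact.
have sq (f : R -> R) (i : 'I_n) : continuous f -> continuous (fun t => `|f t| ^+ 2 * speed (z i) t)%R.
  move=> cf t; apply: (@continuousM _ _ (fun t => `|f t| ^+ 2)%R (speed (z i)) t); last exact: cs.
  apply: (@continuous_comp _ _ _ (fun t => `|f t|)%R (fun s => s ^+ 2)%R); last exact: exprn_continuous.
  by apply: (@continuous_comp _ _ _ f (fun s => `|s|)%R); [exact: cf|exact: norm_continuous].
have cV b i : continuous (pd b V \o z i).
  move=> t; apply: continuous_comp; first exact: cz.
  exact: (@class_C_continuous _ _ _ (class_C_pd b CV) (z i t)).
have cf b i : continuous (fun t => co b (w i t)).
  by move=> t; apply: (@continuous_comp _ _ _ (w i) (co b)); [exact: cw|exact: continuous_co].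
have normE i t : normal (z i t) =
   ((pd false V (z i t) * co true (w i t) - pd true V (z i t) * co false (w i t)) / speed (z i) t)%R.
  have alg (a1 a2 c1 c2 s : R) : ((a1 * c1 + a2 * c2) / s = (a1 * c1 - a2 * - c2) / s)%R by rewrite mulrN opprK.
  by rewrite /normal (speed_flow t (hz i)) norm2_hamiltonian; exact: alg.
have cn i : continuous (fun t => normal (z i t)).
  rewrite (_ : (fun t => _) = fun t => (((pd false V \o z i) t * co true (w i t) - (pd true V \o z i) t * co false (w i t)) *
     (speed (z i) t)^-1)%R); last by apply/funext => t; exact: normE.
  move=> t; apply: (@continuousM _ _ (fun t => (pd false V \o z i) t * co true (w i t) - (pd true V \o z i) t * co false (w i t))%R
    (fun t => (speed (z i) t)^-1)%R t); last first.
    by apply: continuousV; [rewrite gt_eqF|exact: cs].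
  apply: (@continuousB _ _ _ (fun t => (pd false V \o z i) t * co true (w i t))%R (fun t => (pd true V \o z i) t * co false (w i t))%R t).
    by apply: (@continuousM _ _ (pd false V \o z i) (fun t => co true (w i t)) t); [exact: cV|exact: cf].
  by apply: (@continuousM _ _ (pd true V \o z i) (fun t => co false (w i t)) t); [exact: cV|exact: cf].
have cVz i : continuous (V \o z i).
  by move=> t; apply: continuous_comp; [exact: cz|exact: (@class_C_continuous _ _ _ C1 (z i t))].
move=> [E1 E2].
have z0 (f : R -> R) (i : 'I_n) t : (`|f t| ^+ 2 * speed (z i) t = 0)%R -> f t = 0%R.
  move/eqP; rewrite mulf_eq0 (gt_eqF (sp i t)) orbF sqrf_eq0 normr_eq0 => /eqP//.
have nn (f : 'I_n -> R -> R) i t : (0 <= `|f i t| ^+ 2 * speed (z i) t)%R by rewrite mulr_ge0 ?sqr_ge0// ltW.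
have A1 := sum_zero (fun i => sq _ i (cVz i)) (nn (fun i => V \o z i)) E1.
have A2 := sum_zero (fun i => sq _ i (cn i)) (nn (fun i t => normal (z i t))) E2.
have V_0 x : G x -> V x = 0%R.
  move=> /boundary_point[i [t [/andP[t0 tT] <-]]]; apply: (z0 (V \o z i) i t); apply: A1.
  by rewrite t0 ltW.
move=> x Gx; split; first exact: V_0.
have [i [t [/andP[t0 tT] zt]]] := boundary_point Gx.
have n0 : normal (z i t) = 0%R by apply: (z0 (fun t => normal (z i t)) i t); apply: A2; rewrite t0 ltW.
have [_ zw _ wp _] := boundary_loop i.
(* [V] is 0 along the trajectory, so its derivative in the direction of the velocity vanishes
   too. *)
have := velocity_chain openT C1 (Logic.I : setT (z i t)) zw.
rewrite (_ : V \o z i = cst 0%R); last by apply/funext => s; exact: V_0.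
move=> [_]; rewrite derive_cst => /esym e1.
move: n0 (wp t) e1; rewrite normE /norm2 zt.
move=> /eqP; rewrite mulf_eq0 invr_eq0 (gt_eqF (sp i t)) orbF => /eqP.
rewrite /co; set a := pd false V x; set c := pd true V x; set u := (w i t).1; set v := (w i t).2 => e2.
rewrite sqrtr_gt0 => pos e1.
(* The tangential equation a u + c v = 0 and the normal one a v - c u = 0 form a linear system in
   the gradient (a, c) whose determinant is, up to sign, the squared speed. *)
have ea : (a * (u ^+ 2 + v ^+ 2) = 0)%R.
  have -> : (a * (u ^+ 2 + v ^+ 2) = (a * u + c * v) * u + (a * v - c * u) * v)%R by ring.
  by rewrite e1 e2 !mul0r addr0.
have ec : (c * (u ^+ 2 + v ^+ 2) = 0)%R.
  have -> : (c * (u ^+ 2 + v ^+ 2) = (a * u + c * v) * v - (a * v - c * u) * u)%R by ring.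
  by rewrite e1 e2 !mul0r subr0.
by case; apply/eqP; [move/eqP: ec|move/eqP: ea]; rewrite mulf_eq0 (gt_eqF pos) orbF.
Qed.

End constraints.

End boundary.

(** * The equivalence *)

Section restriction.
Context {R : realType}.
Local Notation mR := (measurableTypeR R).
Local Notation mP := (mR * mR)%type.
Implicit Types (U V K : set (R * R)) (h f y w v : R * R -> R) (m : nat).

Lemma L2_sub U V h : open U -> open V -> V `<=` U -> L2 U h -> L2 V h.
Proof. by move=> oU oV VU /wderiv_nil/(wderiv_sub oU oV VU)/wderiv_L2[]. Qed.

Lemma wlap_sub U V y w : open U -> open V -> V `<=` U -> wlap U y w -> wlap V y w.
Proof.
move=> oU oV VU [v1 [v2 [D1 D2 E]]]; exists v1, v2; split; [exact: wderiv_sub D1|exact: wderiv_sub D2|].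
by apply: (aeS E) => x h /VU/h.
Qed.

Lemma wlap_ae_unique U y h w v : open U -> wlap U y w -> wlap U h v ->
  {ae leb2, forall x, U x -> y x = h x} -> {ae leb2, forall x, U x -> w x = v x}.
Proof.
move=> oU [w1 [w2 [D1 D2 Ew]]] [v1 [v2 [D3 D4 Ev]]] E.
have E1 := wderiv_ae_unique oU D1 D3 E; have E2 := wderiv_ae_unique oU D2 D4 E.
by apply: (aeS (aeI (aeI Ew Ev) (aeI E1 E2))) => x [[h1 h2] [h3 h4]] Ux; rewrite h1// h2// h3// h4.
Qed.

Lemma sobolev_wlap m U y : open U -> sobolev m.+2 U y -> exists w, wlap U y w /\ sobolev m U w.
Proof.
move=> oU /(sobolevS _ _ oU)[Ly H].
have K b : exists v, wderiv U [:: b; b] y v /\ sobolev m U v.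
  have [v [D1 /(sobolevS _ _ oU)[_ /(_ b)[v' [D2 S2]]]]] := H b.
  by exists v'; split => //; exact: wderiv_cons D1 D2.
have [v1 [D1 S1]] := K false; have [v2 [D2 S2]] := K true.
exists (fun x => v1 x + v2 x); split; last exact: sobolevD.
by exists v1, v2; split => //; exact: aeW.
Qed.

Lemma clap_representative U y (V : R * R -> R) K (x : R * R) : open U -> compact K -> class_C 2 setT V -> zero_off K V -> L2 U y ->
  {ae leb2, forall x, U x -> y x = V x} -> closure U x -> clap U y x = lap V x.
Proof. by move=> oU cK CV V0 Ly E Ux; rewrite /clap !(cderiv_representative oU _ cK CV V0 Ly E Ux). Qed.

Lemma continuous_lap (V : R * R -> R) : class_C 2 setT V -> continuous (lap V).
Proof.
move=> CV x; have c b : continuous (pds [:: b; b] V) by apply: (@class_C_continuous _ 0); apply: class_C_pds.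
exact: (@continuousD _ _ _ (pds [:: false; false] V) (pds [:: true; true] V) x (c false x) (c true x)).
Qed.

End restriction.

Theorem proposition3p1 (R : realType) (D : set (R * R)) (f : R * R -> R)
    (x0 : R * R) (F : set (R * R -> R)) (j : R * R -> R -> R)
    (domD : bounded_domain D) (bdD : boundary_C 4 D) (fL2 : L2 D f)
    (Dx0 : D x0) (admF : admissible_family D x0 F)
    (jcar : caratheodory_fun D j)
    (g : R * R -> R) (Fg : F g)
    (n : nat) (p : 'I_n -> R * R) (z : 'I_n -> R -> R * R) (T : 'I_n -> R)
    (zT : boundary_param D x0 g p z T) :
  (forall u y, control D g u -> is_state D f g u y -> constraints D g z T y ->
     clamped_plate (Omega D x0 g) f y /\
     forall yO, clamped_plate (Omega D x0 g) f yO ->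
       {ae leb2, forall x, Omega D x0 g x -> y x = yO x} /\
       equal_costs j D (Omega D x0 g) z T y yO)
  /\
  (forall yO, clamped_plate (Omega D x0 g) f yO ->
     exists u y,
       [/\ control D g u, is_state D f g u y, constraints D g z T y,
           {ae leb2, forall x, Omega D x0 g x -> y x = yO x} &
           equal_costs j D (Omega D x0 g) z T y yO]).
Proof.
have [oD _ _ bD] := domD; have [CgD _ gr gb bO] := admF g Fg.
set Om := Omega D x0 g in bO *.
have oOm : open Om := open_Omega oD bD CgD gr gb bO.
have OmD : Om `<=` D := Omega_D oD bD CgD gr gb bO.
have OmE : Om = [set x | D x /\ g x < 0] := OmegaE oD bD CgD gr gb bO.
have clOm : closure Om = [set x | D x /\ g x <= 0] := closure_Omega oD bD CgD gr gb bO.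
have cOm : compact (closure Om) := compact_closure_Omega oD bD CgD gr gb bO.
have gOm x : Om x -> gplus g x = 0.
  by rewrite OmE => -[_ gx]; rewrite /gplus; apply/max_idPr; exact: ltW.
have mG : @measurable _ (measurableTypeR R * measurableTypeR R)%type [set x | D x /\ g x = 0].
  by apply: closed_measurable2; apply: compact_closed2; exact: (compact_zero oD bD CgD gr gb bO).
have LfO := L2_sub oD oOm OmD fL2.
(* One [V] represents [y] in [D] and [yO] in Omega_g, so the two Laplacians, taken from inside [D]
   and from inside Omega_g, have the same values on {g = 0}. *)
have costs (y yO V : R * R -> R) (K : set (R * R)) : compact K -> class_C 2 setT V -> zero_off K V ->
    L2 D y -> {ae leb2, forall x, D x -> y x = V x} -> L2 Om yO -> {ae leb2, forall x, Om x -> yO x = V x} ->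
    equal_costs j D Om z T y yO.
  move=> cK CV V0 Ly yV LyO yOV.
  apply: (equal_costs_density oD bD CgD gr gb bO zT jcar (continuous_lap CV)) => x [Dx gx].
    by apply: (clap_representative oD cK CV V0 Ly yV); exact: subset_closure.
  by apply: (clap_representative oOm cK CV V0 LyO yOV); rewrite clOm/= gx.
split.
  move=> u y _ [Sy _ [w [b [W1 W2 bf]]]] cons.
  have [V [K [cK CV V0 yV]]] := C2_representative oD bD bdD Sy.
  have Ly := sobolev_L2 Sy; have LyO := L2_sub oD oOm OmD Ly.
  have yVO : {ae leb2, forall x, Om x -> y x = V x} by apply: (aeS yV) => x h /OmD/h.
  have tr := (constraints_trace oD bD CgD gr gb bO zT cK CV V0 Ly yV).1 cons.
  have Hy : H20 Om y.
    apply: (H20_ae oOm LyO yVO); apply: (H20_zero_trace oD bD CgD gr gb bO cK CV V0) => [x /tr[]//|x d /tr[_ ->]//].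
  have cpl : clamped_plate Om f y.
    split => //; first exact: sobolev_sub oD oOm OmD Sy.
    exists w, b; split; [exact: wlap_sub W1|exact: wlap_sub W2|].
    apply: (aeS bf) => x h Ox; rewrite h; last exact: OmD.
    by rewrite gOm// expr0n mul0r addr0.
  split => // yO cO; have bOm := bounded_Omega oD bD CgD gr gb bO.
  have E := clamped_plate_unique oOm bOm LfO cpl cO; split => //.
  have LO : L2 Om yO by have [/sobolev_L2] := cO.
  by apply: (costs y yO V K) => //; apply: (aeS (aeI E yVO)) => x [h1 h2] Ox; rewrite -h1// h2.
move=> yO cO; have [SO HO [wO [bO' [WO1 WO2 bfO]]]] := cO.
have [Y [KY [cKY SY _ YO]]] := sobolev_extension oOm (bounded_Omega oD bD CgD gr gb bO) (boundary_C_Omega oD bD CgD gr gb bO) SO.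
have clOD : closure Om `<=` D by rewrite clOm => x [].
have [chi [schi _ [N _ [ON chi1]] [K cK [KD chi0]]]] := smooth_cutoff cOm oD clOD.
(* The cutoff is 1 near the closure of Omega_g, so [y] still extends [yO]; its compact support in
   [D] supplies the clamped conditions on the outer boundary. *)
pose y x := chi x * Y x.
have y0 : zero_off K y by move=> x /chi0; rewrite /y => ->; rewrite mul0r.
have S4 : sobolev 4 setT y by apply: (sobolev_mul openT cK (schi 4%N) chi0 SY).
have [V [CV V0 yV]] := sobolev_class_C cK y0 S4.
have Sy : sobolev 4 D y by exact: sobolev_sub openT oD (@subsetT _ _) S4.
have Ly := sobolev_L2 Sy.
have yVD : {ae leb2, forall x, D x -> y x = V x} by apply: (aeS yV).
have yE x : Om x -> y x = yO x.
  by move=> Ox; rewrite /y YO// chi1 ?mul1r//; apply: ON; exact: subset_closure.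
have yOV : {ae leb2, forall x, Om x -> yO x = V x} by apply: (aeS yV) => x h Ox; rewrite -yE.
have Hy : H20 D y by apply: (H20_ae oD Ly yVD); exact: H20_C2_compact cK KD CV V0.
have [w [W1 Sw]] := sobolev_wlap oD Sy; have [b [W2 Sb]] := sobolev_wlap oD Sw.
have Lb := sobolev_L2 Sb.
have bf : {ae leb2, forall x, Om x -> b x = f x}.
  have E0 : {ae leb2, forall x, Om x -> y x = yO x} by exact: aeW.
  have E1 := wlap_ae_unique oOm (wlap_sub oD oOm OmD W1) WO1 E0.
  have E2 := wlap_ae_unique oOm (wlap_sub oD oOm OmD W2) WO2 E1.
  by apply: (aeS (aeI E2 bfO)) => x [h1 h2] Ox; rewrite h1// h2.
pose P := [set x | D x /\ 0 < g x].
have oP : open P.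
  rewrite (_ : P = D `&` ~` closure Om); first by apply: openI => //; rewrite openC; exact: closed_closure.
  rewrite clOm; apply/seteqP; split => x [Dx gx]; split => //=; first by move=> [_]; rewrite leNgt gx.
  by rewrite ltNge; apply/negP => h; apply: gx.
have PD : P `<=` D by move=> x [].
have Lbf : L2 P (fun x => b x - f x).
  have := L2_sub oD oP PD (L2D_on oD Lb (L2Z_on (- 1) oD fL2)).
  by congr L2; apply/funext => x; rewrite mulN1r.
(* [u] may blow up at {g = 0}; only its product with g_+^2, which is b - f on {g > 0}, has to be
   square integrable. *)
pose u x := if 0 < g x then (b x - f x) * (g x ^+ 2)^-1 else 0.
have guE x : gplus g x ^+ 2 * u x = if 0 < g x then b x - f x else 0.
  rewrite /u /gplus; case: ltP => gx; last by rewrite mulr0.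
  by rewrite mulrCA divff ?mulr1// expf_neq0// gt_eqF.
have patchD (h : R * R -> R) : ((fun x => if 0 < g x then h x else 0) \_ D) = h \_ P.
  apply/funext => x; rewrite !patchE; have [Dx|nD] := pselect (D x); last first.
    by rewrite !memNset// => -[].
  rewrite mem_set//; case: ifPn => gx; first by rewrite mem_set.
  by rewrite memNset// => -[_]; apply/negP.
have mD := open_measurable2 oD; have mP' := open_measurable2 oP.
have ctrl : control D g u.
  split; last first.
    apply/(L2_patch _ mD); rewrite (_ : _ \_ D = (fun x => b x - f x) \_ P); first exact/(L2_patch _ mP').
    by rewrite -patchD; congr (_ \_ D); apply/funext => x; exact: guE.
  apply/(measurable_restrictT _ mD); rewrite patchD; apply/(measurable_restrictT _ mP').
  apply: measurable_funM; first by case: Lbf.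
  apply: continuous_measurable_on => // x [Dx gx].
  apply: continuousV; first by rewrite expf_neq0// gt_eqF.
  apply: (@continuous_comp _ _ _ g (fun t => t ^+ 2)); last exact: exprn_continuous.
  exact: (g_continuous CgD Dx).
have state : is_state D f g u y.
  split => //; exists w, b; split => //.
  apply: (aeS (aeI bf (null_ae mG (zero_null oD bD CgD gr gb bO) (fun x => id)))) => x [h1 nG] Dx.
  rewrite guE; case: ifPn => gx; first by rewrite addrC subrK.
  rewrite addr0; apply: h1; rewrite OmE; split => //.
  by rewrite lt_neqAle leNgt gx andbT; apply/eqP => g0; apply: nG.
exists u, y; split => //; last 2 first.
- exact: aeW.
- by apply: (costs y yO V K) => //; exact: sobolev_L2 SO.
apply/(constraints_trace oD bD CgD gr gb bO zT cK CV V0 Ly yVD) => x [Dx gx].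
split; first exact: (H20_trace oD bD CgD gr gb bO (s := [::]) HO cK CV V0 yOV).
by move=> d; exact: (H20_trace oD bD CgD gr gb bO (s := [:: d]) HO cK CV V0 yOV).
Qed.
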